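(* For all real $\beta$, all $0<\eta\le 1$ and all $\lambda>0$, the limit $g_1(\lambda):=\lim_{Q\to\infty} g_1^{\beta,\eta}(\lambda;Q)$ exists, is independent of $\beta$ and $\eta$, and equals \[ g_1(\lambda)=\frac{6}{\pi^2}\begin{cases} \frac{\pi^2}{6}-\lambda, & 0<\lambda<1,\\[4pt] \log^2 2-\frac{2\pi^2}{3}-1+\left(\frac{\lambda}{2}-\frac{2}{\lambda}\right)\log\!\left(\frac{2-\lambda}{\lambda-1}\right)+\frac{3\lambda}{2}\log\!\left(\frac{\lambda}{\lambda-1}\right)-\log\!\left(\frac{4}{\lambda}\right)\log\lambda+4\operatorname{Li}_2\!\left(\frac1\lambda\right)+2\operatorname{Li}_2\!\left(\frac\lambda2\right), & 1<\lambda<2,\\[4pt] -1+\left(\frac{\lambda}{2}-\frac{2}{\lambda}\right)\log\!\left(\frac{\lambda-2}{\lambda-1}\right)+\frac{3\lambda}{2}\log\!\left(\frac{\lambda}{\lambda-1}\right)+4\operatorname{Li}_2\!\left(\frac1\lambda\right)-2\operatorname{Li}_2\!\left(\frac2\lambda\right), & 2<\lambda. \end{cases} \] Moreover, for every $\epsilon>0$, \[ \left|g_1^{\beta,\eta}(\lambda;Q)-g_1(\lambda)\right|\ll_\epsilon (1+\lambda)\,\frac{Q^{\epsilon-1/2}}{\eta}, \] with implied constant depending only on $\epsilon$.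
   Context: For real $\alpha$ and an integer $Q\ge 1$, let $S_Q(\alpha)$ be the set of fractional parts $\{n\alpha\}$, $0\le n<Q$, placed on $[0,1]$ with $0$ and $1$ identified, so that $Q$ gaps appear between consecutive points (circularly). Let $\sigma=\sigma(\alpha,Q)$ be the permutation of $\{0,\dots,Q-1\}$ such that $\{\sigma_0\alpha\}<\{\sigma_1\alpha\}<\dots<\{\sigma_{Q-1}\alpha\}$ (for irrational $\alpha$), and interpret $\{\sigma_Q\alpha\}$ as $1$ (i.e. $\{\sigma_0\alpha\}+1$), so the $n$-th gap is $\{\sigma_{n+1}\alpha\}-\{\sigma_n\alpha\}$ for $0\le n<Q$. Define \[ g_1^{\beta,\eta}(\lambda;Q)=\frac1\eta\int_\beta^{\beta+\eta}\frac{\#\{0\le n<Q:\ \{\sigma_{n+1}\alpha\}-\{\sigma_n\alpha\}\ge \lambda/Q\}}{Q}\,d\alpha . \] $\operatorname{Li}_2(z)=\sum_{n\ge1} z^n/n^2$ for $|z|\le1$. *)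

(* Defs.v *)
From Stdlib Require Import Reals Lra Lia List ClassicalEpsilon.
Import ListNotations.
Open Scope R_scope.

Definition fracp (x : R) : R := frac_part x.

Fixpoint rinsert (x : R) (l : list R) : list R :=
  match l with
  | [] => [x]
  | y :: l' => if Rle_dec x y then x :: l else y :: rinsert x l'
  end.

Fixpoint rsort (l : list R) : list R :=
  match l with
  | [] => []
  | x :: l' => rinsert x (rsort l')
  end.

Definition points (alpha : R) (Q : nat) : list R :=
  map (fun n => fracp (INR n * alpha)) (seq 0 Q).

Fixpoint consec_diffs (l : list R) : list R :=
  match l with
  | a :: ((b :: _) as t) => (b - a) :: consec_diffs t
  | _ => []
  end.

Definition circ_gaps (s : list R) : list R :=
  match s with
  | [] => []
  | y0 :: _ => consec_diffs s ++ [(y0 + 1) - last s 0]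
  end.

Definition gaps (alpha : R) (Q : nat) : list R := circ_gaps (rsort (points alpha Q)).

Definition gap_frac (lam : R) (Q : nat) (alpha : R) : R :=
  INR (length (filter (fun g => if Rle_dec (lam / INR Q) g then true else false)
                      (gaps alpha Q))) / INR Q.

(* dilogarithm Li_2(z) = sum_{n>=1} z^n / n^2 (for |z| <= 1) *)
Definition Li2 (z : R) : R :=
  epsilon (inhabits 0)
    (fun l => Un_cv (fun N => sum_f_R0 (fun n => z ^ (S n) / (INR (S n)) ^ 2) N) l).

Definition g1_formula (lam : R) : R :=
  6 / PI ^ 2 *
  (if Rlt_dec lam 1 then PI ^ 2 / 6 - lam
   else if Rlt_dec lam 2 then
     (ln 2) ^ 2 - 2 * PI ^ 2 / 3 - 1
     + (lam / 2 - 2 / lam) * ln ((2 - lam) / (lam - 1))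
     + 3 * lam / 2 * ln (lam / (lam - 1))
     - ln (4 / lam) * ln lam
     + 4 * Li2 (1 / lam) + 2 * Li2 (lam / 2)
   else
     -1 + (lam / 2 - 2 / lam) * ln ((lam - 2) / (lam - 1))
     + 3 * lam / 2 * ln (lam / (lam - 1))
     + 4 * Li2 (1 / lam) - 2 * Li2 (2 / lam)).

(* Main.v *)
Require Import Defs.
From Stdlib Require Import Reals Lra Lia List ClassicalEpsilon.
From Stdlib Require Permutation Sorted ZArith.
From Coquelicot Require Coquelicot.
From HB Require Import structures.
From mathcomp Require all_boot all_order all_algebra all_fingroup all_field.
From mathcomp Require zify ring.

(** Let Q >= 2, x = q/Q, y = q'/Q.  If alpha lies in the arc (a/q, a'/q') of the Farey
    dissection of order Q-1, then q + q' >= Q and the gaps of S_Q(alpha) are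
    A = q alpha - a, B = a' - q' alpha and A + B, occurring Q-q, Q-q' and q+q'-Q times.
    The measure of the points with a gap below lam/Q is therefore a sum over the pairs
    (q,q') of an explicit function of (x,y) times the number of admissible a, that is of
    the a in a window of length eta q with q' a = -1 mod q.  The arcs cut by the ends
    of the interval contribute only O(1/Q).

    Counting the admissible a for q' in an interval is counting points of the hyperbola
    u v = -1 mod q in a box.  By Weil's bound for Kloosterman sums modulo the squarefree
    part of q and the trivial bound on the powerful part, the error is Q^(1/2+eps) on
    average over q <= Q; partial summation in q' reaches the weights, which are differences
    of functions monotone in q'.  Moebius inversion turns the main term into 6/PI^2 times
    integrals over the triangle x, y <= 1 <= x + y.  These are dilogarithms, and the closed
    form for 1 < lam < 2 needs the four-term relation [dilog_four_term].

    Weil's bound is proved in the tower of fields with q_i = p^(2^i) elements.  For the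
    Kloosterman sums S_i of the tower, S_(i+1) = 2 q_i - S_i^2: an excess of |S_0| over
    2 sqrt p would grow geometrically, against the bound for S_k that Stepanov's method
    gives for the number of x with a prescribed trace of x + a/x. *)

(** Comparing a density with an integral and testing it against the discrepancy needs two
    monotonicities: in [y] along a row, and of the row integrals in [x]. The density
    [(1-x)/x min(lam, 1/y)] of the gap [A] decreases in [y], so it enters as [1/x] minus a kernel.
    That of [A + B] for [x < 1/lam < y] has row integrals that drop to 0 at [x = 1/lam], so [1/x] on
    [x >= 1/lam] is added and subtracted. The threshold is [1/lam] because [A + B] lies between
    [1/q] and [1/q']. All kernels obey [0 <= F <= 1/x], which makes the error uniform in [lam].

    Stepanov's method bounds the fibres of the trace from above only. Their known total turns this
    into a bound for the character sum, with a loss of [21 p] that the growth along the tower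
    absorbs.

    The exponent 1/2 survives the trivial bound on powerful parts: with [s] the squarefree part of
    [q], the discrepancy relative to [q] is about [s^(-1/2)], and the sum of these over [q <= Q] is
    still [sqrt Q] up to logarithms, since the numbers [a^2 b^3] are sparse. *)

Module Sums.
Import Coquelicot.Coquelicot.
Import all_boot.
Import zify.
Set Implicit Arguments. Unset Strict Implicit. Unset Printing Implicit Defensive.
Delimit Scope R_scope with R.
Open Scope R_scope.

(** * Finite sums of real and complex numbers as big operators *)

HB.instance Definition _ := Monoid.isComLaw.Build R 0 Rplus
  (fun x y z => esym (Rplus_assoc x y z)) Rplus_comm Rplus_0_l.
HB.instance Definition _ := Monoid.isMulLaw.Build R 0 Rmult Rmult_0_l Rmult_0_r.
HB.instance Definition _ := Monoid.isAddLaw.Build R Rmult Rplus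
  (fun x y z => Rmult_plus_distr_r x y z) Rmult_plus_distr_l.
HB.instance Definition _ := Monoid.isComLaw.Build C (RtoC 0) Cplus
  Cplus_assoc Cplus_comm Cplus_0_l.
HB.instance Definition _ := Monoid.isMulLaw.Build C (RtoC 0) Cmult Cmult_0_l Cmult_0_r.
HB.instance Definition _ := Monoid.isAddLaw.Build C Cmult Cplus
  (fun x y z => Cmult_plus_distr_r x y z) Cmult_plus_distr_l.

Ltac rring := ring.
Ltac rfield := field.

Notation "\rsum_ ( i <- r | P ) F" := (\big[Rplus/0%R]_(i <- r | P%B) F%R)
  (at level 41, F at level 41, i, r at level 50).
Notation "\rsum_ ( i <- r ) F" := (\big[Rplus/0%R]_(i <- r) F%R)
  (at level 41, F at level 41, i, r at level 50).
Notation "\rsum_ ( i < n | P ) F" := (\big[Rplus/0%R]_(i < n | P%B) F%R)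
  (at level 41, F at level 41, i, n at level 50).
Notation "\rsum_ ( i < n ) F" := (\big[Rplus/0%R]_(i < n) F%R)
  (at level 41, F at level 41, i, n at level 50).
Notation "\rsum_ ( i | P ) F" := (\big[Rplus/0%R]_(i | P%B) F%R)
  (at level 41, F at level 41, i at level 50).
Notation "\rsum_ ( m <= i < n ) F" := (\big[Rplus/0%R]_(m <= i < n) F%R)
  (at level 41, F at level 41, i, m, n at level 50).
Notation "\csum_ ( i <- r | P ) F" := (\big[Cplus/RtoC 0]_(i <- r | P%B) F%C)
  (at level 41, F at level 41, i, r at level 50).
Notation "\csum_ ( i <- r ) F" := (\big[Cplus/RtoC 0]_(i <- r) F%C)
  (at level 41, F at level 41, i, r at level 50).
Notation "\csum_ ( i < n | P ) F" := (\big[Cplus/RtoC 0]_(i < n | P%B) F%C)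
  (at level 41, F at level 41, i, n at level 50).
Notation "\csum_ ( i < n ) F" := (\big[Cplus/RtoC 0]_(i < n) F%C)
  (at level 41, F at level 41, i, n at level 50).
Notation "\csum_ ( i | P ) F" := (\big[Cplus/RtoC 0]_(i | P%B) F%C)
  (at level 41, F at level 41, i at level 50).

Section Sums.
Variables (I : Type) (r : seq I) (P : pred I).

Lemma rsum_le (F G : I -> R) : (forall i, P i -> F i <= G i) ->
  \rsum_(i <- r | P i) F i <= \rsum_(i <- r | P i) G i.
Proof.
move=> h; elim/big_rec2: _ => [|i x y Pi IH]; first exact: Rle_refl.
by apply: Rplus_le_compat; [apply: h | ].
Qed.

Lemma rsum_ge0 (F : I -> R) : (forall i, P i -> 0 <= F i) -> 0 <= \rsum_(i <- r | P i) F i.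
Proof. move=> h; elim/big_rec: _ => [|i x Pi IH]; [lra | have := h i Pi; lra]. Qed.

Lemma rsumB (F G : I -> R) :
  \rsum_(i <- r | P i) (F i - G i) = \rsum_(i <- r | P i) F i - \rsum_(i <- r | P i) G i.
Proof. elim/big_rec3: _ => [|i x y z _ ->]; lra. Qed.

Lemma rsum_Rabs (F : I -> R) :
  Rabs (\rsum_(i <- r | P i) F i) <= \rsum_(i <- r | P i) Rabs (F i).
Proof.
elim/big_rec2: _ => [|i x y Pi IH]; first by rewrite Rabs_R0; lra.
by apply: (Rle_trans _ _ _ (Rabs_triang _ _)); lra.
Qed.

Lemma csum_Cmod (F : I -> C) :
  Cmod (\csum_(i <- r | P i) F i) <= \rsum_(i <- r | P i) Cmod (F i).
Proof.
elim/big_rec2: _ => [|i x y Pi IH]; first by rewrite Cmod_0; lra.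
by apply: (Rle_trans _ _ _ (Cmod_triangle _ _)); lra.
Qed.

Lemma RtoC_rsum (F : I -> R) :
  RtoC (\rsum_(i <- r | P i) F i) = \csum_(i <- r | P i) RtoC (F i).
Proof. elim/big_rec2: _ => [|i x y _ <-] //; by rewrite RtoC_plus. Qed.

End Sums.

Lemma iter_Rplus (n : nat) (c : R) : ssrnat.iter n (Rplus c) 0 = INR n * c.
Proof. elim: n => [|n IH]; first by rewrite Rmult_0_l.
by rewrite iterS IH S_INR; ring. Qed.

Lemma iter_Cplus (n : nat) (c : C) : ssrnat.iter n (Cplus c) (RtoC 0) = (RtoC (INR n) * c)%C.
Proof.
elim: n => [|n IH]; first by rewrite /= Cmult_0_l.
by rewrite iterS IH S_INR RtoC_plus; ring.
Qed.

Lemma rsum_const (I : finType) (P : pred I) (c : R) :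
  \rsum_(i | P i) c = INR #|P| * c.
Proof. by rewrite big_const iter_Rplus. Qed.

Lemma csum_const (I : finType) (P : pred I) (c : C) :
  \csum_(i | P i) c = (RtoC (INR #|P|) * c)%C.
Proof. by rewrite big_const iter_Cplus. Qed.

(** * Additive characters modulo q and Kloosterman sums *)

Definition cis (t : R) : C := (cos t, sin t).

Lemma cisD s t : cis (s + t) = (cis s * cis t)%C.
Proof. by rewrite /cis /Cmult /= cos_plus sin_plus; congr pair; ring. Qed.

Lemma Cmod_cis t : Cmod (cis t) = 1.
Proof.
rewrite /Cmod /cis /= -[RHS]sqrt_1; congr sqrt.
have := sin2_cos2 t; rewrite /Rsqr; lra.
Qed.

Lemma cis_2PI n : cis (2 * PI * INR n) = RtoC 1.
Proof.
rewrite /cis -[2 * PI * INR n]Rplus_0_l -[2 * PI * INR n](_ : 2 * INR n * PI = _); last ring.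
by rewrite cos_period sin_period cos_0 sin_0.
Qed.

Definition expi (q k : nat) : C := cis (2 * PI * (INR k / INR q)).

Lemma Cmod_expi q k : Cmod (expi q k) = 1. Proof. exact: Cmod_cis. Qed.

Lemma expi0 q : expi q 0 = RtoC 1.
Proof. by rewrite /expi /= (_ : 2 * PI * (0 / INR q) = 2 * PI * INR 0) ?cis_2PI //= /Rdiv; ring. Qed.

Lemma expiD q k l : expi q (k + l) = (expi q k * expi q l)%C.
Proof. by rewrite /expi -cisD; congr cis; rewrite plus_INR /Rdiv; ring. Qed.

Lemma expi_mulq q k : (0 < q)%N -> expi q (q * k) = RtoC 1.
Proof.
move=> q0; rewrite -(cis_2PI k) /expi; congr cis; rewrite mult_INR.
by field; apply: not_0_INR; lia.
Qed.

Lemma expi_mod q k : (0 < q)%N -> expi q (k %% q) = expi q k.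
Proof.
by move=> q0; rewrite {2}(divn_eq k q) expiD mulnC expi_mulq // Cmult_1_l.
Qed.

Lemma expi_eqmod q k l : (0 < q)%N -> k = l %[mod q] -> expi q k = expi q l.
Proof. by move=> q0 e; rewrite -(expi_mod k q0) e expi_mod. Qed.

Lemma expi_neq1 q k : (0 < k < q)%N -> expi q k <> RtoC 1.
Proof.
move=> /andP[k0 kq] [h _].
have q0 : 0 < INR q by apply: lt_0_INR; lia.
have k0' : 0 < INR k by apply: lt_0_INR; lia.
have kq' : INR k < INR q by apply: lt_INR; lia.
have x0 : 0 < INR k / INR q by apply: Rdiv_lt_0_compat.
have x1 : INR k / INR q < 1 by apply: (Rmult_lt_reg_r (INR q)) => //; field_simplify; lra.
move: h; set x := INR k / INR q in x0 x1 *.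
have -> : 2 * PI * x = 2 * (PI * x) by ring.
rewrite cos_2a_sin => h.
have : 0 < sin (PI * x).
  have PI0 := PI_RGT_0; apply: sin_gt_0; nra.
by nra.
Qed.

Lemma Cmult_fixed (w S : C) : w <> RtoC 1 -> S = (w * S)%C -> S = RtoC 0.
Proof.
move=> w1 E; have : ((w - RtoC 1) * S)%C = RtoC 0.
  by transitivity (w * S - S)%C; [ring | rewrite -E; ring].
move=> /(congr1 (Cmult (/ (w - RtoC 1)))); rewrite Cmult_0_r Cmult_assoc Cinv_l ?Cmult_1_l //.
by move=> /(congr1 (Cplus (RtoC 1))); rewrite Cplus_0_r => h; apply: w1; rewrite -h; ring.
Qed.

Lemma csum_expi q k : (0 < q)%N ->
  \csum_(m < q) expi q (m * k) = RtoC (if q %| k then INR q else 0).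
Proof.
move=> q0; case: ifP => qk.
  rewrite (eq_bigr (fun _ => RtoC 1)); last first.
    move=> m _; rewrite (expi_eqmod q0 (l := 0)) ?expi0 //.
    by apply/eqP; rewrite mod0n; apply: dvdn_mull.
  by rewrite csum_const card_ord Cmult_1_r.
set S := bigop _ _ _.
have e1 : expi q k <> RtoC 1.
  rewrite -expi_mod //; apply: expi_neq1; rewrite ltn_mod q0 andbT lt0n.
  by rewrite -[_ == _]/(q %| k) qk.
(* Multiplication by [expi q k] permutes the summands cyclically, so the sum is fixed by a factor
   different from 1. *)
have E : (expi q k * S)%C = S.
  rewrite /S big_distrr /=; case: q q0 {qk e1} @S => // q _ S.
  rewrite big_ord_recr /= /S big_ord_recl /= Cplus_comm; congr Cplus; last first.
    by apply: eq_bigr => i _; rewrite -expiD; congr expi; rewrite /bump /=; lia.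
  by rewrite -expiD -mulSn expi_mulq // mul0n expi0.
exact: (Cmult_fixed e1).
Qed.

(* pairs [x y = 1 mod q] replace the inverse of [x] *)
Definition kloosterman (q m n : nat) : C :=
  \csum_(x < q) \csum_(y < q | x * y == 1 %[mod q]) expi q (m * x + n * y).

Lemma leq_INR (m n : nat) : (m <= n)%N -> INR m <= INR n.
Proof. by move=> h; apply: le_INR; apply/leP. Qed.

Lemma INR2 : INR 2 = 2. Proof. by []. Qed.
Lemma INR3 : INR 3 = 3. Proof. rewrite /=; lra. Qed.

(** Clears the denominator [r - (3 pr + 1)] of Stepanov's bound, [r] being the square root of the
    size of the field. The 10 is 1 + 4 + 5 in units of [r * r]: 1 from the [+ 1] on the right, at
    most 4 from [r P (3 pr + 1)], and at most 5 from [10 r (3 pr + 1)] by [2 (3 pr + 1) <= r]. *)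
Lemma stepanov_real (N r P pr : R) :
  (2 <= pr)%R -> (r = P * pr)%R -> (2 * (3 * pr + 1) <= r)%R ->
  (N * (r - (3 * pr + 1)) <= r * r * (P + 1))%R -> (N <= r * r / pr + 10 * r)%R.
Proof.
move=> p2 rE re h.
have P0 : (0 < P)%R by nra.
apply: (Rmult_le_reg_r (r - (3 * pr + 1))); first lra.
apply: Rle_trans h _.
have -> : (r * r / pr = r * P)%R by rewrite rE; field; lra.
have : (r * P * (3 * pr + 1) <= 4 * (r * r))%R by rewrite rE; nra.
nra.
Qed.


End Sums.

(** * Stepanov's method for points with a prescribed trace of x + a/x *)

Module Stepanov.
Import all_boot all_order all_algebra all_fingroup all_field.
Import zify ring.
Import GRing.Theory.
Local Open Scope ring_scope.
Set Implicit Arguments. Unset Strict Implicit. Unset Printing Implicit Defensive.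

(** The leading term of largest degree among those with a nonzero scalar cannot be cancelled. *)
Lemma sum_distinct_degrees_neq0 (F : fieldType) (I : finType) (d : I -> nat)
    (f : I -> {poly F}) (c : I -> F) (i1 : I) :
  injective d -> (forall i, size (f i) = (d i).+1) -> c i1 != 0 ->
  \sum_i c i *: f i != 0.
Proof.
move=> dinj sf ci1.
have [i0 ci0 mx] := @arg_maxnP _ i1 (fun i => c i != 0) d ci1.
apply/eqP => /(congr1 (fun g : {poly F} => g`_(d i0))).
rewrite coef0 coef_sum (bigD1 i0) //= big1 ?addr0 => [|i ne].
  rewrite coefZ => /eqP; rewrite mulf_eq0 (negPf ci0) /=.
  rewrite (_ : d i0 = (size (f i0)).-1) ?sf // -?[_`_ _]/(_`_(d i0)).
  by have := lead_coef_eq0 (f i0); rewrite lead_coefE sf /= => ->; rewrite -size_poly_eq0 sf.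
have [->|ci] := eqVneq (c i) 0; first by rewrite scale0r coef0.
rewrite coefZ nth_default ?mulr0 // sf ltn_neqAle; have /= -> := mx i ci; rewrite andbT.
by apply: contra ne => /eqP/dinj ->.
Qed.

Section CoefficientWeight.
Variable F : fieldType.
Implicit Types A B : {poly {poly F}}.

(** A polynomial over polynomials carries two variables: the inner one is the base point where
    vanishing is wanted, the outer one the displacement from it. The bound concerns the degree in
    the base point, uniformly over the orders of the expansion. *)
Definition coef_size_le (n : nat) A := forall s, (size (A`_s)%R <= n.+1)%N.

Lemma coef_size_leW n m A : (n <= m)%N -> coef_size_le n A -> coef_size_le m A.
Proof. by move=> nm h s; apply: leq_trans (h s) _. Qed.

Lemma coef_size_leD n A B : coef_size_le n A -> coef_size_le n B -> coef_size_le n (A + B).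
Proof.
move=> hA hB s; rewrite coefD (leq_trans (size_polyD _ _)) // geq_max hA hB //.
Qed.

Lemma coef_size_leN n A : coef_size_le n A -> coef_size_le n (- A).
Proof. by move=> hA s; rewrite coefN size_polyN. Qed.

Lemma coef_size_le_sum n (I : finType) (A : I -> {poly {poly F}}) :
  (forall i, coef_size_le n (A i)) -> coef_size_le n (\sum_i A i).
Proof.
move=> h; elim/big_ind: _ => [s||i _]; [by rewrite coef0 size_poly0| |exact: h].
by move=> ? ?; apply: coef_size_leD.
Qed.

Lemma coef_size_leM n m A B :
  coef_size_le n A -> coef_size_le m B -> coef_size_le (n + m) (A * B).
Proof.
move=> hA hB s; rewrite coefM (leq_trans (size_sum _ _ _)) //.
apply/bigmax_leqP => i _; rewrite (leq_trans (size_polyMleq _ _)) //.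
have := hA i; have := hB (s - i)%N; lia.
Qed.

Lemma coef_size_le1 : coef_size_le 0 1.
Proof. by move=> [|s]; rewrite coef1 /= ?size_poly1 // size_poly0. Qed.

Lemma coef_size_leX n k A : coef_size_le n A -> coef_size_le (n * k) (A ^+ k).
Proof.
move=> hA; elim: k => [|k IH]; first by rewrite muln0 expr0; apply: coef_size_le1.
by rewrite exprS mulnS; apply: coef_size_leM.
Qed.

Lemma coef_size_leC c : coef_size_le 0 c%:P%:P.
Proof.
by move=> [|s]; rewrite coefC /= ?size_poly0 // size_polyC; case: (c != 0).
Qed.

Lemma coef_size_leZ : coef_size_le 1 'X%:P.
Proof. by move=> [|s]; rewrite coefC /= ?size_polyX // size_poly0. Qed.

Lemma coef_size_leT : coef_size_le 1 ('X%:P + 'X).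
Proof.
apply: coef_size_leD; first exact: coef_size_leZ.
by move=> s; rewrite coefX; case: (s == _); rewrite ?size_poly1 ?size_poly0.
Qed.

End CoefficientWeight.

Section Stepanov.
Variables (L : finFieldType) (p n : nat) (a t : L).
Hypothesis p_pr : prime p.
Hypothesis pL : p \in [pchar L].
Hypothesis cardL : #|L| = (p ^ (n.+1 + n.+1))%N.

Let P := (p ^ n)%N.
Let D := (p ^ (n + n.+1))%N.
Let q := (p ^ (n.+1 + n.+1))%N.

(* [y ^+ e * (y^(p^i) + al / y^(p^i))], summed over [i < k], without the pole *)
Definition poleless (R : comNzRingType) (al y : R) (e k : nat) : R :=
  \sum_(i < k) (y ^+ (e + p ^ i) + al * y ^+ (e - p ^ i)).

Lemma rmorph_poleless (R S : comNzRingType) (f : {rmorphism R -> S}) al y e k :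
  f (poleless al y e k) = poleless (f al) (f y) e k.
Proof.
rewrite /poleless rmorph_sum; apply: eq_bigr => i _.
by rewrite rmorphD rmorphM !rmorphXn.
Qed.

Let I : Type := ('I_D * 'I_P * 'I_p)%type.

(** [X^D] times the full trace of [x + a/x]; [D] is the largest Frobenius power in the trace, so all
    poles are cleared. *)
Let H : {poly L} := poleless a%:P 'X D (n.+1 + n.+1).

(** Divided by [X^(D (p-1))] this is [x^r (x^q)^j Tr^k]. Near a point [z] of the field, [x^q] agrees
    with [z], and the trace with an expression in much smaller powers of [x], to high order. A
    combination of very large degree thus has a cheap local expansion. *)
Let auxterm (i : I) : {poly L} :=
  'X^(i.1.1) * 'X^(q * i.1.2) * 'X^(D * (p.-1 - i.2)) * H ^+ i.2.

Let aux (c : {ffun I -> L}) : {poly L} := \sum_i c i *: auxterm i.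

(** [Z] is the base point and [T] the point displaced from it by the outer variable. *)
Let T : {poly {poly L}} := 'X%:P + 'X.
Let Z : {poly {poly L}} := 'X%:P.

(** This is [(x z)^P (t + f(x) - f(z))] without poles, [f] being the half of the trace with
    Frobenius powers up to [P = p^n]. The other half is frozen at [z], where it equals
    [t - f(z)]. *)
Definition local_factor (R : comNzRingType) (tt al x z : R) : R :=
  tt * (x * z) ^+ P + z ^+ P * poleless al x P n.+1 - x ^+ P * poleless al z P n.+1.

Let V := local_factor t%:P%:P a%:P%:P T Z.

(** What [auxterm] becomes near the base point, up to the factors [(x z)^(P (p-1))] and
    [x^(D (p-1))], which are invertible there. *)
Let biterm (i : I) : {poly {poly L}} :=
  T ^+ i.1.1 * Z ^+ i.1.2 * (T * Z) ^+ (P * (p.-1 - i.2)) * V ^+ i.2.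
Let bi (c : {ffun I -> L}) : {poly {poly L}} := \sum_i (c i)%:P%:P * biterm i.

Let p_gt1 : (1 < p)%N. Proof. exact: prime_gt1. Qed.
Let P_gt0 : (0 < P)%N. Proof. by rewrite expn_gt0 ltnW. Qed.
Let D_gt0 : (0 < D)%N. Proof. by rewrite expn_gt0 ltnW. Qed.
Let qE : q = (p * D)%N. Proof. by rewrite /q /D addSn expnS. Qed.
Let PD : (P <= D)%N. Proof. by rewrite leq_exp2l //; lia. Qed.

Let lead_H : size H = (D + D).+1 /\ lead_coef H = 1.
Proof.
have E : H = 'X^(D + D) + (a%:P + poleless a%:P 'X D (n + n.+1)).
  rewrite /H addSn /poleless big_ord_recr /= subnn expr0 mulr1 addrC -/D.
  by rewrite addrA.
suff s : (size (a%:P + poleless a%:P 'X D (n + n.+1))%R <= D + D)%N.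
  rewrite E; split; first by rewrite size_polyDl size_polyXn.
  by rewrite lead_coefDl ?lead_coefXn // size_polyXn.
rewrite (leq_trans (size_polyD _ _)) // geq_max; apply/andP; split.
  by rewrite (leq_trans (size_polyC_leq1 _)) //; lia.
rewrite (leq_trans (size_sum _ _ _)) //; apply/bigmax_leqP => i _.
have lti : (p ^ i < D)%N by rewrite ltn_exp2l.
rewrite (leq_trans (size_polyD _ _)) // geq_max size_polyXn mul_polyC.
rewrite (leq_trans (size_scale_leq _ _)) ?size_polyXn; lia.
Qed.

Let adeg (i : I) : nat := (i.1.1 + q * i.1.2 + D * i.2 + D * p.-1)%N.

Let size_auxterm i : size (auxterm i) = (adeg i).+1.
Proof.
have [sH lH] := lead_H.
have mH : H \is monic by rewrite monicE lH.
have mon : auxterm i \is monic by rewrite /auxterm !rpredM ?rpredX ?monicX.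
rewrite /auxterm -!exprD size_monicM ?monic_neq0 ?rpredX ?monicX //.
rewrite size_polyXn; have := size_exp H i.2; rewrite sH /=.
have := ltn_ord i.2; rewrite /adeg.
have : size (H ^+ i.2) != 0%N by rewrite size_poly_eq0 monic_neq0 ?rpredX.
move: (size (H ^+ i.2)%R) => sz; rewrite -lt0n; case: sz => // sz _ lt /= ->.
have : (D * p.-1 = D * (p.-1 - i.2) + D * i.2)%N.
  by rewrite -mulnDr; congr (_ * _)%N; lia.
rewrite mulnDl; move: (D * i.2)%N (D * p.-1)%N => u v; lia.
Qed.

(** Mixed radix: since [q = p D], the degree is [(j p + k) D + r] up to the constant [D (p-1)], with
    digits [r < D] and [k < p]. *)
Let adeg_inj : injective adeg.
Proof.
move=> [[r j] k] [[r' j'] k']; rewrite /adeg /= qE => /addIn.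
have rw (x : 'I_D) (y : 'I_P) (z : 'I_p) :
  (x + p * D * y + D * z = (y * p + z) * D + x)%N by ring.
rewrite !rw => E.
have Er : r = r' :> nat.
  by have := congr1 (modn^~ D) E; rewrite /= !modnMDl !modn_small.
have E2 : (j * p + k = j' * p + k')%N.
  by apply/eqP; rewrite -(eqn_pmul2r D_gt0); apply/eqP; move: E; rewrite Er => /addIn.
have Ek : k = k' :> nat.
  by have := congr1 (modn^~ p) E2; rewrite /= !modnMDl !modn_small.
have Ej : j = j' :> nat.
  by apply/eqP; rewrite -(eqn_pmul2r (ltnW p_gt1)); apply/eqP; move: E2; rewrite Ek => /addIn.
by congr (_, _, _); apply: val_inj.
Qed.

Let aux_neq0 c : c != 0 -> aux c != 0.
Proof.
move=> cn0; have [i ci] : exists i, c i != 0.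
  apply/existsP; apply: contraR cn0 => /existsPn h.
  by apply/eqP/ffunP => i; rewrite ffunE; apply/eqP; move/negPn: (h i).
exact: (sum_distinct_degrees_neq0 adeg_inj size_auxterm ci).
Qed.

Let size_aux c : (size (aux c) <= q * P.+1)%N.
Proof.
rewrite (leq_trans (size_sum _ _ _)) //; apply/bigmax_leqP => i _.
rewrite (leq_trans (size_scale_leq _ _)) // size_auxterm /adeg qE.
case: i => [[r j] k] /=.
have [[hr hj] hk] := (ltn_ord r, ltn_ord j, ltn_ord k).
have h1 : (p * D * j + p * D <= p * D * P)%N by rewrite -mulnSr leq_mul2l hj orbT.
have h2 : (D * k + D <= D * p)%N by rewrite -mulnSr leq_mul2l hk orbT.
have h3 : (D * p.-1 + D = D * p)%N by rewrite -mulnSr prednK // ltnW.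
move: h1 h2 h3; rewrite mulnSr (mulnC p D).
move: (D * p.-1)%N (D * p)%N (D * k)%N => d1 d2 d3.
move: (d2 * j)%N (d2 * P)%N => d4 d5; lia.
Qed.

(** Bounds the number of coefficients in the base point: [D] and [P] for the powers of [T] and [Z],
    and [3 P] for each of the [p - 1] remaining factors, which are [V] of degree at most [3 P] or
    the padding [(T Z)^P] of degree [2 P]. *)
Let N1 := (D + P + 3 * P * p)%N.

Lemma coef_size_poleless (A : {poly {poly L}}) :
  coef_size_le 1 A -> coef_size_le (P + P) (poleless a%:P%:P A P n.+1).
Proof.
move=> hA; apply: coef_size_le_sum => i.
have hi : (p ^ i <= P)%N by rewrite leq_exp2l // -ltnS.
apply: coef_size_leD.
  by apply: (@coef_size_leW _ (1 * (P + p ^ i))); [lia | apply: coef_size_leX].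
apply: (@coef_size_leW _ (0 + 1 * (P - p ^ i))); first lia.
by apply: coef_size_leM; [apply: coef_size_leC | apply: coef_size_leX].
Qed.

Let size_bi c s : (size ((bi c)`_s)%R <= N1)%N.
Proof.
suff h : coef_size_le N1.-1 (bi c) by have := h s; rewrite prednK // /N1; lia.
apply: coef_size_le_sum => -[[r j] k]; rewrite /biterm /=.
have [[hr hj] hk] := (ltn_ord r, ltn_ord j, ltn_ord k).
have hT := @coef_size_leT L; have hZ := @coef_size_leZ L.
have hV : coef_size_le (3 * P) V.
  apply: coef_size_leD; last apply: coef_size_leN; first apply: coef_size_leD.
  - apply: (@coef_size_leW _ (0 + (1 + 1) * P)); first lia.
    apply: coef_size_leM; first exact: coef_size_leC.
    by apply: coef_size_leX; apply: coef_size_leM.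
  - apply: (@coef_size_leW _ (1 * P + (P + P))); first lia.
    by apply: coef_size_leM; [apply: coef_size_leX | apply: coef_size_poleless].
  - apply: (@coef_size_leW _ (1 * P + (P + P))); first lia.
    by apply: coef_size_leM; [apply: coef_size_leX | apply: coef_size_poleless].
apply: (@coef_size_leW _ (0 + (1 * r + 1 * j + (1 + 1) * (P * (p.-1 - k)) + (3 * P) * k))).
  have : (P * (p.-1 - k) + P * k = P * p.-1)%N by rewrite -mulnDr; congr (_ * _)%N; lia.
  have : (P * p.-1 + P = P * p)%N by rewrite -mulnSr prednK // ltnW.
  rewrite /N1 -!mulnA; move: (P * (p.-1 - k))%N (P * k)%N (P * p.-1)%N (P * p)%N => u v w x; lia.
apply: coef_size_leM; first exact: coef_size_leC.
apply: coef_size_leM; last exact: coef_size_leX.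
apply: coef_size_leM; last by apply: coef_size_leX; apply: coef_size_leM.
by apply: coef_size_leM; apply: coef_size_leX.
Qed.

Definition twisted_trace (x : L) : L := \sum_(i < n.+1 + n.+1) (x ^+ (p ^ i) + a * x ^- (p ^ i)).

Section Local.
Variables (M : nat) (z : L).
Hypothesis M_le : (M <= p ^ n.+1)%N.
Hypothesis z_neq0 : z != 0.
Hypothesis trz : twisted_trace z = t.

Let cong (f g : {poly L}) := ('X^M %| f - g).

Let cong_refl f : cong f f. Proof. by rewrite /cong subrr dvdp0. Qed.
Let cong_mul f g f' g' : cong f g -> cong f' g' -> cong (f * f') (g * g').
Proof.
move=> h h'; rewrite /cong (_ : _ - _ = (f - g) * f' + g * (f' - g')); last first.
  by rewrite mulrBl mulrBr addrA subrK.
by apply: dvdp_add; [apply: dvdp_mulr | apply: dvdp_mull].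
Qed.
Let cong_exp f g k : cong f g -> cong (f ^+ k) (g ^+ k).
Proof. by move=> h; elim: k => // k IH; rewrite !exprS cong_mul. Qed.
Let cong_add f g f' g' : cong f g -> cong f' g' -> cong (f + f') (g + g').
Proof.
move=> h h'; rewrite /cong (_ : _ - _ = (f - g) + (f' - g')); last by rewrite opprD addrACA.
exact: dvdp_add.
Qed.
Let cong_sum (J : finType) (f g : J -> {poly L}) :
  (forall i, cong (f i) (g i)) -> cong (\sum_i f i) (\sum_i g i).
Proof.
move=> h; elim/big_rec2: _ => [|i ? ? _ IH]; first exact: cong_refl.
exact: cong_add.
Qed.
Let cong_sym f g : cong f g -> cong g f.
Proof. by rewrite /cong -dvdpNr opprB. Qed.

Let X : {poly L} := 'X + z%:P.

Let frobX i : X ^+ (p ^ i) = 'X^(p ^ i) + (z ^+ (p ^ i))%:P.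
Proof.
rewrite /X exprDn_pchar ?rmorphXn //.
have pp : p \in [pchar {poly L}] by rewrite pchar_lalg.
by rewrite (eq_pnat _ (pcharf_eq pp)) pnatX pnat_id.
Qed.

(** Frobenius is additive, and the power [p^i] of the displacement is divisible by its power [M],
    since [M <= p^(n+1) <= p^i]. This is the origin of the limit on the order of vanishing. *)
Let frob_cong i : (n.+1 <= i)%N -> cong (X ^+ (p ^ i)) (z ^+ (p ^ i))%:P.
Proof.
move=> ni; rewrite /cong frobX addrK dvdp_exp2l //.
by rewrite (leq_trans M_le) // leq_exp2l.
Qed.

Let X_pow_q j : cong (X ^+ (q * j)) (z ^+ j)%:P.
Proof.
rewrite exprM rmorphXn; apply: cong_exp.
have := @frob_cong (n.+1 + n.+1); rewrite -cardL expf_card cardL; apply; lia.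
Qed.

Let local_H :
  cong ((X * z%:P) ^+ P * poleless a%:P X D (n.+1 + n.+1))
       (X ^+ D * local_factor t%:P a%:P X z%:P).
Proof.
(* The upper half of the trace at [z], to which the upper half at the displaced point is congruent.
   As the trace at [z] is [t], it is [t] minus the lower half. *)
pose hi := \sum_(i < n.+1) ((z ^+ (p ^ (n.+1 + i))) + a * z ^- (p ^ (n.+1 + i))).
have Elo : z ^+ P * (t - hi) = poleless a z P n.+1.
  rewrite -trz /twisted_trace big_split_ord /= addrK /poleless mulr_sumr.
  apply: eq_bigr => i _; rewrite mulrDr -exprD mulrCA; congr (_ + _ * _).
  have hi' : (p ^ i <= P)%N by rewrite leq_exp2l // -ltnS.
  by rewrite -{1}(subnK hi') exprD mulfK // expf_neq0.
have h : cong (poleless a%:P X D (n.+1 + n.+1))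
     (X ^+ (D - P) * poleless a%:P X P n.+1 + X ^+ D * hi%:P).
  rewrite {1}/poleless big_split_ord /=; apply: cong_add.
    rewrite /poleless mulr_sumr; apply: cong_sum => i.
    have hi' : (p ^ i <= P)%N by rewrite leq_exp2l // -ltnS.
    rewrite mulrDr mulrCA -!exprD.
    have -> : (D - P + (P + p ^ i) = D + p ^ i)%N by lia.
    have -> : (D - P + (P - p ^ i) = D - p ^ i)%N by lia.
    exact: cong_refl.
  rewrite /hi rmorph_sum mulr_sumr; apply: cong_sum => i.
  rewrite rmorphD mulrDr; apply: cong_add.
    by rewrite exprD; apply: cong_mul => //; apply: frob_cong; rewrite leq_addr.
  rewrite rmorphM mulrCA; apply: cong_mul => //.
  (* Negative powers are frozen as well: [X^e] times [z^(-e)] is congruent to 1. *)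
  set e := (p ^ _)%N.
  have eD : (e <= D)%N by rewrite leq_exp2l //; have := ltn_ord i; lia.
  rewrite -{2}(subnK eD) exprD -mulrA -{1}[_ ^+ (D - e)]mulr1; apply: cong_mul => //.
  apply: cong_sym; rewrite -[1](_ : (z ^+ e)%:P * (z ^- e)%:P = _); last first.
    by rewrite -rmorphM mulfV ?expf_neq0.
  by apply: cong_mul => //; apply: frob_cong; rewrite leq_addr.
have -> : X ^+ D * local_factor t%:P a%:P X z%:P =
  (X * z%:P) ^+ P * (X ^+ (D - P) * poleless a%:P X P n.+1 + X ^+ D * hi%:P).
  have Elo' : poleless a%:P z%:P P n.+1 = z%:P ^+ P * (t%:P - hi%:P).
    by rewrite -(rmorph_poleless polyC) -Elo rmorphM rmorphB rmorphXn.
  rewrite /local_factor Elo' -(subnK PD) exprD addnK exprMn.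
  set A := X ^+ P; set B := X ^+ _; set C := z%:P ^+ P; set E := poleless _ _ _ _.
  by rewrite !mulrDr !mulrN !mulrA; ring.
exact: cong_mul.
Qed.

Let ev : {rmorphism {poly {poly L}} -> {poly L}} := map_poly (horner_eval z).

Let evT : ev T = X.
Proof.
by rewrite /T rmorphD /= map_polyC map_polyX /= /horner_eval hornerX addrC.
Qed.
Let evZ : ev Z = z%:P.
Proof. by rewrite /= map_polyC /= /horner_eval hornerX. Qed.
Let evC c : ev c%:P%:P = c%:P.
Proof. by rewrite /= map_polyC /= /horner_eval hornerC. Qed.

Let evV : ev V = local_factor t%:P a%:P X z%:P.
Proof.
by rewrite /V /local_factor rmorphB rmorphD !rmorphM !rmorphXn rmorphM
   !rmorph_poleless evT evZ !evC.
Qed.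

Lemma aux_local c : (forall s, (s < M)%N -> (bi c)`_s = 0) -> 'X^M %| aux c \Po X.
Proof.
move=> hc.
have d1 : 'X^M %| ev (bi c).
  rewrite -(poly_take_drop M (ev (bi c))) (_ : take_poly _ _ = 0) ?add0r ?dvdp_mull //.
  apply/polyP => s; rewrite coef_take_poly coef0; case: ifP => // sM.
  by rewrite /= coef_map hc //= /horner_eval horner0.
have d2 : cong ((X * z%:P) ^+ (P * p.-1) * (aux c \Po X)) (X ^+ (D * p.-1) * ev (bi c)).
  rewrite /aux /bi raddf_sum rmorph_sum !mulr_sumr; apply: cong_sum => -[[r j] k] /=.
  rewrite linearZ /= -mul_polyC mulrCA [ev _]rmorphM evC [X in cong _ X]mulrCA.
  apply: cong_mul => //; rewrite /biterm /auxterm /=.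
  rewrite !rmorphM /= !comp_Xn_poly rmorphXn /= rmorph_poleless /= comp_polyC comp_polyX.
  rewrite [ev (_ ^+ r)]rmorphXn [ev (_ ^+ j)]rmorphXn [ev ((_ * _) ^+ _)]rmorphXn.
  rewrite [ev (_ * _)]rmorphM [ev (V ^+ k)]rmorphXn evV evT evZ.
  set Hx := poleless _ _ _ _; set Vx := local_factor _ _ _ _.
  have kp : (k <= p.-1)%N by rewrite -ltnS prednK ?ltn_ord // ltnW.
  have -> : (X * z%:P) ^+ (P * p.-1) *
     (X ^+ r * X ^+ (q * j) * X ^+ (D * (p.-1 - k)) * Hx ^+ k) =
     (X ^+ r * (X * z%:P) ^+ (P * (p.-1 - k)) * X ^+ (D * (p.-1 - k))) *
     (X ^+ (q * j) * ((X * z%:P) ^+ P * Hx) ^+ k).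
    rewrite -{1}(subnK kp) mulnDr exprD (exprMn_comm k (mulrC _ _)) -exprM.
    move: (X ^+ (q * j)) (X ^+ (D * _)) (Hx ^+ k) (X ^+ r) => A1 A2 A3 A4.
    move: ((X * z%:P) ^+ (P * _)) ((X * z%:P) ^+ _) => A5 A6; ring.
  have -> : X ^+ (D * p.-1) *
      (X ^+ r * z%:P ^+ j * (X * z%:P) ^+ (P * (p.-1 - k)) * Vx ^+ k) =
     (X ^+ r * (X * z%:P) ^+ (P * (p.-1 - k)) * X ^+ (D * (p.-1 - k))) *
     (z%:P ^+ j * (X ^+ D * Vx) ^+ k).
    rewrite -{1}(subnK kp) mulnDr exprD (exprMn_comm k (mulrC _ _)) -exprM.
    move: (z%:P ^+ j) (X ^+ (D * _)) (Vx ^+ k) (X ^+ r) (X ^+ (D * k)) => A1 A2 A3 A4 A7.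
    move: ((X * z%:P) ^+ (P * _)) => A5; ring.
  apply: cong_mul => //; apply: cong_mul; first by rewrite -rmorphXn; apply: X_pow_q.
  by apply: cong_exp; apply: local_H.
have d3 : 'X^M %| (X * z%:P) ^+ (P * p.-1) * (aux c \Po X).
  by rewrite -(subrK (X ^+ (D * p.-1) * ev (bi c)) (_ * _)) dvdp_add ?dvdp_mull.
(* The displaced point has constant term [z != 0], so the padding is prime to the displacement and
   can be divided out. *)
have cp : coprimep 'X^M ((X * z%:P) ^+ (P * p.-1)).
  rewrite coprimep_expl // coprimep_expr // coprimepMr coprimep_sym.
  rewrite -[X in coprimep _ X](subr0 'X) -polyC0 coprimep_XsubC /root /X !hornerE z_neq0 /=.
  by rewrite coprimep_sym -[X in coprimep _ X](subr0 'X) -polyC0 coprimep_XsubC /root !hornerE.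
by rewrite -(Gauss_dvdpr _ cp).
Qed.

Lemma aux_dvd c : (forall s, (s < M)%N -> (bi c)`_s = 0) -> ('X - z%:P) ^+ M %| aux c.
Proof.
move=> /aux_local /(dvdp_comp_poly ('X - z%:P)).
by rewrite comp_polyXaddC_K comp_Xn_poly.
Qed.
End Local.

Lemma prod_pow_dvdp (rs : seq L) (M : nat) (f : {poly L}) : uniq rs ->
  (forall z, z \in rs -> ('X - z%:P) ^+ M %| f) ->
  (\prod_(z <- rs) ('X - z%:P)) ^+ M %| f.
Proof.
elim: rs => [|z rs IH] /=; first by rewrite big_nil expr1n dvd1p.
case/andP => zrs urs h; rewrite big_cons exprMn Gauss_dvdp.
  rewrite h ?mem_head //=; apply: IH => // y yrs; apply: h.
  by rewrite inE yrs orbT.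
rewrite coprimep_expl // coprimep_expr // coprimep_sym coprimep_XsubC.
by rewrite root_prod_XsubC.
Qed.

(* A nonzero [aux c] of degree at most [q * P.+1] that vanishes to order [M] at every
   counted point exists because there are fewer linear conditions than coefficients. *)
Lemma stepanov_bound (M : nat) : (M <= p ^ n.+1)%N ->
  (M * (D + P + 3 * P * p) < D * P * p)%N ->
  (#|[set x : L | (x != 0%R) && (twisted_trace x == t)]| * M <= q * P.+1)%N.
Proof.
move=> M_le M_lt.
pose coefs (c : {ffun I -> L}) : {ffun 'I_M * 'I_N1 -> L} :=
  [ffun sl : 'I_M * 'I_N1 => ((bi c)`_(sl.1))`_(sl.2)].
(* Linear algebra by counting: there are more families of coefficients than values of [coefs], so
   two families agree and their difference satisfies every condition. *)
have [inj|ninj] := boolP (injectiveb coefs).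
  have := leq_card _ (injectiveP _ inj).
  rewrite !card_ffun !card_prod !card_ord leq_exp2l; last first.
    exact: finNzRing_gt1.
  by rewrite leqNgt M_lt.
have [c1 [c2 [ne e]]] : exists c1 c2, c1 != c2 /\ coefs c1 = coefs c2.
  move/injectivePn: ninj => [c1 [c2 ne e]]; by exists c1, c2.
pose c := c1 - c2.
have c_neq0 : c != 0 by rewrite subr_eq0.
have biB : bi c = bi c1 - bi c2.
  rewrite /bi -sumrB; apply: eq_bigr => i _.
  by rewrite !ffunE !polyCB mulrBl.
have hc s : (s < M)%N -> (bi c)`_s = 0.
  move=> sM; apply/polyP => l; rewrite coef0.
  have [lN|lN] := ltnP l N1; last by rewrite nth_default // (leq_trans (size_bi _ _)).
  move/ffunP: e => /(_ (Ordinal sM, Ordinal lN)); rewrite !ffunE /= biB coefB coefB => ->.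
  by rewrite subrr.
set S := [set x | _].
have dv : (\prod_(z <- enum S) ('X - z%:P)) ^+ M %| aux c.
  apply: prod_pow_dvdp; first exact: enum_uniq.
  by move=> z; rewrite mem_enum inE => /andP[z0 /eqP tz]; apply: aux_dvd.
have := dvdp_leq (aux_neq0 c_neq0) dv.
have mon : (\prod_(z <- enum S) ('X - z%:P)) \is monic by rewrite monic_prod_XsubC.
have := size_exp (\prod_(z <- enum S) ('X - z%:P)) M.
rewrite size_prod_XsubC /= -cardE => <- h.
by apply: leq_trans (size_aux c); apply: leq_trans h; apply: leq_pred.
Qed.

End Stepanov.
End Stepanov.

(** * Kloosterman sums along a tower of quadratic extensions *)

Module Tower.
Import Coquelicot.Coquelicot.
Import all_boot all_order all_algebra all_fingroup all_field.
Import zify ring.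
Import GRing.Theory Sums Stepanov.
Local Open Scope ring_scope.
Set Implicit Arguments. Unset Strict Implicit. Unset Printing Implicit Defensive.

Section Tower.
Variables (p : nat) (k : nat) (L : finFieldType) (a : L) (psi : L -> C).
Hypothesis p_pr : prime p.
Hypothesis pL : p \in [pchar L].
Hypothesis cardL : #|L| = (p ^ (2 ^ k))%N.

Definition qlev i : nat := (p ^ (2 ^ i))%N.
(** The subfield with [p^(2^i)] elements, cut out of the top field by Frobenius so that all levels
    share one type. *)
Definition lev i : {set L} := [set x | x ^+ qlev i == x].
Definition trlev i (x : L) : L := \sum_(j < 2 ^ i) x ^+ (p ^ j).

Hypothesis a_lev : a \in lev 0.
Hypothesis a_neq0 : a != 0.
Hypothesis psiD : forall s t, s \in lev 0 -> t \in lev 0 -> psi (s + t) = Cmult (psi s) (psi t).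
Hypothesis psi0 : psi 0 = RtoC (IZR 1).
Hypothesis psi1 : psi 1 <> RtoC (IZR (Zpos xH)).

Lemma qlevS i : qlev i.+1 = (qlev i * qlev i)%N.
Proof. by rewrite /qlev expnS mul2n -addnn expnD. Qed.

Lemma qlev_gt1 i : (1 < qlev i)%N.
Proof. by rewrite -(exp1n (2 ^ i)) ltn_exp2r ?prime_gt1 // expn_gt0. Qed.

Lemma frobD j (x y : L) : (x + y) ^+ (p ^ j) = x ^+ (p ^ j) + y ^+ (p ^ j).
Proof. by rewrite exprDn_pchar // (eq_pnat _ (pcharf_eq pL)) pnatX pnat_id. Qed.

Lemma frob_sum j (I : finType) (F : I -> L) :
  (\sum_i F i) ^+ (p ^ j) = \sum_i F i ^+ (p ^ j).
Proof.
elim/big_ind2: _ => [|x y x' y' <- <-|//]; last exact: frobD.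
by rewrite expr0n gtn_eqF // expn_gt0 prime_gt0.
Qed.

Lemma lev0E x : (x \in lev 0) = (x ^+ p == x).
Proof. by rewrite inE /qlev expn0 expn1. Qed.

Lemma lev_mono i x : x \in lev i -> x \in lev i.+1.
Proof. by rewrite !inE qlevS exprM => /eqP h; rewrite !h. Qed.

Lemma lev0_lev i x : x \in lev 0 -> x \in lev i.
Proof. by move=> h; elim: i => // i; apply: lev_mono. Qed.

Lemma levD i x y : x \in lev i -> y \in lev i -> x + y \in lev i.
Proof. by rewrite !inE frobD => /eqP -> /eqP ->. Qed.

Lemma levM i x y : x \in lev i -> y \in lev i -> x * y \in lev i.
Proof. by rewrite !inE exprMn => /eqP -> /eqP ->. Qed.

Lemma levV i x : x \in lev i -> x^-1 \in lev i.
Proof. by rewrite !inE exprVn => /eqP ->. Qed.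

Lemma levN i x : x \in lev i -> - x \in lev i.
Proof.
rewrite !inE exprNn_pchar ?(eq_pnat _ (pcharf_eq pL)) ?pnatX ?pnat_id //.
by move=> /eqP ->.
Qed.

Lemma lev_0 i : 0 \in lev i.
Proof. by rewrite inE expr0n gtn_eqF // ltnW // qlev_gt1. Qed.

Lemma lev_1 i : 1 \in lev i. Proof. by rewrite inE expr1n. Qed.

(** [X^q - X] divides [X^|L| - X], which splits into distinct linear factors over [L], so it has as
    many roots as its degree. *)
Lemma card_lev i : (i <= k)%N -> #|lev i| = qlev i.
Proof.
move=> ik; set q := qlev i; have q1 : (1 < q)%N := qlev_gt1 i.
have dv j : ('X^q - 'X : {poly L}) %| 'X^(q ^ j) - 'X.
  elim: j => [|j IH]; first by rewrite expn0 expr1 subrr dvdp0.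
  have -> : ('X^(q ^ j.+1) - 'X : {poly L}) = ('X^(q ^ j) - 'X) ^+ q + ('X^q - 'X).
    have qn : [pchar {poly L}].-nat q.
      have pp : p \in [pchar {poly L}] by rewrite pchar_poly.
      by rewrite /q /qlev (eq_pnat _ (pcharf_eq pp)) pnatX pnat_id.
    by rewrite exprDn_pchar // exprNn_pchar // -exprM -expnSr addrA subrK.
  by rewrite dvdp_add // (dvdp_trans IH) // dvdp_exp // ltnW.
have := dv (2 ^ (k - i))%N.
rewrite -expnM -expnD subnKC // -cardL finField_genPoly.
case/dvdp_prod_XsubC => m; set s := mask _ _ => e.
have us : uniq s by rewrite mask_uniq // index_enum_uniq.
have sq : size ('X^q - 'X : {poly L}) = q.+1.
  by rewrite size_polyDl ?size_polyXn // size_polyN size_polyX.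
have -> : #|lev i| = size s.
  rewrite -(card_uniqP us); apply: eq_card => x.
  rewrite inE -root_prod_XsubC -(eqp_root e) rootE !hornerE.
  by rewrite subr_eq0.
by have := eqp_size e; rewrite sq size_prod_XsubC => -[].
Qed.

Lemma trlevS i x : trlev i.+1 x = trlev i (x + x ^+ qlev i).
Proof.
rewrite /trlev expnS mul2n -addnn big_split_ord /= -big_split /=.
by apply: eq_bigr => j _; rewrite frobD /qlev -exprM -expnD.
Qed.

Lemma trlevD i x y : trlev i (x + y) = trlev i x + trlev i y.
Proof. by rewrite /trlev -big_split; apply: eq_bigr => j _; rewrite frobD. Qed.

Lemma lev0_frob c j : c \in lev 0 -> c ^+ (p ^ j) = c.
Proof.
rewrite lev0E => /eqP h; elim: j => [|j IH]; first by rewrite expr1.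
by rewrite expnS exprM h IH.
Qed.

Lemma trlevZ i c x : c \in lev 0 -> trlev i (c * x) = c * trlev i x.
Proof.
move=> hc; rewrite /trlev mulr_sumr; apply: eq_bigr => j _.
by rewrite exprMn lev0_frob.
Qed.

Lemma trlev_lev i x : x \in lev i -> trlev i x \in lev 0.
Proof.
rewrite lev0E inE => /eqP h; rewrite -{1}[p]expn1 /trlev frob_sum.
move: h; rewrite /qlev; case: (2 ^ i)%N (expn_gt0 2 i) => // n _ h.
rewrite big_ord_recr /= big_ord_recl /= addrC.
apply/eqP; congr (_ + _); first by rewrite -exprM -expnSr h expn0 expr1.
by apply: eq_bigr => j _; rewrite -exprM -expnSr.
Qed.

Definition klarg (x : L) : L := x + a / x.
Definition unitlev i x := (x \in lev i) && (x != 0).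

Definition levsum i : C := \csum_(x | unitlev i x) psi (trlev i (klarg x)).

(** The trace is a polynomial of degree [p^(2^i - 1)], too small to vanish on all of level [i]; a
    scalar of the prime field then normalises the value. *)
Lemma trlev_nonzero i : (i <= k)%N -> exists2 x, x \in lev i & trlev i x = 1.
Proof.
move=> ik.
suff [x hx nx] : exists2 x, x \in lev i & trlev i x != 0.
  have h0 := trlev_lev hx.
  exists ((trlev i x)^-1 * x); first by rewrite levM // levV // lev0_lev.
  by rewrite trlevZ ?levV // mulVf.
apply/exists_inP; apply: contraT; rewrite negb_exists_in => /forall_inP h.
pose f : {poly L} := \sum_(j < 2 ^ i) 'X^(p ^ j).
have hf : size f = (p ^ (2 ^ i).-1).+1.
  rewrite /f; case: (2 ^ i)%N (expn_gt0 2 i) => // n _.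
  rewrite big_ord_recr /= addrC size_polyDl size_polyXn //.
  rewrite (leq_ltn_trans (size_sum _ _ _)) //= ltnS; apply/bigmax_leqP => j _.
  by rewrite size_polyXn ltn_exp2l // prime_gt1.
have f0 : f != 0 by rewrite -size_poly_eq0 hf.
have := max_poly_roots f0 (rs := enum (lev i)); rewrite enum_uniq hf -cardE card_lev //.
have -> : all (root f) (enum (lev i)).
  apply/allP => x; rewrite mem_enum => hx; have := h x hx; rewrite negbK => /eqP e.
  by rewrite rootE -e /f horner_sum; apply/eqP/eq_bigr => j _; rewrite hornerXn.
move=> /(_ isT isT); rewrite ltnS leqNgt /qlev ltn_exp2l ?prime_gt1 //.
by rewrite prednK ?expn_gt0 // leqnn.
Qed.

Lemma csum_translate i c x0 : (i <= k)%N -> c \in lev i -> x0 \in lev i ->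
  (psi (trlev i (c * x0)) <> RtoC (IZR 1)) ->
  \csum_(t | t \in lev i) psi (trlev i (GRing.mul c t)) = RtoC (IZR 0).
Proof.
move=> ik hc hx; set w := psi (trlev i (c * x0)) => hw.
set S := bigop _ _ _.
have E : S = Cmult w S.
  rewrite {1}/S (reindex_inj (@addrI _ x0)) /=.
  have dom t : (x0 + t \in lev i) = (t \in lev i).
    by apply/idP/idP => [h|]; [rewrite -(addKr x0 t) levD // levN | apply: levD].
  rewrite (eq_bigl _ _ dom) /S big_distrr /=; apply: eq_bigr => t ht.
  by rewrite mulrDr trlevD psiD // trlev_lev // levM.
exact: (Cmult_fixed hw).
Qed.

Lemma csum_lev i c : (i <= k)%N -> c \in lev i ->
  \csum_(t | t \in lev i) psi (trlev i (GRing.mul c t)) =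
  if c == 0 then RtoC (INR (qlev i)) else RtoC (IZR 0).
Proof.
move=> ik hc; case: eqP => [->|/eqP c0].
  rewrite (eq_bigr (fun _ => RtoC (IZR 1))) => [|t _].
    by rewrite csum_const card_lev // Cmult_1_r.
  rewrite mul0r /trlev big1 // => j _.
  by rewrite expr0n gtn_eqF // expn_gt0 prime_gt0.
have [x hx e] := trlev_nonzero ik.
apply: (csum_translate (x0 := c^-1 * x)) => //; first by rewrite levM // levV.
by rewrite mulVKf // e.
Qed.

(** The two ways to factor a monic quadratic given by the sum and the product of its roots: with
    both roots in level [i], or with a root of level [i+1] and its conjugate. *)
Definition fiber_pair i (u : L * L) : nat :=
  #|[set v : L * L | (v.1 \in lev i) && (v.2 \in lev i) && ((v.1 + v.2 == u.1) && (v.1 * v.2 == u.2))]|.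
Definition fiber_conj i (u : L * L) : nat :=
  #|[set x | (x \in lev i.+1) && ((x + x ^+ qlev i == u.1) && (x * x ^+ qlev i == u.2))]|.

Lemma quadratic_roots (x y z : L) : z * z - (x + y) * z + x * y = 0 -> z = x \/ z = y.
Proof.
have -> : z * z - (x + y) * z + x * y = (z - x) * (z - y) by ring.
by move/eqP; rewrite mulf_eq0 !subr_eq0 => /orP[] /eqP; [left|right].
Qed.

(** A quadratic has at most two roots. If it splits in level [i], a root counted by [fiber_conj] is
    its own conjugate, hence a double root, and each of the two ways then counts it once. *)
Lemma fiber_le2 i u : (fiber_pair i u + fiber_conj i u <= 2)%N.
Proof.
rewrite /fiber_pair /fiber_conj; set A : {set L * L} := [set v | _]; set B : {set L} := [set x | _].
have [A0|[[x y] Axy]] := set_0Vmem A.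
  rewrite A0 cards0 add0n.
  have [->|[z Bz]] := set_0Vmem B; first by rewrite cards0.
  move: (Bz); rewrite inE => /and3P[hz /eqP e1 /eqP e2].
  suff : B \subset [set z; z ^+ qlev i].
    by move=> /subset_leq_card h; rewrite (leq_trans h) // cards2; case: (_ != _).
  apply/subsetP => w; rewrite inE => /and3P[_ /eqP f1 /eqP f2].
  rewrite !inE; have := @quadratic_roots z (z ^+ qlev i) w.
  rewrite e1 e2 -f1 -f2 => -[|->|->]; rewrite ?eqxx ?orbT //; ring.
move: (Axy); rewrite inE /= => /andP[/andP[hx hy] /andP[/eqP e1 /eqP e2]].
have hA : A \subset [set (x, y); (y, x)].
  apply/subsetP => -[v w]; rewrite inE /= => /and3P[_ /eqP f1 /eqP f2].
  rewrite !inE !xpair_eqE; have := @quadratic_roots x y v.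
  rewrite e1 e2 -f1 -f2 => -[|ev|ev]; first ring.
    by have := etrans f1 (esym e1); rewrite ev => /addrI ->; rewrite !eqxx.
  have : v + w = y + x by rewrite f1 -e1 addrC.
  by rewrite ev => /addrI ->; rewrite !eqxx orbT.
have hB : B \subset (if x == y then [set x] else set0).
  apply/subsetP => z; rewrite inE => /and3P[hz /eqP f1 /eqP f2].
  have zz : z ^+ qlev i = z.
    have := @quadratic_roots x y z; rewrite e1 e2 -f1 -f2 => -[|ez|ez]; first ring.
      by move: hx; rewrite inE -ez => /eqP.
    by move: hy; rewrite inE -ez => /eqP.
  rewrite zz in f1 f2.
  have := @quadratic_roots z z x; rewrite f1 f2 -e1 -e2 => -[|zx|zx]; first ring.
    have /addrI -> : x + y = x + x by rewrite e1 -f1 zx.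
    by rewrite eqxx inE zx.
  have /addrI -> : x + y = x + x by rewrite e1 -f1 zx.
  by rewrite eqxx inE zx.
have := subset_leq_card hA; have := subset_leq_card hB.
rewrite cards2; have [xy|_] := eqVneq x y; last first.
  rewrite cards0 => h1 h2; apply: leq_trans (leq_add h2 h1) _.
  by case: ((x, y) != (y, x)).
by rewrite xy eqxx cards1 => h1 h2; apply: leq_trans (leq_add h2 h1) _.
Qed.

Let pairs i : {set L * L} := setX (lev i) (lev i).

Lemma sum_fiber_pair i : (\sum_(u in pairs i) fiber_pair i u = #|lev i| * #|lev i|)%N.
Proof.
rewrite -cardsX -/(pairs i) -sum1_card.
rewrite [RHS](partition_big (fun v : L * L => (v.1 + v.2, v.1 * v.2)) (mem (pairs i))) /=.
  apply: eq_bigr => u _; rewrite sum1dep_card /fiber_pair; apply: eq_card => v.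
  rewrite !inE /=; case: u => u1 u2; rewrite xpair_eqE //.
by move=> [v w] /setXP[h1 h2]; apply/setXP; split; [apply: levD | apply: levM].
Qed.

Lemma levS_norm i x : x \in lev i.+1 ->
  x + x ^+ qlev i \in lev i /\ x * x ^+ qlev i \in lev i.
Proof.
rewrite 3!inE qlevS exprM => /eqP h.
by rewrite frobD exprMn h addrC mulrC !eqxx.
Qed.

Lemma sum_fiber_conj i : (\sum_(u in pairs i) fiber_conj i u = #|lev i.+1|)%N.
Proof.
rewrite -sum1_card.
rewrite [RHS](partition_big (fun x => (x + x ^+ qlev i, x * x ^+ qlev i)) (mem (pairs i))) /=.
  apply: eq_bigr => u _; rewrite sum1dep_card /fiber_conj; apply: eq_card => v.
  by rewrite !inE /=.
by move=> x /levS_norm [h1 h2]; apply/setXP.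
Qed.

(** Equality comes without discriminants, in every characteristic: the fibres over the [q_i^2]
    quadratics have [q_i^2 + q_i^2] elements in all, and none has more than two. *)
Lemma fiber_eq2 i u : (i < k)%N -> u \in pairs i -> (fiber_pair i u + fiber_conj i u = 2)%N.
Proof.
move=> ik; have : (\sum_(u in pairs i) (fiber_pair i u + fiber_conj i u) = \sum_(u in pairs i) 2)%N.
  rewrite big_split /= sum_fiber_pair sum_fiber_conj sum_nat_const cardsX.
  by rewrite !card_lev // 1?ltnW // qlevS; lia.
have := leqif_sum (fun u (_ : u \in pairs i) => leqif_eq (fiber_le2 i u)).
by move=> [_ e] /eqP; rewrite e => /forall_inP h /h /eqP.
Qed.

(** The argument is [x + a/x + y + a/y] in terms of the sum [u.1] and the product [u.2] of [x] and
    [y]. *)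
Let weight i (u : L * L) : C := psi (trlev i (u.1 + a * u.1 / u.2)).

Lemma psi_trlev_prod i x y : x \in lev i -> x != 0 -> y \in lev i -> y != 0 ->
  Cmult (psi (trlev i (klarg x))) (psi (trlev i (klarg y))) = weight i (x + y, x * y).
Proof.
move=> hx x0 hy y0.
have al := lev0_lev i a_lev.
rewrite -psiD -?trlevD; last 2 first.
- by rewrite trlev_lev // levD // levM // levV.
- by rewrite trlev_lev // levD // levM // levV.
rewrite /weight /=; congr (psi (trlev i _)); rewrite /klarg; field.
by rewrite x0 y0.
Qed.

Lemma psi_trlevS i x : x \in lev i.+1 -> x != 0 ->
  psi (trlev i.+1 (klarg x)) = weight i (x + x ^+ qlev i, x * x ^+ qlev i).
Proof.
move=> hx x0; rewrite trlevS /weight /=; congr (psi (trlev i _)); rewrite /klarg.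
rewrite frobD exprMn exprVn (eqP (_ : a ^+ qlev i == a)); last first.
  by have := lev0_lev i a_lev; rewrite inE.
have : x ^+ qlev i != 0 by rewrite expf_neq0.
by move: (x ^+ qlev i) => y y0; field; rewrite x0 y0.
Qed.

Let upairs i (u : L * L) : bool := (u.1 \in lev i) && unitlev i u.2.

Lemma levsum_sqr i :
  Cmult (levsum i) (levsum i) =
  \csum_(u | upairs i u) Cmult (RtoC (INR (fiber_pair i u))) (weight i u).
Proof.
rewrite {1}/levsum big_distrl /=.
transitivity (\big[Cplus/RtoC (IZR 0)]_(v : L * L | unitlev i v.1 && unitlev i v.2)
                weight i (GRing.add v.1 v.2, GRing.mul v.1 v.2)).
  rewrite -(pair_big (unitlev i) (unitlev i)
     (fun x y => weight i (GRing.add x y, GRing.mul x y))) /=.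
  apply: eq_bigr => x /andP[hx x0]; rewrite /levsum big_distrr /=.
  by apply: eq_bigr => y /andP[hy y0]; apply: psi_trlev_prod.
rewrite (partition_big (fun v : L * L => (GRing.add v.1 v.2, GRing.mul v.1 v.2)) (upairs i)) /=.
  apply: eq_bigr => u /andP[hu1 /andP[hu2 u0]].
  rewrite (eq_bigr (fun _ => weight i u)) => [|v /andP[_ /eqP ->] //].
  rewrite csum_const; congr (Cmult (RtoC (INR _)) _).
  rewrite /fiber_pair; apply: eq_card => -[v w]; rewrite !inE /= /unitlev.
  case: u u0 {hu1 hu2} => u1 u2 /= u0; rewrite unfold_in /= xpair_eqE.
  case: (v + w == u1) => //=; rewrite ?andbF // !inE.
  have [e|] := eqVneq (v * w) u2; rewrite ?andbF //= !andbT.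
  by move: u0; rewrite -e mulf_eq0 negb_or => /andP[-> ->]; rewrite !andbT.
move=> [v w] /= /andP[/andP[hv v0] /andP[hw w0]].
by rewrite /upairs /unitlev /= levD // levM // mulf_neq0.
Qed.

Lemma levsumS_fiber i :
  levsum i.+1 =
  \csum_(u | upairs i u) Cmult (RtoC (INR (fiber_conj i u))) (weight i u).
Proof.
rewrite {1}/levsum.
transitivity (\csum_(x | unitlev i.+1 x)
   weight i (GRing.add x (GRing.exp x (qlev i)), GRing.mul x (GRing.exp x (qlev i)))).
  by apply: eq_bigr => x /andP[hx x0]; apply: psi_trlevS.
rewrite (partition_big (fun x : L =>
  (GRing.add x (GRing.exp x (qlev i)), GRing.mul x (GRing.exp x (qlev i)))) (upairs i)) /=.
  apply: eq_bigr => u /andP[hu1 /andP[hu2 u0]].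
  rewrite (eq_bigr (fun _ => weight i u)) => [|v /andP[_ /eqP ->] //].
  rewrite csum_const; congr (Cmult (RtoC (INR _)) _).
  rewrite /fiber_conj; apply: eq_card => v; rewrite !inE /= /unitlev.
  case: u u0 {hu1 hu2} => u1 u2 /= u0; rewrite unfold_in /= xpair_eqE.
  case: (v + _ == u1) => //=; rewrite ?andbF // !inE.
  have [e|] := eqVneq (v * _) u2; rewrite ?andbF //= !andbT.
  by move: u0; rewrite -e mulf_eq0 negb_or => /andP[-> _]; rewrite andbT.
move=> v /andP[hv v0]; have [h1 h2] := levS_norm hv.
by rewrite /upairs /unitlev /= h1 h2 mulf_neq0 // expf_neq0.
Qed.

(* A pair (sum, product) over level [i] comes either from two elements of level [i] or
   from an element of level [i.+1] and its conjugate, two ways in total. *)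
Lemma levsum_quadratic i : (i < k)%N ->
  Cplus (Cmult (levsum i) (levsum i)) (levsum i.+1) = RtoC (Rmult (INR 2) (INR (qlev i))).
Proof.
move=> ik; rewrite levsum_sqr levsumS_fiber -big_split /=.
have -> : RtoC (Rmult (INR 2) (INR (qlev i))) = Cmult (RtoC (INR 2)) (RtoC (INR (qlev i))).
  exact: RtoC_mult.
transitivity (\csum_(u | upairs i u) Cmult (RtoC (INR 2)) (weight i u)).
  apply: eq_bigr => u /andP[hu1 /andP[hu2 u0]].
  rewrite -Cmult_plus_distr_r -RtoC_plus -plus_INR; congr (Cmult (RtoC (INR _)) _).
  by apply: fiber_eq2 => //; case: u hu1 hu2 {u0} => u1 u2 *; apply/setXP.
rewrite -big_distrr /=; congr Cmult.
transitivity (\csum_(t | t \in lev i) \csum_(v | unitlev i v) weight i (t, v)).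
  by rewrite pair_big /=; apply: eq_big => -[].
rewrite exchange_big /=.
have aN : unitlev i (- a) 
  by rewrite /unitlev oppr_eq0 a_neq0 andbT; apply: levN; apply: lev0_lev.
(* For a fixed product [v] the argument is linear in the sum [t], with slope [1 + a/v];
   orthogonality leaves only [v = -a]. *)
rewrite (bigD1 (- a) aN) /=.
rewrite [X in Cplus _ X]big1 ?Cplus_0_r => [|v /andP[/andP[hv v0] va]].
  rewrite (eq_bigr (fun t => psi (trlev i (GRing.mul 0 t)))).
    by rewrite (csum_lev (ltnW ik) (lev_0 i)) eqxx.
  move=> t _; rewrite /weight /=; congr (psi (trlev i _)).
  by rewrite invrN mulrN [a * t]mulrC mulfK // subrr mul0r.
have al := lev0_lev i a_lev.
rewrite (eq_bigr (fun t => psi (trlev i (GRing.mul (1 + a / v) t)))).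
  have hc : 1 + a / v \in lev i by apply: levD (lev_1 i) (levM al (levV hv)).
  rewrite (csum_lev (ltnW ik) hc).
  rewrite (_ : (1 + a / v == 0) = false) //; apply: contraNF va => /eqP h.
  apply/eqP; have : v * (1 + a / v) = 0 by rewrite h mulr0.
  by rewrite mulrDr mulr1 mulrCA mulfV // mulr1 => /eqP; rewrite addr_eq0 => /eqP.
move=> t _; rewrite /weight /=; congr (psi (trlev i _)).
by rewrite mulrDl mul1r mulrAC.
Qed.


(** With [M = r - e] the left side is [P r r + (3 r r + P r - e P r) - e (P + 3 r)], and
    [e = 3 p + 1] is the value for which the bracket vanishes. *)
Lemma stepanov_parameters (r P M e : nat) : (0 < P)%N -> r = (P * p)%N ->
  e = (3 * p + 1)%N -> (M + e = r)%N ->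
  (M * (P * r + P + 3 * P * p) < P * r * P * p)%N.
Proof.
move=> P0 rE eE Mr.
have -> : (3 * P * p = 3 * r)%N by rewrite rE mulnA.
have -> : (P * r * P * p = P * r * r)%N by rewrite -mulnA -rE.
have E1 : (e * (P * r) = 3 * r * r + P * r)%N.
  rewrite eE mulnDl mul1n; congr addn; rewrite mulnA; congr muln.
  by rewrite rE -!mulnA [(p * P)%N]mulnC.
have E2 : (M * (P * r + P + 3 * r) + e * (P * r + P + 3 * r) = P * r * r + e * (P * r))%N.
  by rewrite -mulnDl Mr E1; ring.
have E3 : (e * (P * r + P + 3 * r) = e * (P * r) + e * (P + 3 * r))%N by rewrite -addnA mulnDr.
have : (0 < e * (P + 3 * r))%N by rewrite muln_gt0 eE addn1 /= ltn_addr.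
by rewrite E3 in E2; move: E2; move: (M * _)%N (e * _)%N (e * _)%N (P * r * r)%N; lia.
Qed.

Definition trace_fiber t : {set L} := [set x : L | (x != 0) && (trlev k (klarg x) == t)].

Lemma card_trace_fiber n t : (k > 0)%N -> (2 ^ k = n.+1 + n.+1)%N ->
  (2 * (3 * p + 1) <= p ^ n.+1)%N -> t \in lev 0 ->
  (INR #|trace_fiber t| <=
     INR (p ^ n.+1) * INR (p ^ n.+1) / INR p + 10 * INR (p ^ n.+1))%R.
Proof.
move=> k0 kn big ht; set N := #|_|.
have cL : #|L| = (p ^ (n.+1 + n.+1))%N by rewrite cardL kn.
have p1 := prime_gt1 p_pr.
have := @stepanov_bound L p n a t p_pr pL cL (p ^ n.+1 - (3 * p + 1)) (leq_subr _ _).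
have -> : #|[set x : L | (x != 0) && (twisted_trace p n a x == t)]| = N.
  apply: eq_card => x; rewrite !inE; congr (_ && (_ == _)).
  rewrite /twisted_trace /trlev kn; apply: eq_bigr => j _.
  by rewrite /klarg frobD exprMn exprVn (lev0_frob j a_lev).
have -> : (p ^ (n + n.+1) = p ^ n * p ^ n.+1)%N by rewrite expnD.
have -> : (p ^ (n.+1 + n.+1) = p ^ n.+1 * p ^ n.+1)%N by rewrite expnD.
have rE : (p ^ n.+1 = p ^ n * p)%N by rewrite expnSr.
have P0 : (0 < p ^ n)%N by rewrite expn_gt0 ltnW.
move: (p ^ n.+1)%N (p ^ n)%N rE P0 big => r P rE P0 big h.
apply: (@stepanov_real _ _ (INR P) _).
- by rewrite -INR2; apply: leq_INR.
- by rewrite rE mult_INR.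
- by rewrite -INR2 -INR3 -[IZR 1]/(INR 1) -!mult_INR -plus_INR -mult_INR; apply: leq_INR.
have {}h : (N * (r - (3 * p + 1)) <= r * r * P.+1)%N.
  by apply: h; apply: (@stepanov_parameters r P _ (3 * p + 1)) => //; lia.
have := leq_INR h; rewrite !mult_INR S_INR minus_INR ?plus_INR ?mult_INR ?INR3 //.
  by rewrite /=; lra.
by apply/leP; lia.
Qed.

Hypothesis psi_norm : forall t, t \in lev 0 -> Cmod (psi t) = 1%R.

Lemma sum_psi0 : \csum_(t | t \in lev 0) psi t = RtoC (IZR 0).
Proof.
have := @csum_lev 0 1 (leq0n k) (lev_1 0); rewrite oner_eq0 => h.
rewrite -[RHS]h; apply: eq_bigr => t _.
by rewrite mul1r /trlev big_ord1 expr1.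
Qed.

(** Upper bounds for the fibres suffice: a deviation [d <= 10 r] satisfies [|d| <= 20 r - d], and
    the deviations from [r^2/p] add up to -1 over the [p] fibres. Hence at most [20 p r + 1]. *)
Lemma levsum_top_bound n : (k > 0)%N -> (2 ^ k = n.+1 + n.+1)%N ->
  (2 * (3 * p + 1) <= p ^ n.+1)%N ->
  (Cmod (levsum k) <= 21 * INR p * INR (p ^ n.+1))%R.
Proof.
move=> k0 kn big; set r := INR (p ^ n.+1).
have p1 : (1 <= INR p)%R by apply: (@leq_INR 1); rewrite ?expn_gt0 prime_gt0.
have r1 : (1 <= r)%R by apply: (@leq_INR 1); rewrite ?expn_gt0 prime_gt0.
have full x : x \in lev k by rewrite inE /qlev -cardL expf_card.
pose N t := #|trace_fiber t|.
have card0 : INR #|[pred t | t \in lev 0]| = INR p.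
  by congr INR; rewrite -[RHS]expn1; apply: card_lev.
have E1 : levsum k = \csum_(t | t \in lev 0) Cmult (RtoC (INR (N t))) (psi t).
  rewrite /levsum (partition_big (fun x => trlev k (klarg x)) (mem (lev 0))) /=.
    apply: eq_bigr => t ht.
    rewrite (eq_bigr (fun _ => psi t)) => [|x /andP[_ /eqP ->] //].
    rewrite csum_const; congr (Cmult (RtoC (INR _)) _).
    by apply: eq_card => x; rewrite !inE /= unfold_in /= /unitlev full.
  by move=> x _; apply: trlev_lev.
have E2 : (\rsum_(t | t \in lev 0) INR (N t) = r * r - 1)%R.
  have -> : (r * r - 1 = INR (#|L|.-1))%R.
    have L0 : (0 < #|L|)%N by rewrite cardL expn_gt0 prime_gt0.
    rewrite -[in RHS]subn1 minus_INR; last by apply/leP.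
    by rewrite cardL kn expnD mult_INR.
  rewrite -[#|L|.-1](_ : #|[pred x : L | x != 0]| = _); last first.
    by rewrite -(cardC1 (0 : L)); apply: eq_card => x; rewrite !inE.
  have -> : INR #|[pred x : L | x != 0]| = \rsum_(x | x != 0 :> L) 1%R.
    by rewrite rsum_const Rmult_1_r.
  rewrite [RHS](partition_big (fun x => trlev k (klarg x)) (mem (lev 0))) /=.
    apply: eq_bigr => t ht; rewrite rsum_const Rmult_1_r; congr INR.
    by apply: eq_card => x; rewrite !inE.
  by move=> x _; apply: trlev_lev.
pose c := (r * r / INR p)%R.
have -> : levsum k = \csum_(t | t \in lev 0) Cmult (RtoC (INR (N t) - c)%R) (psi t).
  rewrite E1; transitivity (Cplus (\csum_(t | t \in lev 0) Cmult (RtoC (INR (N t))) (psi t))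
    (Cmult (RtoC (- c)%R) (\csum_(t | t \in lev 0) psi t))).
    by rewrite sum_psi0 Cmult_0_r Cplus_0_r.
  rewrite big_distrr -big_split /=; apply: eq_bigr => t _.
  by rewrite RtoC_plus Cmult_plus_distr_r.
apply: Rle_trans (csum_Cmod _ _ _) _.
apply: (@Rle_trans _ (\rsum_(t | t \in lev 0) (20 * r - (INR (N t) - c))%R)).
  apply: rsum_le => t ht; rewrite Cmod_mult psi_norm // Rmult_1_r Cmod_R.
  have := card_trace_fiber k0 kn big ht; rewrite -/r -/c -/(N t) => h.
  by apply: Rabs_le; split; lra.
rewrite rsumB rsumB !rsum_const card0 E2.
have -> : (INR p * c = r * r)%R by rewrite /c; rfield; lra.
nra.
Qed.

(** With [w = 4^i d], the recursion gives [|S_(i+1)| >= |S_i|^2 - 2 q_i >= ((2 + w)^2 - 2) q_i >= (2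
    + 4 w) q_i], and [q_i] is the square root of [q_(i+1)]. *)
Lemma levsum_growth (d : R) : (0 <= d)%R ->
  ((2 + d) * sqrt (INR p) <= Cmod (levsum 0))%R -> forall i, (i <= k)%N ->
  ((2 + 4 ^ i * d) * sqrt (INR (qlev i)) <= Cmod (levsum i))%R.
Proof.
move=> d0 h0; elim=> [|i IH] ik.
  by rewrite /qlev expn0 expn1 /= Rmult_1_l.
have {}IH := IH (ltnW ik).
have q0 i' : (0 <= INR (qlev i'))%R by apply: pos_INR.
have E : levsum i.+1 = Cminus (RtoC (2 * INR (qlev i))%R) (Cmult (levsum i) (levsum i)).
  rewrite -[RtoC (2 * _)%R]/(RtoC (Rmult (INR 2) _)) -(levsum_quadratic ik); rring.
have tri : (Cmod (levsum i) * Cmod (levsum i) - 2 * INR (qlev i) <= Cmod (levsum i.+1))%R.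
  have := Cmod_triangle (RtoC (2 * INR (qlev i))%R) (Copp (levsum i.+1)).
  rewrite Cmod_opp Cmod_R Rabs_pos_eq; last by have := q0 i; lra.
  rewrite (_ : Cplus _ _ = Cmult (levsum i) (levsum i)); first by rewrite Cmod_mult; lra.
  rewrite E; rring.
apply: Rle_trans tri.
rewrite qlevS mult_INR sqrt_square; last exact: q0.
have sq := sqrt_sqrt _ (q0 i); have s0 := sqrt_pos (INR (qlev i)).
have e0 : (0 <= 4 ^ i * d)%R by apply: Rmult_le_pos => //; apply: pow_le; lra.
have -> : (4 ^ i.+1 * d = 4 * (4 ^ i * d))%R by rewrite /=; rring.
set w := (4 ^ i * d)%R in IH e0 *.
move: IH sq s0; move: (sqrt (INR (qlev i))) (Cmod (levsum i)) => s S IH <- s0.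
have : ((2 + w) * s * ((2 + w) * s) <= S * S)%R.
  by apply: Rmult_le_compat => //; apply: Rmult_le_pos => //; lra.
nra.
Qed.
End Tower.
End Tower.

(** * Weil's bound for Kloosterman sums modulo a prime *)

Module Weil.
Import Coquelicot.Coquelicot.
Import all_boot all_order all_algebra all_fingroup all_field.
Import zify ring.
Import GRing.Theory Sums Stepanov Tower.
Local Open Scope ring_scope.
Set Implicit Arguments. Unset Strict Implicit. Unset Printing Implicit Defensive.

Section PrimeField.
Variables (p k : nat) (L : finFieldType).
Hypothesis p_pr : prime p.
Hypothesis pL : p \in [pchar L].
Hypothesis cardL : #|L| = (p ^ (2 ^ k))%N.

(** Inverse of the embedding of the residues modulo [p], with the default 0 off the prime field. *)
Definition residue (x : L) : nat := if [pick i : 'I_p | (i : nat)%:R == x] is Some i then i else 0%N.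
Definition stdchar (x : L) : C := expi p (residue x).

Let p_gt0 : (0 < p)%N. Proof. exact: prime_gt0. Qed.

Lemma natr_mod n : (n %% p)%:R = n%:R :> L.
Proof.
by rewrite {2}(divn_eq n p) natrD natrM (pcharf0 pL) mulr0 add0r.
Qed.

Lemma natr_inj_ord (i j : 'I_p) : i%:R = j%:R :> L -> i = j.
Proof.
wlog ij : i j / (i <= j)%N.
  by move=> h e; case: (leqP i j) => [/h|/ltnW/h h']; [apply | apply/esym/h'].
move=> e; apply: val_inj => /=.
have : (j - i)%:R == 0 :> L by rewrite natrB // e subrr.
rewrite -(dvdn_pcharf pL) /dvdn modn_small; last by rewrite (leq_ltn_trans (leq_subr _ _)).
by rewrite subn_eq0 => ji; apply/eqP; rewrite eqn_leq ij.
Qed.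

Lemma residue_natr n : residue n%:R = (n %% p)%N.
Proof.
rewrite /residue; case: pickP => [i /eqP e|/(_ (Ordinal (ltn_pmod n p_gt0)))].
  rewrite -(natr_mod n) in e.
  by rewrite (natr_inj_ord (e : i%:R = (Ordinal (ltn_pmod n p_gt0) : nat)%:R)).
by rewrite /= natr_mod eqxx.
Qed.

Lemma natr_lev n : n%:R \in lev p L 0.
Proof. by rewrite lev0E -(pFrobenius_autE pL) rmorph_nat. Qed.

Lemma lev_natr x : x \in lev p L 0 -> (residue x)%:R = x.
Proof.
move=> hx; have : codom (fun i : 'I_p => (i : nat)%:R : L) =i lev p L 0.
  apply/subset_cardP.
    rewrite (card_lev p_pr pL cardL) // card_codom ?card_ord ?expn1 //.
    exact: natr_inj_ord.
  by apply/subsetP => y /codomP [i ->]; apply: natr_lev.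
move=> /(_ x); rewrite hx => /codomP [i ->].
by rewrite residue_natr natr_mod.
Qed.

Lemma stdchar_natr n : stdchar n%:R = expi p n.
Proof. by rewrite /stdchar residue_natr expi_mod. Qed.

Lemma stdcharD s t : s \in lev p L 0 -> t \in lev p L 0 ->
  stdchar (s + t) = Cmult (stdchar s) (stdchar t).
Proof.
move=> /lev_natr <- /lev_natr <-.
by rewrite -natrD !stdchar_natr expiD.
Qed.

Lemma stdchar0 : stdchar 0 = RtoC (IZR 1).
Proof. by rewrite -[0]/(0%:R) stdchar_natr expi0. Qed.

Lemma stdchar1 : stdchar 1 <> RtoC (IZR 1).
Proof. by rewrite -[1]/(1%:R) stdchar_natr; apply: expi_neq1; rewrite prime_gt1. Qed.

Lemma stdchar_norm t : Cmod (stdchar t) = IZR 1.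
Proof. exact: Cmod_expi. Qed.

Lemma natr_eq0p n : (n%:R == 0 :> L) = (p %| n)%N.
Proof. by rewrite (dvdn_pcharf pL). Qed.

(** The substitution [y = m x], invertible when [p] does not divide [m], turns [m x + n/x] into
    [y + (m n)/y]. *)
Lemma kloosterman_levsum m n : ~~ (p %| m)%N ->
  kloosterman p m n = levsum p (m * n)%:R stdchar 0.
Proof.
move=> pm; have m0 : m%:R != 0 :> L by rewrite natr_eq0p.
rewrite /levsum (reindex_inj (mulfI m0)) /=.
rewrite (reindex_onto (fun i : 'I_p => (i : nat)%:R)
  (fun x => Ordinal (ltn_pmod (residue x) p_gt0))) /=; last first.
  move=> x /andP[hx _]; rewrite natr_mod lev_natr //.
  by rewrite -(mulKf m0 x) levM // levV // natr_lev.
have dom (i : 'I_p) : (unitlev p 0 (m%:R * i%:R : L) &&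
   (Ordinal (ltn_pmod (residue i%:R) p_gt0) == i)) = ~~ (p %| i)%N.
  rewrite /unitlev levM ?natr_lev //= -val_eqE /= residue_natr modn_mod modn_small //.
  by rewrite eqxx andbT mulf_eq0 (negPf m0) natr_eq0p.
rewrite (eq_bigl _ _ dom) [RHS]big_mkcond /=; apply: eq_bigr => x _.
have eq1 y : (x * y == 1 %[mod p])%N = (x%:R * y%:R == 1 :> L).
  rewrite -natrM -[1 in RHS]/(1%:R); apply/eqP/eqP => [e|e].
    by rewrite -(natr_mod (x * y)) e natr_mod.
  by rewrite -!residue_natr e.
case: ifPn => px; last first.
  rewrite big1 // => y; rewrite eq1; have -> : x%:R = 0 :> L.
    by apply/eqP; rewrite natr_eq0p; apply: negbNE.
  by rewrite mul0r eq_sym oner_eq0.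
have x0 : x%:R != 0 :> L by rewrite natr_eq0p.
have xV : x%:R^-1 \in lev p L 0 by rewrite levV // natr_lev.
have hy : (residue (x%:R^-1) < p)%N.
  by rewrite /residue; case: pickP => // i.
rewrite (big_pred1 (Ordinal hy)) => [|y] /=.
  rewrite /trlev big_ord1 expr1 -stdchar_natr; congr stdchar.
  rewrite /klarg natrD !natrM lev_natr //; field.
  by rewrite m0 x0.
rewrite eq1 -val_eqE /=; apply/eqP/eqP => [e|->]; last first.
  by rewrite lev_natr // mulfV.
have -> : x%:R^-1 = y%:R :> L by rewrite -[RHS](mulKf x0) e mulr1.
by rewrite residue_natr modn_small.
Qed.

End PrimeField.

Lemma pow4_unbounded (d B : R) : (0 < d)%R -> exists j0, forall j, (j0 <= j)%N -> (B < 4 ^ j * d)%R.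
Proof.
move=> d0; have [j0 h] := Pow_x_infinity 4 ltac:(rewrite Rabs_pos_eq; lra) (B / d + 1)%R.
exists j0 => j hj; have := h j ltac:(apply/leP; exact: hj).
rewrite Rabs_pos_eq; last by apply: pow_le; lra.
move=> h'; have : (B / d * d = B)%R by rfield; lra.
nra.
Qed.

Lemma weil_kloosterman (p m n : nat) : prime p -> ~~ (p %| m)%N -> ~~ (p %| n)%N ->
  (Cmod (kloosterman p m n) <= 2 * sqrt (INR p))%R.
Proof.
move=> p_pr pm pn; apply: Rnot_lt_le => gt.
have p_gt0 := prime_gt0 p_pr.
have sp : (0 < sqrt (INR p))%R by apply: sqrt_lt_R0; apply: lt_0_INR; apply/leP.
pose d := (Cmod (kloosterman p m n) / sqrt (INR p) - 2)%R.
have dE : ((2 + d) * sqrt (INR p) = Cmod (kloosterman p m n))%R by rewrite /d; rfield; lra.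
have d0 : (0 < d)%R by nra.
have [j0 hj] := pow4_unbounded (21 * INR p) d0.
(* [j0] makes the growth exceed [21 p]; the rest makes [p^(2^j)] large enough for Stepanov's
   bound. *)
pose j := (j0 + 2 * (3 * p + 1))%N.
have [L pL cardL] := pPrimePowerField p_pr (expn_gt0 2 j.+1 : (0 < 2 ^ j.+1)%N).
have mn0 : (m * n)%:R != 0 :> L by rewrite (natr_eq0p pL) Euclid_dvdM // negb_or pm.
have amem := natr_lev pL (m * n).
have sD := stdcharD p_pr pL cardL; have s0 := stdchar0 p_pr pL.
have s1 := stdchar1 p_pr pL.
have sn t (_ : t \in lev p L 0) := stdchar_norm p t.
pose e := (2 ^ j)%N.-1.
have eE : e.+1 = (2 ^ j)%N by rewrite prednK ?expn_gt0.
have kE : (2 ^ j.+1 = e.+1 + e.+1)%N by rewrite eE expnS mul2n addnn.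
have big : (2 * (3 * p + 1) <= p ^ e.+1)%N.
  have h1 : (2 ^ j < p ^ (2 ^ j))%N by rewrite ltn_expl // prime_gt1.
  have h2 : (j < 2 ^ j)%N by rewrite ltn_expl.
  by rewrite eE; rewrite /j in h1 h2 *; lia.
have U := levsum_top_bound p_pr pL cardL amem mn0 sD s0 s1 sn (ltn0Sn j) kE big.
have low : ((2 + d) * sqrt (INR p) <= Cmod (levsum p (m * n)%:R (stdchar p (L:=L)) 0))%R.
  by rewrite dE (kloosterman_levsum p_pr pL cardL) //; lra.
have G := levsum_growth p_pr pL cardL amem mn0 sD s0 s1 (Rlt_le _ _ d0) low (leqnn j.+1).
have qE : sqrt (INR (qlev p j.+1)) = INR (p ^ e.+1).
  by rewrite /qlev kE expnD mult_INR sqrt_square //; apply: pos_INR.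
have r0 : (0 < INR (p ^ e.+1))%R by apply: lt_0_INR; apply/leP; rewrite expn_gt0 p_gt0.
have H4 := hj j.+1 ltac:(rewrite /j; lia).
rewrite qE in G; nra.
Qed.
End Weil.

(** * Kloosterman sums to composite moduli *)

Module Discrepancy.
Import Coquelicot.Coquelicot.
Import all_boot.
Import zify.
Import Sums Weil.
Set Implicit Arguments. Unset Strict Implicit. Unset Printing Implicit Defensive.
Open Scope R_scope.

Lemma unit_pair_unique q x y y' : (y < q)%N -> (y' < q)%N ->
  x * y == 1 %[mod q] -> x * y' == 1 %[mod q] -> y = y'.
Proof.
move=> yq y'q /eqP e /eqP e'; rewrite -(modn_small yq) -(modn_small y'q).
have -> : y' %% q = (y' * (x * y)) %% q by rewrite -modnMmr e modnMmr muln1.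
by rewrite -[in LHS](muln1 y) -modnMmr -e' modnMmr mulnA mulnC [(y * x)%N]mulnC.
Qed.

Lemma card_unit_pair_le1 q (x : nat) : (#|[pred y : 'I_q | x * y == 1 %[mod q]]| <= 1)%N.
Proof.
apply/card_le1_eqP => y y'; rewrite !inE => h h'.
by apply: val_inj; apply: (unit_pair_unique (x := x)) h' h; rewrite ?ltn_ord.
Qed.

Lemma card_unit_pair q (x : nat) : (0 < q)%N ->
  #|[pred y : 'I_q | x * y == 1 %[mod q]]| = coprime x q.
Proof.
move=> q0; apply/eqP; rewrite eqn_leq; apply/andP; split; last first.
  case: (boolP (coprime x q)) => // cp; change (0 < #|[pred y : 'I_q | x * y == 1 %[mod q]]|)%N.
  have [x0|x0] := posnP x.
    move: cp; rewrite x0 /coprime gcd0n => /eqP q1.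
    by apply/card_gt0P; exists (Ordinal q0); rewrite inE /=; have := modn1 1; rewrite -q1 mul0n => ->; rewrite mod0n.
  case: (egcdnP q x0) => km kn e _.
  apply/card_gt0P; exists (Ordinal (ltn_pmod km q0)); rewrite inE /= modnMmr mulnC e.
  by rewrite (eqP cp) modnMDl.
case: (boolP (coprime x q)) => [_|]; first exact: card_unit_pair_le1.
move=> ncp; rewrite leqn0; apply/eqP/eq_card0 => y; rewrite inE.
apply: contraNF ncp => /eqP e; rewrite /coprime -dvdn1.
set g := gcdn x q; have gq : g %| q := dvdn_gcdr _ _.
have : (x * y) %% q %% g = 1 %% q %% g by rewrite e.
rewrite !modn_dvdm // -modnMml (eqP (dvdn_gcdl x q : g %| x)) mul0n mod0n.
by move=> /esym/eqP.
Qed.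

Lemma Cmod_kloosterman_le q m n : Cmod (kloosterman q m n) <= INR q.
Proof.
apply: (Rle_trans _ _ _ (csum_Cmod _ _ _)).
have -> : INR q = \rsum_(x < q) 1 by rewrite rsum_const card_ord Rmult_1_r.
apply: rsum_le => x _.
apply: (Rle_trans _ _ _ (csum_Cmod _ _ _)).
rewrite (eq_bigr (fun _ => 1)) => [|y _]; last exact: Cmod_expi.
by rewrite rsum_const Rmult_1_r; apply: (@leq_INR _ 1); apply: card_unit_pair_le1.
Qed.

Lemma csum_chinese q1 q2 (F : nat -> nat -> C) : coprime q1 q2 -> (0 < q1)%N -> (0 < q2)%N ->
  \csum_(x < q1 * q2) F (x %% q1)%N (x %% q2)%N = \csum_(x1 < q1) \csum_(x2 < q2) F x1 x2.
Proof.
move=> co q10 q20; rewrite pair_big /=.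
have q0 : (0 < q1 * q2)%N by rewrite muln_gt0 q10.
pose h (x : 'I_(q1 * q2)) := (Ordinal (ltn_pmod x q10), Ordinal (ltn_pmod x q20)).
pose g (u : 'I_q1 * 'I_q2) : 'I_(q1 * q2) := Ordinal (ltn_pmod (chinese q1 q2 u.1 u.2) q0).
rewrite (reindex h) //=.
exists g => [x _|[x1 x2] _].
  apply: val_inj => /=; rewrite -[RHS](modn_small (ltn_ord x)); apply/eqP.
  by rewrite chinese_remainder // chinese_modl // chinese_modr // !modn_mod !eqxx.
congr (_, _); apply: val_inj => /=.
  by rewrite modn_dvdm ?dvdn_mulr // chinese_modl // modn_small.
by rewrite modn_dvdm ?dvdn_mull // chinese_modr // modn_small.
Qed.

Lemma modular_inverse q x : coprime x q -> (0 < q)%N -> exists u, u * x = 1 %[mod q].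
Proof.
move=> cp q0; have := card_unit_pair x q0; rewrite cp => h.
have /card_gt0P [y] : (0 < #|[pred y : 'I_q | x * y == 1 %[mod q]]|)%N by rewrite h.
by rewrite inE => /eqP e; exists y; rewrite mulnC.
Qed.

Lemma coprime_of_inverse q u x : u * x = 1 %[mod q] -> coprime u q.
Proof.
move=> hu; rewrite /coprime -dvdn1; set g := gcdn u q.
have gq : g %| q := dvdn_gcdr _ _.
have : (u * x) %% q %% g = 1 %% q %% g by rewrite hu.
rewrite !modn_dvdm // -modnMml (eqP (dvdn_gcdl u q : g %| u)) mul0n mod0n.
by move=> /esym/eqP.
Qed.

Lemma expi_mulM q1 q2 k : (0 < q1)%N -> (0 < q2)%N -> expi (q1 * q2) (q2 * k) = expi q1 k.
Proof.
move=> q10 q20; rewrite /expi; congr cis; rewrite !mult_INR; field.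
by split; apply: not_0_INR; lia.
Qed.

(** Twisted multiplicativity: [1/(q1 q2) = u/q1 + v/q2] modulo 1, where [u] and [v] invert [q2]
    modulo [q1] and [q1] modulo [q2]. Both arguments get multiplied by units, so their gcds with the
    moduli do not change. *)
Lemma kloosterman_mul q1 q2 : coprime q1 q2 -> (0 < q1)%N -> (0 < q2)%N ->
  exists u v, [/\ coprime u q1, coprime v q2 & forall m n,
    kloosterman (q1 * q2) m n =
    (kloosterman q1 (u * m) (u * n) * kloosterman q2 (v * m) (v * n))%C].
Proof.
move=> co q10 q20.
have [u hu] : exists u, u * q2 = 1 %[mod q1] by apply: modular_inverse; rewrite 1?coprime_sym.
have [v hv] : exists v, v * q1 = 1 %[mod q2] by apply: modular_inverse.
exists u, v; split; [exact: (coprime_of_inverse hu) | exact: (coprime_of_inverse hv) |].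
have q0 : (0 < q1 * q2)%N by rewrite muln_gt0 q10.
have split_e k : expi (q1 * q2) k = (expi q1 (u * k) * expi q2 (v * k))%C.
  rewrite -(@expi_mulM q1 q2) // -(@expi_mulM q2 q1) // [(q2 * q1)%N]mulnC -expiD.
  apply: expi_eqmod => //; apply/eqP; rewrite chinese_remainder //.
  rewrite !mulnA -mulnDl; apply/andP; split.
    by rewrite -modnMml -modnDmr [(q1 * v)%N]mulnC modnMl addn0 [(q2 * u)%N]mulnC hu modnMml mul1n.
  by rewrite -modnMml -modnDml modnMr add0n [(q1 * v)%N]mulnC hv modnMml mul1n.
move=> m n; rewrite /kloosterman.
pose E1 x1 y1 := if x1 * y1 == 1 %[mod q1] then expi q1 (u * m * x1 + u * n * y1) else RtoC 0.
pose E2 x2 y2 := if x2 * y2 == 1 %[mod q2] then expi q2 (v * m * x2 + v * n * y2) else RtoC 0.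
transitivity (\csum_(x < q1 * q2) \csum_(y < q1 * q2)
   (E1 (x %% q1)%N (y %% q1)%N * E2 (x %% q2)%N (y %% q2)%N)%C).
  apply: eq_bigr => x _; rewrite big_mkcond; apply: eq_bigr => y _.
  rewrite chinese_remainder // /E1 /E2 !modnMml !modnMmr.
  case: ifP => [/andP[-> ->]|]; last first.
    by case: eqP => //= _; [case: eqP => // _ _ | move=> _]; rewrite ?Cmult_0_l ?Cmult_0_r.
  rewrite split_e; congr Cmult; apply: expi_eqmod => //.
    by rewrite -modnDm !modnMmr modnDm mulnDr !mulnA.
  by rewrite -modnDm !modnMmr modnDm mulnDr !mulnA.
transitivity (\csum_(x < q1 * q2) \csum_(y1 < q1) \csum_(y2 < q2)
   (E1 (x %% q1)%N y1 * E2 (x %% q2)%N y2)%C).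
  apply: eq_bigr => x _.
  by rewrite (csum_chinese (fun y1 y2 => E1 (x %% q1)%N y1 * E2 (x %% q2)%N y2)%C co).
rewrite (csum_chinese (fun x1 x2 => \csum_(y1 < q1) \csum_(y2 < q2) (E1 x1 y1 * E2 x2 y2)%C) co) //.
rewrite big_distrl /=; apply: eq_bigr => x1 _.
rewrite big_distrr /=; apply: eq_bigr => x2 _.
rewrite [in RHS]big_mkcond /= big_distrl /=; apply: eq_bigr => y1 _.
rewrite [in RHS]big_mkcond /= -big_distrr /=; congr Cmult.
Qed.

(** The gcd absorbs the degenerate case [p | n], where the trivial bound [p] is enough. If [p]
    divides [m] alone, the sum is a Ramanujan sum with value -1. *)
Lemma Cmod_kloosterman_prime p m n : prime p ->
  Cmod (kloosterman p m n) <= 2 * sqrt (INR p) * INR (gcdn n p).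
Proof.
move=> pp; have p1 : 1 <= INR p by apply: (@leq_INR 1); apply: prime_gt0.
have s1 : 1 <= sqrt (INR p) by rewrite -sqrt_1; apply: sqrt_le_1_alt.
have ss : sqrt (INR p) * sqrt (INR p) = INR p by apply: sqrt_sqrt; lra.
have [pn|pn] := boolP (p %| n).
  have -> : gcdn n p = p by apply/gcdn_idPr.
  by apply: (Rle_trans _ _ _ (Cmod_kloosterman_le _ _ _)); nra.
have -> : gcdn n p = 1%N by apply/eqP; rewrite gcdnC -/(coprime p n) prime_coprime.
rewrite Rmult_1_r.
have [pm|pm] := boolP (p %| m); last exact: weil_kloosterman.
have p0 := prime_gt0 pp.
have -> : kloosterman p m n = (- RtoC 1)%C; last by rewrite Cmod_opp Cmod_1; lra.
transitivity (\csum_(y < p) ((if y == 0%N :> nat then RtoC 0 else expi p (n * y)))%C).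
  rewrite /kloosterman (eq_bigr (fun x : 'I_p => \csum_(y < p | (x * y == 1 %[mod p])%N) expi p (n * y))).
    rewrite (exchange_big_dep xpredT) //=; apply: eq_bigr => y _.
    rewrite csum_const.
    have -> : #|[pred x : 'I_p | x * y == 1 %[mod p]]| = coprime y p.
      by rewrite -(card_unit_pair y p0); apply: eq_card => x; rewrite !inE mulnC.
    rewrite coprime_sym prime_coprime //.
    case: eqP => [->|/eqP y0]; first by rewrite dvdn0 Cmult_0_l.
    by rewrite gtnNdvd ?lt0n ?Cmult_1_l.
  move=> x _; apply: eq_bigr => y _; apply: expi_eqmod => //.
  by rewrite -modnDml -modnMml (eqP pm) mul0n mod0n.
have := csum_expi n p0; rewrite (negPf pn) => E.
case: p pp p0 E {p1 s1 ss pn pm} => // p pp p0; rewrite !big_ord_recl /= mul0n expi0 Cplus_0_l.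
rewrite (eq_bigr (fun i : 'I_p => expi p.+1 (n * lift ord0 i))) => [E|i _]; last by rewrite mulnC.
set S := bigop _ _ _ in E *.
transitivity ((RtoC 1 + S) + - RtoC 1)%C; [ring | by rewrite E; ring].
Qed.


(** Each prime of [ps] contributes the constant 2 of Weil's bound; the cofactor [r] takes the
    trivial bound. *)
Lemma Cmod_kloosterman_squarefree (ps : seq nat) r m n :
  uniq ps -> all prime ps -> coprime (\prod_(p <- ps) p) r -> (0 < r)%N ->
  Cmod (kloosterman (\prod_(p <- ps) p * r) m n) <=
    2 ^ (size ps) * sqrt (INR (\prod_(p <- ps) p)) * INR r * INR (gcdn n (\prod_(p <- ps) p)).
Proof.
elim: ps m n => [|p ps IH] m n.
  move=> _ _ _ r0; rewrite big_nil gcdn1 mul1n /= sqrt_1.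
  by have := Cmod_kloosterman_le r m n; lra.
rewrite big_cons /= => /andP[pps ups] /andP[pp aps]; rewrite coprimeMl => /andP[cpr csr] r0.
set s := \prod_(j <- ps) j in IH csr *.
have s0 : (0 < s)%N.
  rewrite /s big_seq; apply: prodn_cond_gt0 => q qs.
  by apply: prime_gt0; apply: (allP aps).
have cps : coprime p s.
  rewrite /s big_seq; apply: (big_ind (coprime p)) => [|x y cx cy|q qs]; first exact: coprimen1.
    by rewrite coprimeMr cx.
  rewrite prime_coprime // dvdn_prime2 //; last by apply: (allP aps).
  by apply: contraNN pps => /eqP ->.
have p0 := prime_gt0 pp.
have sr0 : (0 < s * r)%N by rewrite muln_gt0 s0.
have [u [v [cu cv E]]] := @kloosterman_mul p (s * r) ltac:(by rewrite coprimeMr cps) p0 sr0.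
rewrite -mulnA E Cmod_mult.
move: cv; rewrite coprimeMr => /andP[cvs _].
have B1 := Cmod_kloosterman_prime (u * m) (u * n) pp.
have B2 := IH (v * m)%N (v * n)%N ups aps csr r0.
have G1 : gcdn (u * n) p = gcdn n p by rewrite gcdnC Gauss_gcdr 1?coprime_sym // gcdnC.
have G2 : gcdn (v * n) s = gcdn n s by rewrite gcdnC Gauss_gcdr 1?coprime_sym // gcdnC.
rewrite G1 in B1; rewrite G2 in B2.
have G : INR (gcdn n p) * INR (gcdn n s) <= INR (gcdn n (p * s)).
  rewrite -mult_INR; apply: leq_INR; apply: dvdn_leq.
    by rewrite gcdn_gt0 muln_gt0 p0 s0 orbT.
  rewrite dvdn_gcd Gauss_dvd ?dvdn_gcdl /= ?dvdn_mul ?dvdn_gcdr //.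
  by apply: coprime_dvdl (dvdn_gcdr _ _) _; apply: coprime_dvdr (dvdn_gcdr _ _) _.
rewrite mult_INR sqrt_mult; try exact: pos_INR.
apply: (Rle_trans _ (2 * sqrt (INR p) * INR (gcdn n p) *
  (2 ^ size ps * sqrt (INR s) * INR r * INR (gcdn n s)))).
  by apply: Rmult_le_compat => //; apply: Cmod_ge_0.
have P2 : 0 <= 2 ^ size ps by apply: pow_le; lra.
have Pp := sqrt_pos (INR p); have Ps := sqrt_pos (INR s); have Pr := pos_INR r.
have H : 0 <= 2 * 2 ^ size ps * sqrt (INR p) * sqrt (INR s) * INR r.
  by do 4 (apply: Rmult_le_pos => //); lra.
have := Rmult_le_compat_l _ _ _ H G; lra.
Qed.

(* [a ^ 2 * b ^ 3] is the general shape of a powerful number *)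
Lemma powerful_decomposition q : (0 < q)%N -> exists ps a b,
  [/\ uniq ps, all prime ps, coprime (\prod_(p <- ps) p) (a ^ 2 * b ^ 3), (0 < a * b)%N &
      q = (\prod_(p <- ps) p * (a ^ 2 * b ^ 3))%N].
Proof.
elim/ltn_ind: q => q IH q0; have [q1|q1] := leqP q 1.
  by exists [::], 1%N, 1%N; rewrite big_nil; split=> //; lia.
set p := pdiv q; have pp : prime p by rewrite pdiv_prime.
have [m cpm qE] := pfactor_coprime pp q0; set k := logn p q in qE.
have k0 : (0 < k)%N by rewrite logn_gt0 mem_primes pp q0 pdiv_dvd.
have p1 := prime_gt1 pp.
have m0 : (0 < m)%N by move: q0; rewrite qE; case: (m).
have mq : (m < q)%N by rewrite qE ltn_Pmulr // -(exp1n k) ltn_exp2r.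
have [ps [a [b [ups aps co /[!muln_gt0] /andP[a0 b0] mE]]]] := IH m mq m0.
have cps : coprime p (\prod_(j <- ps) j) /\ coprime p (a ^ 2 * b ^ 3).
  by move: cpm; rewrite mE coprimeMr => /andP.
case: cps => cps cpab.
have pnps : p \notin ps.
  apply/negP => pin; move: cps; rewrite (big_rem p pin) /= coprimeMr prime_coprime //.
  by rewrite dvdnn.
have [k1|k1] := eqVneq k 1%N.
  exists (p :: ps), a, b; rewrite big_cons /= pnps ups pp aps coprimeMl co cpab muln_gt0 a0 b0; split => //.
  by rewrite qE k1 expn1 mE mulnC mulnA.
have cx i : coprime (\prod_(j <- ps) j) (p ^ i) by rewrite coprime_sym coprimeXl.
have [a1 [b1 [ha hb e]]] : exists a1 b1 : nat, [/\ (0 < p ^ a1)%N, (0 < p ^ b1)%N & (k = a1 * 2 + b1 * 3)%N].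
  have := odd_double_half k; case: (odd k) => /= hk.
    exists (k./2 - 1)%N, 1%N; rewrite !expn_gt0 !(ltnW p1); split => //; lia.
  by exists (k./2), 0%N; rewrite !expn_gt0 !(ltnW p1); split => //; lia.
exists ps, (a * p ^ a1)%N, (b * p ^ b1)%N; rewrite !muln_gt0 a0 b0 ha hb; split=> //.
  rewrite !expnMn -!expnM !coprimeMr !cx !andbT.
  by move: co; rewrite !coprimeMr.
rewrite qE {1}mE e expnD !expnMn -!expnM.
move: (\prod_(j <- ps) j)%N (a ^ 2)%N (b ^ 3)%N (p ^ (a1 * 2))%N (p ^ (b1 * 3))%N => x1 x2 x3 x4 x5.
rewrite -!mulnA; congr muln; congr muln; rewrite mulnCA; congr muln.
Qed.

Lemma size_divisors_squarefree (ps : seq nat) : uniq ps -> all prime ps ->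
  (size (divisors (\prod_(p <- ps) p)) <= 2 ^ size ps)%N.
Proof.
elim: ps => [|p ps IH]; first by rewrite big_nil.
rewrite big_cons /= => /andP[pps ups] /andP[pp aps].
set s := \prod_(j <- ps) j in IH *.
have s0 : (0 < s)%N.
  by rewrite /s big_seq; apply: prodn_cond_gt0 => q qs; apply: prime_gt0; apply: (allP aps).
have p0 := prime_gt0 pp.
have : (size (divisors (p * s)) <= size (divisors s ++ map (muln p) (divisors s)))%N.
  apply: uniq_leq_size; first exact: divisors_uniq.
  move=> d; rewrite -dvdn_divisors ?muln_gt0 ?p0 // mem_cat => dps.
  have [pd|pd] := boolP (p %| d).
    apply/orP; right; apply/mapP; exists (d %/ p)%N; last by rewrite mulnC divnK.
    by rewrite -dvdn_divisors // -(@dvdn_pmul2l p) // mulnC divnK.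
  by rewrite -dvdn_divisors // -(@Gauss_dvdr _ p) ?dps // coprime_sym prime_coprime.
rewrite size_cat size_map addnn -mul2n expnS => h; apply: leq_trans h _.
by rewrite leq_mul2l IH.
Qed.

(** * Harmonic sums and incomplete exponential sums *)

Definition harmonic (n : nat) : R := \rsum_(i < n) / INR i.+1.

Lemma harmonic_ge0 n : 0 <= harmonic n.
Proof.
by apply: rsum_ge0 => i _; apply/Rlt_le/Rinv_0_lt_compat/lt_0_INR/leP.
Qed.

Lemma harmonicS n : harmonic n.+1 = harmonic n + / INR n.+1.
Proof. by rewrite /harmonic big_ord_recr. Qed.

Lemma harmonic_mono m n : (m <= n)%N -> harmonic m <= harmonic n.
Proof.
move=> mn; rewrite -(subnKC mn); elim: (n - m)%N => [|k IH]; first by rewrite addn0; lra.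
rewrite addnS harmonicS; have : 0 < / INR (m + k).+1 by apply/Rinv_0_lt_compat/lt_0_INR/leP.
lra.
Qed.

Lemma rsum_multiples_harmonic d n : (0 < d)%N ->
  \rsum_(i < n | d %| i.+1) (INR d / INR i.+1) <= harmonic n.
Proof.
move=> d0.
suff h : \rsum_(i < n | d %| i.+1) (INR d / INR i.+1) = harmonic (n %/ d).
  by rewrite h; apply: harmonic_mono; apply: leq_div.
elim: n => [|n IH]; first by rewrite div0n /harmonic !big_ord0.
rewrite big_mkcond big_ord_recr -big_mkcond /= IH -/(INR n.+1).
case: ifPn => dn; last first.
  rewrite Rplus_0_r; congr harmonic.
  have r0 : (0 < n.+1 %% d)%N by rewrite lt0n.
  have rd := ltn_pmod n.+1 d0.
  have E : n = (n.+1 %/ d * d + (n.+1 %% d).-1)%N by have := divn_eq n.+1 d; lia.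
  by rewrite {1}E divnMDl // [X in (_ + X)%N]divn_small ?addn0 //; lia.
have [k kE] := dvdnP dn.
have k0 : (0 < k)%N by case: k kE.
have -> : (n %/ d = k.-1)%N.
  have -> : n = (k.-1 * d + d.-1)%N.
    by apply: succn_inj; rewrite kE -addnS prednK // -mulSnr prednK.
  by rewrite divnMDl // divn_small ?addn0 // prednK.
rewrite kE mulnK // -[in RHS](prednK k0) harmonicS (prednK k0); congr Rplus.
by rewrite mult_INR; field; split; apply: not_0_INR; lia.
Qed.

(** The gcd is one of the common divisors [d] of [i + 1] and [s], hence at most their sum; each [d]
    then contributes a harmonic sum over its multiples. *)
Lemma rsum_gcd_harmonic s n : (0 < s)%N ->
  \rsum_(i < n) (INR (gcdn i.+1 s) / INR i.+1) <= INR (size (divisors s)) * harmonic n.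
Proof.
move=> s0.
apply: (Rle_trans _ (\rsum_(i < n) \rsum_(d <- divisors s | d %| i.+1) (INR d / INR i.+1))).
  apply: rsum_le => i _.
  have i0 : 0 < / INR i.+1 by apply/Rinv_0_lt_compat/lt_0_INR/leP.
  have gin : gcdn i.+1 s \in divisors s by rewrite -dvdn_divisors // dvdn_gcdr.
  rewrite big_mkcond (big_rem _ gin) dvdn_gcdl.
  rewrite -[X in X <= _]Rplus_0_r; apply: Rplus_le_compat_l; apply: rsum_ge0 => d _.
  by case: ifP => _; [apply: Rmult_le_pos; [apply: pos_INR | lra] | lra].
rewrite (exchange_big_dep xpredT) //=.
apply: (Rle_trans _ (\rsum_(d <- divisors s) harmonic n)).
  rewrite !big_seq; apply: rsum_le => d; rewrite -dvdn_divisors // => ds.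
  by apply: rsum_multiples_harmonic; apply: dvdn_gt0 ds.
elim: (divisors s) => [|d l IH]; first by rewrite big_nil /=; lra.
by rewrite big_cons [size _]/= S_INR; lra.
Qed.


(** The slope 1/3 is enough because [PI > 3] turns it into [x <= sin (PI x)] for [x <= 1/2]. *)
Lemma sin_ge_third t : 0 <= t <= PI / 2 -> t / 3 <= sin t.
Proof.
move=> [t0 t1]; have PI4 := PI_4.
have [t3|t3] := Rle_lt_dec t (PI / 3); last first.
  have h : sin (PI / 3) <= sin t by apply: sin_incr_1; lra.
  rewrite sin_PI3 in h.
  have : 1.7 <= sqrt 3 by rewrite -(sqrt_square 1.7); [apply: sqrt_le_1_alt|]; lra.
  lra.
have [->|t0'] : t = 0 \/ 0 < t by lra.
  by rewrite sin_0; lra.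
have [c [hc1 hc2]] := MVT_cor2 sin cos 0 t t0' (fun c _ => derivable_pt_lim_sin c).
rewrite sin_0 in hc1.
have : cos (PI / 3) <= cos c by apply: cos_decr_1; lra.
rewrite cos_PI3; nra.
Qed.

Lemma Cmod_1_cis t : Cmod (RtoC 1 - cis (2 * t))%C = 2 * Rabs (sin t).
Proof.
have -> : (RtoC 1 - cis (2 * t))%C = (RtoC (2 * sin t) * ((sin t, (- cos t)%R) : C))%C.
  rewrite /cis cos_2a_sin sin_2a /Cminus /Cplus /Copp /Cmult /RtoC /=.
  by congr pair; ring.
rewrite Cmod_mult Cmod_R Rabs_mult (Rabs_pos_eq 2); last lra.
rewrite /Cmod /= (_ : _ + _ = 1); first by rewrite sqrt_1; ring.
by have := sin2_cos2 t; rewrite /Rsqr; lra.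
Qed.

Lemma csum_geometric (z : C) l :
  ((RtoC 1 - z) * (\csum_(j < l) ssrnat.iter j (Cmult z) (RtoC 1)) = RtoC 1 - ssrnat.iter l (Cmult z) (RtoC 1))%C.
Proof.
elim: l => [|l IH]; first by rewrite !big_ord0 /=; ring.
rewrite big_ord_recr Cmult_plus_distr_l IH iterS /=; ring.
Qed.

(** A geometric sum is at most [2 / |1 - z|], and [|1 - z| = 2 |sin (PI n / q)|] is at least twice
    the distance from [n/q] to the integers. Adding the inverses of both distances avoids a minimum
    in the later summation over [n]. *)
Lemma expi_window q n c l : (0 < n < q)%N ->
  Cmod (\csum_(j < l) expi q (n * (c + j))) <= INR q * (/ INR n + / INR (q - n)).
Proof.
move=> /andP[n0 nq]; set z := expi q n.
have q0 : (0 < q)%N by lia.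
have zpow j : expi q (n * j) = ssrnat.iter j (Cmult z) (RtoC 1).
  elim: j => [|j IH]; first by rewrite muln0 expi0.
  by rewrite iterS -IH mulnS expiD.
have -> : \csum_(j < l) expi q (n * (c + j)) =
    (expi q (n * c) * (\csum_(j < l) ssrnat.iter j (Cmult z) (RtoC 1)))%C.
  by rewrite big_distrr /=; apply: eq_bigr => j _; rewrite mulnDr expiD !zpow. 
rewrite Cmod_mult Cmod_expi Rmult_1_l.
set S := bigop _ _ _.
have num : Cmod (RtoC 1 - z)%C * Cmod S <= 2.
  rewrite -Cmod_mult csum_geometric -zpow.
  apply: (Rle_trans _ _ _ (Cmod_triangle _ _)).
  by rewrite Cmod_opp Cmod_1 Cmod_expi; lra.
have iq : 0 < INR q by apply/lt_0_INR/leP.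
have in0 : 0 < INR n by apply/lt_0_INR/leP.
have iqn : 0 < INR (q - n) by apply/lt_0_INR/leP; rewrite subn_gt0.
have sumE : INR (q - n) = INR q - INR n by rewrite minus_INR //; apply/leP/ltnW.
set x := INR n / INR q.
have xE : INR n = x * INR q by rewrite /x; field; lra.
have x01 : 0 < x < 1.
  by split; [apply: Rdiv_lt_0_compat | apply: (Rmult_lt_reg_r (INR q)) => //; rewrite -xE; lra].
have zE : z = cis (2 * (PI * x)) by rewrite /z /expi; congr cis; rewrite /x; ring.
have PI3 : 3 / 2 < PI / 2 := PI2_3_2.
have low : 2 * Rmin x (1 - x) <= Cmod (RtoC 1 - z)%C.
  rewrite zE Cmod_1_cis.
  have [h|h] := Rle_lt_dec x (1 / 2).
    rewrite Rmin_left; last lra.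
    have := @sin_ge_third (PI * x) ltac:(split; nra).
    by have := Rle_abs (sin (PI * x)); nra.
  rewrite Rmin_right; last lra.
  have := @sin_ge_third (PI * (1 - x)) ltac:(split; nra).
  rewrite (_ : PI * (1 - x) = PI - PI * x); last ring.
  rewrite sin_minus sin_PI cos_PI.
  by have := Rle_abs (sin (PI * x)); nra.
have S0 := Cmod_ge_0 S.
have mS : Rmin x (1 - x) * Cmod S <= 1 by nra.
have -> : INR q * (/ INR n + / INR (q - n)) = / x + / (1 - x).
  by rewrite sumE xE; field; nra.
have ix : 0 < / x by apply: Rinv_0_lt_compat; lra.
have ix1 : 0 < / (1 - x) by apply: Rinv_0_lt_compat; lra.
have e1 : x * / x = 1 by field; lra.
have e2 : (1 - x) * / (1 - x) = 1 by field; lra.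
move: mS; have [h|h] := Rle_lt_dec x (1 / 2).
  by rewrite Rmin_left; [nra|lra].
by rewrite Rmin_right; [nra|lra].
Qed.

(** * Points of a modular hyperbola in a box *)

Section Counting.
Variables (q b c l' l : nat).
Hypothesis q_gt0 : (0 < q)%N.

(** Here [q.-1] stands for -1 modulo [q], so that exponents remain natural numbers. *)
Let A (m : nat) : C := \csum_(i < l') expi q (m * (q.-1 * b + q.-1 * i)).
Let B (n : nat) : C := \csum_(j < l) expi q (n * (c + j)).
Let U (u : 'I_q * 'I_q) : bool := u.1 * u.2 == 1 %[mod q].

Definition hyperbola_count : R :=
  \rsum_(i < l') \rsum_(j < l) (if q %| (b + i) * (c + j) + 1 then 1 else 0).
Definition coprime_count : R := \rsum_(i < l') (if coprime (b + i) q then 1 else 0).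

Let kloosterman_pairs m n :
  kloosterman q m n = \csum_(u | U u) expi q (m * u.1 + n * u.2).
Proof.
rewrite /kloosterman (pair_big_dep xpredT (fun x y : 'I_q => x * y == 1 %[mod q])
  (fun x y : 'I_q => expi q (m * x + n * y))) /=.
by apply: eq_bigl => -[].
Qed.

Let dvd_neg x k : (q %| x + q.-1 * k) = (x == k %[mod q]).
Proof.
have -> : (x == k %[mod q]) = (x + q.-1 * k == k + q.-1 * k %[mod q]) by rewrite eqn_modDr.
by rewrite -mulSn prednK // modnMr.
Qed.

Let indicatorC (P : bool) : C := RtoC (if P then INR q else 0).

Let sum_A (x : nat) :
  \csum_(m < q) (expi q (m * x) * A m)%C = \csum_(i < l') indicatorC (x == b + i %[mod q]).
Proof.
transitivity (\csum_(m < q) \csum_(i < l') expi q (m * (x + q.-1 * (b + i)))).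
  apply: eq_bigr => m _; rewrite big_distrr /=; apply: eq_bigr => i _.
  by rewrite -expiD; congr expi; rewrite -mulnDr -mulnDr.
rewrite exchange_big /=; apply: eq_bigr => i _.
by rewrite csum_expi // dvd_neg.
Qed.

Let sum_B (y : nat) :
  \csum_(n < q) (expi q (n * y) * B n)%C = \csum_(j < l) indicatorC (q %| y + (c + j)).
Proof.
transitivity (\csum_(n < q) \csum_(j < l) expi q (n * (y + (c + j)))).
  apply: eq_bigr => m _; rewrite big_distrr /=; apply: eq_bigr => i _.
  by rewrite -expiD -mulnDr.
rewrite exchange_big /=; apply: eq_bigr => i _.
by rewrite csum_expi.
Qed.

Let unit_indicator (x y : nat) :
  \csum_(u | U u) (indicatorC (u.1 == x %[mod q]) * indicatorC (q %| u.2 + y))%C =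
  RtoC (INR q * INR q * (if q %| x * y + 1 then 1 else 0)).
Proof.
have E (u : 'I_q * 'I_q) : U u ->
  (u.1 == x %[mod q]) && (q %| u.2 + y) = (u == (Ordinal (ltn_pmod x q_gt0), Ordinal (ltn_pmod (q.-1 * y) q_gt0))).
  move=> _; case: u => u1 u2 /=; rewrite xpair_eqE -!val_eqE /= !(modn_small (ltn_ord _)).
  congr andb; rewrite -[in RHS](modn_small (ltn_ord u2)).
  have -> : (u2 == q.-1 * y %[mod q]) = (u2 + y == q.-1 * y + y %[mod q]) by rewrite eqn_modDr.
  by rewrite [(q.-1 * y + y)%N]addnC -mulSn prednK // modnMr.
transitivity (\csum_(u | U u) if (u.1 == x %[mod q]) && (q %| u.2 + y) then RtoC (INR q * INR q) else RtoC 0).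
  apply: eq_bigr => u _; rewrite /indicatorC -RtoC_mult.
  by case: ifP => _; case: ifP => _ //=; congr RtoC; ring.
rewrite -big_mkcondr /=.
rewrite (eq_bigl (fun u => (u == (Ordinal (ltn_pmod x q_gt0), Ordinal (ltn_pmod (q.-1 * y) q_gt0)))
   && (q %| x * y + 1))).
  rewrite big_mkcondr big_pred1_eq; case: ifP => _; congr RtoC; ring.
move=> u; have [uu|nu] := boolP (U u); rewrite /= ?E //.
  have [ue|] := eqVneq; rewrite //=; move: uu; rewrite /U ue /= modnMml modnMmr.
  rewrite mulnCA -(eqn_modDr (x * y)) -mulSnr prednK // -modnMml modnn mul0n mod0n.
  by rewrite eq_sym addnC => /eqP h; rewrite /dvdn h.
have [ue|//] := eqVneq; apply/esym; apply: contraNF nu => h.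
rewrite /U ue /= modnMml modnMmr mulnCA -(eqn_modDr (x * y)) -mulSnr prednK //.
by rewrite -modnMml modnn mul0n mod0n eq_sym addnC.
Qed.

(** Characters detect [u = b + i] and [v = -(c + j)] among the pairs with [u v = 1]; the sign in the
    second window produces [(b + i) (c + j) = -1]. *)
Lemma hyperbola_countE :
  RtoC (INR q * INR q * hyperbola_count) =
  \csum_(m < q) \csum_(n < q) (A m * B n * kloosterman q m n)%C.
Proof.
transitivity (\csum_(u | U u) ((\csum_(m < q) (expi q (m * u.1) * A m)) * (\csum_(n < q) (expi q (n * u.2) * B n)))%C).
  rewrite /hyperbola_count RtoC_mult RtoC_rsum.
  transitivity (\csum_(i < l') \csum_(j < l) \csum_(u | U u)
     (indicatorC (u.1 == b + i %[mod q]) * indicatorC (q %| u.2 + (c + j)))%C).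
    rewrite big_distrr /=; apply: eq_bigr => i _; rewrite RtoC_rsum big_distrr /=.
    by apply: eq_bigr => j _; rewrite unit_indicator -RtoC_mult.
  rewrite (eq_bigr _ (fun i _ => exchange_big _ _ _ _ _ _)) exchange_big /=.
  apply: eq_bigr => u _; rewrite sum_A sum_B big_distrl /=; apply: eq_bigr => i _.
  by rewrite big_distrr.
transitivity (\csum_(u | U u) \csum_(m < q) \csum_(n < q) (A m * B n * expi q (m * u.1 + n * u.2))%C).
  apply: eq_bigr => u _; rewrite big_distrl /=; apply: eq_bigr => m _.
  by rewrite big_distrr /=; apply: eq_bigr => n _; rewrite expiD; ring.
rewrite exchange_big /=; apply: eq_bigr => m _; rewrite exchange_big /=; apply: eq_bigr => n _.
by rewrite kloosterman_pairs; move: (A m) (B n) => Am Bn; rewrite big_distrr.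
Qed.

(** The terms [n = 0] in the expansion of [hyperbola_count], up to the factor [B 0 = l]. They form
    the main term, which is therefore extracted exactly. *)
Lemma coprime_countE :
  RtoC (INR q * coprime_count) = \csum_(m < q) (A m * kloosterman q m 0)%C.
Proof.
transitivity (\csum_(u | U u) \csum_(m < q) (expi q (m * u.1) * A m)%C); last first.
  rewrite exchange_big /=; apply: eq_bigr => m _; rewrite kloosterman_pairs big_distrr /=.
  by apply: eq_bigr => u _; rewrite mul0n addn0 Cmult_comm.
transitivity (\csum_(u | U u) \csum_(i < l') indicatorC (u.1 == b + i %[mod q])); last first.
  by apply: eq_bigr => u _; rewrite sum_A.
rewrite exchange_big /= RtoC_mult /coprime_count RtoC_rsum big_distrr /=.
apply: eq_bigr => i _.
transitivity (\csum_(x < q) \csum_(y < q | x * y == 1 %[mod q]) indicatorC (x == b + i %[mod q])).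
  rewrite (eq_bigr (fun x : 'I_q => if x == (b + i) %% q :> nat then indicatorC (coprime (b + i) q) else RtoC 0)).
    rewrite -big_mkcond (big_pred1 (Ordinal (ltn_pmod (b + i) q_gt0))) => [|x] //.
    by rewrite /indicatorC -RtoC_mult; case: ifP => _; congr RtoC; ring.
  move=> x _; rewrite csum_const card_unit_pair // modn_small //.
  case: eqP => [->|_]; last by rewrite /indicatorC Cmult_0_r.
  by rewrite coprime_modl /indicatorC; case: coprime; rewrite /= ?Cmult_1_l // Cmult_0_l.
rewrite (pair_big_dep xpredT (fun x y : 'I_q => x * y == 1 %[mod q])
  (fun x y : 'I_q => indicatorC (x == b + i %[mod q]))) /=.
by apply: eq_bigl => -[].
Qed.


End Counting.

Local Arguments INR : simpl never.

Lemma window_dual q m b l : (0 < m < q)%N ->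
  Cmod (\csum_(i < l) expi q (m * (q.-1 * b + q.-1 * i))) <= INR q * (/ INR m + / INR (q - m)).
Proof.
move=> /andP[m0 mq]; have q0 : (0 < q)%N by lia.
rewrite (eq_bigr (fun i : 'I_l => expi q ((q - m) * (b + i)))) => [|i _].
  have := @expi_window q (q - m) b l ltac:(lia).
  by rewrite subKn 1?ltnW // Rplus_comm.
apply: expi_eqmod => //; apply/eqP.
rewrite -mulnDr -(eqn_modDr (m * (b + i))) -mulnDl subnK 1?ltnW //.
by rewrite -mulnDr -mulSnr prednK // mulnCA !modnMr.
Qed.

Lemma harmonic_rev n (g : nat -> R) :
  \rsum_(i < n) (g (n - i)%N * / INR i.+1) = \rsum_(i < n) (g i.+1 * / INR (n - i)).
Proof.
rewrite (reindex_inj rev_ord_inj); apply: eq_bigr => i _; simpl nat_of_ord.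
by rewrite subnSK // subKn.
Qed.

Lemma INR_expn m n : INR (m ^ n) = INR m ^ n.
Proof. by elim: n => // n IH; rewrite expnS mult_INR IH. Qed.

Lemma csum_ord_recl n (F : nat -> C) : (0 < n)%N ->
  \csum_(i < n) F i = (F 0%N + \csum_(i < n.-1) F i.+1)%C.
Proof. by case: n => // n _; rewrite big_ord_recl. Qed.

Lemma harmonic_sym n : \rsum_(i < n) (/ INR i.+1 + / INR (n - i)) = 2 * harmonic n.
Proof.
transitivity (harmonic n + harmonic n); last by ring.
rewrite big_split; congr Rplus.
transitivity (\rsum_(i < n) (1 * / INR (n - i))).
  by apply: eq_bigr => i _; rewrite Rmult_1_l.
rewrite -(harmonic_rev n (fun _ => 1)).
by apply: eq_bigr => i _; rewrite Rmult_1_l.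
Qed.

(** Only [n != 0] remains, with every [m] including 0; hence a bound for the Kloosterman sums with a
    gcd in [n] alone. One factor [2^(size ps)] comes from Weil's bound, the other from the divisors
    of [s] in the sum of [gcdn n s / n]. *)
Lemma hyperbola_discrepancy q b c l' l ps r :
  (0 < q)%N -> (l' <= q)%N -> (l <= q)%N -> uniq ps -> all prime ps ->
  coprime (\prod_(p <- ps) p) r -> q = (\prod_(p <- ps) p * r)%N ->
  Rabs (hyperbola_count q b c l' l - INR l / INR q * coprime_count q b l') <=
    2 * 4 ^ size ps * sqrt (INR (\prod_(p <- ps) p)) * INR r * (1 + 2 * harmonic q) ^ 2.
Proof.
move=> q0 l'q lq ups aps co qE.
set s := \prod_(p <- ps) p in co qE *.
have r0 : (0 < r)%N by move: q0; rewrite qE muln_gt0 => /andP[].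
have s0 : (0 < s)%N by move: q0; rewrite qE muln_gt0 => /andP[].
have iq : 0 < INR q by apply/lt_0_INR/leP.
set kap := 2 ^ size ps * sqrt (INR s) * INR r.
have kap0 : 0 <= kap.
  by apply: Rmult_le_pos; [apply: Rmult_le_pos; [apply: pow_le; lra | apply: sqrt_pos] | apply: pos_INR].
have Kb m n : Cmod (kloosterman q m n) <= kap * INR (gcdn n s).
  by rewrite qE; apply: Cmod_kloosterman_squarefree.
have E1 := hyperbola_countE b c l' l q0; have E2 := coprime_countE b l' q0.
set A := fun m : nat => \csum_(i < l') expi q (m * (q.-1 * b + q.-1 * i)).
set B := fun n : nat => \csum_(j < l) expi q (n * (c + j)).
pose H := harmonic q.-1.
have H0 : 0 <= H by apply: harmonic_ge0.
have HH : H <= harmonic q by apply: harmonic_mono; apply: leq_pred.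
have SA : \rsum_(m < q) Cmod (A m) <= INR q * (1 + 2 * H).
  rewrite /H /A; case: (q) q0 l'q {E1 E2 A B H H0 HH Kb qE iq} => // q' _ l'q.
  rewrite big_ord_recl; simpl nat_of_ord.
  have h0 : Cmod (\csum_(i < l') expi q'.+1 (0 * (q' * b + q' * i))) <= INR q'.+1.
    apply: (Rle_trans _ _ _ (csum_Cmod _ _ _)).
    rewrite (eq_bigr (fun _ => 1)) => [|i _]; last exact: Cmod_expi.
    by rewrite rsum_const card_ord Rmult_1_r; apply: leq_INR.
  apply: (Rle_trans _ (INR q'.+1 + \rsum_(m < q') (INR q'.+1 * (/ INR m.+1 + / INR (q' - m))))).
    apply: Rplus_le_compat => //; apply: rsum_le => m _.
    exact: (@window_dual q'.+1 m.+1 b l' (ltn_ord m : (0 < m.+1 < q'.+1)%N)).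
  by rewrite -big_distrr harmonic_sym /=; apply: Req_le; ring.
have SB : \rsum_(i < q.-1) (Cmod (B i.+1) * (kap * INR (gcdn i.+1 s))) <=
    INR q * kap * (2 * (2 ^ size ps * H)).
  have sq : s %| q by rewrite qE dvdn_mulr.
  (* Since [s] divides [q], reversal turns the half with [1/(q - n)] into the half with [1/n]. *)
  have gsym k j : (k + j = q)%N -> gcdn k s = gcdn j s.
    move=> e; apply/eqP; rewrite eqn_dvd !dvdn_gcd !dvdn_gcdr !andbT.
    have s1 : gcdn k s %| k + j by rewrite e (dvdn_trans (dvdn_gcdr _ _)).
    have s2 : gcdn j s %| k + j by rewrite e (dvdn_trans (dvdn_gcdr _ _)).
    rewrite dvdn_addr ?dvdn_gcdl // in s1.
    by rewrite dvdn_addl ?dvdn_gcdl // in s2; rewrite s1 s2.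
  have D : \rsum_(i < q.-1) (INR (gcdn i.+1 s) * / INR i.+1) <= 2 ^ size ps * H.
    apply: (Rle_trans _ _ _ (rsum_gcd_harmonic q.-1 s0)); apply: Rmult_le_compat_r => //.
    have := leq_INR (size_divisors_squarefree ups aps); rewrite -/s INR_expn => h.
    exact: h.
  have D' : \rsum_(i < q.-1) (INR (gcdn i.+1 s) * / INR (q.-1 - i)) <= 2 ^ size ps * H.
    have := @harmonic_rev q.-1 (fun i => INR (gcdn i s)) => /= <-.
    rewrite (eq_bigr (fun i : 'I_q.-1 => INR (gcdn i.+1 s) * / INR i.+1)) => [//|i _].
    congr (INR _ * _).
    by apply: gsym; have := ltn_ord i; lia.
  apply: (Rle_trans _ (\rsum_(i < q.-1) (INR q * kap *
     (INR (gcdn i.+1 s) * / INR i.+1 + INR (gcdn i.+1 s) * / INR (q.-1 - i))))).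
    apply: rsum_le => i _.
    have iq' : (0 < i.+1 < q)%N by have := ltn_ord i; lia.
    have := expi_window c l iq'; rewrite -/(B i.+1).
    have -> : (q - i.+1 = q.-1 - i)%N by lia.
    have := pos_INR (gcdn i.+1 s); set g := INR (gcdn _ _) => g0 hB.
    have : 0 <= kap * g by apply: Rmult_le_pos.
    move=> kg; have := Rmult_le_compat_r _ _ _ kg hB; lra.
  rewrite -big_distrr big_split; apply: Rmult_le_compat_l; last first.
    by apply: (Rle_trans _ _ _ (Rplus_le_compat _ _ _ _ D D')); lra.
  by apply: Rmult_le_pos => //; lra.
have main : INR q * INR q * Rabs (hyperbola_count q b c l' l - INR l / INR q * coprime_count q b l') <=
   (INR q * (1 + 2 * H)) * (INR q * kap * (2 * (2 ^ size ps * H))).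
  rewrite -{1}(Rabs_pos_eq (INR q * INR q)); last by nra.
  rewrite -Rabs_mult -Cmod_R.
  have -> : RtoC (INR q * INR q * (hyperbola_count q b c l' l - INR l / INR q * coprime_count q b l')) =
     \csum_(m < q) \csum_(i < q.-1) (A m * B i.+1 * kloosterman q m i.+1)%C.
    have -> : INR q * INR q * (hyperbola_count q b c l' l - INR l / INR q * coprime_count q b l') =
      INR q * INR q * hyperbola_count q b c l' l - INR l * (INR q * coprime_count q b l').
      by field; lra.
    rewrite RtoC_minus E1 RtoC_mult E2 -/A -/B.
    have B0 : B 0%N = RtoC (INR l).
      rewrite /B (eq_bigr (fun _ => RtoC 1)) => [|j _]; last by rewrite mul0n expi0.
      by rewrite csum_const card_ord Cmult_1_r.
    have S m : \csum_(n < q) (A m * B n * kloosterman q m n)%C =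
       (RtoC (INR l) * (A m * kloosterman q m 0) + \csum_(i < q.-1) (A m * B i.+1 * kloosterman q m i.+1))%C.
      rewrite (csum_ord_recl (fun n => (A m * B n * kloosterman q m n)%C) q0); congr Cplus.
      by rewrite B0; ring.
    rewrite (eq_bigr (fun m : 'I_q => (RtoC (INR l) * (A m * kloosterman q m 0) +
      \csum_(i < q.-1) (A m * B i.+1 * kloosterman q m i.+1))%C)); last by move=> m _; apply: S.
    have cancel (x y : C) : (x + y - x)%C = y by ring.
    by rewrite big_split -big_distrr; apply: cancel.
  apply: (Rle_trans _ _ _ (csum_Cmod _ _ _)).
  apply: (Rle_trans _ (\rsum_(m < q) (Cmod (A m) * \rsum_(i < q.-1) (Cmod (B i.+1) * (kap * INR (gcdn i.+1 s)))))).
    apply: rsum_le => m _; apply: (Rle_trans _ _ _ (csum_Cmod _ _ _)).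
    rewrite big_distrr /=; apply: rsum_le => i _; rewrite !Cmod_mult Rmult_assoc.
    apply: Rmult_le_compat_l; first exact: Cmod_ge_0.
    by apply: Rmult_le_compat_l; [exact: Cmod_ge_0 | exact: Kb].
  rewrite -big_distrl /=; apply: Rmult_le_compat => //.
    by apply: rsum_ge0 => m _; apply: Cmod_ge_0.
  apply: rsum_ge0 => m _; apply: Rmult_le_pos; first exact: Cmod_ge_0.
  by apply: Rmult_le_pos => //; apply: pos_INR.
have {}main : Rabs (hyperbola_count q b c l' l - INR l / INR q * coprime_count q b l') <=
   (1 + 2 * H) * (kap * (2 * (2 ^ size ps * H))).
  apply: (Rmult_le_reg_l (INR q * INR q)); first nra.
  by apply: (Rle_trans _ _ _ main); apply: Req_le; ring.
apply: (Rle_trans _ _ _ main).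
have p2 : 0 <= 2 ^ size ps by apply: pow_le; lra.
have -> : 2 * 4 ^ size ps * sqrt (INR s) * INR r * (1 + 2 * harmonic q) ^ 2 =
  2 ^ size ps * kap * 2 * (1 + 2 * harmonic q) ^ 2.
  by rewrite /kap (_ : 4 = 2 * 2) ?Rpow_mult_distr; [ring|lra].
have : (1 + 2 * H) * H <= (1 + 2 * harmonic q) ^ 2 by nra.
have : 0 <= 2 ^ size ps * kap * 2 by apply: Rmult_le_pos; [apply: Rmult_le_pos|lra].
move=> h1 h2; have := Rmult_le_compat_l _ _ _ h1 h2; lra.
Qed.
End Discrepancy.

(** * The discrepancy on average over the modulus *)

Module Average.
Import Coquelicot.Coquelicot.
Import all_boot.
Import zify.
Import Sums Discrepancy.
Set Implicit Arguments. Unset Strict Implicit. Unset Printing Implicit Defensive.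
Open Scope R_scope.
Local Arguments INR : simpl never.

Lemma rsum_term_le (I : finType) (P : pred I) (F : I -> R) i0 :
  (forall i, P i -> 0 <= F i) -> P i0 -> F i0 <= \rsum_(i | P i) F i.
Proof.
move=> h p0; rewrite (bigD1 i0) //= -[X in X <= _]Rplus_0_r; apply: Rplus_le_compat_l.
by apply: rsum_ge0 => i /andP[pi _]; apply: h.
Qed.

Lemma INR_pos n : (0 < n)%N -> 0 < INR n.
Proof. by move=> h; apply/lt_0_INR/leP. Qed.

Lemma rsum_inv_sqrt n : \rsum_(i < n) / sqrt (INR i.+1) <= 2 * sqrt (INR n).
Proof.
elim: n => [|n IH]; first by rewrite big_ord0 sqrt_0; lra.
rewrite big_ord_recr /=; apply: (Rle_trans _ _ _ (Rplus_le_compat_r _ _ _ IH)).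
have p1 : 0 < INR n.+1 by apply: INR_pos.
have s1 := sqrt_lt_R0 _ p1; have s0 := sqrt_pos (INR n).
have e1 := sqrt_sqrt _ (Rlt_le _ _ p1); have e0 := sqrt_sqrt _ (pos_INR n).
rewrite S_INR in e1 *; rewrite S_INR in s1.
set x := sqrt (INR n) in s0 e0 *; set y := sqrt (INR n + 1) in s1 e1 *.
have xy : x <= y by apply: sqrt_le_1_alt; lra.
apply: (Rmult_le_reg_r y) => //; rewrite Rmult_plus_distr_r Rinv_l; last lra.
nra.
Qed.

Lemma harmonic_le_ln n : (0 < n)%N -> harmonic n <= 1 + ln (INR n).
Proof.
elim: n => // -[|n] IH _; first by rewrite /harmonic big_ord1 ln_1 Rinv_1; lra.
rewrite harmonicS; have {}IH := IH isT.
have p1 : 0 < INR n.+1 by apply: INR_pos.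
have p2 : 0 < INR n.+2 by apply: INR_pos.
have : ln (INR n.+1) <= ln (INR n.+2) - / INR n.+2.
  have -> : INR n.+1 = INR n.+2 * (1 - / INR n.+2) by rewrite (S_INR n.+1); field; rewrite -S_INR; lra.
  have i1 : 0 < 1 - / INR n.+2.
    have -> : 1 - / INR n.+2 = INR n.+1 / INR n.+2 by rewrite (S_INR n.+1); field; rewrite -S_INR; lra.
    exact: Rdiv_lt_0_compat.
  rewrite ln_mult //; have := exp_ineq1_le (- / INR n.+2) => h.
  have : ln (1 - / INR n.+2) <= - / INR n.+2; last lra.
  rewrite -[X in _ <= X]ln_exp; apply: Rcomplements.ln_le => //; lra.
lra.
Qed.

Lemma ln_le_Rpower x d : 0 < d -> 1 <= x -> ln x <= Rpower x d / d.
Proof.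
move=> d0 x1; apply: (Rmult_le_reg_r d) => //; rewrite /Rdiv Rmult_assoc Rinv_l ?Rmult_1_r; last lra.
rewrite /Rpower; have := exp_ineq1_le (d * ln x); lra.
Qed.

Lemma Rpower_ge1 x d : 0 <= d -> 1 <= x -> 1 <= Rpower x d.
Proof.
move=> d0 x1; rewrite -(Rpower_O x); last lra.
by apply: Rle_Rpower.
Qed.

Lemma harmonic_le_Rpower d : 0 < d ->
  exists2 C, 0 < C & forall n, (0 < n)%N -> 1 + 2 * harmonic n <= C * Rpower (INR n) d.
Proof.
move=> d0; have i0 : 0 < / d by apply: Rinv_0_lt_compat.
exists (3 + 2 / d); first by rewrite /Rdiv; lra.
move=> n n0; have n1 : 1 <= INR n by apply: (@leq_INR 1).
have := harmonic_le_ln n0; have := ln_le_Rpower d0 n1; have := Rpower_ge1 (Rlt_le _ _ d0) n1.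
rewrite /Rdiv; set X := Rpower _ _; set l := ln _; nra.
Qed.

(** Primes with [p^e >= 4] pay for their own factor 4, and at most [P0] primes are smaller than
    that. *)
Lemma prime_count_bound e : 0 < e ->
  exists2 C, 1 <= C & forall ps : seq nat, uniq ps -> all prime ps ->
    4 ^ size ps <= C * Rpower (INR (\prod_(p <- ps) p)) e.
Proof.
move=> e0.
(* [p >= exp (2/e)] gives [p^e >= exp 2 >= 4]. *)
pose B := exp (2 / e); have [M hM] := nfloor_ex B ltac:(left; apply: exp_pos).
pose P0 := M.+1.
have big p : (P0 <= p)%N -> 4 <= Rpower (INR p) e.
  move=> hp; have hB : B <= INR p.
    by apply: (Rle_trans _ (INR P0)); [rewrite /P0 S_INR; lra | apply: leq_INR].
  have B0 : 0 < B by apply: exp_pos.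
  have h2 : 2 / e <= ln (INR p) by rewrite -[X in X <= _]ln_exp; apply: Rcomplements.ln_le.
  have : 2 <= e * ln (INR p).
    have := Rmult_le_compat_l e _ _ (Rlt_le _ _ e0) h2.
    by rewrite (_ : e * (2 / e) = 2); [|field; lra].
  have e1 : 2 <= exp 1 by have := exp_ineq1_le 1; lra.
  move=> h; rewrite /Rpower; apply: (Rle_trans _ (exp (1 + 1))).
    by rewrite exp_plus; nra.
  have [h'|<-] : 1 + 1 < e * ln (INR p) \/ 1 + 1 = e * ln (INR p) by lra.
    by left; apply: exp_increasing.
  lra.
exists (4 ^ P0); first by apply: pow_R1_Rle; lra.
move=> ps ups aps.
have key (l : seq nat) : all prime l ->
  4 ^ size l <= 4 ^ (count (fun p => p < P0)%N l) * Rpower (INR (\prod_(p <- l) p)) e.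
  elim: l => [|p l IH] /=.
    by rewrite big_nil /Rpower (_ : INR 1 = 1) // ln_1 Rmult_0_r exp_0; lra.
  case/andP => pp al; rewrite big_cons mult_INR.
  have p0 : 0 < INR p by apply/INR_pos/prime_gt0.
  have l0 : 0 < INR (\prod_(j <- l) j).
    by apply: INR_pos; rewrite big_seq; apply: prodn_cond_gt0 => q ql; apply/prime_gt0/(allP al).
  rewrite -Rpower_mult_distr //.
  have {}IH := IH al; have R0 : 0 < Rpower (INR (\prod_(j <- l) j)) e by apply: exp_pos.
  have p1 : 1 <= Rpower (INR p) e.
    by apply: Rpower_ge1; [lra | apply: (@leq_INR 1); apply: prime_gt0].
  have c0 : 0 < 4 ^ count (fun p => p < P0)%N l by apply: pow_lt; lra.
  set c := 4 ^ count _ _ in IH c0 *; set Y := Rpower (INR (\prod_(j <- l) j)) e in IH R0 *.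
  have cY : 0 < c * Y by apply: Rmult_lt_0_compat.
  case: ltnP => hp /=; rewrite -/c.
    have := Rmult_le_compat_l (c * Y) _ _ (Rlt_le _ _ cY) p1; nra.
  have := big p hp => h4.
  have := Rmult_le_compat_l (c * Y) _ _ (Rlt_le _ _ cY) h4; nra.
have cnt : (count (fun p => p < P0)%N ps <= P0)%N.
  rewrite -size_filter -[X in (_ <= X)%N](size_iota 0); apply: uniq_leq_size.
    exact: filter_uniq.
  by move=> p; rewrite mem_filter mem_iota add0n => /andP[].
apply: (Rle_trans _ _ _ (key ps aps)); apply: Rmult_le_compat_r; first by left; apply: exp_pos.
by apply: Rle_pow; [lra | apply/leP].
Qed.

(** For fixed [a] and [b] the sum of [1/sqrt s] over [s <= Q/(a^2 b^3)] is at most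
    [2 sqrt Q / (a b)], as [b^3 >= b^2]; summing over [a] and [b] costs two harmonic sums. One
    decomposition is given for each [q], and passing to all triples only enlarges the sum. *)
Lemma rsum_powerful_decomposition (Q : nat) (s a b : nat -> nat) :
  (forall q, (0 < q)%N -> q = (s q * (a q ^ 2 * b q ^ 3))%N) ->
  \rsum_(i < Q) / sqrt (INR (s i.+1)) <= 2 * sqrt (INR Q) * (harmonic Q * harmonic Q).
Proof.
move=> dec.
pose T (a b s i : 'I_Q) : bool := (i.+1 == s.+1 * (a.+1 ^ 2 * b.+1 ^ 3))%N.
have inv0 (x : 'I_Q) : 0 <= / sqrt (INR x.+1).
  by left; apply/Rinv_0_lt_compat/sqrt_lt_R0/INR_pos.
have step1 : \rsum_(i < Q) / sqrt (INR (s i.+1)) <=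
  \rsum_(i < Q) \rsum_(x < Q) \rsum_(y < Q) \rsum_(z < Q | T x y z i) / sqrt (INR z.+1).
  apply: rsum_le => i _.
  have E := dec i.+1 isT.
  have pos : [&& 0 < s i.+1, 0 < a i.+1 & 0 < b i.+1]%N.
    have : (0 < s i.+1 * (a i.+1 ^ 2 * b i.+1 ^ 3))%N by rewrite -E.
    by rewrite !muln_gt0 => /and3P[-> /andP[-> _] /and3P[-> _ _]].
  case/and3P: pos => s0 a0 b0.
  have iQ := ltn_ord i.
  have le1 : (s i.+1 <= i.+1)%N by rewrite {2}E leq_pmulr // muln_gt0 !expn_gt0 a0 b0.
  have le2 : (a i.+1 <= i.+1)%N.
    by apply: dvdn_leq => //; rewrite {2}E dvdn_mull // dvdn_mulr // dvdn_exp.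
  have le3 : (b i.+1 <= i.+1)%N.
    by apply: dvdn_leq => //; rewrite {2}E dvdn_mull // dvdn_mull // dvdn_exp.
  have ha : ((a i.+1).-1 < Q)%N by lia.
  have hb : ((b i.+1).-1 < Q)%N by lia.
  have hs : ((s i.+1).-1 < Q)%N by lia.
  have tt : T (Ordinal ha) (Ordinal hb) (Ordinal hs) i.
    by rewrite /T /= !prednK //; apply/eqP.
  apply: (Rle_trans _ (\rsum_(z < Q | T (Ordinal ha) (Ordinal hb) z i) / sqrt (INR z.+1))).
    have := @rsum_term_le _ (T (Ordinal ha) (Ordinal hb) ^~ i) (fun z : 'I_Q => / sqrt (INR z.+1)) (Ordinal hs) (fun z _ => inv0 z) tt.
    by rewrite /= prednK.
  apply: (Rle_trans _ (\rsum_(y < Q) \rsum_(z < Q | T (Ordinal ha) y z i) / sqrt (INR z.+1))).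
    apply: (@rsum_term_le _ xpredT (fun y => \rsum_(z < Q | T (Ordinal ha) y z i) / sqrt (INR z.+1))) => // y _.
    by apply: rsum_ge0.
  apply: (@rsum_term_le _ xpredT (fun x => \rsum_(y < Q) \rsum_(z < Q | T x y z i) / sqrt (INR z.+1))) => // x _.
  by apply: rsum_ge0 => y _; apply: rsum_ge0.
apply: (Rle_trans _ _ _ step1).
rewrite exchange_big /=.
apply: (Rle_trans _ (\rsum_(x < Q) \rsum_(y < Q) (2 * sqrt (INR Q) * (/ INR x.+1 * / INR y.+1)))); last first.
  apply: Req_le; rewrite /harmonic big_distrl big_distrr /=; apply: eq_bigr => x _.
  by rewrite !big_distrr /=; apply: eq_bigr => y _; ring.
apply: rsum_le => x _; rewrite exchange_big /=; apply: rsum_le => y _.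
set m := (x.+1 ^ 2 * y.+1 ^ 3)%N.
have m0 : (0 < m)%N by rewrite muln_gt0 !expn_gt0.
(* A triple determines its product, so each [z] occurs for at most one [i], and for none unless the
   product is at most [Q]. *)
apply: (Rle_trans _ (\rsum_(z < Q | (z.+1 * m <= Q)%N) / sqrt (INR z.+1))).
  rewrite (exchange_big_dep xpredT) //= [X in _ <= X]big_mkcond /=; apply: rsum_le => z _.
  rewrite big_const iter_Rplus.
  have [zm|zm] := leqP (z.+1 * m) Q.
    rewrite -[X in _ <= X]Rmult_1_l; apply: Rmult_le_compat_r => //.
    apply: (@leq_INR _ 1); apply/card_le1_eqP => i j; rewrite !unfold_in => /eqnP h1 /eqnP h2.
    by apply: val_inj; apply: succn_inj; rewrite h1 h2.
  rewrite (_ : #|_| = 0%N) ?Rmult_0_l; first lra.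
  apply: eq_card0 => i; rewrite !unfold_in; apply/negbTE/eqnP => h.
  by move: zm; rewrite -h ltnS leqNgt ltn_ord.
apply: (Rle_trans _ (\rsum_(z < Q %/ m) / sqrt (INR z.+1))).
  have le : (Q %/ m <= Q)%N by apply: leq_div.
  rewrite (big_ord_widen Q (fun z => / sqrt (INR z.+1)) le).
  apply: Req_le; apply: eq_bigl => z; by rewrite leq_divRL.
apply: (Rle_trans _ _ _ (rsum_inv_sqrt _)).
rewrite Rmult_assoc; apply: Rmult_le_compat_l; first lra.
have px : 0 < INR x.+1 by apply: INR_pos.
have py : 1 <= INR y.+1 by apply: (@leq_INR 1).
have le : INR (Q %/ m) <= INR Q * ((/ INR x.+1 * / INR y.+1) * (/ INR x.+1 * / INR y.+1)).
  have : INR (Q %/ m) * INR m <= INR Q by rewrite -mult_INR; apply: leq_INR; apply: leq_trunc_div.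
  have -> : INR m = INR x.+1 * INR x.+1 * (INR y.+1 * INR y.+1 * INR y.+1).
    by rewrite /m mult_INR !INR_expn; ring.
  set X := INR x.+1 in px *; set Y := INR y.+1 in py *; set d := INR (Q %/ m) => h.
  have d0 : 0 <= d by apply: pos_INR.
  apply: (Rmult_le_reg_r (X * X * (Y * Y))).
    by apply: Rmult_lt_0_compat; nra.
  have -> : INR Q * (/ X * / Y * (/ X * / Y)) * (X * X * (Y * Y)) = INR Q by field; lra.
  have : d * (X * X * (Y * Y)) * 1 <= d * (X * X * (Y * Y)) * Y; last nra.
  apply: Rmult_le_compat_l => //; do 2 (apply: Rmult_le_pos => //); nra.
apply: (Rle_trans _ _ _ (sqrt_le_1_alt _ _ le)).
have i1 : 0 <= / INR x.+1 by left; apply: Rinv_0_lt_compat.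
have i2 : 0 <= / INR y.+1 by left; apply: Rinv_0_lt_compat; lra.
have i3 : 0 <= / INR x.+1 * / INR y.+1 by apply: Rmult_le_pos.
rewrite sqrt_mult ?sqrt_square //; first lra.
  exact: pos_INR.
exact: Rmult_le_pos.
Qed.

Definition discrepancy_le (q : nat) (D : R) : Prop :=
  forall b c l' l, (l' <= q)%N -> (l <= q)%N ->
    Rabs (hyperbola_count q b c l' l - INR l / INR q * coprime_count q b l') <= D.

Theorem discrepancy_average e : 0 < e ->
  exists2 C, 0 < C & forall Q, (0 < Q)%N -> exists2 D : nat -> R,
    (forall q, (0 < q <= Q)%N -> 0 <= D q /\ discrepancy_le q (D q)) &
    \rsum_(i < Q) (D i.+1 / INR i.+1) <= C * (sqrt (INR Q) * Rpower (INR Q) e).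
Proof.
(* Five factors [Q^d] are lost: one in [4 ^ size ps], two in the square of [1 + 2 * harmonic q], and
   two in the summation over [a] and [b]. *)
move=> e0; pose d := e / 5; have d0 : 0 < d by rewrite /d; lra.
have [C1 hC1 P1] := prime_count_bound d0.
have [C2 hC2 P2] := harmonic_le_Rpower d0.
exists (4 * C1 * C2 ^ 4); first by apply: Rmult_lt_0_compat; [lra | apply: pow_lt].
move=> Q Q0.
pose good q (t : seq nat * nat * nat) := [/\ uniq t.1.1, all prime t.1.1,
   coprime (\prod_(p <- t.1.1) p) (t.1.2 ^ 2 * t.2 ^ 3) &
   q = (\prod_(p <- t.1.1) p * (t.1.2 ^ 2 * t.2 ^ 3))%N].
pose t q := epsilon (inhabits ([::], 1%N, 1%N)) (good q).
have tP q : (0 < q)%N -> good q (t q).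
  move=> q0; apply: epsilon_spec; have [ps [a [b [u1 u2 u3 _ u4]]]] := powerful_decomposition q0.
  by exists (ps, a, b); split.
pose s q := (\prod_(p <- (t q).1.1) p)%N.
pose r q := ((t q).1.2 ^ 2 * (t q).2 ^ 3)%N.
pose D q := 2 * 4 ^ size (t q).1.1 * sqrt (INR (s q)) * INR (r q) * (1 + 2 * harmonic q) ^ 2.
exists D.
  move=> q /andP[q0 qQ]; have [u1 u2 u3 u4] := tP q q0; split.
    apply: Rmult_le_pos; last exact: pow2_ge_0.
    apply: Rmult_le_pos; last exact: pos_INR.
    apply: Rmult_le_pos; last exact: sqrt_pos.
    apply: Rmult_le_pos; [lra | apply: pow_le; lra].
  by move=> b c l' l h1 h2; apply: hyperbola_discrepancy.
set X := Rpower (INR Q) d.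
have Q1 : 1 <= INR Q by apply: (@leq_INR 1).
have X1 : 1 <= X by apply: Rpower_ge1; lra.
have XE : Rpower (INR Q) e = X ^ 5.
  rewrite /X -Rpower_pow; last exact: exp_pos.
  rewrite Rpower_mult; congr Rpower; rewrite /d (_ : INR 5 = 5); [field | rewrite /INR; lra].
have hQ := P2 Q Q0; rewrite -/X in hQ; have H0 := harmonic_ge0 Q.
apply: (Rle_trans _ (\rsum_(i < Q) (2 * (C1 * X) * (C2 * X) ^ 2 * / sqrt (INR (s i.+1))))).
  apply: rsum_le => i _; have [u1 u2 u3 u4] := tP i.+1 isT; rewrite -/(s i.+1) -/(r i.+1) in u4.
  have : (0 < s i.+1 * r i.+1)%N by rewrite -u4.
  rewrite muln_gt0 => /andP[s0 r0].
  have ps := INR_pos s0; have pr := INR_pos r0.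
  have ss := sqrt_lt_R0 _ ps; have es := sqrt_sqrt _ (Rlt_le _ _ ps).
  have -> : D i.+1 / INR i.+1 = 2 * 4 ^ size (t i.+1).1.1 * (1 + 2 * harmonic i.+1) ^ 2 * / sqrt (INR (s i.+1)).
    have -> : INR i.+1 = sqrt (INR (s i.+1)) * sqrt (INR (s i.+1)) * INR (r i.+1).
      by rewrite es {1}u4 mult_INR.
    rewrite /D; field; lra.
  apply: Rmult_le_compat_r; first by left; apply: Rinv_0_lt_compat.
  apply: Rmult_le_compat; [|exact: pow2_ge_0| |].
  - by apply: Rmult_le_pos; [lra | apply: pow_le; lra].
  - apply: Rmult_le_compat_l; first lra.
    apply: (Rle_trans _ _ _ (P1 _ u1 u2)); apply: Rmult_le_compat_l; first lra.
    apply: Rle_Rpower_l; first lra; split => //.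
    apply: leq_INR; apply: (@leq_trans i.+1) => //; by rewrite {2}u4 leq_pmulr.
  - apply: pow_incr; have h0 := harmonic_ge0 i.+1; split; first lra.
    apply: (Rle_trans _ _ _ _ hQ); have := harmonic_mono (ltn_ord i); lra.
rewrite -big_distrr /=.
have := @rsum_powerful_decomposition Q s (fun q => (t q).1.2) (fun q => (t q).2) ltac:(by move=> q q0; have [] := tP q q0).
have HX : harmonic Q <= C2 * X by lra.
have sq := sqrt_pos (INR Q).
set S := bigop _ _ _ => hS.
have K0 : 0 <= 2 * (C1 * X) * (C2 * X) ^ 2.
  apply: Rmult_le_pos; last exact: pow2_ge_0.
  by apply: Rmult_le_pos; [lra | apply: Rmult_le_pos; lra].
apply: (Rle_trans _ (2 * (C1 * X) * (C2 * X) ^ 2 * (2 * sqrt (INR Q) * ((C2 * X) * (C2 * X))))).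
  apply: Rmult_le_compat_l => //; apply: (Rle_trans _ _ _ hS); apply: Rmult_le_compat_l; first lra.
  by apply: Rmult_le_compat.
by rewrite XE; apply: Req_le; ring.
Qed.
End Average.

(** * Euler's sum of inverse squares, with a rate *)

Module Lattice.
Import Coquelicot.Coquelicot.
Import all_boot.
Import zify.
Import Sums Discrepancy Average.
Set Implicit Arguments. Unset Strict Implicit. Unset Printing Implicit Defensive.
Open Scope R_scope.
Local Arguments INR : simpl never.

Lemma sin_sqr_bounds t : 0 < t < PI / 2 ->
  / (t * t) <= / (sin t * sin t) <= / (t * t) + 1.
Proof.
move=> [t0 t1].
have s0 : 0 < sin t by apply: sin_gt_0; have := PI_RGT_0; lra.
have c0 : 0 < cos t by apply: cos_gt_0; lra.
have st : sin t < t by apply: sin_lt_x.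
have ct : t * cos t <= sin t.
  have [c [h1 h2]] := MVT_cor2 (fun x => sin x - x * cos x) (fun x => x * sin x) 0 t t0
    ltac:(move=> c _; apply/is_derive_Reals; auto_derive => //; ring).
  have : 0 < sin c by apply: sin_gt_0; have := PI_RGT_0; lra.
  rewrite sin_0 in h1 => sc; have := Rmult_lt_0_compat _ _ (Rmult_lt_0_compat _ _ (proj1 h2) sc) t0; lra.
split; first by apply: Rinv_le_contravar; nra.
apply: (Rmult_le_reg_r (sin t * sin t)); first nra.
rewrite Rinv_l; last nra.
have := sin2_cos2 t; rewrite /Rsqr => sc.
have -> : (/ (t * t) + 1) * (sin t * sin t) = (sin t / t) * (sin t / t) + sin t * sin t by field; lra.
have : cos t <= sin t / t.
  by apply: (Rmult_le_reg_r t) => //; rewrite (_ : sin t / t * t = sin t); [lra | field; lra].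
nra.
Qed.

Definition theta n k := (INR (2 * k + 1) * PI / 2 ^ n.+2).

Lemma theta_bounds n k : (k < 2 ^ n)%N -> 0 < theta n k < PI / 2.
Proof.
move=> h; have PI0 := PI_RGT_0; rewrite /theta.
have p2 : 0 < 2 ^ n by apply: pow_lt; lra.
have le : INR (2 * k + 1) + 1 <= 2 * 2 ^ n.
  rewrite -(_ : INR 2 = 2) // -INR_expn -mult_INR -[X in _ + X](_ : INR 1 = 1) // -plus_INR.
  by apply: leq_INR; lia.
have p0 : 0 < INR (2 * k + 1) by apply: INR_pos; lia.
have -> : 2 ^ n.+2 = 4 * 2 ^ n by rewrite /=; ring.
split; first by apply: Rdiv_lt_0_compat; nra.
apply: (Rmult_lt_reg_r (4 * 2 ^ n)); first lra.
have -> : INR (2 * k + 1) * PI / (4 * 2 ^ n) * (4 * 2 ^ n) = INR (2 * k + 1) * PI by field; lra.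
nra.
Qed.

Definition csc2 n := \rsum_(k < 2 ^ n) / (sin (theta n k) * sin (theta n k)).

Lemma csc2_cos n : \rsum_(k < 2 ^ n) / (cos (theta n k) * cos (theta n k)) = csc2 n.
Proof.
rewrite /csc2 (reindex_inj rev_ord_inj); apply: eq_bigr => k _; simpl nat_of_ord.
have -> : sin (theta n k) = cos (theta n (2 ^ n - k.+1)); last by [].
rewrite -cos_shift; congr cos; rewrite /theta.
have e : INR (2 * (2 ^ n - k.+1) + 1) = 2 * 2 ^ n - INR (2 * k + 1).
  have : (2 * (2 ^ n - k.+1) + 1 + (2 * k + 1) = 2 * 2 ^ n)%N by have := ltn_ord k; lia.
  move/(congr1 INR); rewrite plus_INR mult_INR INR_expn (_ : INR 2 = 2) //; lra.
have p2 : 0 < 2 ^ n by apply: pow_lt; lra.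
rewrite e /=; field; lra.
Qed.

(** [1/sin^2 + 1/cos^2] at an angle is [4/sin^2] at twice the angle, so halving the angles
    multiplies the sum by 4. The doubled angles beyond [PI/2] are those of [csc2 n] shifted by
    [PI/2], where sines become cosines. *)
Lemma csc2E n : 2 * csc2 n = 4 ^ n.+1.
Proof.
elim: n => [|n IH].
  rewrite /csc2 /theta expn0 big_ord1 /= (_ : INR (2 * 0 + 1) = 1) // (_ : 1 * PI / (2 * (2 * 1)) = PI / 4); last by field.
  rewrite sin_PI4 /Rdiv (_ : 1 * / sqrt 2 * (1 * / sqrt 2) = / (sqrt 2 * sqrt 2)).
    by rewrite sqrt_sqrt; lra.
  by field; apply: Rgt_not_eq; apply: sqrt_lt_R0; lra.
have -> : 4 ^ n.+2 = 4 * 4 ^ n.+1 by [].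
have p : 0 < 2 ^ n by apply: pow_lt; lra.
have e2 k : theta n (2 ^ n + k) = PI / 2 + theta n k.
  rewrite /theta mulnDr -addnA plus_INR mult_INR INR_expn (_ : INR 2 = 2) //=; field; lra.
have step k : (k < 2 ^ n.+1)%N ->
   / (sin (theta n.+1 k) * sin (theta n.+1 k)) + / (cos (theta n.+1 k) * cos (theta n.+1 k)) =
   4 * / (sin (theta n k) * sin (theta n k)).
  move=> kn; have [t0 t1] := theta_bounds kn.
  have -> : theta n k = 2 * theta n.+1 k by rewrite /theta /=; field; lra.
  have s0 : 0 < sin (theta n.+1 k) by apply: sin_gt_0; have := PI_RGT_0; lra.
  have c0 : 0 < cos (theta n.+1 k) by apply: cos_gt_0; lra.
  rewrite sin_2a; have := sin2_cos2 (theta n.+1 k); rewrite /Rsqr.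
  move: s0 c0; set x := sin _; set y := cos _ => s0 c0 e.
  apply: (Rmult_eq_reg_r (x * x * (y * y))); last by apply: Rgt_not_eq; repeat apply: Rmult_lt_0_compat.
  transitivity 1; last by field; lra.
  by rewrite -e; field; lra.
have -> : 2 * csc2 n.+1 = csc2 n.+1 + csc2 n.+1 by ring.
rewrite -{2}csc2_cos {1}/csc2 -big_split /=.
transitivity (\rsum_(k < 2 ^ n.+1) (4 * / (sin (theta n k) * sin (theta n k)))).
  by apply: eq_bigr => k _; apply: step.
rewrite -[4 * (4 * 4 ^ n)]/(4 * 4 ^ n.+1) -IH -big_distrr /=; congr Rmult.
have -> : 2 * csc2 n = csc2 n + csc2 n by ring.
have e3 : (2 ^ n.+1 = 2 ^ n + 2 ^ n)%N by rewrite expnS mul2n addnn.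
rewrite e3 big_split_ord /= -{2}csc2_cos; congr Rplus; apply: eq_bigr => k _.
by rewrite /= e2 -cos_sin.
Qed.

Definition zsum n := \rsum_(k < n) / (INR k.+1 * INR k.+1).

Lemma odd_zsum n : \rsum_(k < n) / (INR (2 * k + 1) * INR (2 * k + 1)) = zsum (2 * n) - zsum n / 4.
Proof.
elim: n => [|n IH]; first by rewrite muln0 /zsum !big_ord0; lra.
rewrite big_ord_recr /= IH /zsum mulnS add2n !big_ord_recr /= -/(zsum _) -/(zsum _).
have -> : INR (2 * n).+2 = 2 * INR n.+1 by rewrite !S_INR mult_INR (_ : INR 2 = 2) //; ring.
rewrite addn1; have := INR_pos (ltn0Sn n); have := INR_pos (ltn0Sn (2 * n)) => h1 h2.
rewrite /zsum; field; lra.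
Qed.

(** Termwise, [1/sin^2] exceeds [1/theta^2] by at most 1, so the error is at most the number [2^n]
    of angles, against a total [2 * 4^n]. *)
Lemma odd_zsum_bounds n :
  PI ^ 2 / 8 - PI ^ 2 / 16 * / 2 ^ n <= zsum (2 * 2 ^ n) - zsum (2 ^ n) / 4 <= PI ^ 2 / 8.
Proof.
have p : 0 < 2 ^ n by apply: pow_lt; lra.
have PI0 := PI_RGT_0.
rewrite -odd_zsum; set O := bigop _ _ _.
have E : \rsum_(k < 2 ^ n) / (theta n k * theta n k) = 16 * (2 ^ n * 2 ^ n) / PI ^ 2 * O.
  rewrite /O big_distrr /=; apply: eq_bigr => k _; rewrite /theta.
  have := @INR_pos (2 * k + 1) ltac:(lia) => h; rewrite /=; field; lra.
have F : csc2 n = 2 * (2 ^ n * 2 ^ n).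
  have := csc2E n; rewrite (_ : 4 ^ n.+1 = 4 * (2 ^ n * 2 ^ n)); first lra.
  by rewrite -Rpow_mult_distr /= (_ : 2 * 2 = 4) //; lra.
have low : \rsum_(k < 2 ^ n) / (theta n k * theta n k) <= csc2 n.
  by apply: rsum_le => k _; have [] := sin_sqr_bounds (theta_bounds (ltn_ord k)).
have up : csc2 n <= \rsum_(k < 2 ^ n) / (theta n k * theta n k) + 2 ^ n.
  have -> : 2 ^ n = \rsum_(k < 2 ^ n) 1 by rewrite rsum_const card_ord INR_expn Rmult_1_r.
  rewrite -big_split /=; apply: rsum_le => k _.
  by have [] := sin_sqr_bounds (theta_bounds (ltn_ord k)).
rewrite E F in low; rewrite E F in up.
have c0 : 0 < 16 * (2 ^ n * 2 ^ n) / PI ^ 2 by apply: Rdiv_lt_0_compat; nra.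
split; apply: (Rmult_le_reg_l (16 * (2 ^ n * 2 ^ n) / PI ^ 2)) => //.
  rewrite (_ : _ * (PI ^ 2 / 8 - _) = 2 * (2 ^ n * 2 ^ n) - 2 ^ n); first lra.
  by field; lra.
rewrite (_ : _ * (PI ^ 2 / 8) = 2 * (2 ^ n * 2 ^ n)); first lra.
by field; lra.
Qed.

Lemma zsumS n : zsum n.+1 = zsum n + / (INR n.+1 * INR n.+1).
Proof. by rewrite /zsum big_ord_recr. Qed.

Lemma zsum_tail m n : (0 < m)%N -> (m <= n)%N -> 0 <= zsum n - zsum m <= / INR m - / INR n.
Proof.
move=> m0 mn; rewrite -(subnKC mn); elim: (n - m)%N => [|k IH]; first by rewrite addn0; lra.
rewrite addnS zsumS.
have p1 := @INR_pos (m + k) ltac:(lia); have p2 := INR_pos (ltn0Sn (m + k)).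
have h : 0 < / (INR (m + k).+1 * INR (m + k).+1) <= / INR (m + k) - / INR (m + k).+1.
  split; first by apply: Rinv_0_lt_compat; nra.
  have -> : / INR (m + k) - / INR (m + k).+1 = / (INR (m + k) * INR (m + k).+1).
    by rewrite (S_INR (m + k)) in p2 *; field; lra.
  apply: Rinv_le_contravar; first nra.
  by rewrite (S_INR (m + k)) in p2 *; nra.
lra.
Qed.

Lemma ltn_2pow n : (n < 2 ^ n)%N. Proof. exact: ltn_expl. Qed.

(** The rate is what the truncation of the sum of [mobius d / d^2] uses. The limit is identified
    along powers of 2, and the tail estimate carries it to every [n]. *)
Theorem basel n : (0 < n)%N -> 0 <= PI ^ 2 / 6 - zsum n <= / INR n.
Proof.
move=> n0.
(* with [u = zsum (2^j)], [zsum (2^(j+1)) - u/4] is within [PI^2/(16 2^j)] of [PI^2/8], and [zsum (2^(j+1)) - u <= 2^-j] *)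
have key j : Rabs (zsum (2 ^ j) - PI ^ 2 / 6) <= (4 / 3) * (1 + PI ^ 2 / 16) * / 2 ^ j.
  have p : 0 < / 2 ^ j by apply/Rinv_0_lt_compat/pow_lt; lra.
  have [h1 h2] := odd_zsum_bounds j.
  have := @zsum_tail (2 ^ j) (2 * 2 ^ j) ltac:(by rewrite expn_gt0) ltac:(lia).
  rewrite mult_INR INR_expn (_ : INR 2 = 2) // => -[h3 h4].
  have h5 : 0 < / (2 * 2 ^ j) by apply/Rinv_0_lt_compat; have := pow_lt 2 j; lra.
  have PI0 := PI_RGT_0; have q : 0 < PI ^ 2 * / 2 ^ j by apply: Rmult_lt_0_compat => //; nra.
  apply: Rabs_le; split; lra.
have i0 := Rinv_0_lt_compat _ (INR_pos n0).
pose K := (4 / 3) * (1 + PI ^ 2 / 16).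
have K0 : 0 < K by rewrite /K; have := PI_RGT_0; nra.
have lim e : 0 < e -> exists2 j, (n <= 2 ^ j)%N & K * / 2 ^ j < e.
  move=> e0; have [N hN] := nfloor_ex (K / e) ltac:(left; apply: Rdiv_lt_0_compat; lra).
  exists (n + N.+1)%N; first by have := ltn_2pow (n + N.+1); lia.
  have p : INR N.+1 < 2 ^ (n + N.+1).
    rewrite -(_ : INR 2 = 2) // -INR_expn; apply: lt_INR; apply/ltP.
    by have := ltn_2pow (n + N.+1); lia.
  have p0 := INR_pos (ltn0Sn N); rewrite S_INR in p p0.
  have big : K / e < 2 ^ (n + N.+1) by lra.
  apply: (Rmult_lt_reg_r (2 ^ (n + N.+1))); first lra.
  rewrite Rmult_assoc Rinv_l ?Rmult_1_r; last lra.
  have ke : K / e * e = K by field; lra.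
  nra.
split; apply: Rnot_lt_le => neg.
  have [j nj hj] := lim (zsum n - PI ^ 2 / 6) ltac:(lra).
  have := key j; have [h1 _] := zsum_tail n0 nj; rewrite -/K => /Rabs_le_between; lra.
have [j nj hj] := lim (PI ^ 2 / 6 - zsum n - / INR n) ltac:(lra).
have := key j; have [_ h1] := zsum_tail n0 nj; rewrite -/K => /Rabs_le_between.
have : 0 < / INR (2 ^ j) by apply/Rinv_0_lt_compat/INR_pos; rewrite expn_gt0.
lra.
Qed.

(** * Moebius inversion and the density of coprime pairs *)

Definition mobius (n : nat) : R :=
  if (\prod_(p <- primes n) p == n)%N then (-1) ^ size (primes n) else 0.

Lemma mobius_le1 n : Rabs (mobius n) <= 1.
Proof.
rewrite /mobius; case: ifP => _; last by rewrite Rabs_R0; lra.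
by rewrite pow_1_abs; lra.
Qed.

Lemma mobius1 : mobius 1 = 1.
Proof. by rewrite /mobius /= big_nil eqxx. Qed.

Lemma mobius_prime_mul p e : prime p -> (0 < e)%N ->
  mobius (p * e) = if (p %| e)%N then 0 else - mobius e.
Proof.
move=> pp e0; have p0 := prime_gt0 pp.
have mem q : (q \in primes (p * e)) = (q == p) || (q \in primes e).
  by rewrite primesM // primes_prime // inE.
case: ifPn => pe.
  rewrite /mobius; have -> : primes (p * e) = primes e.
    apply/irr_sorted_eq; [exact: ltn_trans | exact: ltnn | exact: sorted_primes | exact: sorted_primes |].
    by move=> q; rewrite mem; case: eqP => // ->; rewrite mem_primes pp e0 pe.
  rewrite ifF //; apply/negbTE; rewrite neq_ltn; apply/orP; left.
  have d : (\prod_(q <- primes e) q <= e)%N.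
    apply: dvdn_leq => //; rewrite {2}(prod_prime_decomp e0) prime_decompE big_map /=.
    rewrite !big_seq; apply: (big_ind2 (fun x y => x %| y)%N) => // [x1 x2 y1 y2|q].
      exact: dvdn_mul.
    by rewrite /= => h; rewrite -{1}(expn1 q) dvdn_exp2l // logn_gt0.
  by apply: leq_ltn_trans d _; rewrite ltn_Pmull // prime_gt1.
have perm : perm_eq (primes (p * e)) (p :: primes e).
  apply: uniq_perm; [exact: primes_uniq | rewrite /= primes_uniq andbT mem_primes pp e0 //= |].
  by move=> q; rewrite mem inE.
rewrite /mobius (perm_big _ perm) (perm_size perm) big_cons eqn_pmul2l //=.
by case: ifP => _; lra.
Qed.

(** Write [n = p m] with [p] prime. The divisors divisible by [p] are the [p e] with [e | m], and
    they cancel against the divisors prime to [p], which divide [m] as well. *)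
Lemma sum_mobius n : (0 < n)%N ->
  \rsum_(d <- divisors n) mobius d = if n == 1%N then 1 else 0.
Proof.
move=> n0; case: eqP => [->|/eqP n1].
  by rewrite (_ : divisors 1 = [:: 1%N]) // big_seq1 mobius1.
set p := pdiv n; have pp : prime p by rewrite pdiv_prime // ltn_neqAle eq_sym n1.
have pn : (p %| n)%N := pdiv_dvd n; have p0 := prime_gt0 pp.
rewrite (bigID (fun d => p %| d)%N) /=.
set m := (n %/ p)%N; have m0 : (0 < m)%N by rewrite divn_gt0 // dvdn_leq.
have nE : n = (p * m)%N by rewrite /m mulnC divnK.
rewrite -big_filter.
have perm : perm_eq [seq d <- divisors n | (p %| d)%N] (map (muln p) (divisors m)).
  apply: uniq_perm; first by rewrite filter_uniq // divisors_uniq.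
    rewrite map_inj_uniq ?divisors_uniq // => x y /eqP; rewrite eqn_pmul2l //; exact: eqP.
  move=> d; rewrite mem_filter -dvdn_divisors //; apply/andP/mapP.
    move=> [pd dn]; exists (d %/ p)%N; last by rewrite mulnC divnK.
    by rewrite -dvdn_divisors // -(@dvdn_pmul2l p) // -nE mulnC divnK.
  by move=> [e]; rewrite -dvdn_divisors // => em ->; rewrite dvdn_mulr // nE dvdn_pmul2l.
rewrite (perm_big _ perm) big_map /=.
rewrite -[X in _ + X]big_filter.
have perm2 : perm_eq [seq d <- divisors n | ~~ (p %| d)%N] [seq d <- divisors m | ~~ (p %| d)%N].
  apply: uniq_perm; try by rewrite filter_uniq // divisors_uniq.
  move=> d; rewrite !mem_filter -!dvdn_divisors //; case: (boolP (p %| d)%N) => //= pd.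
  by rewrite nE Gauss_dvdr // coprime_sym prime_coprime.
rewrite (perm_big _ perm2) big_filter.
rewrite [X in _ + X]big_mkcond -big_split /= big_seq big1 // => d; rewrite -dvdn_divisors // => dm.
rewrite mobius_prime_mul //; last exact: dvdn_gt0 dm.
by case: ifP => _ /=; lra.
Qed.

Lemma sum_mobius_range Q n : (0 < n <= Q)%N ->
  \rsum_(i < Q | (i.+1 %| n)%N) mobius i.+1 = if n == 1%N then 1 else 0.
Proof.
move=> /andP[n0 nQ]; rewrite -sum_mobius //.
have -> : \rsum_(i < Q | (i.+1 %| n)%N) mobius i.+1 = \rsum_(d <- [seq d <- iota 1 Q | (d %| n)%N]) mobius d.
  rewrite big_filter -(big_mkord (fun i => i.+1 %| n)%N (fun i => mobius i.+1)) /index_iota subn0.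
  by rewrite -[1%N]addn0 iotaDl big_map.
apply: perm_big; apply: uniq_perm; [by rewrite filter_uniq // iota_uniq | exact: divisors_uniq |].
move=> d; rewrite mem_filter mem_iota -dvdn_divisors //; case: (boolP (d %| n)%N) => //= dn.
by have := dvdn_gt0 n0 dn; have := dvdn_leq n0 dn; lia.
Qed.

Lemma rsum_multiples Q d (f : nat -> R) : (0 < d)%N -> (0 < Q)%N ->
  \rsum_(q < Q | (d %| q)%N) f q = \rsum_(k < (Q.-1 %/ d).+1) f (d * k)%N.
Proof.
move=> d0; case: Q => // Q _ /=; elim: Q => [|Q IH].
  by rewrite div0n big_mkcond !big_ord_recr !big_ord0 /= dvdn0 muln0.
rewrite big_mkcond big_ord_recr -big_mkcond /= IH.
case: ifPn => dn.
  have [k kE] := dvdnP dn; have k0 : (0 < k)%N by case: k kE.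
  have -> : (Q.+1 %/ d = (Q %/ d).+1)%N.
    have -> : (Q %/ d = k.-1)%N.
      have -> : Q = (k.-1 * d + d.-1)%N.
        by apply: succn_inj; rewrite kE -addnS prednK // -mulSnr prednK.
      by rewrite divnMDl // divn_small ?addn0 // prednK.
    by rewrite kE mulnK // prednK.
  rewrite [RHS]big_ord_recr /=; congr (_ + f _).
  have -> : (Q %/ d).+1 = k.
    have -> : Q = (k.-1 * d + d.-1)%N.
      by apply: succn_inj; rewrite kE -addnS prednK // -mulSnr prednK.
    by rewrite divnMDl // divn_small ?addn0 ?prednK // prednK.
  by rewrite kE mulnC.
rewrite Rplus_0_r.
have r0 : (0 < Q.+1 %% d)%N by rewrite lt0n.
have rd := ltn_pmod Q.+1 d0.
have E : Q = (Q.+1 %/ d * d + (Q.+1 %% d).-1)%N by have := divn_eq Q.+1 d; lia.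
suff -> : (Q %/ d = Q.+1 %/ d)%N by [].
by rewrite {1}E divnMDl // [X in (_ + X)%N]divn_small ?addn0 //; lia.
Qed.

(** An exact finite identity replaces Dirichlet series: summed over [d <= Q], [mobius d / d^2] times
    [zsum (Q %/ d)] gives 1, being a sum over [n = d k <= Q]. Replacing each [zsum] by [PI^2/6]
    costs the inverse of [Q %/ d], at most [2 d / Q]. *)
Lemma sum_mobius_div2 Q : (0 < Q)%N ->
  Rabs (\rsum_(i < Q) (mobius i.+1 / (INR i.+1 * INR i.+1)) - 6 / PI ^ 2) <= 4 * harmonic Q / INR Q.
Proof.
move=> Q0; set M := bigop _ _ _.
have PI0 := PI_RGT_0; have PI3 : 3 < PI by have := PI2_3_2; lra.
have Qp := INR_pos Q0.
pose z (d : nat) := zsum (Q %/ d).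
have one : \rsum_(i < Q) (mobius i.+1 / (INR i.+1 * INR i.+1) * z i.+1) = 1.
  have -> : \rsum_(i < Q) (mobius i.+1 / (INR i.+1 * INR i.+1) * z i.+1) =
    \rsum_(i < Q) \rsum_(n < Q.+1 | (i.+1 %| n)%N && (0 < n)%N) (mobius i.+1 * / (INR n * INR n)).
    apply: eq_bigr => i _.
    have -> : \rsum_(n < Q.+1 | (i.+1 %| n)%N && (0 < n)%N) (mobius i.+1 * / (INR n * INR n)) =
       \rsum_(n < Q.+1 | (i.+1 %| n)%N) (if (0 < n)%N then mobius i.+1 * / (INR n * INR n) else 0).
      by rewrite big_mkcondr.
    rewrite (rsum_multiples (fun n => if (0 < n)%N then mobius i.+1 * / (INR n * INR n) else 0)) //=.
    rewrite big_ord_recl /= muln0 /= Rplus_0_l /z /zsum big_distrr /=; apply: eq_bigr => k _.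
    rewrite /bump /= add1n mult_INR.
    by have := INR_pos (ltn0Sn i); have := INR_pos (ltn0Sn k) => h1 h2; field; lra.
  rewrite (exchange_big_dep (fun n : 'I_Q.+1 => (0 < n)%N)) /=; last by move=> i n _ /andP[].
  rewrite big_mkcond big_ord_recl /= Rplus_0_l.
  transitivity (\rsum_(n < Q) (if n.+1 == 1%N then 1 else 0) * / (INR n.+1 * INR n.+1)).
    apply: eq_bigr => n _; rewrite /bump /= add1n -(@sum_mobius_range Q n.+1); last by rewrite /= ltn_ord.
    by rewrite big_distrl /=; apply: eq_bigl => i; rewrite andbT.
  case: (Q) Q0 => // Q' _; rewrite big_ord_recl /= big1 => [|i _]; last by rewrite Rmult_0_l.
  by rewrite (_ : INR 1 = 1) //; field.
have diff : PI ^ 2 / 6 * M - 1 = \rsum_(i < Q) (mobius i.+1 / (INR i.+1 * INR i.+1) * (PI ^ 2 / 6 - z i.+1)).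
  rewrite -one /M big_distrr /= -rsumB; apply: eq_bigr => i _; ring.
have bound : Rabs (PI ^ 2 / 6 * M - 1) <= 2 * harmonic Q / INR Q.
  rewrite diff; apply: (Rle_trans _ _ _ (rsum_Rabs _ _ _)).
  rewrite /harmonic big_distrr /= /Rdiv big_distrl /=; apply: rsum_le => i _.
  have ip := INR_pos (ltn0Sn i).
  have q0 : (0 < Q %/ i.+1)%N by rewrite divn_gt0 // ltn_ord.
  have [b1 b2] := basel q0.
  rewrite Rabs_mult Rabs_mult (Rabs_pos_eq (/ _)); last by left; apply: Rinv_0_lt_compat; nra.
  rewrite (Rabs_pos_eq (_ - _)) // -/(z i.+1).
  have m1 := mobius_le1 i.+1; have m0 := Rabs_pos (mobius i.+1).
  have i0 := Rinv_0_lt_compat _ (INR_pos q0).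
  have le : / INR (Q %/ i.+1) <= 2 * INR i.+1 / INR Q.
    have : (Q < 2 * (i.+1 * (Q %/ i.+1)))%N.
      by have := divn_eq Q i.+1; have := @ltn_pmod Q i.+1 isT; nia.
    move=> /ltP /lt_INR; rewrite !mult_INR (_ : INR 2 = 2) // => h.
    apply: (Rmult_le_reg_r (INR (Q %/ i.+1))); first exact: INR_pos.
    rewrite Rinv_l; last by have := INR_pos q0; lra.
    apply: (Rmult_le_reg_r (INR Q)) => //; rewrite Rmult_1_l.
    have -> : 2 * INR i.+1 / INR Q * INR (Q %/ i.+1) * INR Q = 2 * (INR i.+1 * INR (Q %/ i.+1)) by field; lra.
    lra.
  have -> : 2 * / INR i.+1 * / INR Q = 1 * / (INR i.+1 * INR i.+1) * (2 * INR i.+1 / INR Q) by field; lra.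
  have j0 : 0 < / (INR i.+1 * INR i.+1) by apply: Rinv_0_lt_compat; nra.
  apply: Rmult_le_compat; [by apply: Rmult_le_pos; lra | by [] | | by rewrite /z; lra].
  by apply: Rmult_le_compat_r; lra.
have -> : M - 6 / PI ^ 2 = (6 / PI ^ 2) * (PI ^ 2 / 6 * M - 1) by field; lra.
have c1 : 0 < 6 / PI ^ 2 <= 1.
  split; first by apply: Rdiv_lt_0_compat; nra.
  by apply: (Rmult_le_reg_r (PI ^ 2)); [nra | rewrite (_ : 6 / PI ^ 2 * PI ^ 2 = 6); [nra | field; lra]].
rewrite Rabs_mult (Rabs_pos_eq (6 / _)); last lra.
have H0 := harmonic_ge0 Q; have hq : 0 <= harmonic Q / INR Q by apply: Rmult_le_pos => //; left; apply: Rinv_0_lt_compat.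
have := Rabs_pos (PI ^ 2 / 6 * M - 1); rewrite /Rdiv !Rmult_assoc in bound hq *; nra.
Qed.
End Lattice.

(** * Sums over the Farey triangle compared with integrals *)

Module Kernel.
Import Coquelicot.Coquelicot.
Import all_boot.
Import zify.
Import Sums Discrepancy Average Lattice.
Set Implicit Arguments. Unset Strict Implicit. Unset Printing Implicit Defensive.
Open Scope R_scope.
Local Arguments INR : simpl never.

(* [G] is a primitive of the nondecreasing function [f] on [a,b], in the weak
   sense needed to compare sums with integrals *)
Definition primitive_on (f G : R -> R) (a b : R) : Prop :=
  forall u v, a <= u -> u <= v -> v <= b ->
    f u <= f v /\ f u * (v - u) <= G v - G u <= f v * (v - u).

Definition bounded_on (f : R -> R) (B a b : R) : Prop :=
  forall u, a <= u <= b -> 0 <= f u <= B.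

Definition le_dec_b (x y : R) : bool := if Rle_dec x y then true else false.

Lemma le_decP x y : reflect (x <= y) (le_dec_b x y).
Proof. by rewrite /le_dec_b; case: Rle_dec => h; constructor. Qed.

(** On each cell the increment of [G] lies between the values of [f] at the two ends times the
    length; the differences telescope to one value of [f], at most [B], times [d]. *)
Lemma riemann_sum f G a B d N :
  0 <= a <= 1 -> 0 < d -> (0 < N)%N -> INR N.-1 * d < 1 -> 1 <= INR N * d ->
  primitive_on f G a 1 -> bounded_on f B a 1 ->
  Rabs (d * (\rsum_(k < N | le_dec_b a (INR k * d)) f (INR k * d)) - (G 1 - G a)) <= B * d.
Proof.
move=> [a0 a1] d0; case: N => // N _ /= N1 N2 hG hf.
have mono u v : a <= u -> u <= v -> v <= 1 -> 0 <= G v - G u.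
  move=> h1 h2 h3; have [_ [h _]] := hG u v h1 h2 h3; have [h' _] := hf u ltac:(lra); nra.
pose S n := d * (\rsum_(k < n | le_dec_b a (INR k * d)) f (INR k * d)).
have SS n : S n.+1 = S n + (if le_dec_b a (INR n * d) then d * f (INR n * d) else 0).
  rewrite /S big_mkcond big_ord_recr -big_mkcond /=; case: ifP => _; ring.
(* Clamping the grid to [[a,1]] treats the incomplete cells at both ends like the others. *)
pose h t := Rmax a (Rmin t 1).
have hb t : a <= h t <= 1.
  by rewrite /h; split; [apply: Rmax_l | apply: Rmax_lub => //; apply: Rmin_r].
have hm s t : s <= t -> h s <= h t <= h s + (t - s).
  by rewrite /h /Rmax /Rmin => st; repeat destruct Rle_dec; lra.
have ha t : t <= a -> h t = a by rewrite /h /Rmax /Rmin => st; repeat destruct Rle_dec; lra.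
have hi t : a <= t <= 1 -> h t = t by rewrite /h /Rmax /Rmin => st; repeat destruct Rle_dec; lra.
have h1 t : 1 <= t -> h t = 1 by rewrite /h /Rmax /Rmin => st; repeat destruct Rle_dec; lra.
have small n : (n <= N)%N -> INR n * d < 1.
  by move=> nN; have := leq_INR nN; nra.
have step n : INR n.+1 * d = INR n * d + d by rewrite S_INR; ring.
have S0 n : (n <= N.+1)%N -> 0 <= S n.
  elim: n => [|n IH] nN; first by rewrite /S big_ord0; lra.
  rewrite SS; have := IH (ltnW nN); case: le_decP => hn; last lra.
  by have [] := hf (INR n * d) ltac:(have := small n nN; lra); nra.
have up n : (n <= N)%N -> S n <= G (h (INR n * d)) - G a.
  elim: n => [|n IH] nN.
    by rewrite /S big_ord0 Rmult_0_r; apply: mono; [lra | have := hb (INR 0 * d); lra | have := hb (INR 0 * d); lra].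
  have {}IH := IH (ltnW nN); rewrite SS.
  have sn := small _ nN; have sn' := small _ (ltnW nN).
  have [m1 m2] := hm (INR n * d) (INR n.+1 * d) ltac:(rewrite step; lra).
  case: le_decP => hn.
    rewrite (hi (INR n.+1 * d)); last by rewrite step; rewrite step in sn; lra.
    rewrite (hi (INR n * d)) in IH; last by lra.
    have [_ [q1 _]] := hG (INR n * d) (INR n.+1 * d) hn ltac:(rewrite step; lra) ltac:(lra).
    rewrite step in q1 *; nra.
  have := mono (h (INR n * d)) (h (INR n.+1 * d)) (proj1 (hb _)) m1 (proj2 (hb _)); lra.
have low n : (n <= N.+1)%N -> G (h (INR n * d)) - G a <= S n + d * f (h (INR n * d)).
  elim: n => [|n IH] nN.
    rewrite ha; last by rewrite /INR; lra.
    rewrite /S big_ord0 Rmult_0_r; have [] := hf a ltac:(lra); nra.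
  have {}IH := IH (ltnW nN).
  have sn := small _ nN.
  have [m1 m2] := hm (INR n * d) (INR n.+1 * d) ltac:(rewrite step; lra).
  have [_ [_ q2]] := hG (h (INR n * d)) (h (INR n.+1 * d)) (proj1 (hb _)) m1 (proj2 (hb _)).
  have [f0 _] := hf _ (hb (INR n.+1 * d)).
  have q3 : f (h (INR n.+1 * d)) * (h (INR n.+1 * d) - h (INR n * d)) <= f (h (INR n.+1 * d)) * d.
    by apply: Rmult_le_compat_l => //; rewrite step in m2 *; lra.
  rewrite SS; case: le_decP => hn.
    rewrite (hi (INR n * d)) in IH q2 q3; last lra.
    lra.
  rewrite (ha (INR n * d)) in IH q2 q3; last lra.
  have := S0 n (ltnW nN); lra.
have eN : h (INR N.+1 * d) = 1 by apply: h1.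
have L := low N.+1 (leqnn _); rewrite eN in L.
have U : S N.+1 <= G 1 - G a + B * d.
  have := up N (leqnn _); rewrite SS.
  have := mono (h (INR N * d)) 1 (proj1 (hb _)) (proj2 (hb _)) ltac:(lra).
  have B0 : 0 <= B by have := hf 1 ltac:(lra); lra.
  case: le_decP => hn; last nra.
  have [_ q] := hf (INR N * d) ltac:(lra).
  have := Rmult_le_compat_r d _ _ ltac:(lra) q; lra.
have [_ f1] := hf 1 ltac:(lra); have := Rmult_le_compat_r d _ _ ltac:(lra) f1.
by move=> f1'; rewrite -/(S N.+1); apply: Rabs_le; split; lra.
Qed.

(* [V] is the integral of [F] over the Farey triangle [0 < x < 1, 1 - x <= y <= 1] *)
Definition kernel (F : R -> R -> R) (V : R) : Prop :=
  exists E P : R -> R, exists G : R -> R -> R,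
    [/\ forall x, 0 < x < 1 -> primitive_on (F x) (G x) (1 - x) 1,
        forall x, 0 < x < 1 -> bounded_on (F x) (/ x) (1 - x) 1,
        forall x, 0 < x < 1 -> G x 1 - G x (1 - x) = E x,
        primitive_on E P 0 1 /\ bounded_on E 1 0 1 &
        V = P 1 - P 0].

Definition in_triangle (Q q q' : nat) : bool := (0 < q)%N && (Q <= q + q')%N.

Definition triangle_sum (F : R -> R -> R) (Q : nat) (P : nat -> nat -> bool) : R :=
  \rsum_(q < Q) \rsum_(q' < Q | in_triangle Q q q' && P q q') F (INR q / INR Q) (INR q' / INR Q).

Lemma triangle_condition d Q k l : (0 < Q)%N ->
  le_dec_b (1 - INR k * (INR d / INR Q)) (INR l * (INR d / INR Q)) = (Q <= d * k + d * l)%N.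
Proof.
move=> Q0; have Qp := INR_pos Q0.
have e : (INR k * (INR d / INR Q) + INR l * (INR d / INR Q)) * INR Q = INR (d * k + d * l).
  by rewrite plus_INR !mult_INR; field; lra.
apply/le_decP/idP => h.
  rewrite leqNgt; apply/negP => /ltP /lt_INR; rewrite -e; nra.
have := leq_INR h; rewrite -e => h'; nra.
Qed.

(** At [x = k d/Q] the error of a row is [1/x] times the step, that is [1/k], so the rows together
    cost a harmonic sum; the outer Riemann sum of [E <= 1] costs a bounded number of steps. *)
Lemma kernel_grid F V Q d : kernel F V -> (0 < d)%N -> (d <= Q)%N ->
  Rabs ((INR d / INR Q) ^ 2 *
    (\rsum_(q < Q | (d %| q)%N) \rsum_(q' < Q | (d %| q')%N)
        if in_triangle Q q q' then F (INR q / INR Q) (INR q' / INR Q) else 0) - V)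
  <= (INR d / INR Q) * (harmonic Q + 3).
Proof.
move=> [E [P [G [hG hF hE [hP hB] ->]]]] d0 dQ.
have Q0 : (0 < Q)%N by lia.
have Qp := INR_pos Q0; have dp := INR_pos d0.
set de := INR d / INR Q; have de0 : 0 < de by apply: Rdiv_lt_0_compat.
set N := (Q.-1 %/ d).+1.
have N1 k : (k < N)%N -> INR k * de < 1.
  move=> kN; have : (k * d < Q)%N.
    have : (k <= Q.-1 %/ d)%N by []. rewrite leq_divRL // => h; lia.
  move=> /ltP /lt_INR; rewrite mult_INR => h; apply: (Rmult_lt_reg_r (INR Q)) => //.
  by rewrite /de (_ : INR k * (INR d / INR Q) * INR Q = INR k * INR d); [lra | field; lra].
have N2 : 1 <= INR N * de.
  have : (Q <= N * d)%N.
    by have := divn_eq Q.-1 d; have := ltn_pmod Q.-1 d0; rewrite /N mulSn; lia.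
  move=> /leq_INR; rewrite mult_INR => h; apply: (Rmult_le_reg_r (INR Q)) => //.
  by rewrite /de (_ : INR N * (INR d / INR Q) * INR Q = INR N * INR d); [lra | field; lra].
have NQ : (N <= Q)%N by rewrite /N; have := leq_div Q.-1 d; lia.
have xE k : INR (d * k) / INR Q = INR k * de by rewrite mult_INR /de; field; lra.
rewrite (rsum_multiples (fun q => \rsum_(q' < Q | (d %| q')%N)
   if in_triangle Q q q' then F (INR q / INR Q) (INR q' / INR Q) else 0) d0 Q0) -/N.
have inner (k : 'I_N) : (0 < k)%N ->
  Rabs (de * (\rsum_(q' < Q | (d %| q')%N) if in_triangle Q (d * k) q' then
     F (INR (d * k) / INR Q) (INR q' / INR Q) else 0) - E (INR k * de)) <= / INR k.
  move=> k0; set x := INR k * de.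
  have x01 : 0 < x < 1.
    by split; [apply: Rmult_lt_0_compat => //; apply: INR_pos | apply: N1].
  rewrite (rsum_multiples (fun q' => if in_triangle Q (d * k) q' then
     F (INR (d * k) / INR Q) (INR q' / INR Q) else 0) d0 Q0) -/N.
  have -> : \rsum_(l < N) (if in_triangle Q (d * k) (d * l) then F (INR (d * k) / INR Q) (INR (d * l) / INR Q) else 0) =
     \rsum_(l < N | le_dec_b (1 - x) (INR l * de)) F x (INR l * de).
    rewrite -big_mkcond /=; apply: eq_big => [l|l _]; last by rewrite !xE.
    by rewrite /in_triangle muln_gt0 d0 k0 triangle_condition.
  rewrite -(hE x x01).
  have := @riemann_sum (F x) (G x) (1 - x) (/ x) de N ltac:(lra) de0 isT (N1 N.-1 (leqnn _)) N2 (hG x x01) (hF x x01).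
  rewrite (_ : / x * de = / INR k) //.
  by have kp := INR_pos k0; rewrite /x; field; lra.
have outer := @riemann_sum E P 0 1 de N ltac:(lra) de0 isT (N1 N.-1 (leqnn _)) N2 hP hB.
set I := fun k : nat => \rsum_(q' < Q | (d %| q')%N) if in_triangle Q (d * k) q' then
     F (INR (d * k) / INR Q) (INR q' / INR Q) else 0.
have I0 : I 0%N = 0.
  by rewrite /I big1 // => q' _; rewrite /in_triangle muln0.
have -> : \rsum_(k < N) I k = \rsum_(k < N.-1) I k.+1.
  by rewrite /N big_ord_recl I0 Rplus_0_l.
have eE : \rsum_(k < N | le_dec_b 0 (INR k * de)) E (INR k * de) = E 0 + \rsum_(k < N.-1) E (INR k.+1 * de).
  rewrite (eq_bigl xpredT); last first.
    by move=> k; apply/le_decP; apply: Rmult_le_pos; [apply: pos_INR | lra].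
  by rewrite /N big_ord_recl; congr (E _ + _); rewrite (_ : INR 0 = 0) // Rmult_0_l.
rewrite eE in outer.
have [E00 E01] := hB 0 ltac:(lra).
have split_ : Rabs (de * (\rsum_(k < N.-1) (de * I k.+1)) - de * (\rsum_(k < N.-1) E (INR k.+1 * de))) <= de * harmonic Q.
  rewrite -Rmult_minus_distr_l -rsumB Rabs_mult (Rabs_pos_eq de); last lra.
  apply: Rmult_le_compat_l; first lra.
  apply: (Rle_trans _ _ _ (rsum_Rabs _ _ _)); apply: (Rle_trans _ (harmonic N.-1)).
    apply: rsum_le => k _.
    by have := inner (Ordinal (ltn_ord k : (k.+1 < N)%N)) isT.
  by apply: harmonic_mono; lia.
have -> : de ^ 2 * (\rsum_(k < N.-1) I k.+1) = de * (\rsum_(k < N.-1) (de * I k.+1)).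
  by rewrite -big_distrr /=; ring.
move: split_ outer; set A := de * _; set B := de * (\rsum_(k < N.-1) _).
rewrite Rmult_plus_distr_l -/B => h1 h2.
(* The row [q = 0] is empty, whereas [E 0] belongs to the outer Riemann sum; the difference is at
   most one step. *)
have h3 : 0 <= de * E 0 <= de by nra.
by apply: Rabs_le; move: h1 h2 => /Rabs_le_between h1 /Rabs_le_between h2; split; lra.
Qed.

(** The grid of step [d/Q] carries the weight [mobius d / d^2], which damps its error to order
    [1/(d Q)]; summation over [d] costs one more harmonic factor. *)
Theorem kernel_lattice F V Q : kernel F V -> (0 < Q)%N ->
  Rabs (triangle_sum F Q coprime / INR Q ^ 2 - 6 / PI ^ 2 * V) <= (1 + 2 * harmonic Q) ^ 2 * 4 / INR Q.
Proof.
move=> hK Q0; have Qp := INR_pos Q0; have H0 := harmonic_ge0 Q.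
have V01 : 0 <= V <= 1.
  have [E [P [G [_ _ _ [hP hB] ->]]]] := hK.
  have [_ [h1 h2]] := hP 0 1 ltac:(lra) ltac:(lra) ltac:(lra).
  have := hB 0 ltac:(lra); have := hB 1 ltac:(lra); lra.
pose Sd d := \rsum_(q < Q | (d %| q)%N) \rsum_(q' < Q | (d %| q')%N)
        if in_triangle Q q q' then F (INR q / INR Q) (INR q' / INR Q) else 0.
have E1 : triangle_sum F Q coprime = \rsum_(i < Q) (mobius i.+1 * Sd i.+1).
  rewrite /triangle_sum.
  transitivity (\rsum_(q < Q) \rsum_(q' < Q) \rsum_(i < Q | (i.+1 %| q)%N && (i.+1 %| q')%N)
     (mobius i.+1 * if in_triangle Q q q' then F (INR q / INR Q) (INR q' / INR Q) else 0)).
    apply: eq_bigr => q _; rewrite big_mkcond /=; apply: eq_bigr => q' _.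
    have [tri|] /= := boolP (in_triangle Q q q'); last first.
      by rewrite big1 // => i _; rewrite Rmult_0_r.
    have q0 : (0 < q)%N by case/andP: tri.
    have g0 : (0 < gcdn q q' <= Q)%N.
      rewrite gcdn_gt0 q0 /=; apply: (leq_trans (dvdn_leq q0 (dvdn_gcdl _ _))).
      by apply: ltnW.
    have := sum_mobius_range g0; rewrite -/(coprime q q') => e.
    transitivity ((if coprime q q' then 1 else 0) * F (INR q / INR Q) (INR q' / INR Q)).
      by case: coprime; ring.
    by rewrite -e big_distrl /=; apply: eq_bigl => i; rewrite dvdn_gcd.
  transitivity (\rsum_(q < Q) \rsum_(i < Q | (i.+1 %| q)%N) \rsum_(q' < Q | (i.+1 %| q')%N)
     (mobius i.+1 * if in_triangle Q q q' then F (INR q / INR Q) (INR q' / INR Q) else 0)).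
    apply: eq_bigr => q _; rewrite (exchange_big_dep (fun i : 'I_Q => i.+1 %| q)%N) /=; last first.
      by move=> ? ? _ /andP[].
    by apply: eq_bigr => i hi; apply: eq_bigl => q'; rewrite hi.
  rewrite (exchange_big_dep xpredT) //=; apply: eq_bigr => i _.
  rewrite /Sd big_distrr /=; apply: eq_bigr => q _.
  by rewrite big_distrr.
have E2 : triangle_sum F Q coprime / INR Q ^ 2 =
   \rsum_(i < Q) (mobius i.+1 / (INR i.+1 * INR i.+1) * ((INR i.+1 / INR Q) ^ 2 * Sd i.+1)).
  rewrite E1 /Rdiv big_distrl /=; apply: eq_bigr => i _.
  by have := INR_pos (ltn0Sn i) => hi; field; lra.
pose M := \rsum_(i < Q) (mobius i.+1 / (INR i.+1 * INR i.+1)).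
have D : Rabs (triangle_sum F Q coprime / INR Q ^ 2 - M * V) <= harmonic Q * (harmonic Q + 3) / INR Q.
  rewrite E2 /M big_distrl /= -rsumB; apply: (Rle_trans _ _ _ (rsum_Rabs _ _ _)).
  rewrite {1}/harmonic /Rdiv !big_distrl /=; apply: rsum_le => i _.
  have ip := INR_pos (ltn0Sn i).
  rewrite -/(Rdiv _ _) -/(Rdiv _ (INR Q)) -Rmult_minus_distr_l Rabs_mult Rabs_mult.
  have := kernel_grid hK (ltn0Sn i) (ltn_ord i); rewrite -/(Sd i.+1) => hg.
  rewrite (Rabs_pos_eq (/ _)); last by left; apply: Rinv_0_lt_compat; nra.
  have -> : / INR i.+1 * (harmonic Q + 3) * / INR Q =
    1 * / (INR i.+1 * INR i.+1) * (INR i.+1 / INR Q * (harmonic Q + 3)) by field; lra.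
  have j0 : 0 < / (INR i.+1 * INR i.+1) by apply: Rinv_0_lt_compat; nra.
  apply: Rmult_le_compat => //; last by apply: Rmult_le_compat_r; [lra | exact: mobius_le1].
    by apply: Rmult_le_pos; [exact: Rabs_pos | lra].
  exact: Rabs_pos.
have D2 := sum_mobius_div2 Q0; rewrite -/M in D2.
have hq : 0 <= harmonic Q / INR Q by apply: Rmult_le_pos => //; left; apply: Rinv_0_lt_compat.
have iq : 0 < / INR Q by apply: Rinv_0_lt_compat.
have -> : triangle_sum F Q coprime / INR Q ^ 2 - 6 / PI ^ 2 * V =
  (triangle_sum F Q coprime / INR Q ^ 2 - M * V) + (M - 6 / PI ^ 2) * V by ring.
apply: (Rle_trans _ _ _ (Rabs_triang _ _)); rewrite Rabs_mult (Rabs_pos_eq V); last lra.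
have : Rabs (M - 6 / PI ^ 2) * V <= 4 * harmonic Q / INR Q.
  by have := Rabs_pos (M - 6 / PI ^ 2); nra.
move=> h; apply: (Rle_trans _ (harmonic Q * (harmonic Q + 3) / INR Q + 4 * harmonic Q / INR Q)); first lra.
by rewrite /Rdiv -Rmult_plus_distr_r; apply: Rmult_le_compat_r; nra.
Qed.

(* Abel summation *)
Lemma monotone_weight_discrepancy (N : nat) (f a : nat -> R) (B D : R) : 0 <= B ->
  (forall k, (k < N)%N -> 0 <= f k <= B) ->
  (forall k, (k.+1 < N)%N -> f k <= f k.+1) ->
  (forall n, (n <= N)%N -> Rabs (\rsum_(k < n) a k) <= D) ->
  Rabs (\rsum_(k < N) (f k * a k)) <= 2 * B * D.
Proof.
move=> B0 fB fm hD.
have D0 : 0 <= D by have := hD 0%N isT; rewrite big_ord0 Rabs_R0.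
case: N fB fm hD => [|N] fB fm hD; first by rewrite big_ord0 Rabs_R0; nra.
have key n : (n <= N)%N ->
  Rabs (\rsum_(k < n.+1) (f k * a k) - f n * \rsum_(k < n.+1) a k) <= D * (f n - f 0%N).
  elim: n => [|n IH] nN; first by rewrite !big_ord1 /= Rminus_diag // Rabs_R0; lra.
  have {}IH := IH (ltnW nN).
  rewrite (big_ord_recr n.+1) [X in _ - _ * X]big_ord_recr /=.
  have A1 := hD n.+1 ltac:(lia); have m := fm n ltac:(lia).
  move: IH A1; set S := bigop _ _ _; set A := \rsum_(k < n.+1) a k => IH A1.
  have -> : S + f n.+1 * a n.+1 - f n.+1 * (A + a n.+1) = (S - f n * A) - (f n.+1 - f n) * A by ring.
  apply: (Rle_trans _ _ _ (Rabs_triang _ _)); rewrite Rabs_Ropp Rabs_mult (Rabs_pos_eq (f n.+1 - f n)); last lra.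
  by have := Rmult_le_compat_l (f n.+1 - f n) _ _ ltac:(lra) A1; lra.
have K := key N (leqnn _); have A := hD N.+1 (leqnn _).
have [f0 f1] := fB N (leqnn _); have [f00 _] := fB 0%N isT.
have -> : \rsum_(k < N.+1) (f k * a k) =
  (\rsum_(k < N.+1) (f k * a k) - f N * \rsum_(k < N.+1) a k) + f N * \rsum_(k < N.+1) a k by ring.
apply: (Rle_trans _ _ _ (Rabs_triang _ _)); rewrite Rabs_mult (Rabs_pos_eq (f N)) //.
have := Rmult_le_compat_l _ _ _ f0 A; nra.
Qed.

(** * Triangle sums weighted by counts of numerators in a window *)

Definition window_count (c l : nat -> nat) (q q' : nat) : R :=
  \rsum_(j < l q) (if (q %| q' * (c q + j) + 1)%N then 1 else 0).

Definition window_sum (F : R -> R -> R) (Q : nat) (c l : nat -> nat) : R :=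
  \rsum_(q < Q) \rsum_(q' < Q | in_triangle Q q q')
    (F (INR q / INR Q) (INR q' / INR Q) * window_count c l q q').

Lemma triangle_row Q q (f : nat -> R) : (0 < q < Q)%N ->
  \rsum_(q' < Q | in_triangle Q q q') f q' = \rsum_(k < q) f (Q - q + k)%N.
Proof.
move=> /andP[q0 qQ].
have e : (Q = (Q - q) + q)%N by lia.
rewrite (eq_bigl (fun q' : 'I_Q => Q - q <= q')%N); last first.
  by move=> k; rewrite /in_triangle q0 /= leq_subLR.
rewrite big_mkcond -(big_mkord xpredT (fun i => if (Q - q <= i)%N then f i else 0)) /=.
rewrite (big_cat_nat (n := (Q - q)%N)) ?leq_subr //= big_nat_cond big1 ?Rplus_0_l; last first.
  by move=> i /andP[/andP[_ h] _]; rewrite leqNgt h.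
rewrite {2}e -{1}[(Q - q)%N]add0n big_addn addKn big_mkord.
by apply: eq_bigr => k _; rewrite leq_addl addnC.
Qed.

(** In a row the partial sums over [q'] are hyperbola counts in boxes that start at [q' = Q - q], so
    monotonicity of [F] in [y] brings in [D q]. Replacing [l q / q] by [eta] costs [1/q] per row,
    which is the harmonic term. *)
Lemma window_sum_approx F V Q (D : nat -> R) c l eta :
  kernel F V -> (0 < Q)%N -> 0 <= eta <= 1 ->
  (forall q, (0 < q <= Q)%N -> 0 <= D q /\ discrepancy_le q (D q)) ->
  (forall q, (0 < q < Q)%N -> (l q <= q)%N /\ Rabs (INR (l q) - eta * INR q) <= 1) ->
  Rabs (window_sum F Q c l - eta * triangle_sum F Q coprime) <=
    INR Q * (2 * (\rsum_(i < Q) (D i.+1 / INR i.+1)) + harmonic Q).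
Proof.
move=> [E [P [G [hG hF _ _ _]]]] Q0 he hD hl; have Qp := INR_pos Q0.
have tE : triangle_sum F Q coprime = \rsum_(q < Q) \rsum_(q' < Q | in_triangle Q q q')
   (F (INR q / INR Q) (INR q' / INR Q) * if coprime q' q then 1 else 0).
  apply: eq_bigr => q _; rewrite big_mkcondr; apply: eq_bigr => q' _.
  by rewrite coprime_sym; case: coprime; rewrite ?Rmult_1_r ?Rmult_0_r.
rewrite tE /window_sum big_distrr /= -rsumB.
apply: (Rle_trans _ _ _ (rsum_Rabs _ _ _)).
pose K q := INR Q * (2 * (D q / INR q) + / INR q).
apply: (Rle_trans _ (\rsum_(i < Q.-1) K i.+1)); last first.
  have -> : INR Q * (2 * (\rsum_(i < Q) (D i.+1 / INR i.+1)) + harmonic Q) = \rsum_(i < Q) K i.+1.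
    rewrite /K -big_distrr /=; congr Rmult; rewrite big_split /= -big_distrr /=; congr Rplus.
  have -> : \rsum_(i < Q) K i.+1 = \rsum_(i < Q.-1.+1) K i.+1 by rewrite prednK.
  rewrite big_ord_recr /= prednK //.
  have [d0 _] := hD Q ltac:(by rewrite Q0 leqnn); have i0 := Rinv_0_lt_compat _ Qp.
  have : 0 <= K Q.
    rewrite /K; apply: Rmult_le_pos; first lra.
    have : 0 <= D Q / INR Q by apply: Rmult_le_pos; lra.
    lra.
  lra.
have Qe : Q = Q.-1.+1 by rewrite prednK.
pose row q := Rabs (\rsum_(q' < Q | in_triangle Q q q') (F (INR q / INR Q) (INR q' / INR Q) * window_count c l q q') -
   eta * \rsum_(q' < Q | in_triangle Q q q') (F (INR q / INR Q) (INR q' / INR Q) * if coprime q' q then 1 else 0)).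
have -> : \rsum_(q < Q) Rabs (\rsum_(q' < Q | in_triangle Q q q') (F (INR q / INR Q) (INR q' / INR Q) * window_count c l q q') -
   eta * \rsum_(q' < Q | in_triangle Q q q') (F (INR q / INR Q) (INR q' / INR Q) * if coprime q' q then 1 else 0)) =
   \rsum_(i < Q.-1) row i.+1.
  transitivity (\rsum_(q < Q.-1.+1) row q); first by rewrite -Qe.
  have r0 : row 0%N = 0 by rewrite /row !big_pred0 // Rmult_0_r Rminus_diag // Rabs_R0.
  by rewrite big_ord_recl [X in X + _]r0 Rplus_0_l.
apply: rsum_le => i _; rewrite /row /K; set q := i.+1.
have qQ : (0 < q < Q)%N by have := ltn_ord i; rewrite /q; lia.
have qp : 0 < INR q by apply: INR_pos.
have [hl1 hl2] := hl q qQ.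
have [D0 Dq] := hD q ltac:(lia).
set x := INR q / INR Q.
have x01 : 0 < x < 1.
  split; first by apply: Rdiv_lt_0_compat.
  apply: (Rmult_lt_reg_r (INR Q)) => //; rewrite /x (_ : INR q / INR Q * INR Q = INR q); last by field; lra.
  by rewrite Rmult_1_l; apply: lt_INR; apply/ltP; case/andP: qQ.
pose f k := F x (INR (Q - q + k) / INR Q).
have yk k : (k < q)%N -> 1 - x <= INR (Q - q + k) / INR Q <= 1.
  move=> kq.
  have h1 : INR (Q - q + k) <= INR Q by apply: leq_INR; lia.
  have h2 : INR Q <= INR (Q - q + k) + INR q by rewrite -plus_INR; apply: leq_INR; lia.
  rewrite /x; move: (INR (Q - q + k)) (INR q) (INR Q) Qp h1 h2 => Y y0 Y0 Qp' h1 h2.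
  have e1 : (1 - y0 / Y0) * Y0 = Y0 - y0 by field; lra.
  have e2 : Y / Y0 * Y0 = Y by field; lra.
  by split; apply: (Rmult_le_reg_r Y0) => //; rewrite ?e1 e2; lra.
have fB k : (k < q)%N -> 0 <= f k <= / x by move=> kq; apply: hF => //; apply: yk.
have fm k : (k.+1 < q)%N -> f k <= f k.+1.
  move=> kq; have [h1 h2] := yk k (ltnW kq); have [h3 h4] := yk k.+1 kq.
  have le : INR (Q - q + k) / INR Q <= INR (Q - q + k.+1) / INR Q.
    by apply: Rmult_le_compat_r; [left; apply: Rinv_0_lt_compat | apply: leq_INR; lia].
  by have [h _] := hG x x01 _ _ h1 le h4; exact: h.
rewrite (triangle_row (fun q' => F x (INR q' / INR Q) * window_count c l q q') qQ).
rewrite (triangle_row (fun q' => F x (INR q' / INR Q) * if coprime q' q then 1 else 0) qQ).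
pose w k := window_count c l q (Q - q + k).
pose cp k := if coprime (Q - q + k) q then 1 else 0.
have -> : \rsum_(k < q) (F x (INR (Q - q + k) / INR Q) * window_count c l q (Q - q + k)) -
    eta * (\rsum_(k < q) (F x (INR (Q - q + k) / INR Q) * if coprime (Q - q + k) q then 1 else 0)) =
    \rsum_(k < q) (f k * (w k - INR (l q) / INR q * cp k)) +
    (INR (l q) / INR q - eta) * (\rsum_(k < q) (f k * cp k)).
  rewrite !big_distrr /= -rsumB -big_split /=; apply: eq_bigr => k _; rewrite /f /w /cp; ring.
apply: (Rle_trans _ _ _ (Rabs_triang _ _)).
have ix : / x = INR Q / INR q by rewrite /x; field; lra.
have ix0 : 0 < / x by apply: Rinv_0_lt_compat; lra.
have part1 : Rabs (\rsum_(k < q) (f k * (w k - INR (l q) / INR q * cp k))) <= 2 * / x * D q.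
  apply: (@monotone_weight_discrepancy q f (fun k => w k - INR (l q) / INR q * cp k)) => //; first lra.
  move=> n nq; have := Dq (Q - q)%N (c q) n (l q) nq hl1.
  by rewrite /hyperbola_count /coprime_count big_distrr /= -rsumB.
have part2 : Rabs ((INR (l q) / INR q - eta) * \rsum_(k < q) (f k * cp k)) <= / x.
  have s1 : Rabs (\rsum_(k < q) (f k * cp k)) <= INR q * / x.
    apply: (Rle_trans _ _ _ (rsum_Rabs _ _ _)).
    have -> : INR q * / x = \rsum_(k < q) / x by rewrite rsum_const card_ord.
    apply: rsum_le => k _; have [f0 f1] := fB k (ltn_ord k).
    by rewrite /cp Rabs_pos_eq; case: coprime; lra.
  have s2 : Rabs (INR (l q) / INR q - eta) <= / INR q.
    have -> : INR (l q) / INR q - eta = (INR (l q) - eta * INR q) * / INR q by field; lra.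
    have i0 := Rinv_0_lt_compat _ qp.
    by rewrite Rabs_mult (Rabs_pos_eq (/ _)); nra.
  rewrite Rabs_mult; apply: (Rle_trans _ (/ INR q * (INR q * / x))).
    by apply: Rmult_le_compat => //; apply: Rabs_pos.
  by apply: Req_le; field; lra.
by rewrite ix in part1 part2; apply: (Rle_trans _ _ _ (Rplus_le_compat _ _ _ _ part1 part2)); apply: Req_le; field; lra.
Qed.

Lemma sqrt_Rpower x : 0 < x -> sqrt x = Rpower x (/ 2).
Proof. by move=> x0; rewrite Rpower_sqrt. Qed.

Theorem window_sum_asymptotics e : 0 < e -> exists2 C, 0 < C &
  forall F V Q c l eta, kernel F V -> (0 < Q)%N -> 0 <= eta <= 1 ->
  (forall q, (0 < q < Q)%N -> (l q <= q)%N /\ Rabs (INR (l q) - eta * INR q) <= 1) ->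
  Rabs (window_sum F Q c l / INR Q ^ 2 - eta * (6 / PI ^ 2 * V)) <= C * Rpower (INR Q) (e - 1 / 2).
Proof.
move=> e0.
have [C1 hC1 avg] := discrepancy_average e0.
(* Half of [e], because the harmonic factor enters squared. *)
have e2 : 0 < e / 2 by lra.
have [C2 hC2 har] := harmonic_le_Rpower e2.
exists (2 * C1 + 5 * C2 ^ 2); first by have := pow_lt C2 2 hC2; lra.
move=> F V Q c l eta hK Q0 he hl.
have [D hD hS] := avg Q Q0.
have A := window_sum_approx c hK Q0 he hD hl.
have L := kernel_lattice hK Q0.
have Qp := INR_pos Q0; have Q1 : 1 <= INR Q by apply: (@leq_INR 1).
have H0 := harmonic_ge0 Q; have hH := har Q Q0.
set X := Rpower (INR Q) (e - 1 / 2).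
have sq0 : 0 < sqrt (INR Q) by apply: sqrt_lt_R0.
have sq := sqrt_sqrt _ (Rlt_le _ _ Qp).
have sq1 : 1 <= sqrt (INR Q) by rewrite -sqrt_1; apply: sqrt_le_1_alt.
have XE : sqrt (INR Q) * Rpower (INR Q) e = INR Q * X.
  rewrite sqrt_Rpower // -Rpower_plus -{2}(Rpower_1 (INR Q)) // -Rpower_plus; congr Rpower; lra.
have YE : Rpower (INR Q) (e / 2) * Rpower (INR Q) (e / 2) = sqrt (INR Q) * X.
  by rewrite -Rpower_plus sqrt_Rpower // -Rpower_plus; congr Rpower; lra.
have X0 : 0 < X by apply: exp_pos.
have H2 : (1 + 2 * harmonic Q) ^ 2 <= C2 ^ 2 * (sqrt (INR Q) * X).
  rewrite -YE; set Y := Rpower _ _ in hH *.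
  have -> : C2 ^ 2 * (Y * Y) = (C2 * Y) ^ 2 by ring.
  by apply: pow_incr; lra.
have i0 := Rinv_0_lt_compat _ Qp.
have H3 : (1 + 2 * harmonic Q) ^ 2 / INR Q <= C2 ^ 2 * X.
  apply: (Rmult_le_reg_r (INR Q)) => //; rewrite /Rdiv Rmult_assoc Rinv_l ?Rmult_1_r; last lra.
  apply: (Rle_trans _ _ _ H2); rewrite -{2}sq.
  have := Rmult_le_compat_l (C2 ^ 2 * X * sqrt (INR Q)) _ _ ltac:(do 2 (apply: Rmult_le_pos; try lra); apply: pow2_ge_0) sq1.
  lra.
have -> : window_sum F Q c l / INR Q ^ 2 - eta * (6 / PI ^ 2 * V) =
  (window_sum F Q c l - eta * triangle_sum F Q coprime) * (/ INR Q * / INR Q) +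
  eta * (triangle_sum F Q coprime / INR Q ^ 2 - 6 / PI ^ 2 * V).
  by field; have := PI_RGT_0; lra.
apply: (Rle_trans _ _ _ (Rabs_triang _ _)); rewrite !Rabs_mult (Rabs_pos_eq eta); last lra.
rewrite !(Rabs_pos_eq (/ _)); try lra.
have B1 : Rabs (window_sum F Q c l - eta * triangle_sum F Q coprime) * (/ INR Q * / INR Q) <=
   2 * C1 * X + C2 ^ 2 * X.
  apply: (Rmult_le_reg_r (INR Q * INR Q)); first nra.
  rewrite Rmult_assoc (_ : / INR Q * / INR Q * (INR Q * INR Q) = 1) ?Rmult_1_r; last by field; lra.
  apply: (Rle_trans _ _ _ A).
  have h1 : harmonic Q <= C2 ^ 2 * (INR Q * X).
    apply: (Rle_trans _ ((1 + 2 * harmonic Q) ^ 2)); first nra.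
    apply: (Rmult_le_reg_r (/ INR Q)) => //; rewrite -/(Rdiv _ _); apply: (Rle_trans _ _ _ H3).
    rewrite (_ : C2 ^ 2 * (INR Q * X) * / INR Q = C2 ^ 2 * X); [lra | field; lra].
  rewrite XE in hS.
  have -> : (2 * C1 * X + C2 ^ 2 * X) * (INR Q * INR Q) = INR Q * (2 * (C1 * (INR Q * X)) + C2 ^ 2 * (INR Q * X)) by ring.
  by apply: Rmult_le_compat_l; lra.
have B2 : eta * Rabs (triangle_sum F Q coprime / INR Q ^ 2 - 6 / PI ^ 2 * V) <= 4 * (C2 ^ 2 * X).
  have := Rabs_pos (triangle_sum F Q coprime / INR Q ^ 2 - 6 / PI ^ 2 * V).
  set T := Rabs _ in L *; move=> T0; have : T <= 4 * (C2 ^ 2 * X) by rewrite /Rdiv in L H3; lra.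
  nra.
lra.
Qed.
End Kernel.

(** * The three gap theorem *)

Module Gaps.
Import Permutation Sorted ZArith.
Import ListNotations.
Open Scope R_scope.

Lemma Permutation_rinsert x l : Permutation (rinsert x l) (x :: l).
Proof.
induction l as [|y l IH]; simpl; [reflexivity|].
destruct (Rle_dec x y); [reflexivity|].
rewrite IH; apply perm_swap.
Qed.

Lemma Permutation_rsort l : Permutation (rsort l) l.
Proof.
induction l as [|x l IH]; simpl; [reflexivity|].
now rewrite Permutation_rinsert, IH.
Qed.

Lemma StronglySorted_rinsert x l : StronglySorted Rle l -> StronglySorted Rle (rinsert x l).
Proof.
induction l as [|y l IH]; simpl; intros h.
- repeat constructor.
- apply StronglySorted_inv in h; destruct h as [hl hy].
  destruct (Rle_dec x y) as [xy|xy].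
  + constructor; [constructor; assumption|].
    constructor; [assumption|].
    eapply Forall_impl; [|exact hy]; simpl; intros; lra.
  + constructor; [now apply IH|].
    apply Forall_forall; intros z hz.
    assert (hz' : In z (x :: l)) by (eapply Permutation_in; [apply Permutation_rinsert | exact hz]).
    destruct hz' as [<-|hz']; [lra|].
    rewrite Forall_forall in hy; now apply hy.
Qed.

Lemma StronglySorted_rsort l : StronglySorted Rle (rsort l).
Proof. induction l; simpl; [constructor | now apply StronglySorted_rinsert]. Qed.

Lemma StronglySorted_app_le (pre : list R) l x y :
  StronglySorted Rle (pre ++ l) -> In x pre -> In y l -> x <= y.
Proof.
induction pre as [|z pre IH]; simpl; intros h hx hy; [contradiction|].
apply StronglySorted_inv in h; destruct h as [h1 h2].
destruct hx as [<-|hx]; [|now apply IH].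
rewrite Forall_forall in h2; apply h2; apply in_or_app; now right.
Qed.

Section CircularGaps.
Variables (S : list R) (g : R -> R).
Hypothesis S_sorted : StronglySorted Rle S.
Hypothesis S_nodup : NoDup S.
Hypothesis S_range : forall y, In y S -> 0 <= y < 1.
Hypothesis g_pos : forall y, In y S -> 0 < g y.
Hypothesis g_next : forall y, In y S -> exists z, In z S /\ (z = y + g y \/ z + 1 = y + g y).
Hypothesis g_free : forall y z, In y S -> In z S -> ~ (y < z < y + g y) /\ ~ (y < z + 1 < y + g y).

Lemma gap_to_successor pre x b t : S = pre ++ x :: b :: t -> b - x = g x.
Proof.
intros E.
assert (hx : In x S) by (rewrite E; apply in_or_app; right; now left).
assert (hb : In b S) by (rewrite E; apply in_or_app; right; right; now left).
assert (xb : x < b).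
{ pose proof S_sorted as hs; rewrite E in hs.
  assert (x <= b).
  { clear - hs. induction pre as [|p pre IH]; simpl in hs.
    - apply StronglySorted_inv in hs; destruct hs as [_ hs].
      rewrite Forall_forall in hs; apply hs; now left.
    - apply StronglySorted_inv in hs; now apply IH. }
  pose proof S_nodup as hn; rewrite E in hn; apply NoDup_remove_2 in hn.
  destruct (Req_dec x b) as [->|]; [|lra].
  exfalso; apply hn; apply in_or_app; right; now left. }
destruct (S_range x hx), (S_range b hb).
destruct (g_free x b hx hb) as [f1 _].
destruct (g_next x hx) as [z [hz [ez|ez]]].
- assert (zx : x < z) by (pose proof (g_pos x hx); lra).
  assert (b <= z); [|lra].
  pose proof hz as hz'; rewrite E in hz'; apply in_app_or in hz'.
  pose proof S_sorted as hs; rewrite E in hs.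
  destruct hz' as [hz'|[<-|[<-|hz']]]; try lra.
  + pose proof (StronglySorted_app_le _ _ z x hs hz' (or_introl eq_refl)); lra.
  + replace (pre ++ x :: b :: t) with ((pre ++ [x; b]) ++ t) in hs by (rewrite <- app_assoc; reflexivity).
    apply (StronglySorted_app_le _ _ b z hs); [|exact hz'].
    apply in_or_app; right; right; now left.
- destruct (S_range z hz); lra.
Qed.

Lemma gap_around y0 rest pre x : S = y0 :: rest -> S = pre ++ [x] -> (y0 + 1) - x = g x.
Proof.
intros E0 E.
assert (hx : In x S) by (rewrite E; apply in_or_app; right; now left).
assert (h0 : In y0 S) by (rewrite E0; now left).
assert (max : forall z, In z S -> z <= x).
{ intros z hz; rewrite E in hz; apply in_app_or in hz; destruct hz as [hz|[<-|[]]]; [|lra].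
  pose proof S_sorted as hs; rewrite E in hs.
  apply (StronglySorted_app_le _ _ z x hs hz); now left. }
assert (min : forall z, In z S -> y0 <= z).
{ intros z hz; rewrite E0 in hz; destruct hz as [<-|hz]; [lra|].
  pose proof S_sorted as hs; rewrite E0 in hs; apply StronglySorted_inv in hs.
  destruct hs as [_ hs]; rewrite Forall_forall in hs; now apply hs. }
destruct (S_range x hx), (S_range y0 h0).
pose proof (g_pos x hx).
destruct (g_free x y0 hx h0) as [_ f2].
destruct (g_next x hx) as [z [hz [ez|ez]]].
- pose proof (max z hz); lra.
- pose proof (min z hz); lra.
Qed.

(** A function that gives each point the distance to some point ahead, with no point in between,
    must list the gaps of the sorted points; the order itself need not be determined. *)
Lemma circ_gaps_map : circ_gaps S = map g S.
Proof.
assert (key : forall y0 rest, S = y0 :: rest -> forall l pre, S = pre ++ l -> l <> [] ->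
  consec_diffs l ++ [(y0 + 1) - last l 0] = map g l).
{ intros y0 rest E0; induction l as [|x l IH]; intros pre E ne; [congruence|].
  destruct l as [|b t].
  - simpl; f_equal; eapply gap_around; eauto.
  - change (consec_diffs (x :: b :: t)) with ((b - x) :: consec_diffs (b :: t)).
    change (last (x :: b :: t) 0) with (last (b :: t) 0).
    change (map g (x :: b :: t)) with (g x :: map g (b :: t)).
    rewrite <- app_comm_cons; f_equal.
    + eapply gap_to_successor; eauto.
    + apply (IH (pre ++ [x])); [rewrite <- app_assoc; exact E | congruence]. }
destruct S as [|y0 rest]; [reflexivity|].
apply (key y0 rest eq_refl (y0 :: rest) []); [reflexivity | congruence].
Qed.
End CircularGaps.

Lemma length_filter_Permutation (A : Type) (f : A -> bool) l l' :
  Permutation l l' -> length (filter f l) = length (filter f l').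
Proof.
induction 1; simpl; auto.
- destruct (f x); simpl; congruence.
- destruct (f x), (f y); reflexivity.
- congruence.
Qed.

Lemma filter_map_comm (A B : Type) (f : B -> bool) (g : A -> B) l :
  filter f (map g l) = map g (filter (fun x => f (g x)) l).
Proof.
induction l as [|x l IH]; simpl; [reflexivity|].
destruct (f (g x)); simpl; now rewrite IH.
Qed.

Lemma length_filter_seq (f : nat -> bool) (c : bool) s n :
  (forall k, (s <= k < s + n)%nat -> f k = c) ->
  length (filter f (seq s n)) = if c then n else 0%nat.
Proof.
revert s; induction n as [|n IH]; intros s h; simpl; [now destruct c|].
rewrite (h s) by lia.
specialize (IH (S s)); destruct c; simpl; rewrite IH; auto; intros; apply h; lia.
Qed.

Definition ge_indicator (L x : R) : R := if Rle_dec L x then 1 else 0.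

Section Arc.
Variables (alpha : R) (Q q q' : nat) (a a' : Z).
Hypothesis q_pos : (1 <= q)%nat.
Hypothesis q'_pos : (1 <= q')%nat.
Hypothesis qQ : (q < Q)%nat.
Hypothesis q'Q : (q' < Q)%nat.
Hypothesis qq' : (Q <= q + q')%nat.
Hypothesis det : (a' * Z.of_nat q - a * Z.of_nat q' = 1)%Z.
Let A := INR q * alpha - IZR a.
Let B := IZR a' - INR q' * alpha.
Hypothesis A_pos : 0 < A.
Hypothesis B_pos : 0 < B.

Let AB : INR q' * A + INR q * B = 1.
Proof.
unfold A, B; rewrite !INR_IZR_INZ.
replace 1 with (IZR (a' * Z.of_nat q - a * Z.of_nat q')) by now rewrite det.
rewrite minus_IZR, !mult_IZR; ring.
Qed.

(** Determinant 1 makes [(q, a)] and [(-q', -a')] a basis of the integer lattice, on which the form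
    [k alpha - z] takes the positive values [A] and [B]. *)
Let A_lattice (k z : Z) :
  exists i j : Z, IZR k * alpha - IZR z = IZR i * A + IZR j * B /\
    (k = i * Z.of_nat q - j * Z.of_nat q')%Z.
Proof.
exists (a' * k - Z.of_nat q' * z)%Z, (a * k - Z.of_nat q * z)%Z; split.
- pose proof AB as h; unfold A, B in *; rewrite !INR_IZR_INZ in *.
  rewrite !minus_IZR, !mult_IZR.
  assert (d : IZR a' * IZR (Z.of_nat q) - IZR a * IZR (Z.of_nat q') = 1) by
    (rewrite <- !mult_IZR, <- minus_IZR, det; reflexivity).
  replace (IZR k * alpha - IZR z) with
   ((IZR k * alpha - IZR z) * (IZR a' * IZR (Z.of_nat q) - IZR a * IZR (Z.of_nat q'))) by (rewrite d; ring).
  ring.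
- transitivity (k * (a' * Z.of_nat q - a * Z.of_nat q'))%Z; [rewrite det; ring | ring].
Qed.

(** Coordinates of opposite signs would give [|k| >= q + q' >= Q]. Hence both are nonnegative, and
    the form is at least the sum of the basis values that occur. *)
Let small_vectors (k z : Z) : (Z.abs k < Z.of_nat Q)%Z -> 0 < IZR k * alpha - IZR z ->
  ((Z.of_nat q <= k)%Z /\ A <= IZR k * alpha - IZR z) \/
  ((k <= - Z.of_nat q')%Z /\ B <= IZR k * alpha - IZR z) \/
  A + B <= IZR k * alpha - IZR z.
Proof.
intros hk hpos.
destruct (A_lattice k z) as [i [j [e1 e2]]]; rewrite e1 in *.
destruct (Z_le_gt_dec 1 i) as [i1|i0].
- assert (ii : 1 <= IZR i) by (apply (IZR_le 1); lia).
  destruct (Z_le_gt_dec 1 j) as [j1|j0].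
  + assert (1 <= IZR j) by (apply (IZR_le 1); lia). right; right; nra.
  + destruct (Z.eq_dec j 0) as [->|jn]; [left; split; [nia | simpl; nra]|].
    exfalso; nia.
- destruct (Z_le_gt_dec 1 j) as [j1|j0].
  + assert (1 <= IZR j) by (apply (IZR_le 1); lia).
    destruct (Z.eq_dec i 0) as [->|jn]; [right; left; split; [nia | simpl; nra]|].
    exfalso; nia.
  + exfalso.
    assert (IZR i <= 0) by (apply (IZR_le i 0); lia).
    assert (IZR j <= 0) by (apply (IZR_le j 0); lia). nra.
Qed.

Let zero_vector (k z : Z) : (Z.abs k < Z.of_nat Q)%Z -> IZR k * alpha - IZR z = 0 -> k = 0%Z.
Proof.
intros hk h0.
destruct (A_lattice k z) as [i [j [e1 e2]]]; rewrite e1 in h0.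
destruct (Z_lt_ge_dec 0 i) as [i1|i0].
- assert (1 <= IZR i) by (apply (IZR_le 1); lia).
  destruct (Z_lt_ge_dec j 0) as [j1|j0]; [exfalso; nia|].
  assert (0 <= IZR j) by (apply (IZR_le 0); lia). exfalso; nra.
- destruct (Z_lt_ge_dec i 0) as [i1|i1].
  + assert (IZR i <= -1) by (apply (IZR_le i (-1)); lia).
    destruct (Z_lt_ge_dec 0 j) as [j1|j0]; [exfalso; nia|].
    assert (IZR j <= 0) by (apply (IZR_le j 0); lia). exfalso; nra.
  + assert (i = 0%Z) by lia; subst i.
    assert (IZR j = 0) by nra.
    assert (j = 0%Z) by (apply eq_IZR; assumption). lia.
Qed.

Let y (n : nat) := fracp (INR n * alpha).

Let y_range n : 0 <= y n < 1.
Proof. unfold y, fracp; destruct (base_fp (INR n * alpha)); lra. Qed.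

Let y_diff (n l : nat) (e : Z) : exists z : Z,
  y l + IZR e - y n = IZR (Z.of_nat l - Z.of_nat n) * alpha - IZR z.
Proof.
exists (Int_part (INR l * alpha) - Int_part (INR n * alpha) - e)%Z.
unfold y, fracp, frac_part; rewrite !minus_IZR, !INR_IZR_INZ; ring.
Qed.

Let y_inj n l : (n < Q)%nat -> (l < Q)%nat -> y n = y l -> n = l.
Proof.
intros hn hl e.
destruct (y_diff n l 0) as [z hz].
assert (h : (Z.of_nat l - Z.of_nat n = 0)%Z) by (apply (zero_vector _ z); [lia | rewrite <- hz, e; simpl; ring]).
lia.
Qed.

(** The successor of the point of index [n] has index [n + q], [n - q'] or [n + q - q']. The first
    two cases exclude each other because [Q <= q + q']. *)
Definition arc_gap (n : nat) : R :=
  if lt_dec (n + q) Q then A else if le_dec q' n then B else A + B.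

Let arc_gap_pos n : 0 < arc_gap n <= 1.
Proof.
assert (1 <= INR q) by (apply (le_INR 1); lia).
assert (1 <= INR q') by (apply (le_INR 1); lia).
pose proof AB. unfold arc_gap; destruct lt_dec; [|destruct le_dec]; split; nra.
Qed.

Let arc_gap_next n : (n < Q)%nat ->
  exists l, (l < Q)%nat /\ (y l = y n + arc_gap n \/ y l + 1 = y n + arc_gap n).
Proof.
intros hn.
assert (key : exists l z, (l < Q)%nat /\ arc_gap n = IZR (Z.of_nat l - Z.of_nat n) * alpha - IZR z).
{ unfold arc_gap; destruct lt_dec as [h|h]; [|destruct le_dec as [h'|h']].
  - exists (n + q)%nat, a; split; [lia|].
    unfold A; rewrite INR_IZR_INZ; replace (Z.of_nat (n + q) - Z.of_nat n)%Z with (Z.of_nat q) by lia; ring.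
  - exists (n - q')%nat, (- a')%Z; split; [lia|].
    unfold B; rewrite INR_IZR_INZ, opp_IZR; replace (Z.of_nat (n - q') - Z.of_nat n)%Z with (- Z.of_nat q')%Z by lia.
    rewrite opp_IZR; ring.
  - exists (n + q - q')%nat, (a - a')%Z; split; [lia|].
    unfold A, B; rewrite !INR_IZR_INZ.
    replace (Z.of_nat (n + q - q') - Z.of_nat n)%Z with (Z.of_nat q - Z.of_nat q')%Z by lia.
    rewrite !minus_IZR; ring. }
destruct key as [l [z [hl e]]]; exists l; split; [exact hl|].
destruct (y_diff n l 0) as [z' hz'].
assert (E : y n + arc_gap n = y l + IZR (z' - z)).
{ rewrite minus_IZR; simpl in hz'; lra. }
destruct (y_range n), (y_range l), (arc_gap_pos n).
(* An integer strictly between -1 and 2: the successor lies ahead, or ahead after one turn of the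
   circle. *)
assert (hm : (z' - z = 0 \/ z' - z = 1)%Z).
{ assert (h1 : -1 < IZR (z' - z)) by lra. assert (h2 : IZR (z' - z) < 2) by lra.
  apply (lt_IZR (-1)) in h1; apply (lt_IZR _ 2) in h2; lia. }
destruct hm as [hm|hm]; rewrite hm in E; simpl in E; [left|right]; lra.
Qed.

Let arc_gap_free n l (e : Z) : (n < Q)%nat -> (l < Q)%nat ->
  ~ (y n < y l + IZR e < y n + arc_gap n).
Proof.
intros hn hl [h1 h2].
destruct (y_diff n l e) as [z hz].
destruct (small_vectors (Z.of_nat l - Z.of_nat n) z) as [[k1 k2]|[[k1 k2]|k2]]; [lia|lra| | |];
  rewrite <- hz in k2; unfold arc_gap in h2; destruct lt_dec; try lia;
  try destruct le_dec; try lia; try lra.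
Qed.

Lemma gap_frac_arc lam :
  gap_frac lam Q alpha =
  (INR (Q - q) * ge_indicator (lam / INR Q) A + INR (Q - q') * ge_indicator (lam / INR Q) B +
   INR (q + q' - Q) * ge_indicator (lam / INR Q) (A + B)) / INR Q.
Proof.
unfold gap_frac; f_equal.
set (L := lam / INR Q).
set (f := fun g => if Rle_dec L g then true else false).
pose (idx := fun r => epsilon (inhabits 0%nat) (fun n => (n < Q)%nat /\ y n = r)).
assert (idxE : forall n, (n < Q)%nat -> idx (y n) = n).
{ intros n hn.
  assert (h : (idx (y n) < Q)%nat /\ y (idx (y n)) = y n).
  { apply (epsilon_spec (inhabits 0%nat) (fun m => (m < Q)%nat /\ y m = y n)); now exists n. }
  destruct h; now apply y_inj. }
assert (mem : forall r, In r (rsort (points alpha Q)) -> exists n, (n < Q)%nat /\ r = y n).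
{ intros r hr; apply (Permutation_in r (Permutation_rsort _)) in hr.
  unfold points in hr; apply in_map_iff in hr; destruct hr as [n [<- hn]].
  apply in_seq in hn; exists n; split; [lia | reflexivity]. }
assert (mem' : forall n, (n < Q)%nat -> In (y n) (rsort (points alpha Q))).
{ intros n hn; apply (Permutation_in _ (Permutation_sym (Permutation_rsort _))).
  unfold points; apply in_map_iff; exists n; split; [reflexivity|]; apply in_seq; lia. }
assert (E : gaps alpha Q = map (fun r => arc_gap (idx r)) (rsort (points alpha Q))).
{ unfold gaps; apply circ_gaps_map.
  - apply StronglySorted_rsort.
  - apply (Permutation_NoDup (Permutation_sym (Permutation_rsort _))).
    unfold points; apply NoDup_map_NoDup_ForallPairs; [|apply seq_NoDup].
    intros n l hn hl; apply in_seq in hn; apply in_seq in hl; apply y_inj; lia.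
  - intros r hr; destruct (mem r hr) as [n [hn ->]]; apply y_range.
  - intros r hr; apply arc_gap_pos.
  - intros r hr; destruct (mem r hr) as [n [hn ->]]; rewrite idxE by assumption.
    destruct (arc_gap_next n hn) as [l [hl e]]; exists (y l); split; [now apply mem' | exact e].
  - intros r s hr hs; destruct (mem r hr) as [n [hn ->]]; destruct (mem s hs) as [l [hl ->]].
    rewrite idxE by assumption; split; intros h.
    + apply (arc_gap_free n l 0 hn hl); simpl; lra.
    + apply (arc_gap_free n l 1 hn hl); simpl; lra. }
assert (cnt : length (filter f (gaps alpha Q)) = length (filter (fun n => f (arc_gap n)) (seq 0 Q))).
{ rewrite E, filter_map_comm, length_map.
  rewrite (length_filter_Permutation _ _ _ _ (Permutation_rsort _)).
  unfold points; rewrite filter_map_comm, length_map; f_equal.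
  apply filter_ext_in; intros n hn; apply in_seq in hn.
  change (fracp (INR n * alpha)) with (y n); rewrite idxE by lia; reflexivity. }
change (fun g => if Rle_dec L g then true else false) with f; rewrite cnt.
(* In increasing order the indices form three blocks, with gaps [A], [A + B] and [B]. *)
replace Q with ((Q - q) + ((q + q' - Q) + (Q - q')))%nat at 1 by lia.
rewrite !seq_app, !filter_app, !length_app, !plus_INR.
rewrite (length_filter_seq _ (f A)), (length_filter_seq _ (f (A + B))), (length_filter_seq _ (f B)).
- unfold f, ge_indicator; repeat destruct Rle_dec; simpl INR; ring.
- intros k hk; unfold arc_gap; destruct lt_dec; [lia|]; destruct le_dec; [reflexivity | lia].
- intros k hk; unfold arc_gap; destruct lt_dec; [lia|]; destruct le_dec; [lia | reflexivity].
- intros k hk; unfold arc_gap; destruct lt_dec; [reflexivity | lia].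
Qed.
End Arc.

(** * Existence and uniqueness of the Farey arc around a point *)

Lemma arc_exists (alpha : R) (n : nat) : (1 <= n)%nat ->
  (forall k z, (1 <= k <= n)%nat -> INR k * alpha <> IZR z) ->
  exists (q q' : nat) (a a' : Z), (1 <= q <= n)%nat /\ (1 <= q' <= n)%nat /\ (n < q + q')%nat /\
    (a' * Z.of_nat q - a * Z.of_nat q' = 1)%Z /\ 0 < INR q * alpha - IZR a /\ 0 < IZR a' - INR q' * alpha.
Proof.
induction n as [|n IH]; intros hn gen; [lia|].
destruct (Nat.eq_dec n 0) as [->|n0].
- exists 1%nat, 1%nat, (Int_part alpha), (Int_part alpha + 1)%Z.
  destruct (base_Int_part alpha) as [b1 b2]; rewrite plus_IZR; simpl INR.
  assert (IZR (Int_part alpha) <> alpha).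
  { intros e; apply (gen 1%nat (Int_part alpha)); [lia | simpl; lra]. }
  repeat split; try lia; simpl; lra.
- destruct IH as [q [q' [a [a' [h1 [h2 [h3 [h4 [h5 h6]]]]]]]]]; [lia | intros; apply gen; lia |].
  destruct (lt_dec (S n) (q + q')) as [big|big].
  + exists q, q', a, a'; repeat split; try lia; lra.
  (* The mediant of the end points now has an admissible denominator and cuts the arc; [alpha]
     differs from it by hypothesis and selects one side. *)
  + assert (e : (q + q' = S n)%nat) by lia.
    assert (ne : INR (q + q') * alpha <> IZR (a + a')) by (apply gen; lia).
    rewrite plus_INR, plus_IZR in ne.
    destruct (Rlt_le_dec (INR q * alpha + INR q' * alpha) (IZR a + IZR a')) as [lt|ge].
    * exists q, (q + q')%nat, a, (a + a')%Z.
      rewrite plus_INR, plus_IZR, Nat2Z.inj_add; repeat split; try lia; lra.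
    * exists (q + q')%nat, q', (a + a')%Z, a'.
      rewrite plus_INR, plus_IZR, Nat2Z.inj_add; repeat split; try lia; lra.
Qed.

(* no fraction of denominator below [q + q'] lies strictly inside the arc *)
Lemma arc_unique alpha n q q' a a' r r' b b' :
  (1 <= q <= n)%nat -> (1 <= q' <= n)%nat -> (n < q + q')%nat ->
  (a' * Z.of_nat q - a * Z.of_nat q' = 1)%Z -> 0 < INR q * alpha - IZR a -> 0 < IZR a' - INR q' * alpha ->
  (1 <= r <= n)%nat -> (1 <= r' <= n)%nat -> (n < r + r')%nat ->
  (b' * Z.of_nat r - b * Z.of_nat r' = 1)%Z -> 0 < INR r * alpha - IZR b -> 0 < IZR b' - INR r' * alpha ->
  q = r /\ q' = r' /\ a = b /\ a' = b'.
Proof.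
assert (left_le : forall q q' a a' r b, (1 <= q)%nat -> (1 <= q')%nat -> (n < q + q')%nat ->
  (a' * Z.of_nat q - a * Z.of_nat q' = 1)%Z -> 0 < IZR a' - INR q' * alpha ->
  (1 <= r <= n)%nat -> 0 < INR r * alpha - IZR b -> (b * Z.of_nat q <= a * Z.of_nat r)%Z).
{ clear; intros q q' a a' r b h1 h2 h3 h4 h6 hr hb.
  destruct (Z_le_gt_dec (b * Z.of_nat q) (a * Z.of_nat r)) as [|gt]; [assumption|exfalso].
  assert (lt2 : (b * Z.of_nat q' < a' * Z.of_nat r)%Z).
  { apply lt_IZR; rewrite !mult_IZR, <- !INR_IZR_INZ.
    assert (0 < INR q') by (apply lt_0_INR; lia). assert (0 < INR r) by (apply lt_0_INR; lia). nra. }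
  assert (Z.of_nat r = (b * Z.of_nat q - a * Z.of_nat r) * Z.of_nat q' + (a' * Z.of_nat r - b * Z.of_nat q') * Z.of_nat q)%Z.
  { transitivity (Z.of_nat r * (a' * Z.of_nat q - a * Z.of_nat q'))%Z; [rewrite h4; ring | ring]. }
  nia. }
assert (right_le : forall q q' a a' r b, (1 <= q)%nat -> (1 <= q')%nat -> (n < q + q')%nat ->
  (a' * Z.of_nat q - a * Z.of_nat q' = 1)%Z -> 0 < INR q * alpha - IZR a ->
  (1 <= r <= n)%nat -> 0 < IZR b - INR r * alpha -> (a' * Z.of_nat r <= b * Z.of_nat q')%Z).
{ clear; intros q q' a a' r b h1 h2 h3 h4 h6 hr hb.
  destruct (Z_le_gt_dec (a' * Z.of_nat r) (b * Z.of_nat q')) as [|gt]; [assumption|exfalso].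
  assert (lt2 : (a * Z.of_nat r < b * Z.of_nat q)%Z).
  { apply lt_IZR; rewrite !mult_IZR, <- !INR_IZR_INZ.
    assert (0 < INR q) by (apply lt_0_INR; lia). assert (0 < INR r) by (apply lt_0_INR; lia). nra. }
  assert (Z.of_nat r = (b * Z.of_nat q - a * Z.of_nat r) * Z.of_nat q' + (a' * Z.of_nat r - b * Z.of_nat q') * Z.of_nat q)%Z.
  { transitivity (Z.of_nat r * (a' * Z.of_nat q - a * Z.of_nat q'))%Z; [rewrite h4; ring | ring]. }
  nia. }
intros h1 h2 h3 h4 h5 h6 k1 k2 k3 k4 k5 k6.
assert (e1 : (b * Z.of_nat q = a * Z.of_nat r)%Z).
{ apply Z.le_antisymm.
  - apply (left_le q q' a a' r b); try lia; assumption.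
  - apply (left_le r r' b b' q a); try lia; assumption. }
assert (e2 : (b' * Z.of_nat q' = a' * Z.of_nat r')%Z).
{ apply Z.le_antisymm.
  - apply (right_le r r' b b' q' a'); try lia; assumption.
  - apply (right_le q q' a a' r' b'); try lia; assumption. }
(* Equal fractions in lowest terms have equal denominators; coprimality is read off from the
   determinants. *)
assert (dvd : forall u v w z c d c' d', (0 < u)%Z -> (0 < v)%Z -> (w * u = z * v)%Z ->
   (c * u - d * z = 1)%Z -> (c' * v - d' * w = 1)%Z -> u = v).
{ clear; intros u v w z c d c' d' hu hv e h k.
  apply Z.divide_antisym_nonneg; try lia.
  - apply (Z.gauss u z v).
    + exists w; lia.
    + apply Z.bezout_1_gcd; exists c, (- d)%Z; lia.
  - apply (Z.gauss v w u).
    + exists z; lia.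
    + apply Z.bezout_1_gcd; exists c', (- d')%Z; lia. }
assert (eq1 : Z.of_nat q = Z.of_nat r).
{ apply (dvd (Z.of_nat q) (Z.of_nat r) b a a' (Z.of_nat q') b' (Z.of_nat r')); lia. }
assert (eq2 : Z.of_nat q' = Z.of_nat r').
{ apply (dvd (Z.of_nat q') (Z.of_nat r') b' a' (- a)%Z (- Z.of_nat q)%Z (- b)%Z (- Z.of_nat r)%Z); lia. }
assert (q = r) by lia; assert (q' = r') by lia; subst r r'.
repeat split; nia.
Qed.
End Gaps.

(** * The dilogarithm on the unit interval *)

Module Dilogarithm.
Import Coquelicot.Coquelicot.
Import ssreflect.
Import Sums Lattice.
Open Scope R_scope.
Local Arguments INR : simpl never.

(** A retraction onto [[0,1]]: composed with it, the series converges normally on the whole line, as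
    [CVN_R] asks. *)
Definition clamp (z : R) : R := Rmax 0 (Rmin z 1).

Lemma clampP z : 0 <= clamp z <= 1.
Proof. by split; [apply: Rmax_l | apply: Rmax_lub; [lra | apply: Rmin_r]]. Qed.

Lemma clamp_id z : 0 <= z <= 1 -> clamp z = z.
Proof. by rewrite /clamp /Rmax /Rmin => h; repeat destruct Rle_dec; lra. Qed.

Lemma clamp_dist x y : Rabs (clamp x - clamp y) <= Rabs (x - y).
Proof.
by rewrite /clamp /Rmax /Rmin; repeat destruct Rle_dec; split_Rabs; lra.
Qed.

Lemma continuity_clamp : continuity clamp.
Proof.
move=> x e e0; exists e; split=> // y [_ hy]; rewrite /= /R_dist in hy *.
by have := clamp_dist y x; lra.
Qed.

Definition li2_term (n : nat) (z : R) : R := z ^ (S n) / (INR (S n)) ^ 2.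

Lemma INR_S_gt0 n : 0 < INR (S n).
Proof. by rewrite S_INR; have := pos_INR n; lra. Qed.

Lemma li2_term_bounds n z : 0 <= z <= 1 -> 0 <= li2_term n z <= / (INR (S n)) ^ 2.
Proof.
move=> h; rewrite /li2_term.
have i0 : 0 < / INR (S n) ^ 2 by apply: Rinv_0_lt_compat; apply: pow_lt; apply: INR_S_gt0.
have p0 : 0 <= z ^ S n by apply: pow_le; lra.
have p1 : z ^ S n <= 1 by rewrite -(pow1 (S n)); apply: pow_incr; lra.
by rewrite /Rdiv; nra.
Qed.

Lemma basel_sum_f_R0 N : sum_f_R0 (fun n => / (INR (S n)) ^ 2) N = zsum (S N).
Proof.
elim: N => [|N IH]; rewrite /zsum bigop.big_ord_recr /=.
  by rewrite bigop.big_ord0 INR_1; field.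
by rewrite IH (Rmult_1_r (INR (S (S N)))).
Qed.

Lemma basel_Un_cv : Un_cv (fun N => sum_f_R0 (fun n => / (INR (S n)) ^ 2) N) (PI ^ 2 / 6).
Proof.
move=> e e0; have [N [hN N0]] := archimed_cor1 e e0.
exists N => n hn; rewrite basel_sum_f_R0 /R_dist.
have [b1 b2] := @basel (S n) (eq_refl _).
have : / INR (S n) <= / INR N.
  by apply: Rinv_le_contravar; [apply: lt_0_INR | apply: le_INR; lia].
by split_Rabs; lra.
Qed.

Lemma li2_term_CVN : CVN_R (fun n z => li2_term n (clamp z)).
Proof.
move=> r; exists (fun n => / (INR (S n)) ^ 2), (PI ^ 2 / 6); split.
  apply: Un_cv_ext basel_Un_cv => N; apply: sum_eq => n _; rewrite Rabs_pos_eq //.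
  by apply: Rlt_le; apply: Rinv_0_lt_compat; apply: pow_lt; apply: INR_S_gt0.
move=> n y _; have := li2_term_bounds n (clamp y) (clampP y).
by move=> h; rewrite Rabs_pos_eq; lra.
Qed.

Lemma li2_cv z : {l : R | Un_cv (fun N => SP (fun n z => li2_term n (clamp z)) N z) l}.
Proof.
apply: (Rseries_CV_comp _ (fun n => / (INR (S n)) ^ 2)).
  by move=> n; apply: li2_term_bounds; apply: clampP.
by exists (PI ^ 2 / 6); apply: basel_Un_cv.
Qed.

(* [Li2] is an unspecified value off its disc of convergence; [dilog] agrees
   with it on [0,1] and is continuous on the whole line. *)
Definition dilog : R -> R := SFL (fun n z => li2_term n (clamp z)) li2_cv.

Lemma continuity_dilog : continuity dilog.
Proof.
apply: SFL_continuity; first exact: li2_term_CVN.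
move=> n; apply: (continuity_comp clamp (li2_term n) continuity_clamp) => z.
apply/continuity_pt_filterlim; apply: (ex_derive_continuous (li2_term n)).
by rewrite /li2_term; auto_derive.
Qed.

Lemma Li2_unique z l : Un_cv (fun N => sum_f_R0 (fun n => z ^ (S n) / (INR (S n)) ^ 2) N) l -> Li2 z = l.
Proof.
move=> h; apply: (UL_sequence _ _ _ _ h).
apply: (epsilon_spec (inhabits 0)
    (fun l => Un_cv (fun N => sum_f_R0 (fun n => z ^ (S n) / (INR (S n)) ^ 2) N) l)).
by exists l.
Qed.

Lemma Li2_dilog z : 0 <= z <= 1 -> Li2 z = dilog z.
Proof.
move=> h; apply: Li2_unique; rewrite /dilog /SFL; case: li2_cv => l.
by rewrite /SP clamp_id.
Qed.

Lemma dilog_unique z l : 0 <= z <= 1 ->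
  Un_cv (fun N => sum_f_R0 (fun n => z ^ (S n) / (INR (S n)) ^ 2) N) l -> dilog z = l.
Proof. by move=> h1 h2; rewrite -Li2_dilog //; apply: Li2_unique. Qed.

Lemma dilog0 : dilog 0 = 0.
Proof.
apply: dilog_unique; first lra.
apply: (Un_cv_ext (fun _ => 0)); last by move=> e e0; exists O => n _; rewrite /R_dist; split_Rabs; lra.
elim=> [|n IH] /=; first by rewrite !Rmult_0_l /Rdiv Rmult_0_l.
by rewrite -IH !Rmult_0_l /Rdiv Rmult_0_l Rplus_0_l.
Qed.

Lemma dilog1 : dilog 1 = PI ^ 2 / 6.
Proof.
apply: dilog_unique; first lra.
apply: Un_cv_ext basel_Un_cv => N; apply: sum_eq => n _.
by rewrite pow1 /Rdiv Rmult_1_l.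
Qed.

Lemma CV_radius_ge1 (a : nat -> R) z : (forall n, Rabs (a n) <= 1) -> 0 <= z < 1 ->
  Rbar_lt (Rabs z) (CV_radius a).
Proof.
move=> ha hz; have [h _] := CV_radius_bounded a.
apply: (Rbar_lt_le_trans _ 1); first by rewrite /= Rabs_pos_eq; lra.
by apply: h; exists 1 => n; rewrite pow1 Rmult_1_r.
Qed.

Lemma Rabs_inv_INR n k : Rabs (/ INR (S n) ^ k) <= 1.
Proof.
have h : 1 <= INR (S n) ^ k by apply: pow_R1_Rle; rewrite S_INR; have := pos_INR n; lra.
have i0 : 0 < / INR (S n) ^ k by apply: Rinv_0_lt_compat; lra.
by rewrite Rabs_pos_eq; [have := Rinv_le_contravar 1 _ ltac:(lra) h; rewrite Rinv_1 | lra].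
Qed.

(** The coefficients of [Li_k(z) / z]; [k = 1] is the logarithm and [k = 0] the geometric series. *)
Definition inv_pow (k : nat) (n : nat) := / INR (S n) ^ k.

Lemma PS_incr_bound k n : Rabs (PS_incr_1 (inv_pow k) n) <= 1.
Proof.
case: n => [|n]; last exact: Rabs_inv_INR.
by rewrite /PS_incr_1 /= Rabs_R0; lra.
Qed.

Lemma PS_derive_incr k n : PS_derive (PS_incr_1 (inv_pow (S k))) n = inv_pow k n.
Proof.
rewrite /PS_derive /PS_incr_1 /inv_pow /=; field.
by split; [apply: pow_nonzero |]; have := INR_S_gt0 n; lra.
Qed.

(** Termwise differentiation inside the disc of convergence: the derivative of [Li_(k+1)] is
    [Li_k(z) / z]. *)
Lemma is_derive_incr k z : 0 <= z < 1 ->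
  is_derive (fun z => z * PSeries (inv_pow (S k)) z) z (PSeries (inv_pow k) z).
Proof.
move=> hz; have := is_derive_PSeries _ _ (CV_radius_ge1 _ z (PS_incr_bound (S k)) hz).
rewrite (PSeries_ext _ _ _ (PS_derive_incr k)).
apply: is_derive_ext => t; exact: PSeries_incr_1.
Qed.

Lemma PSeries_ln z : 0 <= z < 1 -> z * PSeries (inv_pow 1) z = - ln (1 - z).
Proof.
move=> hz; have d t : 0 <= t < 1 -> is_derive (fun t => t * PSeries (inv_pow 1) t + ln (1 - t)) t 0.
  move=> ht; have d1 := is_derive_incr 0 t ht.
  have e : PSeries (inv_pow 0) t = / (1 - t).
    apply: is_pseries_unique; apply/is_pseries_R.
    apply: is_series_ext (is_series_geom t ltac:(rewrite Rabs_pos_eq; lra)) => n.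
    by rewrite /inv_pow pow_O Rinv_1 Rmult_1_l.
  have d2 : is_derive (fun t => ln (1 - t)) t (- / (1 - t)) by auto_derive; [lra | field; lra].
  have := is_derive_plus _ _ _ _ _ d1 d2; rewrite e /plus /=.
  by rewrite Rplus_opp_r.
have [z0|z0] := Req_dec z 0; first by rewrite z0 Rminus_0_r ln_1; ring.
have [c [h1 h2]] := MVT_cor2 (fun t => t * PSeries (inv_pow 1) t + ln (1 - t)) (fun _ => 0) 0 z
  ltac:(lra) ltac:(move=> c hc; apply/is_derive_Reals; apply: d; lra).
by rewrite Rminus_0_r ln_1 in h1; lra.
Qed.

Lemma dilog_PSeries z : 0 <= z < 1 -> dilog z = z * PSeries (inv_pow 2) z.
Proof.
move=> hz; apply: dilog_unique; first lra.
have h : ex_pseries (inv_pow 2) z.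
  by apply: CV_radius_inside; apply: CV_radius_ge1 => // n; apply: Rabs_inv_INR.
have /is_pseries_R h' := PSeries_correct _ _ h.
have /is_series_Reals := is_series_scal z _ _ h'.
apply: Un_cv_ext => N; apply: sum_eq => n _.
rewrite /scal /= /mult /inv_pow /Rdiv -tech_pow_Rmult; change (z * (/ INR (S n) ^ 2 * z ^ n) = z * z ^ n * / INR (S n) ^ 2); ring.
Qed.

Lemma is_derive_dilog z : 0 < z < 1 -> is_derive dilog z (- ln (1 - z) / z).
Proof.
move=> hz.
have -> : - ln (1 - z) / z = PSeries (inv_pow 1) z by rewrite -PSeries_ln; [field; lra | lra].
apply: (is_derive_ext_loc (fun z => z * PSeries (inv_pow 2) z)); last by apply: is_derive_incr; lra.
have d0 : 0 < Rmin z (1 - z) by apply: Rmin_glb_lt; lra.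
exists (mkposreal _ d0) => y hy; rewrite dilog_PSeries //.
rewrite /ball /= /AbsRing_ball /abs /minus /plus /opp /= in hy.
have := Rmin_l z (1 - z); have := Rmin_r z (1 - z).
by move: hy; split_Rabs; lra.
Qed.

End Dilogarithm.

(** * Functional equations of the dilogarithm *)

Module DilogIdentities.
Import Coquelicot.Coquelicot.
Import ssreflect.
Import Dilogarithm.
Open Scope R_scope.

Lemma ln_npos x : x <= 0 -> ln x = 0.
Proof. by move=> h; unfold ln; destruct (Rlt_dec 0 x); [exfalso; lra | reflexivity]. Qed.

(** Holds on the whole line because [ln] is 0 on nonpositive numbers, so primitives containing
    [x ln x] are continuous at end points where the argument vanishes. *)
Lemma continuity_xlnx : continuity (fun x => x * ln x).
Proof.
move=> x; have [x0|[->|x0]] := Rtotal_order x 0.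
- apply: (continuity_pt_ext_loc (fun _ => 0)); last by apply: continuity_const => ? ?.
  have h : 0 < - x by lra.
  exists (mkposreal _ h) => y; rewrite /ball /= /AbsRing_ball /abs /minus /plus /opp /= => hy.
  rewrite /ln; case: Rlt_dec => [y0|_]; last by rewrite Rmult_0_r.
  by exfalso; move: hy; split_Rabs; lra.
- (* |x ln x| <= 2 sqrt x *)
  move=> e e0; have d0 : 0 < Rmin 1 ((e / 4) ^ 2) by apply: Rmin_glb_lt; [lra | apply: pow_lt; lra].
  exists (Rmin 1 ((e / 4) ^ 2)); split=> // y [_]; rewrite /= /R_dist Rmult_0_l !Rminus_0_r => hy.
  have [y0|y0] := Rle_lt_dec y 0.
    by rewrite ln_npos // Rmult_0_r Rabs_R0.
  have hy1 := Rmin_l 1 ((e / 4) ^ 2); have hy2 := Rmin_r 1 ((e / 4) ^ 2).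
  rewrite Rabs_pos_eq in hy; last lra.
  have {}hy : y < Rmin 1 ((e / 4) ^ 2) := hy.
  have sy : y = sqrt y * sqrt y by rewrite sqrt_sqrt; lra.
  have s0 : 0 < sqrt y by apply: sqrt_lt_R0.
  have se : sqrt y < e / 4 by apply: Rsqr_incrst_0; rewrite /Rsqr; [have := hy2; have := hy; rewrite /=; lra | lra | lra].
  have l1 : - ln (sqrt y) <= / sqrt y - 1.
    rewrite -ln_Rinv //; have i0 := Rinv_0_lt_compat _ s0.
    by have := exp_ineq1_le (ln (/ sqrt y)); rewrite exp_ln //; lra.
  have l2 : ln y <= 0 by rewrite -ln_1; apply: Rcomplements.ln_le; lra.
  have l3 : ln y = 2 * ln (sqrt y) by rewrite {1}sy ln_mult //; ring.
  have i1 : sqrt y * / sqrt y = 1 by apply: Rinv_r; lra.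
  have : 0 <= - (y * ln y) <= 2 * sqrt y.
    split; first nra.
    have -> : - (y * ln y) = 2 * (sqrt y * sqrt y) * (- ln (sqrt y)) by rewrite l3 {1}sy; ring.
    apply: (Rle_trans _ (2 * (sqrt y * sqrt y) * (/ sqrt y - 1))); first by apply: Rmult_le_compat_l; nra.
    nra.
  by split_Rabs; lra.
- apply/continuity_pt_filterlim; apply: (ex_derive_continuous (fun x => x * ln x)).
  by auto_derive.
Qed.

Lemma constant_of_derive_zero f a b : a <= b ->
  (forall x, a <= x <= b -> continuity_pt f x) ->
  (forall x, a < x < b -> is_derive f x 0) -> f a = f b.
Proof.
move=> ab hc hd.
have [||c [_ h]] := MVT_gen f a b (fun _ => 0).
- by move=> x; rewrite Rmin_left // Rmax_right //; apply: hd.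
- by move=> x; rewrite Rmin_left // Rmax_right //; apply: hc.
- lra.
Qed.

Lemma continuity_pt_derive f x : ex_derive f x -> continuity_pt f x.
Proof. by move=> h; apply/continuity_pt_filterlim; apply: ex_derive_continuous. Qed.

Lemma continuity_pt_dilog_comp g x : continuity_pt g x -> continuity_pt (fun t => dilog (g t)) x.
Proof. by move=> h; apply: (continuity_pt_comp g dilog) => //; apply: continuity_dilog. Qed.

Lemma is_derive_dilog_comp g x dg : is_derive g x dg -> 0 < g x < 1 ->
  is_derive (fun t => dilog (g t)) x (dg * (- ln (1 - g x) / g x)).
Proof. by move=> h1 h2; apply: (is_derive_comp dilog g) h1; apply: is_derive_dilog. Qed.

(** Near 0 on the positive side [- ln (1 - z) <= 2 z], so the product is controlled by [z ln z]. *)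
Lemma continuity_lnln : continuity_pt (fun z => ln z * ln (1 - z)) 0.
Proof.
move=> e e0; have [d [d0 hd]] := continuity_xlnx 0 (e / 2) ltac:(lra).
exists (Rmin d (1/2)); split; first by apply: Rmin_glb_lt; lra.
move=> y [hy0 hy]; rewrite /= /R_dist in hy *; rewrite Rminus_0_r ln_1 Rmult_0_r Rminus_0_r.
rewrite Rminus_0_r in hy; have := Rmin_l d (1/2); have := Rmin_r d (1/2) => m1 m2.
have := hd y; rewrite /= /R_dist !Rminus_0_r Rmult_0_l Rminus_0_r => h.
have {}h := h ltac:(split; [exact: hy0 | lra]).
have [y0|y0] := Rle_lt_dec y 0.
  by rewrite ln_npos // Rmult_0_l Rabs_R0.
have y2 : y < 1 / 2 by move: hy; split_Rabs; lra.
have l1 : 0 <= - ln (1 - y) <= 2 * y.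
  have := exp_ineq1_le (- ln (1 - y)); have := exp_ineq1_le (ln (1 - y)).
  rewrite exp_Ropp exp_ln; last lra.
  move=> e1 e2; split; first lra.
  have : / (1 - y) <= 1 + 2 * y; last lra.
  by apply: (Rmult_le_reg_l (1 - y)); [lra | rewrite Rinv_r; nra].
have -> : ln y * ln (1 - y) = - ln y * - ln (1 - y) by ring.
rewrite Rabs_mult (Rabs_pos_eq (- ln (1 - y))); last lra.
rewrite Rabs_mult Rabs_pos_eq in h; last lra.
rewrite Rabs_Ropp; have := Rabs_pos (ln y); nra.
Qed.

(** The difference of the two sides has derivative 0, and its value is read off at 0. *)
Lemma dilog_reflection z : 0 <= z < 1 -> dilog z + dilog (1 - z) = PI ^ 2 / 6 - ln z * ln (1 - z).
Proof.
move=> hz; have := @constant_of_derive_zero (fun z => dilog z + dilog (1 - z) + ln z * ln (1 - z)) 0 z.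
rewrite /= dilog0 !Rminus_0_r dilog1 ln_1 Rmult_0_r => h; have {h} := h ltac:(lra) _ _; move=> h.
suff : 0 + PI ^ 2 / 6 + 0 = dilog z + dilog (1 - z) + ln z * ln (1 - z) by rewrite /=; lra.
apply: h => x hx.
  apply: continuity_pt_plus; first apply: continuity_pt_plus.
  - exact: continuity_dilog.
  - by apply: continuity_pt_dilog_comp; apply: continuity_pt_derive; auto_derive.
  have [->|x0] := Req_dec x 0; first exact: continuity_lnln.
  by apply: continuity_pt_derive; auto_derive; lra.
have d1 := is_derive_dilog x ltac:(lra).
have d2 := is_derive_dilog_comp (fun z => 1 - z) x (-1) ltac:(auto_derive; [done | ring]) ltac:(lra).
have d3 : is_derive (fun z => ln z * ln (1 - z)) x (ln (1 - x) / x - ln x / (1 - x)).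
  by auto_derive; [lra | rewrite /Rminus; field; lra].
have := is_derive_plus _ _ _ _ _ (is_derive_plus _ _ _ _ _ d1 d2) d3.
rewrite /plus /= (_ : 1 - (1 - x) = x); last ring.
by rewrite (_ : - ln (1 - x) / x + -1 * (- ln x / (1 - x)) + (ln (1 - x) / x - ln x / (1 - x)) = 0) //; field; lra.
Qed.

Lemma dilog_half : dilog (1 / 2) = PI ^ 2 / 12 - (ln 2) ^ 2 / 2.
Proof.
have := dilog_reflection (1 / 2) ltac:(lra).
rewrite (_ : 1 - 1 / 2 = 1 / 2); last field.
rewrite (_ : ln (1 / 2) = - ln 2); first lra.
by rewrite (_ : 1 / 2 = / 2) ?ln_Rinv; lra.
Qed.

(** Both sides have the same derivative in [lam], and at [lam = 2] the four arguments are 1, 1, 1/2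
    and 1. The relation trades the values at [2 - 2/lam] and [lam - 1], which the primitives
    [primC1] and [primC1'] produce, for the value at [lam/2] in the closed form. *)
Lemma dilog_four_term lam : 1 < lam <= 2 ->
  dilog (2 - 2 / lam) - dilog (lam - 1) + dilog (1 / lam) + dilog (lam / 2)
  = ln lam * ln (lam - 1) - ln lam ^ 2 + ln 2 * ln lam + PI ^ 2 / 4 - ln 2 ^ 2 / 2.
Proof.
move=> hl; have := @constant_of_derive_zero (fun x =>
  dilog (2 - 2 / x) - dilog (x - 1) + dilog (1 / x) + dilog (x / 2)
  - (ln x * ln (x - 1) - ln x ^ 2 + ln 2 * ln x)) lam 2.
rewrite (_ : 2 - 2 / 2 = 1); last field. rewrite (_ : 2 - 1 = 1); last ring.
rewrite (_ : 2 / 2 = 1); last field. rewrite dilog1 dilog_half ln_1 => h.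
have {}h := h ltac:(lra).
match type of h with ?P -> ?Q -> _ => have hP : P; last have hQ : Q end; last by have := h hP hQ; lra.
- move=> x hx; apply: continuity_pt_minus; first apply: continuity_pt_plus; first apply: continuity_pt_plus; first apply: continuity_pt_minus.
  all: try (apply: continuity_pt_dilog_comp; apply: continuity_pt_derive; auto_derive; lra).
  by apply: continuity_pt_derive; auto_derive; lra.
- move=> x hx.
  have d1 := is_derive_dilog_comp (fun x => 2 - 2 / x) x (2 / x ^ 2)
    ltac:(auto_derive; [lra | field; lra])
    ltac:(split; [apply: (Rmult_lt_reg_r x); [lra | field_simplify; lra] | apply: (Rmult_lt_reg_r x); [lra | field_simplify; lra]]).
  have d2 := is_derive_dilog_comp (fun x => x - 1) x 1 ltac:(auto_derive; [done | ring]) ltac:(lra).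
  have d3 := is_derive_dilog_comp (fun x => 1 / x) x (- / x ^ 2)
    ltac:(auto_derive; [lra | field; lra])
    ltac:(split; [apply: (Rmult_lt_reg_r x); [lra | field_simplify; lra] | apply: (Rmult_lt_reg_r x); [lra | field_simplify; lra]]).
  have d4 := is_derive_dilog_comp (fun x => x / 2) x (/ 2) ltac:(auto_derive; [done | field]) ltac:(lra).
  have d5 : is_derive (fun x => ln x * ln (x - 1) - ln x ^ 2 + ln 2 * ln x) x
     (ln (x - 1) / x + ln x / (x - 1) - 2 * ln x / x + ln 2 / x).
    by auto_derive; [lra | rewrite /Rminus; field; lra].
  have := is_derive_minus _ _ _ _ _ (is_derive_plus _ _ _ _ _ (is_derive_plus _ _ _ _ _ (is_derive_minus _ _ _ _ _ d1 d2) d3) d4) d5.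
  rewrite /plus /minus /plus /opp /=.
  rewrite (_ : 1 - (2 - 2 / x) = (2 - x) / x); last by field; lra.
  rewrite (_ : 1 - (x - 1) = 2 - x); last by ring.
  rewrite (_ : 1 - 1 / x = (x - 1) / x); last by field; lra.
  rewrite (_ : 1 - x / 2 = (2 - x) / 2); last by field; lra.
  rewrite !ln_div; try lra.
  match goal with |- is_derive _ _ ?v -> _ => have -> : v = 0 by field; lra end.
  exact.
Qed.

End DilogIdentities.

(** * Integrals of increasing functions and construction of kernels *)

Module Kernels.
Import Coquelicot.Coquelicot.
Import ssreflect.
Import Kernel Dilogarithm DilogIdentities.
Local Open Scope general_if_scope.
Open Scope R_scope.
Local Arguments INR : simpl never.

Definition integral (f : R -> R) (a b V : R) : Prop :=
  exists2 G, primitive_on f G a b & V = G b - G a.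

Definition increasing_on (f : R -> R) (a b : R) : Prop :=
  forall u v, a <= u -> u <= v -> v <= b -> f u <= f v.

(** By the mean value theorem an increment of [G] is a value of [f] times the length. Requiring only
    continuity at the ends admits primitives such as [x ln x] and [dilog] there. *)
Lemma integral_derive f G a b : a <= b -> increasing_on f a b ->
  (forall x, a <= x <= b -> continuity_pt G x) ->
  (forall x, a < x < b -> is_derive G x (f x)) -> integral f a b (G b - G a).
Proof.
move=> ab hf hc hd; exists G => // u v au uv vb; split; first exact: hf.
have [->|uv'] := Req_dec u v; first lra.
have [c [h1 h2]] : exists c, G v - G u = f c * (v - u) /\ u < c < v.
  have hd' x : u < x < v -> derivable_pt G x.
    by move=> hx; exists (f x); apply/is_derive_Reals; apply: hd; lra.
  have [c [hx h3]] := MVT G id u v hd' (fun c _ => derivable_pt_id c) ltac:(lra)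
    ltac:(move=> x hx; apply: hc; lra) ltac:(move=> x hx; apply: derivable_continuous_pt; apply: derivable_pt_id).
  exists c; split=> //; move: h3; rewrite derive_pt_id Rmult_1_r => <-.
  rewrite -(is_derive_unique _ _ _ (hd c ltac:(lra))) (Derive_Reals _ _ (hd' c hx)) /id; ring.
have := hf u c ltac:(lra) ltac:(lra) ltac:(lra); have := hf c v ltac:(lra) ltac:(lra) ltac:(lra).
by rewrite h1; nra.
Qed.

Lemma integral_glue f a b c V W : a <= b -> b <= c ->
  integral f a b V -> integral f b c W -> integral f a c (V + W).
Proof.
move=> ab bc [G hG ->] [H hH ->].
exists (fun x => if Rle_dec x b then G x else H x - H b + G b); last first.
  destruct (Rle_dec a b) as [?|?]; [|lra]; destruct (Rle_dec c b) as [h|?]; [|lra].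
  have -> : c = b by lra.
  lra.
move=> u v au uv vc; destruct (Rle_dec u b) as [hu|hu], (Rle_dec v b) as [hv|hv]; try lra.
- exact: hG.
- have [m1 i1] := hG u b au hu ltac:(lra); have [m2 i2] := hH b v ltac:(lra) ltac:(lra) vc.
  by split; [lra | split; nra].
- by have [m i] := hH u v ltac:(lra) uv vc; split; lra.
Qed.

Lemma integral_ext f g a b V : (forall x, a <= x <= b -> f x = g x) ->
  integral f a b V -> integral g a b V.
Proof.
by move=> h [G hG ->]; exists G => // u v au uv vb; rewrite -!h; [apply: hG | lra | lra].
Qed.

Lemma integral_eq f a b V W : V = W -> integral f a b V -> integral f a b W.
Proof. by move=> <-. Qed.

(** Compares increments over [N] equal cells; the error telescopes to [(f b - f a) (b - a) / N]. *)
Lemma integral_le f g a b V W : a <= b -> (forall x, a <= x <= b -> f x <= g x) ->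
  integral f a b V -> integral g a b W -> V <= W.
Proof.
move=> ab fg [G hG ->] [H hH ->].
have key N : (0 < N)%nat -> G b - G a <= H b - H a + (f b - f a) * ((b - a) / INR N).
  move=> N0; have N0' : 0 < INR N by apply: lt_0_INR; lia.
  set h := (b - a) / INR N; have h0 : 0 <= h.
    by apply: Rmult_le_pos; [lra | apply: Rlt_le; apply: Rinv_0_lt_compat].
  have eb : a + INR N * h = b by rewrite /h; field; lra.
  have step n : (n <= N)%nat -> G (a + INR n * h) - G a <=
     H (a + INR n * h) - H a + (f (a + INR n * h) - f a) * h.
    elim: n => [|n IH] nN; first by rewrite Rmult_0_l Rplus_0_r; lra.
    have {}IH := IH ltac:(lia); have := le_INR _ _ nN; rewrite S_INR in IH *; move=> nN'.
    have n0 := pos_INR n.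
    have e : a + (INR n + 1) * h = (a + INR n * h) + h by ring.
    have l : a + INR n * h + h <= b by rewrite -eb; nra.
    have [_ [_ i1]] := hG (a + INR n * h) (a + INR n * h + h) ltac:(nra) ltac:(lra) l.
    have [_ [i2 _]] := hH (a + INR n * h) (a + INR n * h + h) ltac:(nra) ltac:(lra) l.
    have i3 := fg (a + INR n * h) ltac:(nra).
    by rewrite e; nra.
  by have := step N ltac:(lia); rewrite eb.
have [fm _] := hG a b ltac:(lra) ab ltac:(lra).
apply: le_epsilon => e e0.
have [N [hN N0]] := archimed_cor1 (e / ((f b - f a) * (b - a) + 1)) ltac:(apply: Rdiv_lt_0_compat; nra).
have := key N N0.
have : (f b - f a) * ((b - a) / INR N) <= e; last lra.
have k0 : 0 <= (f b - f a) * (b - a) by nra.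
have -> : (f b - f a) * ((b - a) / INR N) = (f b - f a) * (b - a) * / INR N by rewrite /Rdiv; ring.
apply: (Rle_trans _ ((f b - f a) * (b - a) * (e / ((f b - f a) * (b - a) + 1)))).
  by apply: Rmult_le_compat_l; lra.
by apply: (Rmult_le_reg_r ((f b - f a) * (b - a) + 1)); [lra | field_simplify; nra].
Qed.

Lemma integral_bounds f a b V B : a <= b -> bounded_on f B a b -> integral f a b V ->
  0 <= V <= B * (b - a).
Proof.
move=> ab hf [G hG ->]; have [_ h] := hG a b ltac:(lra) ab ltac:(lra).
have := hf a ltac:(lra); have := hf b ltac:(lra); nra.
Qed.

Lemma integral_sub f a b c V : a <= b -> b <= c -> integral f a c V ->
  (forall x, a <= x <= c -> 0 <= f x) -> exists2 W, integral f b c W & W <= V.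
Proof.
move=> ab bc [G hG ->] f0; exists (G c - G b).
  by exists G => // u v h1 h2 h3; apply: hG; lra.
have := hG a b ltac:(lra) ab bc; have := f0 a ltac:(lra); nra.
Qed.

Lemma kernel_intro F E V :
  (forall x, 0 < x < 1 -> integral (F x) (1 - x) 1 (E x)) ->
  (forall x y, 0 < x < 1 -> 1 - x <= y <= 1 -> 0 <= F x y <= / x) ->
  (forall x x', 0 < x -> x <= x' -> x' < 1 -> E x <= E x') ->
  (forall E', (forall x, 0 < x < 1 -> E' x = E x) -> increasing_on E' 0 1 -> integral E' 0 1 V) ->
  kernel F V.
Proof.
move=> hE hF mE hV.
(* The end values 0 and 1 keep the function increasing and between 0 and 1; inside, [E <= 1] because
   [F <= 1/x] on a row of length [x]. *)
pose E' x := if Rle_dec x 0 then 0 else if Rle_dec 1 x then 1 else E x.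
have E'E x : 0 < x < 1 -> E' x = E x.
  by rewrite /E' => hx; destruct (Rle_dec x 0), (Rle_dec 1 x); lra.
have bE x : 0 < x < 1 -> 0 <= E x <= 1.
  move=> hx; have := integral_bounds _ (1 - x) 1 _ (/ x) ltac:(lra) (fun y => hF x y hx) (hE x hx).
  by rewrite (_ : / x * (1 - (1 - x)) = 1); last by field; lra.
have mE' : increasing_on E' 0 1.
  move=> u v u0 uv v1; rewrite /E'.
  destruct (Rle_dec u 0), (Rle_dec 1 u), (Rle_dec v 0), (Rle_dec 1 v); try lra.
  - by have := bE v ltac:(lra); lra.
  - by have := bE u ltac:(lra); lra.
  - by apply: mE; lra.
have [P hP eV] := hV E' E'E mE'.
pose G x := epsilon (inhabits id) (fun G => primitive_on (F x) G (1 - x) 1 /\ G 1 - G (1 - x) = E x).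
have GP x : 0 < x < 1 -> primitive_on (F x) (G x) (1 - x) 1 /\ G x 1 - G x (1 - x) = E x.
  move=> hx; apply: (epsilon_spec (inhabits id) (fun G => primitive_on (F x) G (1 - x) 1 /\ G 1 - G (1 - x) = E x)).
  by have [H h1 h2] := hE x hx; exists H.
exists E', P, G; split.
- by move=> x hx; have [] := GP x hx.
- by move=> x hx y hy; apply: hF.
- by move=> x hx; rewrite E'E //; have [] := GP x hx.
- split=> // x hx; rewrite /E'.
  destruct (Rle_dec x 0), (Rle_dec 1 x); try lra.
  by have := bE x ltac:(lra); lra.
- by [].
Qed.

(** As [x] grows, the row [[1 - x, 1]] grows and [F] increases on it, so the row integral increases;
    the alternative is that it has already reached its maximal value 1. *)
Lemma kernel_increasing F E V :
  (forall x, 0 < x < 1 -> integral (F x) (1 - x) 1 (E x)) ->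
  (forall x y, 0 < x < 1 -> 1 - x <= y <= 1 -> 0 <= F x y <= / x) ->
  (forall x x', 0 < x -> x <= x' -> x' < 1 ->
     E x' = 1 \/ forall y, 1 - x <= y <= 1 -> F x y <= F x' y) ->
  (forall E', (forall x, 0 < x < 1 -> E' x = E x) -> increasing_on E' 0 1 -> integral E' 0 1 V) ->
  kernel F V.
Proof.
move=> hE hF mF; apply: kernel_intro => // x x' x0 xx' x1.
case: (mF x x' x0 xx' x1) => [->|mF'].
  have := integral_bounds _ (1 - x) 1 _ (/ x) ltac:(lra) (fun y => hF x y ltac:(lra)) (hE x ltac:(lra)).
  by rewrite (_ : / x * (1 - (1 - x)) = 1); [lra | field; lra].
have [W hW le] := integral_sub _ (1 - x') (1 - x) 1 _ ltac:(lra) ltac:(lra) (hE x' ltac:(lra))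
  ltac:(move=> y hy; apply hF; lra).
by apply: Rle_trans le; apply: integral_le (hE x ltac:(lra)) hW; first lra.
Qed.

Lemma integral_piece (E' E P : R -> R) a b : 0 <= a -> a <= b -> b <= 1 ->
  (forall x, 0 < x < 1 -> E' x = E x) -> increasing_on E' 0 1 ->
  (forall x, a <= x <= b -> continuity_pt P x) ->
  (forall x, a < x < b -> is_derive P x (E x)) -> integral E' a b (P b - P a).
Proof.
move=> a0 ab b1 h1 h2 h3 h4; apply: integral_derive => //.
  by move=> u v ? ? ?; apply: h2; lra.
by move=> x hx; rewrite h1; [apply: h4 | lra].
Qed.

Definition xlnx (x : R) : R := x * ln x.

Lemma continuity_pt_xlnx g x : continuity_pt g x -> continuity_pt (fun t => xlnx (g t)) x.
Proof. by move=> h; apply: (continuity_pt_comp g xlnx) => //; apply: continuity_xlnx. Qed.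

Lemma Derive_dilog z : 0 < z < 1 -> Derive dilog z = - ln (1 - z) / z.
Proof. by move=> hz; apply: is_derive_unique; apply: is_derive_dilog. Qed.

Lemma ex_derive_dilog z : 0 < z < 1 -> ex_derive dilog z.
Proof. by move=> hz; eexists; apply: is_derive_dilog. Qed.

End Kernels.

(** * Integrals of the gap densities over the triangle *)

Module KernelValues.
Import Coquelicot.Coquelicot.
Import ssreflect ssrbool.
Import Kernel Dilogarithm DilogIdentities Kernels.
Local Open Scope general_if_scope.
Open Scope R_scope.
Local Arguments INR : simpl never.

Ltac continuity_tac := cbv beta;
  first [ solve [apply: continuity_pt_derive; auto_derive; repeat split; (done || lra || nra)]
        | apply: continuity_pt_dilog_comp; continuity_tac
        | apply: continuity_pt_xlnx; continuity_tac
        | apply: continuity_pt_plus; continuity_tac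
        | apply: continuity_pt_minus; continuity_tac
        | apply: continuity_pt_mult; continuity_tac ].

Ltac derive_tac := rewrite /xlnx; auto_derive;
  [ repeat split; first [done | lra | nra | apply: ex_derive_dilog; (lra || nra)]
  | rewrite ?Derive_dilog; try lra; try nra; rewrite ?/Rminus; try field; try lra; try nra ].

Lemma kernel_one : kernel (fun x _ => / x) 1.
Proof.
apply: (kernel_increasing _ (fun _ => 1)).
- move=> x hx; apply: (integral_eq _ _ _ (1 * / x - (1 - x) * / x)); first by field; lra.
  apply: (integral_derive _ (fun y => y * / x)); [lra | by move=> *; lra | |].
    by move=> y _; continuity_tac.
  by move=> y _; auto_derive => //; ring.
- by move=> x y hx hy; split; [apply: Rlt_le; apply: Rinv_0_lt_compat; lra | lra].
- by move=> *; left.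
- move=> E' h1 h2; apply: (integral_eq _ _ _ (1 - 0)); first ring.
  apply: (integral_piece E' (fun _ => 1) id) => //; try lra.
    by move=> x hx; apply: continuity_pt_derive; rewrite /id; auto_derive.
  by move=> x hx; rewrite /id; auto_derive.
Qed.

(** [1 - x] is the proportion of gaps [A], and [Rmin lam (/ y) / x] the scaled length of the part of
    the arc where [A < lam/Q]. For [lam <= 1] the minimum is constant. *)
Lemma kernel_small lam : 0 < lam <= 1 ->
  kernel (fun x y => / x - (1 - x) / x * Rmin lam (/ y)) (1 - lam / 2).
Proof.
move=> hl; have R y : 0 < y <= 1 -> Rmin lam (/ y) = lam.
  move=> hy; apply: Rmin_left; apply: (Rle_trans _ 1); first lra.
  by rewrite -Rinv_1; apply: Rinv_le_contravar; lra.
apply: (kernel_intro _ (fun x => 1 - (1 - x) * lam)).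
- move=> x hx.
  apply: (integral_ext (fun _ => / x - (1 - x) / x * lam)); first by move=> y hy; rewrite R //; lra.
  apply: (integral_eq _ _ _ (1 * (/ x - (1 - x) / x * lam) - (1 - x) * (/ x - (1 - x) / x * lam))); first by field; lra.
  apply: (integral_derive _ (fun y => y * (/ x - (1 - x) / x * lam))); [lra | by move=> *; lra | |].
    by move=> y _; apply: continuity_pt_derive; auto_derive; lra.
  by move=> y _; auto_derive; [lra | field; lra].
- move=> x y hx hy; rewrite R; last lra.
  have i0 : 0 < / x by apply: Rinv_0_lt_compat; lra.
  have : 0 <= (1 - x) * lam <= 1 by nra.
  rewrite (_ : (1 - x) / x * lam = / x * ((1 - x) * lam)); last by rewrite /Rdiv; ring.
  by nra.
- by move=> x x' *; nra.
- move=> E' h1 h2.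
  apply: (integral_eq _ _ _ (((1 - lam) * 1 + lam * (1 * 1) / 2) - ((1 - lam) * 0 + lam * (0 * 0) / 2))); first field.
  apply: (integral_piece E' (fun x => 1 - (1 - x) * lam) (fun x => (1 - lam) * x + lam * (x * x) / 2)) => //; try lra.
    by move=> x hx; continuity_tac.
  by move=> x hx; auto_derive; [done | field].
Qed.

Section Large.
Variable lam : R.
Hypothesis lam1 : 1 < lam.
Let t := / lam.
Let L := ln lam.

Let lt1 : lam * t = 1. Proof. by rewrite /t Rinv_r; lra. Qed.
Let t0 : 0 < t. Proof. by apply: Rinv_0_lt_compat; lra. Qed.
Let t1 : t < 1. Proof. by nra. Qed.
Let lnt : ln t = - L. Proof. by rewrite /t ln_Rinv //; lra. Qed.

(** Primitives of the row integrals for [x <= 1 - 1/lam], where [1/y <= lam] on the whole row, and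
    beyond that point. The dilogarithm comes from [ln (1 - x) / x]. *)
Definition primA1 (x : R) := 2 * x - dilog x + xlnx (1 - x).
Definition primA2 (x : R) := (2 + L - 2 * lam) * x + (lam - 1 - L) * ln x + lam * (x * x) / 2.

Lemma continuity_primA1 x : continuity_pt primA1 x.
Proof. by rewrite /primA1; continuity_tac. Qed.

Lemma derive_primA1 x : 0 < x < 1 -> is_derive primA1 x (1 + (1 - x) / x * ln (1 - x)).
Proof. by move=> hx; rewrite /primA1; derive_tac. Qed.

Lemma ln_kernel_integral x a : 0 < x < 1 -> 0 < a <= 1 ->
  integral (fun y => / x - (1 - x) / x * / y) a 1 ((1 - a) / x + (1 - x) / x * ln a).
Proof.
move=> hx ha; apply: (integral_eq _ _ _ ((1 / x - (1 - x) / x * ln 1) - (a / x - (1 - x) / x * ln a))).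
  by rewrite ln_1; field; lra.
have x0 : 0 < (1 - x) / x by apply: Rdiv_lt_0_compat; lra.
apply: (integral_derive _ (fun y => y / x - (1 - x) / x * ln y)); first lra.
- move=> u v u0 uv v1; have := Rinv_le_contravar u v ltac:(lra) uv; nra.
- by move=> y hy; apply: continuity_pt_derive; auto_derive; lra.
- by move=> y hy; auto_derive; [lra | field; lra].
Qed.

Lemma kernel_large :
  kernel (fun x y => / x - (1 - x) / x * Rmin lam (/ y))
    (primA1 (1 - t) - primA1 0 + (primA2 1 - primA2 (1 - t))).
Proof.
have Rl y : t <= y -> Rmin lam (/ y) = / y.
  by move=> hy; rewrite Rmin_right // -(Rinv_inv lam); apply: Rinv_le_contravar.
have Rs y : 0 < y <= t -> Rmin lam (/ y) = lam.
  by move=> hy; rewrite Rmin_left // -(Rinv_inv lam); apply: Rinv_le_contravar; rewrite -/t; lra.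
pose E x := if Rle_dec t (1 - x) then 1 + (1 - x) / x * ln (1 - x)
            else 2 + L - (1 + L) / x + lam * (/ x - 2 + x).
apply: (kernel_increasing _ E).
- move=> x hx; rewrite /E; destruct (Rle_dec t (1 - x)) as [h|h].
    apply: (integral_ext (fun y => / x - (1 - x) / x * / y)); first by move=> y hy; rewrite Rl //; lra.
    apply: (integral_eq _ _ _ _ _ _ (ln_kernel_integral x (1 - x) hx ltac:(lra))).
    by field; lra.
  apply: (integral_eq _ _ _ ((t * (/ x - (1 - x) / x * lam) - (1 - x) * (/ x - (1 - x) / x * lam))
      + ((1 - t) / x + (1 - x) / x * ln t))).
    have e : lam = / t by rewrite /t Rinv_inv.
    by rewrite lnt e; field; lra.
  apply: (integral_glue _ _ t); [lra | lra | |].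
    apply: (integral_ext (fun _ => / x - (1 - x) / x * lam)); first by move=> y hy; rewrite Rs //; lra.
    apply: (integral_derive _ (fun y => y * (/ x - (1 - x) / x * lam))); [lra | by move=> *; lra | |].
      by move=> y _; apply: continuity_pt_derive; auto_derive; lra.
    by move=> y _; auto_derive; [lra | field; lra].
  apply: (integral_ext (fun y => / x - (1 - x) / x * / y)); first by move=> y hy; rewrite Rl //; lra.
  by apply: ln_kernel_integral => //; lra.
- move=> x y hx hy; have i0 : 0 < / x by apply: Rinv_0_lt_compat; lra.
  have m1 : Rmin lam (/ y) <= / y by apply: Rmin_r.
  have m0 : 0 <= Rmin lam (/ y) by apply: Rmin_glb; [lra | apply: Rlt_le; apply: Rinv_0_lt_compat; lra].
  have yy : y * / y = 1 by apply: Rinv_r; lra.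
  have : 0 <= (1 - x) * Rmin lam (/ y) <= 1 by nra.
  rewrite (_ : (1 - x) / x * Rmin lam (/ y) = / x * ((1 - x) * Rmin lam (/ y))); last by rewrite /Rdiv; ring.
  by nra.
- move=> x x' x0 xx' x1; right=> y hy.
  have m1 : 1 <= Rmin lam (/ y).
    by apply: Rmin_glb; [lra | rewrite -Rinv_1; apply: Rinv_le_contravar; lra].
  have : / x' <= / x by apply: Rinv_le_contravar.
  (* In this form the variable occurs in [/ z] alone, with a nonpositive coefficient, so the kernel
     increases in [x]. *)
  have e z : 0 < z -> / z - (1 - z) / z * Rmin lam (/ y) = Rmin lam (/ y) - / z * (Rmin lam (/ y) - 1).
    by move=> z0; field; lra.
  by rewrite !e; [nra | lra | lra].
- move=> E' h1 h2; apply: (integral_glue _ _ (1 - t)); [lra | lra | |].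
    apply: (integral_piece E' E primA1) => //; try lra; first by move=> x _; apply: continuity_primA1.
    move=> x hx; rewrite /E; destruct (Rle_dec t (1 - x)); [apply: derive_primA1; lra | lra].
  apply: (integral_piece E' E primA2) => //; try lra.
    by move=> x hx; apply: continuity_pt_derive; rewrite /primA2; auto_derive; lra.
  move=> x hx; rewrite /E; destruct (Rle_dec t (1 - x)); first lra.
  by rewrite /primA2; auto_derive; [lra | field; lra].
Qed.

(** To be subtracted from the kernel for [x < t < y], which carries the same term [1/x] on
    [x >= t]. *)
Lemma kernel_step : kernel (fun x _ => if Rlt_dec x t then 0 else / x) (1 - t).
Proof.
pose E x := if Rlt_dec x t then 0 else 1.
apply: (kernel_increasing _ E).
- move=> x hx; rewrite /E; destruct (Rlt_dec x t) as [h|h].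
    apply: (integral_eq _ _ _ (0 - 0)); first ring.
    apply: (integral_derive _ (fun y => 0)); [lra | by move=> *; lra | |].
      by move=> y _; continuity_tac.
    by move=> y _; auto_derive.
  apply: (integral_eq _ _ _ (1 * / x - (1 - x) * / x)); first by field; lra.
  apply: (integral_derive _ (fun y => y * / x)); [lra | by move=> *; lra | |].
    by move=> y _; continuity_tac.
  by move=> y _; auto_derive => //; ring.
- move=> x y hx hy; have i0 : 0 < / x by apply: Rinv_0_lt_compat; lra.
  by destruct (Rlt_dec x t); lra.
- move=> x x' x0 xx' x1; rewrite /E; destruct (Rlt_dec x' t) as [h|h]; last by left.
  by right=> y _; destruct (Rlt_dec x t); lra.
- move=> E' h1 h2; apply: (integral_eq _ _ _ ((0 - 0) + (1 - t))); first ring.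
  apply: (integral_glue _ _ t); [lra | lra | |].
    apply: (integral_piece E' E (fun _ => 0)) => //; try lra; first by move=> x _; continuity_tac.
    by move=> x hx; rewrite /E; destruct (Rlt_dec x t); [auto_derive | lra].
  apply: (integral_piece E' E id) => //; try lra.
    by move=> x _; apply: continuity_pt_derive; rewrite /id; auto_derive.
  by move=> x hx; rewrite /E /id; destruct (Rlt_dec x t); [lra | auto_derive].
Qed.

Definition primC2 (x : R) := (1 - t - L) * ln x + L * x.

(** For [x, y >= t] the gap [A + B] is short on the whole arc, so the density is the proportion
    [x + y - 1] of such gaps times the scaled length [1/(x y)] of the arc. *)
Lemma kernel_both_large_aux V :
  (forall E', (forall x, 0 < x < 1 -> E' x =
      if Rle_dec t x then if Rle_dec t (1 - x) then 1 + (1 - x) / x * ln (1 - x)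
                        else (1 - t) / x - (1 - x) / x * L
      else 0) -> increasing_on E' 0 1 -> integral E' 0 1 V) ->
  kernel (fun x y => if Rle_dec t x then if Rle_dec t y then (x + y - 1) / (x * y) else 0 else 0) V.
Proof.
have e x y : 0 < x -> 0 < y -> (x + y - 1) / (x * y) = / x - (1 - x) / x * / y by move=> *; field; lra.
apply: kernel_increasing.
- move=> x hx; destruct (Rle_dec t x) as [h|h]; last first.
    apply: (integral_eq _ _ _ (0 - 0)); first ring.
    apply: (integral_derive _ (fun y => 0)); [lra | by move=> *; lra | |].
      by move=> y _; continuity_tac.
    by move=> y _; auto_derive.
  destruct (Rle_dec t (1 - x)) as [h'|h'].
    apply: (integral_ext (fun y => / x - (1 - x) / x * / y)).
      by move=> y hy; destruct (Rle_dec t y); [rewrite e; lra | lra].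
    apply: (integral_eq _ _ _ _ _ _ (ln_kernel_integral x (1 - x) hx ltac:(lra))).
    by field; lra.
  apply: (integral_eq _ _ _ ((0 - 0) + ((1 - t) / x + (1 - x) / x * ln t))); first by rewrite lnt; lra.
  apply: (integral_glue _ _ t); [lra | lra | |]; last first.
    apply: (integral_ext (fun y => / x - (1 - x) / x * / y)).
      by move=> y hy; destruct (Rle_dec t y); [rewrite e; lra | lra].
    by apply: ln_kernel_integral => //; lra.
  apply: (integral_derive _ (fun y => 0)); first lra.
  + move=> u v u0 uv v1; destruct (Rle_dec t u), (Rle_dec t v); try lra.
      by have -> : u = v; lra.
    by apply: Rmult_le_pos; [lra | apply: Rlt_le; apply: Rinv_0_lt_compat; nra].
  + by move=> y _; continuity_tac.
  + by move=> y hy; destruct (Rle_dec t y); [lra | auto_derive].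
- move=> x y hx hy; have i0 : 0 < / x by apply: Rinv_0_lt_compat; lra.
  destruct (Rle_dec t x), (Rle_dec t y); try lra.
  have y0 : 0 < / y by apply: Rinv_0_lt_compat; lra.
  have yy : y * / y = 1 by apply: Rinv_r; lra.
  rewrite (_ : (x + y - 1) / (x * y) = / x * ((x + y - 1) * / y)); last by field; lra.
  have : 0 <= (x + y - 1) * / y <= 1 by nra.
  by nra.
- move=> x x' x0 xx' x1; right=> y hy.
  destruct (Rle_dec t x), (Rle_dec t x'), (Rle_dec t y); try lra.
    have e' z : 0 < z -> (z + y - 1) / (z * y) = / y * (1 - (1 - y) * / z) by move=> *; field; lra.
    have y0 : 0 < / y by apply: Rinv_0_lt_compat; lra.
    rewrite !e'; try lra; apply: Rmult_le_compat_l; first lra.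
    by have : / x' <= / x; [apply: Rinv_le_contravar | nra].
  by apply: Rmult_le_pos; [lra | apply: Rlt_le; apply: Rinv_0_lt_compat; nra].
Qed.

Lemma derive_primC2 x : 0 < x -> is_derive primC2 x ((1 - t) / x - (1 - x) / x * L).
Proof. by move=> hx; rewrite /primC2; auto_derive; [lra | field; lra]. Qed.

Lemma kernel_both_large_le2 : lam <= 2 ->
  kernel (fun x y => if Rle_dec t x then if Rle_dec t y then (x + y - 1) / (x * y) else 0 else 0)
   (primC2 1 - primC2 t).
Proof.
move=> l2; have t2 : 1 <= 2 * t by nra.
apply: kernel_both_large_aux => E' h1 h2.
apply: (integral_eq _ _ _ ((0 - 0) + (primC2 1 - primC2 t))); first ring.
apply: (integral_glue _ _ t); [lra | lra | |].
  apply: (integral_piece E' _ (fun _ => 0) _ _ _ _ _ h1) => //; try lra; first by move=> x _; continuity_tac.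
  by move=> x hx; cbv beta; destruct (Rle_dec t x); [lra | auto_derive].
apply: (integral_piece E' _ primC2 _ _ _ _ _ h1) => //; try lra.
  by move=> x hx; apply: continuity_pt_derive; eexists; apply: derive_primC2; lra.
move=> x hx; cbv beta; destruct (Rle_dec t x), (Rle_dec t (1 - x)); try lra.
by apply: derive_primC2; lra.
Qed.

Lemma kernel_both_large_ge2 : 2 <= lam ->
  kernel (fun x y => if Rle_dec t x then if Rle_dec t y then (x + y - 1) / (x * y) else 0 else 0)
   (primA1 (1 - t) - primA1 t + (primC2 1 - primC2 (1 - t))).
Proof.
move=> l2; have t2 : 2 * t <= 1 by nra.
apply: kernel_both_large_aux => E' h1 h2.
apply: (integral_eq _ _ _ ((0 - 0) + (primA1 (1 - t) - primA1 t + (primC2 1 - primC2 (1 - t))))); first ring.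
apply: (integral_glue _ _ t); [lra | lra | |].
  apply: (integral_piece E' _ (fun _ => 0) _ _ _ _ _ h1) => //; try lra; first by move=> x _; continuity_tac.
  by move=> x hx; cbv beta; destruct (Rle_dec t x); [lra | auto_derive].
apply: (integral_glue _ _ (1 - t)); [lra | lra | |].
  apply: (integral_piece E' _ primA1 _ _ _ _ _ h1) => //; try lra; first by move=> x _; apply: continuity_primA1.
  move=> x hx; cbv beta; destruct (Rle_dec t x), (Rle_dec t (1 - x)); try lra.
  by apply: derive_primA1; lra.
apply: (integral_piece E' _ primC2 _ _ _ _ _ h1) => //; try lra.
  by move=> x hx; apply: continuity_pt_derive; eexists; apply: derive_primC2; lra.
move=> x hx; cbv beta; destruct (Rle_dec t x), (Rle_dec t (1 - x)); try lra.
by apply: derive_primC2; lra.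
Qed.


(** [primC1] and [primC1'] are primitives of [E1] and [E2], the row integrals for [x <= 1 - t] and
    for [1 - t < x < t]. The values [dilog (2 * x)] and [dilog (lam * x)] come from the logarithm of
    [y - x] at the lower end of the row, which is [1 - x] or [t]. *)
Definition primC1 (x : R) :=
  lam * (x * x) / 2 - 2 * dilog x + dilog (2 * x) + xlnx (1 - x) + (2 - lam * x) * xlnx (1 - x)
  - (1 + lam / 4 - lam * x / 2) * xlnx (1 - 2 * x) + (1 - lam / 2) * x.

Definition primC1' (x : R) :=
  (lam - 1 + L) * x - dilog x + dilog (lam * x) + (2 - lam * x) * xlnx (1 - x)
  - (1 + t - x) * xlnx (1 - lam * x) + L * (lam * (x * x) - (2 + lam) * x)
  + (1 - lam) * x.

Let E1 x := lam * x + (1 - x) / x * ln (1 - x)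
   + (1 - 2 * x) * (1 - lam * x) / x * (ln (1 - x) - ln (1 - 2 * x)).
Let E2 x := lam - 1 - (1 - x) / x * L
   + (1 - 2 * x) * (1 - lam * x) / x * (ln (1 - x) - ln (1 - lam * x) + L).

Lemma continuity_primC1 x : continuity_pt primC1 x.
Proof. by rewrite /primC1; continuity_tac. Qed.

Lemma continuity_primC1' x : continuity_pt primC1' x.
Proof. by rewrite /primC1'; continuity_tac. Qed.

Lemma derive_primC1 x : 0 < x -> 2 * x < 1 -> is_derive primC1 x (E1 x).
Proof. by move=> x0 x1; rewrite /primC1 /E1; derive_tac. Qed.

Lemma derive_primC1' x : 0 < x < t -> is_derive primC1' x (E2 x).
Proof.
move=> hx; have lx : 0 < lam * x < 1 by nra.
rewrite /primC1' /E2 /xlnx; auto_derive; first by repeat split; first [done | lra | apply: ex_derive_dilog; lra].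
rewrite !Derive_dilog; try lra; rewrite /Rminus; have -> : t = / lam by [].
by field; lra.
Qed.

(** For [x < t < y]: the proportion [x + y - 1] of gaps [A + B] times the scaled length of the part
    of the arc where [A + B < lam/Q]. *)
Let F1 x y := (x + y - 1) * (lam * y - 1) / (y * (y - x)).

(** Factorisations made for monotonicity: here both factors increase in [y], and in [F1_x] the
    variable [x] occurs in one factor only, with the coefficient [2 y - 1 >= 0]. *)
Lemma F1_y x y : 0 < y -> x < y -> F1 x y = (1 - (1 - x) * / y) * (lam - (1 - lam * x) * / (y - x)).
Proof. by move=> y0 xy; rewrite /F1; field; lra. Qed.

Lemma F1_x x y : 0 < y -> x < y -> F1 x y = ((2 * y - 1) * / (y - x) - 1) * ((lam * y - 1) * / y).
Proof. by move=> y0 xy; rewrite /F1; field; lra. Qed.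

Lemma F1_ge0 x y : 0 < x < t -> 1 - x <= y <= 1 -> t <= y -> 0 <= F1 x y.
Proof.
move=> hx hy ty; rewrite /F1; apply: Rmult_le_pos; first by apply: Rmult_le_pos; nra.
by apply: Rlt_le; apply: Rinv_0_lt_compat; apply: Rmult_lt_0_compat; lra.
Qed.

Lemma F1_mono_y x y y' : 0 < x < t -> 1 - x <= y -> t <= y -> y <= y' -> y' <= 1 -> F1 x y <= F1 x y'.
Proof.
move=> hx xy ty yy y1; rewrite !F1_y; try lra.
have i1 : / y' <= / y by apply: Rinv_le_contravar; lra.
have i2 : / (y' - x) <= / (y - x) by apply: Rinv_le_contravar; lra.
have e1 : y * / y = 1 by apply: Rinv_r; lra.
have e2 : (y - x) * / (y - x) = 1 by apply: Rinv_r; lra.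
have p1 : 0 < / y by apply: Rinv_0_lt_compat; lra.
have p2 : 0 < / (y - x) by apply: Rinv_0_lt_compat; lra.
have lx : 0 < lam * x < 1 by nra.
have ly : 1 <= lam * y by nra.
apply: Rmult_le_compat; try nra.
Qed.

(** The row is largest at [y = 1], where its value [x (lam - 1)/(1 - x)] is at most 1 since
    [lam x <= 1]. *)
Lemma F1_le1 x y : 0 < x < t -> 1 - x <= y <= 1 -> t <= y -> F1 x y <= 1.
Proof.
move=> hx hy ty; apply: (Rle_trans _ (F1 x 1)); first by apply: F1_mono_y; lra.
have lx : 0 < lam * x < 1 by nra.
rewrite /F1; apply: (Rmult_le_reg_r (1 - x)); first lra.
by field_simplify; [nra | lra].
Qed.

Lemma F1_mono_x x x' y : 0 < x -> x <= x' -> x' < t -> 1 - x <= y <= 1 -> t < y -> F1 x y <= F1 x' y.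
Proof.
move=> x0 xx x't hy ty; rewrite !F1_x; try lra.
have i2 : / (y - x) <= / (y - x') by apply: Rinv_le_contravar; lra.
apply: Rmult_le_compat_r; last by nra.
by apply: Rmult_le_pos; [nra | apply: Rlt_le; apply: Rinv_0_lt_compat; lra].
Qed.

Lemma F1_integral x a : 0 < x < t -> 1 - x <= a -> t <= a -> a <= 1 ->
  integral (fun y => if Rle_dec y t then 0 else F1 x y) a 1
   (lam * (1 - a) + (1 - x) / x * ln a + (1 - 2 * x) * (1 - lam * x) / x * (ln (1 - x) - ln (a - x))).
Proof.
move=> hx xa ta a1.
pose b := (1 - 2 * x) * (1 - lam * x) / x.
apply: (integral_eq _ _ _ ((lam * 1 - (1 - x) / x * ln 1 + b * ln (1 - x)) - (lam * a - (1 - x) / x * ln a + b * ln (a - x)))).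
  by rewrite ln_1 /b; lra.
apply: (integral_derive _ (fun y => lam * y - (1 - x) / x * ln y + b * ln (y - x))); first lra.
- move=> u v au uv v1; destruct (Rle_dec u t), (Rle_dec v t); try lra.
    by apply: F1_ge0; lra.
  by apply: F1_mono_y; lra.
- by move=> y hy; apply: continuity_pt_derive; auto_derive; lra.
- move=> y hy; destruct (Rle_dec y t); first lra.
  by rewrite /b /F1; auto_derive; [lra | field; lra].
Qed.

Lemma kernel_one_large_aux V :
  (forall E', (forall x, 0 < x < 1 -> E' x =
      if Rlt_dec x t then if Rle_dec t (1 - x) then E1 x else E2 x
      else 1) -> increasing_on E' 0 1 -> integral E' 0 1 V) ->
  kernel (fun x y => if Rlt_dec x t then if Rle_dec y t then 0 else (x + y - 1) * (lam * y - 1) / (y * (y - x)) else / x) V.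
Proof.
change ((forall E', (forall x, 0 < x < 1 -> E' x =
      if Rlt_dec x t then if Rle_dec t (1 - x) then E1 x else E2 x
      else 1) -> increasing_on E' 0 1 -> integral E' 0 1 V) ->
  kernel (fun x y => if Rlt_dec x t then if Rle_dec y t then 0 else F1 x y else / x) V).
apply: kernel_increasing.
- move=> x hx; destruct (Rlt_dec x t) as [h|h]; last first.
    apply: (integral_eq _ _ _ (1 * / x - (1 - x) * / x)); first by field; lra.
    apply: (integral_derive _ (fun y => y * / x)); [lra | by move=> *; lra | |].
      by move=> y _; continuity_tac.
    by move=> y _; auto_derive => //; ring.
  destruct (Rle_dec t (1 - x)) as [h'|h'].
    apply: (integral_eq _ _ _ _ _ _ (F1_integral x (1 - x) ltac:(lra) ltac:(lra) ltac:(lra) ltac:(lra))).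
    by rewrite /E1 (_ : 1 - x - x = 1 - 2 * x); ring.
  have := F1_integral x t ltac:(lra) ltac:(lra) ltac:(lra) ltac:(lra) => h2.
  apply: (integral_eq _ _ _ ((0 - 0) + _) _ _ (integral_glue _ _ _ _ _ _ _ _ _ h2)); [|lra|lra|].
    have -> : t - x = (1 - lam * x) / lam by rewrite /t; field; lra.
    have lx : lam * x < 1 by nra.
    by rewrite ln_div ?lnt /E2; [| lra | lra]; have := lt1; fold L; nra.
  apply: (integral_derive _ (fun y => 0)); first lra.
  + by move=> u v u0 uv v1; destruct (Rle_dec u t), (Rle_dec v t); lra.
  + by move=> y _; continuity_tac.
  + by move=> y hy; destruct (Rle_dec y t); [auto_derive | lra].
- move=> x y hx hy; have i0 : 0 < / x by apply: Rinv_0_lt_compat; lra.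
  have i1 : 1 <= / x by rewrite -Rinv_1; apply: Rinv_le_contravar; lra.
  destruct (Rlt_dec x t), (Rle_dec y t); try lra.
  have := F1_ge0 x y ltac:(lra) hy ltac:(lra); have := F1_le1 x y ltac:(lra) hy ltac:(lra); lra.
- move=> x x' x0 xx' x1; destruct (Rlt_dec x' t) as [h|h]; last by left.
  right=> y hy; destruct (Rlt_dec x t), (Rle_dec y t); try lra.
  by apply: F1_mono_x; lra.
Qed.

Lemma kernel_one_large_le2 : lam <= 2 ->
  kernel (fun x y => if Rlt_dec x t then if Rle_dec y t then 0 else (x + y - 1) * (lam * y - 1) / (y * (y - x)) else / x)
   ((primC1 (1 - t) - primC1 0) + ((primC1' t - primC1' (1 - t)) + (1 - t))).
Proof.
move=> l2; have t2 : 1 <= 2 * t by nra.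
apply: kernel_one_large_aux => E' h1 h2.
apply: (integral_glue _ _ (1 - t)); [lra | lra | |].
  apply: (integral_piece E' _ primC1 _ _ _ _ _ h1) => //; try lra; first by move=> x _; apply: continuity_primC1.
  move=> x hx; cbv beta; destruct (Rlt_dec x t), (Rle_dec t (1 - x)); try lra.
  by apply: derive_primC1; lra.
apply: (integral_glue _ _ t); [lra | lra | |].
  apply: (integral_piece E' _ primC1' _ _ _ _ _ h1) => //; try lra; first by move=> x _; apply: continuity_primC1'.
  move=> x hx; cbv beta; destruct (Rlt_dec x t), (Rle_dec t (1 - x)); try lra.
  by apply: derive_primC1'; lra.
apply: (integral_piece E' _ id _ _ _ _ _ h1) => //; try lra.
  by move=> x _; apply: continuity_pt_derive; rewrite /id; auto_derive.
by move=> x hx; cbv beta; rewrite /id; destruct (Rlt_dec x t); [lra | auto_derive].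
Qed.

Lemma kernel_one_large_ge2 : 2 <= lam ->
  kernel (fun x y => if Rlt_dec x t then if Rle_dec y t then 0 else (x + y - 1) * (lam * y - 1) / (y * (y - x)) else / x)
   ((primC1 t - primC1 0) + (1 - t)).
Proof.
move=> l2; have t2 : 2 * t <= 1 by nra.
apply: kernel_one_large_aux => E' h1 h2.
apply: (integral_glue _ _ t); [lra | lra | |].
  apply: (integral_piece E' _ primC1 _ _ _ _ _ h1) => //; try lra; first by move=> x _; apply: continuity_primC1.
  move=> x hx; cbv beta; destruct (Rlt_dec x t), (Rle_dec t (1 - x)); try lra.
  by apply: derive_primC1; lra.
apply: (integral_piece E' _ id _ _ _ _ _ h1) => //; try lra.
  by move=> x _; apply: continuity_pt_derive; rewrite /id; auto_derive.
by move=> x hx; cbv beta; rewrite /id; destruct (Rlt_dec x t); [lra | auto_derive].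
Qed.

End Large.
End KernelValues.

(** * Comparison with the closed form *)

Module ClosedForm.
Import Coquelicot.Coquelicot.
Import ssreflect ssrbool.
Import Kernel Dilogarithm DilogIdentities Kernels KernelValues.
Local Open Scope general_if_scope.
Open Scope R_scope.
Local Arguments INR : simpl never.

(** The three values are the integrals of the densities of short gaps over the triangle: gaps [A];
    gaps [A + B] with [x < 1/lam < y]; gaps [A + B] with [x, y >= 1/lam]. For [lam <= 1] the last
    two regions contribute nothing. *)
Definition valueA (lam : R) : R :=
  if Rle_dec lam 1 then lam / 2
  else 1 - (primA1 (1 - / lam) - primA1 0 + (primA2 lam 1 - primA2 lam (1 - / lam))).

Definition valueC1 (lam : R) : R :=
  if Rle_dec lam 1 then 0
  else if Rle_dec lam 2 then
    (primC1 lam (1 - / lam) - primC1 lam 0) + (primC1' lam (/ lam) - primC1' lam (1 - / lam))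
  else primC1 lam (/ lam) - primC1 lam 0.

Definition valueC2 (lam : R) : R :=
  if Rle_dec lam 1 then 0
  else if Rle_dec lam 2 then primC2 lam 1 - primC2 lam (/ lam)
  else primA1 (1 - / lam) - primA1 (/ lam) + (primC2 lam 1 - primC2 lam (1 - / lam)).

(** The factors 2 come from reflection, [6/PI^2] from coprimality. The definition covers [lam = 1]
    and [lam = 2], where it still is the limit. *)
Definition g1_value (lam : R) : R :=
  1 - 6 / PI ^ 2 * (2 * valueA lam + 2 * valueC1 lam + valueC2 lam).

Lemma xlnx0 : xlnx 0 = 0. Proof. by rewrite /xlnx Rmult_0_l. Qed.
Lemma xlnx1 : xlnx 1 = 0. Proof. by rewrite /xlnx ln_1 Rmult_0_r. Qed.

Lemma g1_value_small lam : 0 < lam -> lam < 1 -> g1_value lam = g1_formula lam.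
Proof.
move=> l0 l1; rewrite /g1_value /g1_formula /valueA /valueC1 /valueC2.
have p0 := PI_RGT_0.
destruct (Rle_dec lam 1), (Rlt_dec lam 1); try lra.
by field; lra.
Qed.

Lemma ln_1_inv lam : 1 < lam -> ln (1 - / lam) = ln (lam - 1) - ln lam.
Proof.
move=> h; have -> : 1 - / lam = (lam - 1) / lam by field; lra.
by apply: ln_div; lra.
Qed.

Lemma g1_value_mid lam : 1 < lam -> lam < 2 -> g1_value lam = g1_formula lam.
Proof.
move=> l1 l2; rewrite /g1_value /g1_formula /valueA /valueC1 /valueC2.
have p0 := PI_RGT_0.
destruct (Rle_dec lam 1), (Rle_dec lam 2), (Rlt_dec lam 1), (Rlt_dec lam 2); try lra.
have t01 : 0 < / lam < 1.
  split; first by apply: Rinv_0_lt_compat; lra.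
  by rewrite -Rinv_1; apply: Rinv_lt_contravar; lra.
have lt : lam * / lam = 1 by apply: Rinv_r; lra.
rewrite !Li2_dilog; try by rewrite /Rdiv; lra.
have d4 := dilog_four_term lam ltac:(lra).
have d2 := dilog_reflection (/ lam) ltac:(lra).
rewrite (_ : 1 / lam = / lam) in d4 *; last by field; lra.
have e2 : dilog (1 - / lam) = PI ^ 2 / 6 - ln (/ lam) * ln (1 - / lam) - dilog (/ lam) by lra.
(* The value at [lam/2] occurs in the closed form only; once it is eliminated both sides involve the
   same dilogarithms, which then behave as independent variables. *)
have e4 : dilog (lam / 2) = ln lam * ln (lam - 1) - ln lam ^ 2 + ln 2 * ln lam + PI ^ 2 / 4 - ln 2 ^ 2 / 2
   - dilog (2 - 2 / lam) + dilog (lam - 1) - dilog (/ lam) by lra.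
rewrite /primA1 /primA2 /primC1 /primC1' /primC2.
rewrite e4 !Rmult_0_r !Rminus_0_r dilog0 xlnx1.
rewrite (_ : 2 * (1 - / lam) = 2 - 2 / lam); last by field; lra.
rewrite (_ : lam * (1 - / lam) = lam - 1); last by field; lra.
rewrite lt dilog1 e2.
rewrite (_ : 1 - (1 - / lam) = / lam); last by ring.
rewrite (_ : 1 - (2 - 2 / lam) = (2 - lam) / lam); last by field; lra.
rewrite (_ : 1 - (lam - 1) = 2 - lam); last by ring.
rewrite (_ : 1 - 1 = 0) ?xlnx0; last by ring.
rewrite /xlnx !ln_1_inv // ?ln_Rinv ?ln_div ?ln_1; try lra.
rewrite (_ : ln 4 = 2 * ln 2); last by rewrite (_ : 4 = 2 * 2) ?ln_mult; lra.
move: (dilog _) (dilog _) (dilog _) (ln _) (ln _) (ln _) (ln _) => *.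
by field; lra.
Qed.

Lemma g1_value_large lam : 2 < lam -> g1_value lam = g1_formula lam.
Proof.
move=> l2; rewrite /g1_value /g1_formula /valueA /valueC1 /valueC2.
have p0 := PI_RGT_0.
destruct (Rle_dec lam 1), (Rle_dec lam 2), (Rlt_dec lam 1), (Rlt_dec lam 2); try lra.
have t01 : 0 < / lam < / 2.
  split; first by apply: Rinv_0_lt_compat; lra.
  by apply: Rinv_lt_contravar; lra.
have lt : lam * / lam = 1 by apply: Rinv_r; lra.
rewrite !Li2_dilog; try by rewrite /Rdiv; lra.
have d2 := dilog_reflection (/ lam) ltac:(lra).
rewrite (_ : 1 / lam = / lam); last by field; lra.
have e2 : dilog (1 - / lam) = PI ^ 2 / 6 - ln (/ lam) * ln (1 - / lam) - dilog (/ lam) by lra.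
rewrite /primA1 /primA2 /primC1 /primC2.
rewrite !Rmult_0_r !Rminus_0_r dilog0 xlnx1 e2.
rewrite (_ : 2 * / lam = 2 / lam); last by field; lra.
rewrite (_ : 1 - (1 - / lam) = / lam); last by ring.
rewrite (_ : 1 - 2 / lam = (lam - 2) / lam); last by field; lra.
rewrite lt /xlnx !ln_1_inv; try lra.
rewrite ?ln_Rinv ?ln_div ?ln_1; try lra.
move: (dilog _) (dilog _) (ln _) (ln _) (ln _) => *.
by field; lra.
Qed.

Theorem g1_valueE lam : 0 < lam -> lam <> 1 -> lam <> 2 -> g1_value lam = g1_formula lam.
Proof.
move=> l0 l1 l2; have [h|h] := Rlt_le_dec lam 1; first exact: g1_value_small.
have [h'|h'] := Rlt_le_dec lam 2; first by apply: g1_value_mid; lra.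
by apply: g1_value_large; lra.
Qed.

End ClosedForm.

(** * Measures of pieces of Farey arcs *)

Module Cells.
Import ZArith.
Import Coquelicot.Coquelicot.
Import all_boot.
Import zify.
Import Sums Average Kernel Gaps.
Set Implicit Arguments. Unset Strict Implicit. Unset Printing Implicit Defensive.
Local Open Scope general_if_scope.
Open Scope R_scope.
Local Arguments INR : simpl never.

Definition ind (P : Prop) : R := if excluded_middle_informative P then 1 else 0.

Lemma ind1 (P : Prop) : P -> ind P = 1.
Proof. by rewrite /ind => h; destruct (excluded_middle_informative P). Qed.

Lemma ind0 (P : Prop) : ~ P -> ind P = 0.
Proof. by rewrite /ind => h; destruct (excluded_middle_informative P). Qed.

Lemma ind_bounds P : 0 <= ind P <= 1.
Proof. by rewrite /ind; destruct (excluded_middle_informative P); lra. Qed.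

Lemma ind_le (P Q : Prop) : (P -> Q) -> ind P <= ind Q.
Proof.
move=> h; rewrite /ind; destruct (excluded_middle_informative P), (excluded_middle_informative Q); try lra.
by exfalso; auto.
Qed.

Lemma ind_iff (P Q : Prop) : (P <-> Q) -> ind P = ind Q.
Proof. by move=> h; apply: Rle_antisym; apply: ind_le; tauto. Qed.

Definition adjacent (q q' : nat) (a : Z) : Prop :=
  exists a', (a' * Z.of_nat q - a * Z.of_nat q' = 1)%Z.

(* For an arc [(a/q, a'/q')] of the Farey dissection this is the indicator of its
   subinterval at distance between [s] and [r] from [a/q]. *)
Definition cell (q q' : nat) (s r alpha : R) : R :=
  ind (exists a, adjacent q q' a /\ IZR a / INR q + s < alpha < IZR a / INR q + r).

Lemma cell_le q q' s r s' r' alpha : s' <= s -> r <= r' -> cell q q' s r alpha <= cell q q' s' r' alpha.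
Proof. by move=> hs hr; apply: ind_le => -[a [h1 h2]]; exists a; split=> //; lra. Qed.

Lemma is_RInt_interval u v a b : a <= u -> u <= v -> v <= b ->
  is_RInt (fun x => ind (u < x < v)) a b (v - u).
Proof.
move=> au uv vb; rewrite (_ : v - u = plus (plus 0 (v - u)) 0); last by rewrite /plus /=; ring.
apply: (is_RInt_Chasles _ _ v); first apply: (is_RInt_Chasles _ _ u).
- apply: (is_RInt_ext (fun _ => 0)); last by have := is_RInt_const a u 0; rewrite /scal /= /mult /= Rmult_0_r.
  by move=> x; rewrite Rmin_left // Rmax_right // => hx; rewrite ind0 //; lra.
- apply: (is_RInt_ext (fun _ => 1)); last by have := is_RInt_const u v 1; rewrite /scal /= /mult /= Rmult_1_r.
  by move=> x; rewrite Rmin_left // Rmax_right // => hx; rewrite ind1 //; lra.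
- apply: (is_RInt_ext (fun _ => 0)); last by have := is_RInt_const v b 0; rewrite /scal /= /mult /= Rmult_0_r.
  by move=> x; rewrite Rmin_left // Rmax_right // => hx; rewrite ind0 //; lra.
Qed.

Section Cell.
Variables (q q' : nat) (s r : R).
Hypotheses (q0 : (0 < q)%N) (s0 : 0 <= s) (sr : s <= r) (rq : r <= / INR q).

Let Q0 : 0 < INR q. Proof. exact: INR_pos. Qed.

(** Since [r <= 1/q], pieces attached to different numerators lie in different intervals of length
    [1/q]. *)
Lemma cell_local a alpha : IZR a / INR q < alpha < (IZR a + 1) / INR q ->
  cell q q' s r alpha = ind (adjacent q q' a) * ind (IZR a / INR q + s < alpha < IZR a / INR q + r).
Proof.
move=> [h1 h2].
have only b : IZR b / INR q + s < alpha < IZR b / INR q + r -> b = a.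
  move=> [g1 g2].
  have k1 : IZR b < IZR (a + 1).
    rewrite plus_IZR; apply: (Rmult_lt_reg_r (/ INR q)); first exact: Rinv_0_lt_compat.
    by rewrite -![_ * / INR q]/(_ / INR q); lra.
  have k2 : IZR a < IZR (b + 1).
    rewrite plus_IZR; apply: (Rmult_lt_reg_r (/ INR q)); first exact: Rinv_0_lt_compat.
    by rewrite Rmult_plus_distr_r Rmult_1_l -![_ * / INR q]/(_ / INR q); lra.
  by have := lt_IZR _ _ k1; have := lt_IZR _ _ k2; lia.
have [A|A] := excluded_middle_informative (adjacent q q' a); last first.
  rewrite (ind0 A) Rmult_0_l /cell ind0 // => -[b [hb /only e]].
  by rewrite e in hb.
rewrite (ind1 A) Rmult_1_l; apply: ind_iff; split; last by move=> h; exists a.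
by move=> [b [_ h]]; have e := only b h; rewrite e in h.
Qed.

Lemma cell_RInt a : is_RInt (cell q q' s r) (IZR a / INR q) ((IZR a + 1) / INR q)
  ((r - s) * ind (adjacent q q' a)).
Proof.
have e : (IZR a + 1) / INR q = IZR a / INR q + / INR q by field; lra.
have i0 : 0 < / INR q by apply: Rinv_0_lt_compat.
apply: (is_RInt_ext (fun alpha => scal (ind (adjacent q q' a)) (ind (IZR a / INR q + s < alpha < IZR a / INR q + r)))).
  move=> x; rewrite e Rmin_left; last lra.
  rewrite Rmax_right; last lra.
  by move=> hx; rewrite (@cell_local a) // e.
rewrite Rmult_comm (_ : r - s = (IZR a / INR q + r) - (IZR a / INR q + s)); last ring.
by apply: (is_RInt_scal (V := R_NormedModule)); apply: is_RInt_interval; lra.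
Qed.

Lemma cell_window z n : is_RInt (cell q q' s r) (IZR z / INR q) ((IZR z + INR n) / INR q)
  ((r - s) * (\rsum_(j < n) ind (adjacent q q' (z + Z.of_nat j)))).
Proof.
elim: n => [|n IH].
  rewrite big_ord0 Rmult_0_r Rplus_0_r; exact: is_RInt_point.
rewrite big_ord_recr /= Rmult_plus_distr_l; apply: is_RInt_Chasles IH _.
have := @cell_RInt (z + Z.of_nat n)%Z; rewrite plus_IZR -INR_IZR_INZ S_INR.
by rewrite (_ : IZR z + (INR n + 1) = IZR z + INR n + 1); last ring.
Qed.

Lemma cell_ex_RInt u v : u <= v -> ex_RInt (cell q q' s r) u v.
Proof.
move=> uv; have [h1 h2] := archimed (- u * INR q).
pose z := (- up (- u * INR q))%Z.
have zu : IZR z / INR q <= u.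
  apply: (Rmult_le_reg_r (INR q)) => //.
  rewrite (_ : IZR z / INR q * INR q = IZR z); last by field; lra.
  by rewrite /z opp_IZR; lra.
have [n hn] := INR_unbounded (v * INR q - IZR z).
have vn : v <= (IZR z + INR n) / INR q.
  apply: (Rmult_le_reg_r (INR q)) => //.
  rewrite (_ : (IZR z + INR n) / INR q * INR q = IZR z + INR n); last by field; lra.
  lra.
have ex : ex_RInt (cell q q' s r) (IZR z / INR q) ((IZR z + INR n) / INR q) by eexists; exact: cell_window.
have ex1 : ex_RInt (cell q q' s r) u ((IZR z + INR n) / INR q) by apply: ex_RInt_Chasles_2 ex; lra.
by apply: ex_RInt_Chasles_1 ex1; lra.
Qed.

End Cell.

Definition arc_cell (q q' : nat) : R -> R := cell q q' 0 (/ (INR q * INR q')).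

Lemma arc_cell_range q q' : (0 < q)%N -> (0 < q')%N ->
  0 <= / (INR q * INR q') <= / INR q.
Proof.
move=> q0 q'0; have h := INR_pos q0; have h' : 1 <= INR q' by apply: (@leq_INR 1).
split; first by apply: Rlt_le; apply: Rinv_0_lt_compat; nra.
by apply: Rinv_le_contravar; nra.
Qed.

Lemma arc_cell_ex q q' u v : (0 < q)%N -> (0 < q')%N -> u <= v -> ex_RInt (arc_cell q q') u v.
Proof.
by move=> q0 q'0; have [h1 h2] := arc_cell_range q0 q'0; apply: cell_ex_RInt => //; lra.
Qed.

(** [(q - 1) (q' - 1) >= 0] gives [q q' >= Q - 1 >= Q/2]. *)
Lemma arc_length Q q q' : (1 < Q)%N -> (0 < q)%N -> (0 < q')%N -> (Q <= q + q')%N ->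
  / (INR q * INR q') <= 2 / INR Q.
Proof.
move=> Q1 q0 q'0 h; have := leq_INR h; rewrite plus_INR => h'.
have := @leq_INR 2 Q Q1; rewrite INR2 => h2.
have := @leq_INR 1 q q0; have := @leq_INR 1 q' q'0; rewrite INR_1 => h3 h4.
apply: (Rmult_le_reg_r (INR q * INR q' * INR Q)); first by apply: Rmult_lt_0_compat; nra.
by field_simplify; [nra | lra | lra].
Qed.

(** The least integer not below [x]; [up] is strict, hence the shift by 1. *)
Definition ceil (x : R) : Z := (1 - up (- x))%Z.

Lemma ceilP x : x <= IZR (ceil x) < x + 1.
Proof. by have [h1 h2] := archimed (- x); rewrite /ceil minus_IZR; lra. Qed.

(** Before the next multiple of [1/q] only an arc begun to the left of [beta] can occur, and it ends
    by [beta + 2/Q]. The bound is an integral of the arc indicator rather than a length, because the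
    sum of these integrals over all pairs is small by disjointness. *)
Lemma cell_tail Q q q' s r beta : (1 < Q)%N -> (0 < q)%N -> (0 < q')%N -> (Q <= q + q')%N ->
  0 <= s -> s <= r -> r <= / (INR q * INR q') ->
  0 <= RInt (cell q q' s r) beta (IZR (ceil (beta * INR q)) / INR q)
    <= RInt (arc_cell q q') beta (beta + 2 / INR Q).
Proof.
move=> Q1 q0 q'0 tri s0 sr rr; have Q0 := INR_pos q0.
have [R1 R2] := arc_cell_range q0 q'0.
have al := arc_length Q1 q0 q'0 tri.
set z := ceil (beta * INR q); have [z1 z2] := ceilP (beta * INR q); rewrite -/z in z1 z2.
have d0 : 0 < 2 / INR Q by apply: Rdiv_lt_0_compat; [lra | apply: INR_pos; lia].
have bz : beta <= IZR z / INR q.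
  apply: (Rmult_le_reg_r (INR q)) => //.
  by rewrite (_ : IZR z / INR q * INR q = IZR z); last by field; lra.
have ex : ex_RInt (cell q q' s r) beta (IZR z / INR q) by apply: cell_ex_RInt => //; lra.
split; first by apply: RInt_ge_0 => // x _; case: (ind_bounds (exists a, adjacent q q' a /\ IZR a / INR q + s < x < IZR a / INR q + r)).
have zero x : beta + 2 / INR Q < x < IZR z / INR q -> cell q q' s r x = 0.
  move=> [x1 x2]; have e : IZR (z - 1) = IZR z - 1 by rewrite minus_IZR.
  have l1 : (IZR z - 1) / INR q < beta.
    apply: (Rmult_lt_reg_r (INR q)) => //.
    rewrite (_ : (IZR z - 1) / INR q * INR q = IZR z - 1); last by field; lra.
    lra.
  rewrite (@cell_local q q' s r q0 s0 ltac:(lra) (z - 1)%Z) e; last first.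
    by rewrite (_ : IZR z - 1 + 1 = IZR z); last ring; lra.
  by rewrite (@ind0 (_ < x < _)) ?Rmult_0_r //; lra.
have le x : cell q q' s r x <= arc_cell q q' x by apply: cell_le; lra.
have pos x : 0 <= arc_cell q q' x by case: (ind_bounds (exists a, adjacent q q' a /\ IZR a / INR q + 0 < x < IZR a / INR q + / (INR q * INR q'))).
have [h|h] := Rle_lt_dec (IZR z / INR q) (beta + 2 / INR Q).
  apply: (Rle_trans _ (RInt (arc_cell q q') beta (IZR z / INR q))).
    by apply: RInt_le => //; apply: arc_cell_ex.
  rewrite -(RInt_Chasles (arc_cell q q') beta (IZR z / INR q) (beta + 2 / INR Q)); try by apply: arc_cell_ex.
  have := @RInt_ge_0 (arc_cell q q') (IZR z / INR q) (beta + 2 / INR Q) h (arc_cell_ex q0 q'0 h) (fun x _ => pos x).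
  by rewrite /plus /=; lra.
rewrite -(RInt_Chasles (cell q q' s r) beta (beta + 2 / INR Q)); try by apply: cell_ex_RInt => //; lra.
rewrite (RInt_ext (cell q q' s r) (fun _ => 0) (beta + 2 / INR Q)); last first.
  by move=> x; rewrite Rmin_left ?Rmax_right; try lra; apply: zero.
rewrite RInt_const /scal /= /mult /= Rmult_0_r /plus /= Rplus_0_r.
by apply: RInt_le; [lra | apply: cell_ex_RInt => //; lra | apply: arc_cell_ex => //; lra | by []].
Qed.

(** The least numerator [a] with [a/q >= beta], reduced modulo [q] to become a natural number;
    adjacency depends on the residue only. *)
Definition first_index (beta : R) (q : nat) : nat := Z.to_nat (ceil (beta * INR q) mod Z.of_nat q).
Definition index_count (beta eta : R) (q : nat) : nat :=
  Z.to_nat (ceil ((beta + eta) * INR q) - ceil (beta * INR q)).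

Lemma index_countE beta eta q : 0 <= eta ->
  IZR (ceil ((beta + eta) * INR q)) = IZR (ceil (beta * INR q)) + INR (index_count beta eta q).
Proof.
move=> e0; have q0 := pos_INR q.
have [a1 a2] := ceilP (beta * INR q); have [b1 b2] := ceilP ((beta + eta) * INR q).
have h : (ceil (beta * INR q) <= ceil ((beta + eta) * INR q))%Z.
  have : IZR (ceil (beta * INR q)) < IZR (ceil ((beta + eta) * INR q) + 1) by rewrite plus_IZR; nra.
  by move/lt_IZR; lia.
rewrite /index_count (INR_IZR_INZ (Z.to_nat _)) Z2Nat.id; last lia.
by rewrite minus_IZR; ring.
Qed.

Lemma index_count_bounds beta eta q : 0 <= eta <= 1 ->
  (index_count beta eta q <= q)%N /\ Rabs (INR (index_count beta eta q) - eta * INR q) <= 1.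
Proof.
move=> [e0 e1]; have q0 := pos_INR q; have E := index_countE beta q e0.
have [a1 a2] := ceilP (beta * INR q); have [b1 b2] := ceilP ((beta + eta) * INR q).
split; last by split_Rabs; lra.
have : INR (index_count beta eta q) < INR q.+1 by rewrite S_INR; nra.
by move/INR_lt; lia.
Qed.

Lemma adjacent_dvdn beta q q' j : (0 < q)%N ->
  ind (adjacent q q' (ceil (beta * INR q) + Z.of_nat j)) =
  (if (q %| q' * (first_index beta q + j) + 1)%N then 1 else 0)%R.
Proof.
move=> q0; set z := ceil _; rewrite /first_index -/z.
have qz : (0 < Z.of_nat q)%Z by lia.
have [m1 m2] := Z.mod_pos_bound z _ qz; have dm := Z.div_mod z (Z.of_nat q) ltac:(lia).
set c := Z.to_nat _; have cE : Z.of_nat c = (z mod Z.of_nat q)%Z by rewrite /c Z2Nat.id.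
case: (boolP (q %| _)%N) => [/dvdnP[k hk]|h].
  apply: ind1; exists (Z.of_nat k + (z / Z.of_nat q) * Z.of_nat q')%Z.
  have : (Z.of_nat q' * (z mod Z.of_nat q + Z.of_nat j) + 1 = Z.of_nat k * Z.of_nat q)%Z by rewrite -cE; lia.
  by nia.
apply: ind0 => -[a' ha]; apply: (negP h).
have e : (Z.of_nat q' * (Z.of_nat c + Z.of_nat j) + 1 = (a' - (z / Z.of_nat q) * Z.of_nat q') * Z.of_nat q)%Z by rewrite cE; nia.
apply/dvdnP; exists (Z.to_nat (a' - (z / Z.of_nat q) * Z.of_nat q')).
have k0 : (0 <= a' - (z / Z.of_nat q) * Z.of_nat q')%Z by nia.
by apply: Nat2Z.inj; rewrite [in RHS]Nat2Z.inj_mul Z2Nat.id // -e; lia.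
Qed.

Lemma cell_integral Q q q' s r beta eta : (1 < Q)%N -> (0 < q)%N -> (0 < q')%N -> (Q <= q + q')%N ->
  0 <= s -> s <= r -> r <= / (INR q * INR q') -> 0 <= eta ->
  Rabs (RInt (cell q q' s r) beta (beta + eta) -
        (r - s) * window_count (first_index beta) (index_count beta eta) q q')
  <= RInt (arc_cell q q') beta (beta + 2 / INR Q) +
     RInt (arc_cell q q') (beta + eta) (beta + eta + 2 / INR Q).
Proof.
move=> Q1 q0 q'0 tri s0 sr rr e0.
have t1 := cell_tail beta Q1 q0 q'0 tri s0 sr rr.
have t2 := cell_tail (beta + eta) Q1 q0 q'0 tri s0 sr rr.
have [_ R2] := arc_cell_range q0 q'0; have Q0 := INR_pos q0.
set z0 := ceil (beta * INR q) in t1 *; set z1 := ceil ((beta + eta) * INR q) in t2 *.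
have zz : IZR z1 = IZR z0 + INR (index_count beta eta q) by exact: index_countE.
have W : RInt (cell q q' s r) (IZR z0 / INR q) (IZR z1 / INR q) =
   (r - s) * window_count (first_index beta) (index_count beta eta) q q'.
  rewrite zz; apply: is_RInt_unique.
  rewrite (_ : window_count _ _ _ _ = \rsum_(j < index_count beta eta q) ind (adjacent q q' (z0 + Z.of_nat j))).
    by apply: cell_window => //; lra.
  by apply: eq_bigr => j _; rewrite adjacent_dvdn.
have b0 : beta <= IZR z0 / INR q.
  have [h _] := ceilP (beta * INR q); apply: (Rmult_le_reg_r (INR q)) => //.
  by rewrite (_ : IZR z0 / INR q * INR q = IZR z0); last by field; lra.
have b1 : beta + eta <= IZR z1 / INR q.
  have [h _] := ceilP ((beta + eta) * INR q); apply: (Rmult_le_reg_r (INR q)) => //.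
  by rewrite (_ : IZR z1 / INR q * INR q = IZR z1); last by field; lra.
have b2 : IZR z0 / INR q <= IZR z1 / INR q.
  apply: Rmult_le_compat_r; first by apply: Rlt_le; apply: Rinv_0_lt_compat.
  by rewrite zz; have := pos_INR (index_count beta eta q); lra.
have ex u v : u <= v -> ex_RInt (cell q q' s r) u v by apply: cell_ex_RInt => //; lra.
have := RInt_Chasles (cell q q' s r) beta (IZR z0 / INR q) (IZR z1 / INR q) (ex _ _ b0) (ex _ _ b2).
rewrite -(RInt_Chasles (cell q q' s r) beta (beta + eta) (IZR z1 / INR q)); [|by apply: ex; lra|exact: ex].
by rewrite W /plus /= => E; split_Rabs; lra.
Qed.

Definition tri_sum (Q : nat) (f : nat -> nat -> R) : R :=
  \rsum_(q < Q) \rsum_(q' < Q | in_triangle Q q q') f q q'.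

Lemma in_triangleP Q q q' : in_triangle Q q q' -> (q' < Q)%N -> (q < Q)%N ->
  [/\ (0 < q)%N, (0 < q')%N & (Q <= q + q')%N].
Proof. by rewrite /in_triangle => /andP[h1 h2] h3 h4; split=> //; lia. Qed.

Lemma tri_sum_le Q f g : (forall q q', (q < Q)%N -> (q' < Q)%N -> in_triangle Q q q' -> f q q' <= g q q') ->
  tri_sum Q f <= tri_sum Q g.
Proof. by move=> h; apply: rsum_le => q _; apply: rsum_le => q' t; apply: h. Qed.

Lemma tri_sum_ext Q f g : (forall q q', (q < Q)%N -> (q' < Q)%N -> in_triangle Q q q' -> f q q' = g q q') ->
  tri_sum Q f = tri_sum Q g.
Proof. by move=> h; apply: eq_bigr => q _; apply: eq_bigr => q' t; apply: h. Qed.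

Lemma tri_sumD Q f g : tri_sum Q (fun q q' => f q q' + g q q') = tri_sum Q f + tri_sum Q g.
Proof. by rewrite /tri_sum -big_split; apply: eq_bigr => q _; rewrite -big_split. Qed.

Lemma tri_sumB Q f g : tri_sum Q (fun q q' => f q q' - g q q') = tri_sum Q f - tri_sum Q g.
Proof. by rewrite /tri_sum -rsumB; apply: eq_bigr => q _; rewrite -rsumB. Qed.

Lemma tri_sum_Rabs Q f : Rabs (tri_sum Q f) <= tri_sum Q (fun q q' => Rabs (f q q')).
Proof.
apply: Rle_trans (rsum_Rabs _ _ _) _; apply: rsum_le => q _; exact: rsum_Rabs.
Qed.

Lemma tri_sum_single Q f k k' : (k < Q)%N -> (k' < Q)%N -> in_triangle Q k k' ->
  (forall q q', (q < Q)%N -> (q' < Q)%N -> in_triangle Q q q' -> (q, q') <> (k, k') -> f q q' = 0) ->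
  tri_sum Q f = f k k'.
Proof.
move=> kQ k'Q t h.
rewrite /tri_sum (bigD1 (Ordinal kQ)) //= [X in _ + X]big1 ?Rplus_0_r; last first.
  move=> q qk; apply: big1 => q' tq; apply: h => // -[e _].
  by move/eqP: qk; apply; apply: val_inj.
rewrite (bigD1 (Ordinal k'Q)) //= [X in _ + X]big1 ?Rplus_0_r // => q' /andP[tq qk]; apply: h => // -[e].
by move/eqP: qk; apply; apply: val_inj.
Qed.

Lemma is_RInt_rsum n (P : pred nat) (f : nat -> R -> R) (v : nat -> R) a b :
  (forall i, (i < n)%N -> P i -> is_RInt (f i) a b (v i)) ->
  is_RInt (fun x => \rsum_(i < n | P i) f i x) a b (\rsum_(i < n | P i) v i).
Proof.
elim: n => [|n IH] h.
  rewrite big_ord0; apply: (is_RInt_ext (fun _ => 0)); first by move=> x _; rewrite big_ord0.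
  by have := is_RInt_const a b 0; rewrite /scal /= /mult /= Rmult_0_r.
rewrite big_mkcond big_ord_recr -big_mkcond /=.
apply: (is_RInt_ext (fun x => (\rsum_(i < n | P i) f i x) + (if P n then f n x else 0))).
  by move=> x _; rewrite [RHS]big_mkcond big_ord_recr -big_mkcond.
apply: (is_RInt_plus (V := R_NormedModule)); first by apply: IH => i hi; apply: h; apply: ltnW.
case: (boolP (P n)) => hn; first by apply: h.
by have := is_RInt_const a b 0; rewrite /scal /= /mult /= Rmult_0_r.
Qed.

Lemma is_RInt_tri_sum Q (f : nat -> nat -> R -> R) v a b :
  (forall q q', (q < Q)%N -> (q' < Q)%N -> in_triangle Q q q' -> is_RInt (f q q') a b (v q q')) ->
  is_RInt (fun x => tri_sum Q (fun q q' => f q q' x)) a b (tri_sum Q v).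
Proof.
move=> h; apply: (is_RInt_rsum (P := xpredT)
  (f := fun q x => \rsum_(q' < Q | in_triangle Q q q') f q q' x)
  (v := fun q => \rsum_(q' < Q | in_triangle Q q q') v q q')) => q qQ _.
by apply: (is_RInt_rsum (P := fun q' => in_triangle Q q q')) => q' q'Q t; apply: h.
Qed.

Lemma arc_cellP q q' alpha : (0 < q)%N -> (0 < q')%N -> arc_cell q q' alpha <> 0 ->
  exists a a', [/\ (a' * Z.of_nat q - a * Z.of_nat q' = 1)%Z, 0 < INR q * alpha - IZR a
    & 0 < IZR a' - INR q' * alpha].
Proof.
move=> q0 q'0; rewrite /arc_cell /cell /ind.
destruct (excluded_middle_informative _) as [[a [[a' e] [h1 h2]]]|] => // _.
have Q0 := INR_pos q0; have Q'0 := INR_pos q'0; exists a, a'; split=> //.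
  have := Rmult_lt_compat_l _ _ _ Q0 h1; rewrite Rplus_0_r.
  by rewrite (_ : INR q * (IZR a / INR q) = IZR a); [lra | field; lra].
have := Rmult_lt_compat_l _ _ _ Q'0 h2.
have eR : IZR a' * INR q - IZR a * INR q' = 1 by rewrite !INR_IZR_INZ -!mult_IZR -minus_IZR e.
rewrite (_ : INR q' * (IZR a / INR q + / (INR q * INR q')) = IZR a'); first lra.
have -> : IZR a' = (1 + IZR a * INR q') / INR q by rewrite -eR; field; lra.
by field; lra.
Qed.

Lemma arc_cell_unique Q alpha q q' a a' k k' : (q < Q)%N -> (q' < Q)%N -> in_triangle Q q q' ->
  (a' * Z.of_nat q - a * Z.of_nat q' = 1)%Z -> 0 < INR q * alpha - IZR a -> 0 < IZR a' - INR q' * alpha ->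
  (k < Q)%N -> (k' < Q)%N -> in_triangle Q k k' -> (k, k') <> (q, q') -> arc_cell k k' alpha = 0.
Proof.
move=> qQ q'Q t e h1 h2 kQ k'Q tk ne.
have [//|nz] := Req_dec (arc_cell k k' alpha) 0.
have [q0 q'0 tri] := in_triangleP t q'Q qQ; have [k0 k'0 tri'] := in_triangleP tk k'Q kQ.
have [b [b' [e' g1 g2]]] := arc_cellP k0 k'0 nz.
have [E1 [E2 _]] : k = q /\ k' = q' /\ b = a /\ b' = a'.
  by apply: (@arc_unique alpha Q.-1 k k' b b' q q' a a') => //; try (apply/andP; split); lia.
by case: ne; rewrite E1 E2.
Qed.

(** The open arcs of one dissection are pairwise disjoint. *)
Lemma arc_cell_sum Q alpha : tri_sum Q (fun q q' => arc_cell q q' alpha) <= 1.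
Proof.
have [[k [k' [kQ k'Q t nz]]]|no] := excluded_middle_informative
  (exists k k', [/\ (k < Q)%N, (k' < Q)%N, in_triangle Q k k' & arc_cell k k' alpha <> 0]).
  have [k0 k'0 tri] := in_triangleP t k'Q kQ; have [a [a' [e g1 g2]]] := arc_cellP k0 k'0 nz.
  rewrite (tri_sum_single kQ k'Q t); first by case: (ind_bounds (exists a, adjacent k k' a /\ IZR a / INR k + 0 < alpha < IZR a / INR k + / (INR k * INR k'))).
  by move=> q q' qQ q'Q tq; apply: (arc_cell_unique kQ k'Q t e g1 g2).
rewrite (@tri_sum_ext _ _ (fun _ _ => 0)); first by rewrite /tri_sum big1; [lra | move=> q _; rewrite big1].
move=> q q' qQ q'Q t; have [//|nz] := Req_dec (arc_cell q q' alpha) 0.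
by case: no; exists q, q'.
Qed.

Lemma arc_cell_sum_RInt Q u : (1 < Q)%N ->
  tri_sum Q (fun q q' => RInt (arc_cell q q') u (u + 2 / INR Q)) <= 2 / INR Q.
Proof.
move=> Q1; have d0 : 0 < 2 / INR Q by apply: Rdiv_lt_0_compat; [lra | apply: INR_pos; lia].
have I : is_RInt (fun x => tri_sum Q (fun q q' => arc_cell q q' x)) u (u + 2 / INR Q)
  (tri_sum Q (fun q q' => RInt (arc_cell q q') u (u + 2 / INR Q))).
  apply: is_RInt_tri_sum => q q' qQ q'Q t; have [q0 q'0 _] := in_triangleP t q'Q qQ.
  by apply: RInt_correct; apply: arc_cell_ex => //; lra.
have C := is_RInt_const u (u + 2 / INR Q) 1.
have := is_RInt_le _ _ _ _ _ _ _ I C _; rewrite /scal /= /mult /=.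
rewrite (_ : (u + 2 / INR Q - u) * 1 = 2 / INR Q); last ring.
by apply; [lra | move=> x _; apply: arc_cell_sum].
Qed.

(** Each end of the interval costs the integral of all arc indicators over a length [2/Q], which is
    at most [2/Q] in total. *)
Theorem cell_sum_integral Q (w s r : nat -> nat -> R) beta eta : (1 < Q)%N -> 0 <= eta ->
  (forall q q', (q < Q)%N -> (q' < Q)%N -> in_triangle Q q q' ->
    [/\ 0 <= w q q' <= 1, 0 <= s q q', s q q' <= r q q' & r q q' <= / (INR q * INR q')]) ->
  exists2 v, is_RInt (fun x => tri_sum Q (fun q q' => w q q' * cell q q' (s q q') (r q q') x)) beta (beta + eta) v &
    Rabs (v - tri_sum Q (fun q q' => w q q' * (r q q' - s q q') *
       window_count (first_index beta) (index_count beta eta) q q')) <= 4 / INR Q.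
Proof.
move=> Q1 e0 h; exists (tri_sum Q (fun q q' => w q q' * RInt (cell q q' (s q q') (r q q')) beta (beta + eta))).
  apply: is_RInt_tri_sum => q q' qQ q'Q t; have [q0 q'0 _] := in_triangleP t q'Q qQ.
  have [hw s0 sr rr] := h q q' qQ q'Q t; have [_ R2] := arc_cell_range q0 q'0.
  apply: (is_RInt_scal (V := R_NormedModule)); apply: RInt_correct.
  by apply: cell_ex_RInt => //; lra.
rewrite -tri_sumB; apply: Rle_trans (tri_sum_Rabs _ _) _.
apply: (Rle_trans _ (tri_sum Q (fun q q' => RInt (arc_cell q q') beta (beta + 2 / INR Q) +
     RInt (arc_cell q q') (beta + eta) (beta + eta + 2 / INR Q)))); last first.
  rewrite tri_sumD; have := arc_cell_sum_RInt beta Q1; have := arc_cell_sum_RInt (beta + eta) Q1.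
  by rewrite /Rdiv; lra.
apply: tri_sum_le => q q' qQ q'Q t; have [q0 q'0 tri] := in_triangleP t q'Q qQ.
have [hw s0 sr rr] := h q q' qQ q'Q t.
have C := cell_integral beta Q1 q0 q'0 tri s0 sr rr e0.
rewrite Rmult_assoc -Rmult_minus_distr_l Rabs_mult (Rabs_pos_eq (w q q')); last lra.
apply: Rle_trans C; set X := Rabs _; have : 0 <= X by exact: Rabs_pos.
by nra.
Qed.

End Cells.

(** * The integral of the proportion of gaps *)

Module GapIntegral.
Import ZArith.
Import Coquelicot.Coquelicot.
Import all_boot.
Import zify.
Import Sums Average Kernel Gaps Kernels KernelValues ClosedForm Cells.
Set Implicit Arguments. Unset Strict Implicit. Unset Printing Implicit Defensive.
Local Open Scope general_if_scope.
Open Scope R_scope.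
Local Arguments INR : simpl never.

Definition valid_weights (Q : nat) (w s r : nat -> nat -> R) : Prop :=
  forall q q', (q < Q)%N -> (q' < Q)%N -> in_triangle Q q q' ->
    [/\ 0 <= w q q' <= 1, 0 <= s q q', s q q' <= r q q' & r q q' <= / (INR q * INR q')].

Definition cell_sum (Q : nat) (w s r : nat -> nat -> R) (alpha : R) : R :=
  tri_sum Q (fun q q' => w q q' * cell q q' (s q q') (r q q') alpha).

Section Weights.
Variables (lam : R) (Q : nat).
Let L := lam / INR Q.
Let t := / lam.
Let nx (q : nat) := INR q / INR Q.

Definition full (q q' : nat) : R := / (INR q * INR q').
Definition weightA (q _ : nat) : R := (INR Q - INR q) / INR Q.
Definition weightC (q q' : nat) : R := (INR q + INR q' - INR Q) / INR Q.
Definition endA (q q' : nat) : R := Rmin (L / INR q) (full q q').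
(** When [x < 1/lam < y], the relation [q (A + B) = 1 - (q' - q) A] turns [A + B < lam/Q] into a
    lower bound for [A]; division by [q] makes it a distance from [a/q]. Otherwise the start is
    [full] and the piece is empty. *)
Definition startC (q q' : nat) : R :=
  if Rlt_dec (nx q) t then if Rle_dec (nx q') t then full q q' else (/ INR q - L) / (INR q' - INR q)
  else full q q'.
Definition endD (q q' : nat) : R :=
  if Rle_dec t (nx q) then if Rle_dec t (nx q') then full q q' else 0 else 0.

(* The terms attached to the left end of each arc; those attached to the right end are
   the same terms at [- alpha], because reflection exchanges the two ends. *)
Definition left_part (alpha : R) : R :=
  cell_sum Q weightA (fun _ _ => 0) endA alpha + cell_sum Q weightC startC full alpha.

Definition short_gaps (alpha : R) : R :=
  left_part alpha + left_part (- alpha) + cell_sum Q weightC (fun _ _ => 0) endD alpha.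

Hypotheses (lam0 : 0 < lam) (Q1 : (1 < Q)%N).

Let Qp : 0 < INR Q. Proof. by apply: INR_pos; lia. Qed.

Lemma nx_lt q : nx q < t <-> INR q * L < 1.
Proof.
have e : INR q * L = lam * nx q by rewrite /L /nx; field; lra.
rewrite e /t; split=> h.
  by have := Rmult_lt_compat_l _ _ _ lam0 h; rewrite Rinv_r; lra.
by apply: (Rmult_lt_reg_l lam) => //; rewrite Rinv_r; lra.
Qed.

Lemma nx_gt q : t < nx q <-> 1 < INR q * L.
Proof.
have e : INR q * L = lam * nx q by rewrite /L /nx; field; lra.
rewrite e /t; split=> h.
  by have := Rmult_lt_compat_l _ _ _ lam0 h; rewrite Rinv_r; lra.
by apply: (Rmult_lt_reg_l lam) => //; rewrite Rinv_r; lra.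
Qed.

Lemma weights_triangle q q' : (q < Q)%N -> (q' < Q)%N -> in_triangle Q q q' ->
  [/\ 1 <= INR q <= INR Q, 1 <= INR q' <= INR Q, INR Q <= INR q + INR q' & 0 < full q q'].
Proof.
move=> qQ q'Q t0; have [q0 q'0 tri] := in_triangleP t0 q'Q qQ.
have h1 := @leq_INR 1 q q0; have h2 := @leq_INR 1 q' q'0; rewrite INR_1 in h1 h2.
have h3 := leq_INR (ltnW qQ); have h4 := leq_INR (ltnW q'Q); have h5 := leq_INR tri.
rewrite plus_INR in h5; split=> //.
by apply: Rinv_0_lt_compat; nra.
Qed.

Lemma weightA_bounds q q' : (q < Q)%N -> (q' < Q)%N -> in_triangle Q q q' -> 0 <= weightA q q' <= 1.
Proof.
move=> h1 h2 h3; have [g1 g2 g3 _] := weights_triangle h1 h2 h3; rewrite /weightA.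
split; first by apply: Rmult_le_pos; [lra | apply: Rlt_le; apply: Rinv_0_lt_compat].
by apply: (Rmult_le_reg_r (INR Q)) => //; field_simplify; lra.
Qed.

Lemma weightC_bounds q q' : (q < Q)%N -> (q' < Q)%N -> in_triangle Q q q' -> 0 <= weightC q q' <= 1.
Proof.
move=> h1 h2 h3; have [g1 g2 g3 _] := weights_triangle h1 h2 h3; rewrite /weightC.
split; first by apply: Rmult_le_pos; [lra | apply: Rlt_le; apply: Rinv_0_lt_compat].
by apply: (Rmult_le_reg_r (INR Q)) => //; field_simplify; lra.
Qed.

Lemma valid_A : valid_weights Q weightA (fun _ _ => 0) endA.
Proof.
move=> q q' h1 h2 h3; have [g1 g2 g3 g4] := weights_triangle h1 h2 h3.
split; [exact: weightA_bounds | lra | | exact: Rmin_r].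
apply: Rmin_glb; last lra.
by apply: Rlt_le; apply: Rdiv_lt_0_compat; [apply: Rdiv_lt_0_compat | lra].
Qed.

Lemma valid_C : valid_weights Q weightC startC full.
Proof.
move=> q q' h1 h2 h3; have [g1 g2 g3 g4] := weights_triangle h1 h2 h3.
have [B0 B1] : 0 <= startC q q' <= full q q'; last by split; [exact: weightC_bounds | lra | lra | exact: Rle_refl].
rewrite /startC; destruct (Rlt_dec (nx q) t) as [a1|a1]; last lra.
destruct (Rle_dec (nx q') t) as [a2|a2]; first lra.
have b1 := proj1 (nx_lt q) a1; have b2 := proj1 (nx_gt q') ltac:(lra).
have L0 : 0 < L by apply: Rdiv_lt_0_compat.
have qq : INR q < INR q' by nra.
have i1 : / INR q - L = (1 - INR q * L) / INR q by field; lra.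
split.
  by rewrite i1; apply: Rlt_le; apply: Rdiv_lt_0_compat; [apply: Rdiv_lt_0_compat | ]; lra.
rewrite /full; apply: (Rmult_le_reg_r ((INR q' - INR q) * (INR q * INR q'))); first by apply: Rmult_lt_0_compat; nra.
rewrite i1; field_simplify; [nra | nra | nra].
Qed.

Lemma valid_D : valid_weights Q weightC (fun _ _ => 0) endD.
Proof.
move=> q q' h1 h2 h3; have [g1 g2 g3 g4] := weights_triangle h1 h2 h3.
have [B0 B1] : 0 <= endD q q' <= full q q'; last by split; [exact: weightC_bounds | lra | lra | exact: B1].
by rewrite /endD; destruct (Rle_dec t (nx q)), (Rle_dec t (nx q')); lra.
Qed.

Section Arc.
Variables (alpha : R) (q q' : nat) (a a' : Z).
Hypotheses (qQ : (q < Q)%N) (q'Q : (q' < Q)%N) (tri : in_triangle Q q q').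
Hypothesis det : (a' * Z.of_nat q - a * Z.of_nat q' = 1)%Z.
Let A := INR q * alpha - IZR a.
Let B := IZR a' - INR q' * alpha.
Hypotheses (A0 : 0 < A) (B0 : 0 < B).

Lemma arc_relation : INR q * B + INR q' * A = 1.
Proof.
have eR : IZR a' * INR q - IZR a * INR q' = 1 by rewrite !INR_IZR_INZ -!mult_IZR -minus_IZR det.
by rewrite /A /B; lra.
Qed.

(** Inside an arc the cells of all other pairs vanish, and the distance from [a/q] is [A/q]. *)
Lemma cell_sum_arc w s r : valid_weights Q w s r ->
  cell_sum Q w s r alpha = w q q' * ind (INR q * s q q' < A < INR q * r q q').
Proof.
move=> V; have [g1 g2 g3 g4] := weights_triangle qQ q'Q tri.
rewrite /cell_sum (tri_sum_single qQ q'Q tri); last first.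
  move=> k k' kQ k'Q tk ne; have [w1 s1 s2 s3] := V k k' kQ k'Q tk.
  have z := arc_cell_unique qQ q'Q tri det A0 B0 kQ k'Q tk ne.
  have le := @cell_le k k' (s k k') (r k k') 0 _ alpha s1 s3; rewrite -/(arc_cell k k' alpha) z in le.
  have := ind_bounds (exists a, adjacent k k' a /\ IZR a / INR k + s k k' < alpha < IZR a / INR k + r k k').
  by rewrite -/(cell k k' (s k k') (r k k') alpha) => ge; rewrite (_ : cell _ _ _ _ _ = 0) ?Rmult_0_r; lra.
have [w1 s1 s2 s3] := V q q' qQ q'Q tri; have [q0 q'0 _] := in_triangleP tri q'Q qQ.
have [_ R2] := arc_cell_range q0 q'0; have rel := arc_relation.
have A1 : A < 1 by nra.
have e : alpha = (IZR a + A) / INR q by rewrite /A; field; lra.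
have rq : r q q' <= / INR q by lra.
congr (_ * _); rewrite (@cell_local q q' _ _ q0 s1 rq a); last first.
  by rewrite {1 2}e; split; apply: Rmult_lt_compat_r; try lra; apply: Rinv_0_lt_compat; lra.
rewrite ind1 ?Rmult_1_l; last by exists a'.
have e1 z : IZR a / INR q + z < alpha <-> INR q * z < A.
  rewrite (_ : A = INR q * (alpha - IZR a / INR q)); last by rewrite /A; field; lra.
  by split=> h; [apply: Rmult_lt_compat_l; lra | have := Rmult_lt_reg_l (INR q) z _ ltac:(lra) h; lra].
have e2 z : alpha < IZR a / INR q + z <-> A < INR q * z.
  rewrite (_ : A = INR q * (alpha - IZR a / INR q)); last by rewrite /A; field; lra.
  by split=> h; [apply: Rmult_lt_compat_l; lra | have := Rmult_lt_reg_l (INR q) _ z ltac:(lra) h; lra].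
by apply: ind_iff; rewrite e1 e2.
Qed.

Lemma left_part_arc : left_part alpha =
  weightA q q' * ind (A < L) + weightC q q' * ind (nx q < t /\ t < nx q' /\ A + B < L).
Proof.
have [g1 g2 g3 g4] := weights_triangle qQ q'Q tri; have rel := arc_relation.
have Af : A < INR q * full q q'.
  rewrite (_ : INR q * full q q' = / INR q'); last by rewrite /full; field; lra.
  by apply: (Rmult_lt_reg_l (INR q')); [lra | rewrite Rinv_r; nra].
rewrite /left_part (cell_sum_arc valid_A) (cell_sum_arc valid_C); congr (_ * _ + _ * _); apply: ind_iff.
  rewrite /endA Rmult_0_r; have e : INR q * (L / INR q) = L by field; lra.
  rewrite /Rmin; destruct (Rle_dec (L / INR q) (full q q')) as [c|c]; first by rewrite e; lra.
  have : INR q * full q q' < INR q * (L / INR q) by apply: Rmult_lt_compat_l; lra.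
  by rewrite e; lra.
rewrite /startC; destruct (Rlt_dec (nx q) t) as [a1|a1]; last lra.
destruct (Rle_dec (nx q') t) as [a2|a2]; first lra.
have b1 := proj1 (nx_lt q) a1; have b2 := proj1 (nx_gt q') ltac:(lra).
have L0 : 0 < L by apply: Rdiv_lt_0_compat.
have qq : INR q < INR q' by nra.
have e : (INR q' - INR q) * (INR q * ((/ INR q - L) / (INR q' - INR q))) = 1 - INR q * L by field; lra.
have e' : INR q * (A + B) = 1 - (INR q' - INR q) * A by lra.
split.
  move=> [h _]; split=> //; split; first lra.
  have := Rmult_lt_compat_l (INR q' - INR q) _ _ ltac:(lra) h; rewrite e => h'.
  by apply: (Rmult_lt_reg_l (INR q)); lra.
move=> [_ [_ h]]; split=> //.
have := Rmult_lt_compat_l (INR q) _ _ ltac:(lra) h; rewrite e' => h'.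
by apply: (Rmult_lt_reg_l (INR q' - INR q)); lra.
Qed.

Lemma part_D_arc : cell_sum Q weightC (fun _ _ => 0) endD alpha =
  weightC q q' * ind (t <= nx q /\ t <= nx q').
Proof.
have [g1 g2 g3 g4] := weights_triangle qQ q'Q tri; have rel := arc_relation.
have Af : A < INR q * full q q'.
  rewrite (_ : INR q * full q q' = / INR q'); last by rewrite /full; field; lra.
  by apply: (Rmult_lt_reg_l (INR q')); [lra | rewrite Rinv_r; nra].
rewrite (cell_sum_arc valid_D); congr (_ * _); apply: ind_iff; rewrite /endD Rmult_0_r.
by destruct (Rle_dec t (nx q)), (Rle_dec t (nx q')); lra.
Qed.

End Arc.

Lemma gap_frac_short (alpha : R) : (forall (k : nat) (z : Z), (0 < k < Q)%N -> INR k * alpha <> IZR z) ->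
  gap_frac lam Q alpha = 1 - short_gaps alpha.
Proof.
move=> gen.
have [q [q' [a [a' [h1 [h2 [h3 [det [A0 B0]]]]]]]]] := @arc_exists alpha Q.-1 ltac:(lia)
  ltac:(move=> k z hk; apply: gen; apply/andP; split; lia).
have qQ : (q < Q)%N by lia.
have q'Q : (q' < Q)%N by lia.
have tri : in_triangle Q q q' by rewrite /in_triangle; apply/andP; split; lia.
have tri' : in_triangle Q q' q by rewrite /in_triangle; apply/andP; split; lia.
have [g1 g2 g3 g4] := weights_triangle qQ q'Q tri; have rel := arc_relation alpha det.
rewrite (@gap_frac_arc alpha Q q q' a a' ltac:(lia) ltac:(lia) ltac:(lia) ltac:(lia) ltac:(lia) det A0 B0 lam).
rewrite -/L /short_gaps (left_part_arc qQ q'Q tri det A0 B0) (part_D_arc qQ q'Q tri det A0 B0).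
have det' : (- a * Z.of_nat q' - (- a') * Z.of_nat q = 1)%Z by lia.
have Aeq : INR q' * (- alpha) - IZR (- a') = IZR a' - INR q' * alpha by rewrite opp_IZR; ring.
have Beq : IZR (- a) - INR q * (- alpha) = INR q * alpha - IZR a by rewrite opp_IZR; ring.
rewrite (@left_part_arc (- alpha) q' q (- a')%Z (- a)%Z q'Q qQ tri' det' ltac:(lra) ltac:(lra)).
rewrite Aeq Beq; set A := INR q * alpha - IZR a in A0 rel *; set B := IZR a' - INR q' * alpha in B0 rel *.
have gE z : ge_indicator L z = 1 - ind (z < L).
  rewrite /ge_indicator; destruct (Rle_dec L z); [rewrite ind0 | rewrite ind1]; lra.
rewrite !gE /weightA /weightC minus_INR; last lia.
rewrite minus_INR; last lia.
rewrite minus_INR ?plus_INR; last lia.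
rewrite (Rplus_comm B A).
have n1 := nx_lt q; have n2 := nx_lt q'; have n3 := nx_gt q; have n4 := nx_gt q'.
have L0 : 0 < L by apply: Rdiv_lt_0_compat.
(* [A + B] lies between [1/q] and [1/q']. If both are at most [L] the gap is short, if both are at
   least [L] it is not, and otherwise one of the two one-sided terms decides. Equal denominators
   force [q = q' = 1] and [Q = 2], where the weight vanishes. *)
have key : (INR q + INR q' - INR Q) * (ind (nx q < t /\ t < nx q' /\ A + B < L) +
   ind (nx q' < t /\ t < nx q /\ A + B < L) + ind (t <= nx q /\ t <= nx q')) =
   (INR q + INR q' - INR Q) * ind (A + B < L).
  have s1 : INR q * (A + B) = 1 - (INR q' - INR q) * A by lra.
  have s2 : INR q' * (A + B) = 1 - (INR q - INR q') * B by lra.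
  have low : INR q * L <= 1 -> INR q' * L <= 1 -> L <= A + B.
    by move=> k1 k2; have [c|c] := Rle_lt_dec (INR q) (INR q'); nra.
  have high : 1 <= INR q * L -> 1 <= INR q' * L -> INR q <> INR q' -> A + B < L.
    by move=> k1 k2 ne; have [c|c] := Rle_lt_dec (INR q) (INR q'); nra.
  have same : INR q = INR q' -> INR q + INR q' - INR Q = 0.
    move=> /INR_eq e; rewrite -e in det h3 *.
    have q1 : q = 1%N.
      have : Z.of_nat q = 1%Z; last lia.
      by apply: Z.divide_1_r_nonneg; [lia | exists (a' - a)%Z; lia].
    by rewrite q1 (_ : Q = 2%N) ?INR2 ?INR_1; [ring | lia].
  have [c1|c1] := Rlt_le_dec (nx q) t; have [c2|c2] := Rlt_le_dec (nx q') t.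
  - rewrite !ind0; [ring | | lra | lra | lra].
    by have := low ltac:(lra) ltac:(lra); lra.
  - have d1 := proj1 n1 c1; rewrite (@ind0 (_ <= _ /\ _ <= _)); last lra.
    rewrite (@ind0 (nx q' < _ /\ _)); last lra.
    rewrite (@ind_iff (_ /\ _ /\ _) (A + B < L)); first ring.
    split; first by case=> _ [].
    move=> h; split=> //; split=> //.
    have [//|c3] := Rlt_le_dec t (nx q').
    have : ~ 1 < INR q' * L by move/n4; lra.
    by have := low ltac:(lra); lra.
  - have d1 := proj1 n2 c2; rewrite (@ind0 (_ <= _ /\ _ <= _)); last lra.
    rewrite (@ind0 (nx q < _ /\ _)); last lra.
    rewrite (@ind_iff (_ /\ _ /\ _) (A + B < L)); first ring.
    split; first by case=> _ [].
    move=> h; split=> //; split=> //.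
    have [//|c3] := Rlt_le_dec t (nx q).
    have : ~ 1 < INR q * L by move/n3; lra.
    by move=> k; have := low ltac:(lra) ltac:(lra); lra.
  - have k1 : ~ INR q * L < 1 by move/n1; lra.
    have k2 : ~ INR q' * L < 1 by move/n2; lra.
    rewrite (@ind1 (_ <= _ /\ _ <= _)) // !(@ind0 (_ /\ _ /\ _)); try lra.
    have [/same -> |ne] := Req_dec (INR q) (INR q'); first ring.
    by rewrite (@ind1 (A + B < L)); [ring | apply: high; lra].
move: key; set i1 := ind (nx q < t /\ _); set i2 := ind (nx q' < t /\ _); set i3 := ind (_ <= _ /\ _).
set j1 := ind (A < L); set j2 := ind (B < L); set j3 := ind (A + B < L) => key.
apply: (Rmult_eq_reg_r (INR Q)); last lra.
rewrite (_ : _ / INR Q * INR Q = INR Q - ((INR Q - INR q) * j1 + (INR Q - INR q') * j2 + (INR q + INR q' - INR Q) * j3)).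
  rewrite -key; field; lra.
by field; lra.
Qed.

End Weights.

Lemma kernel_zero : kernel (fun _ _ => 0) 0.
Proof.
have z (f : R -> R) a b : (forall x, f x = 0) -> primitive_on f (fun _ => 0) a b.
  by move=> f0 u v _ _ _; rewrite !f0; lra.
exists (fun _ => 0), (fun _ => 0), (fun _ _ => 0); split.
- by move=> x _; apply: z.
- by move=> x hx y _; split; [lra | apply: Rlt_le; apply: Rinv_0_lt_compat; lra].
- by move=> x _; ring.
- by split; [apply: z | move=> x _; lra].
- by ring.
Qed.

Lemma rsum_distr n (P : pred 'I_n) (F : 'I_n -> R) (c : R) :
  c * (\rsum_(i < n | P i) F i) = \rsum_(i < n | P i) (c * F i).
Proof. exact: big_distrr. Qed.

(** The density is a difference of two kernels: each costs one lattice error [C], and the arcs cut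
    by the ends cost [4/Q], whence [4 + 2 * C]. *)
Lemma kernel_part e : 0 < e -> exists2 C, 0 < C &
  forall Q w s r beta eta F1 V1 F2 V2, (1 < Q)%N -> 0 <= eta <= 1 -> valid_weights Q w s r ->
  kernel F1 V1 -> kernel F2 V2 ->
  (forall q q', (q < Q)%N -> (q' < Q)%N -> in_triangle Q q q' -> w q q' * (r q q' - s q q') =
    (F1 (INR q / INR Q) (INR q' / INR Q) - F2 (INR q / INR Q) (INR q' / INR Q)) / INR Q ^ 2) ->
  exists2 v, is_RInt (cell_sum Q w s r) beta (beta + eta) v &
    Rabs (v - eta * (6 / PI ^ 2 * (V1 - V2))) <= C * Rpower (INR Q) (e - 1 / 2).
Proof.
move=> e0; have [C C0 hC] := window_sum_asymptotics e0.
exists (4 + 2 * C); first lra.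
move=> Q w s r beta eta F1 V1 F2 V2 Q1 he V K1 K2 hw.
have [v hv hb] := @cell_sum_integral Q w s r beta eta Q1 ltac:(lra) V; exists v => //.
have Qp : 0 < INR Q by apply: INR_pos; lia.
have hl q : (0 < q < Q)%N -> (index_count beta eta q <= q)%N /\ Rabs (INR (index_count beta eta q) - eta * INR q) <= 1.
  by move=> _; apply: index_count_bounds.
have Q0 : (0 < Q)%N by lia.
have A1 := hC F1 V1 Q (first_index beta) _ eta K1 Q0 he hl.
have A2 := hC F2 V2 Q (first_index beta) _ eta K2 Q0 he hl.
set W1 := window_sum F1 _ _ _ in A1; set W2 := window_sum F2 _ _ _ in A2.
have E : tri_sum Q (fun q q' => w q q' * (r q q' - s q q') * window_count (first_index beta) (index_count beta eta) q q')
   = W1 / INR Q ^ 2 - W2 / INR Q ^ 2.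
  have -> : W1 / INR Q ^ 2 - W2 / INR Q ^ 2 = / INR Q ^ 2 * (W1 - W2) by rewrite /Rdiv; ring.
  rewrite /W1 /W2 /window_sum -rsumB rsum_distr; apply: eq_bigr => q _.
  rewrite -rsumB rsum_distr; apply: eq_bigr => q' t; rewrite hw // /Rdiv; ring.
rewrite E in hb.
have X : / INR Q <= Rpower (INR Q) (e - 1 / 2).
  have <- : Rpower (INR Q) (- 1) = / INR Q by rewrite Rpower_Ropp Rpower_1.
  apply: Rle_Rpower; last lra.
  by apply: (@leq_INR 1).
rewrite (_ : v - _ = (v - (W1 / INR Q ^ 2 - W2 / INR Q ^ 2)) + (W1 / INR Q ^ 2 - eta * (6 / PI ^ 2 * V1))
   - (W2 / INR Q ^ 2 - eta * (6 / PI ^ 2 * V2))); last by rewrite /Rdiv; ring.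
move: A1 A2 hb X; rewrite /Rdiv; move: (Rpower _ _) => X; split_Rabs; lra.
Qed.

Lemma short_gaps_integral e : 0 < e -> exists2 C, 0 < C &
  forall lam Q beta eta, 0 < lam -> (1 < Q)%N -> 0 <= eta <= 1 ->
  exists2 v, is_RInt (short_gaps lam Q) beta (beta + eta) v &
    Rabs (v - eta * (1 - g1_value lam)) <= C * Rpower (INR Q) (e - 1 / 2).
Proof.
(* Five pieces: two attached to each end of the arcs, and the symmetric one. *)
move=> e0; have [C C0 hC] := kernel_part e0; exists (5 * C); first lra.
move=> lam Q beta eta lam0 Q1 he.
have Qp : 0 < INR Q by apply: INR_pos; lia.
have partA b : exists2 v, is_RInt (cell_sum Q (weightA Q) (fun _ _ => 0) (endA lam Q)) b (b + eta) v &
    Rabs (v - eta * (6 / PI ^ 2 * valueA lam)) <= C * Rpower (INR Q) (e - 1 / 2).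
  have wE q q' : (q < Q)%N -> (q' < Q)%N -> in_triangle Q q q' -> weightA Q q q' * (endA lam Q q q' - 0) =
      (/ (INR q / INR Q) - (/ (INR q / INR Q) - (1 - INR q / INR Q) / (INR q / INR Q) * Rmin lam (/ (INR q' / INR Q)))) / INR Q ^ 2.
    move=> h1 h2 h3; have [g1 g2 g3 g4] := weights_triangle h1 h2 h3.
    rewrite /weightA /endA (_ : full q q' = / (INR q' / INR Q) * / (INR Q * INR q)); last by rewrite /full; field; lra.
    rewrite (_ : lam / INR Q / INR q = lam * / (INR Q * INR q)); last by field; lra.
    have i0 : 0 < / (INR Q * INR q) by apply: Rinv_0_lt_compat; nra.
    rewrite !(Rmult_comm _ (/ (INR Q * INR q))) -Rmult_min_distr_l; last lra.
    by move: (Rmin _ _) => M; field; lra.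
  rewrite /valueA; destruct (Rle_dec lam 1) as [l1|l1].
    rewrite (_ : lam / 2 = 1 - (1 - lam / 2)); last ring.
    by apply: (hC _ _ _ _ _ _ _ _ _ _ Q1 he (valid_A lam0 Q1) kernel_one (@kernel_small lam ltac:(lra))); exact: wE.
  by apply: (hC _ _ _ _ _ _ _ _ _ _ Q1 he (valid_A lam0 Q1) kernel_one (@kernel_large lam ltac:(lra))); exact: wE.
have partC b : exists2 v, is_RInt (cell_sum Q (weightC Q) (startC lam Q) full) b (b + eta) v &
    Rabs (v - eta * (6 / PI ^ 2 * valueC1 lam)) <= C * Rpower (INR Q) (e - 1 / 2).
  rewrite /valueC1; destruct (Rle_dec lam 1) as [l1|l1].
    rewrite {1}(_ : 0 = 0 - 0); last ring.
    apply: (hC _ _ _ _ _ _ _ _ _ _ Q1 he (valid_C lam0 Q1) kernel_zero kernel_zero) => q q' h1 h2 h3.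
    rewrite /startC; destruct (Rle_dec (INR q' / INR Q) (/ lam)) as [c|c].
      by destruct (Rlt_dec (INR q / INR Q) (/ lam)); rewrite /Rdiv; ring.
    case: c; apply: (Rle_trans _ 1).
      have [_ g2 _ _] := weights_triangle h1 h2 h3.
      by apply: (Rmult_le_reg_r (INR Q)) => //; field_simplify; lra.
    by rewrite -Rinv_1; apply: Rinv_le_contravar; lra.
  have wE q q' : (q < Q)%N -> (q' < Q)%N -> in_triangle Q q q' -> weightC Q q q' * (full q q' - startC lam Q q q') =
     ((if Rlt_dec (INR q / INR Q) (/ lam) then if Rle_dec (INR q' / INR Q) (/ lam) then 0 else
        (INR q / INR Q + INR q' / INR Q - 1) * (lam * (INR q' / INR Q) - 1) / (INR q' / INR Q * (INR q' / INR Q - INR q / INR Q))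
      else / (INR q / INR Q)) - (if Rlt_dec (INR q / INR Q) (/ lam) then 0 else / (INR q / INR Q))) / INR Q ^ 2.
    move=> h1 h2 h3; have [g1 g2 g3 g4] := weights_triangle h1 h2 h3.
    rewrite /startC /weightC; destruct (Rlt_dec (INR q / INR Q) (/ lam)) as [c1|c1]; last by rewrite /Rdiv; ring.
    destruct (Rle_dec (INR q' / INR Q) (/ lam)) as [c2|c2]; first by rewrite /Rdiv; ring.
    have qq : INR q < INR q'.
      apply: (Rmult_lt_reg_r (/ INR Q)); first by apply: Rinv_0_lt_compat.
      by rewrite -![_ * / INR Q]/(_ / INR Q); lra.
    by rewrite /full; field; lra.
  destruct (Rle_dec lam 2) as [l2|l2].
    have := hC _ _ _ _ b eta _ _ _ _ Q1 he (valid_C lam0 Q1) (@kernel_one_large_le2 lam ltac:(lra) l2) (@kernel_step lam ltac:(lra)) wE.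
    have r a c d : a + (c + d) - d = a + c by ring.
    by rewrite r.
  have := hC _ _ _ _ b eta _ _ _ _ Q1 he (valid_C lam0 Q1) (@kernel_one_large_ge2 lam ltac:(lra) ltac:(lra)) (@kernel_step lam ltac:(lra)) wE.
  have r a d : a + d - d = a by ring.
  by rewrite r.
have partD b : exists2 v, is_RInt (cell_sum Q (weightC Q) (fun _ _ => 0) (endD lam Q)) b (b + eta) v &
    Rabs (v - eta * (6 / PI ^ 2 * valueC2 lam)) <= C * Rpower (INR Q) (e - 1 / 2).
  rewrite /valueC2; destruct (Rle_dec lam 1) as [l1|l1].
    have wE q q' : (q < Q)%N -> (q' < Q)%N -> in_triangle Q q q' ->
      weightC Q q q' * (endD lam Q q q' - 0) = (0 - 0) / INR Q ^ 2; last first.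
      have := hC _ _ _ _ b eta _ _ _ _ Q1 he (valid_D lam Q1) kernel_zero kernel_zero wE.
      by rewrite Rminus_0_r.
    move=> h1 h2 h3.
    rewrite /endD; destruct (Rle_dec (/ lam) (INR q / INR Q)) as [c|c]; last by rewrite /Rdiv; ring.
    have := leq_INR h1; rewrite S_INR => g.
    have : INR q / INR Q < 1 by apply: (Rmult_lt_reg_r (INR Q)) => //; field_simplify; lra.
    have : 1 <= / lam by rewrite -Rinv_1; apply: Rinv_le_contravar; lra.
    by lra.
  have wE q q' : (q < Q)%N -> (q' < Q)%N -> in_triangle Q q q' -> weightC Q q q' * (endD lam Q q q' - 0) =
     ((if Rle_dec (/ lam) (INR q / INR Q) then if Rle_dec (/ lam) (INR q' / INR Q) then
        (INR q / INR Q + INR q' / INR Q - 1) / (INR q / INR Q * (INR q' / INR Q)) else 0 else 0) - 0) / INR Q ^ 2.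
    move=> h1 h2 h3; have [g1 g2 g3 g4] := weights_triangle h1 h2 h3.
    rewrite /endD /weightC; destruct (Rle_dec (/ lam) (INR q / INR Q)) as [c1|c1]; last by rewrite /Rdiv; ring.
    destruct (Rle_dec (/ lam) (INR q' / INR Q)) as [c2|c2]; last by rewrite /Rdiv; ring.
    by rewrite /full; field; lra.
  destruct (Rle_dec lam 2) as [l2|l2].
    have := hC _ _ _ _ b eta _ _ _ _ Q1 he (valid_D lam Q1) (@kernel_both_large_le2 lam ltac:(lra) l2) kernel_zero wE.
    by rewrite Rminus_0_r.
  have := hC _ _ _ _ b eta _ _ _ _ Q1 he (valid_D lam Q1) (@kernel_both_large_ge2 lam ltac:(lra) ltac:(lra)) kernel_zero wE.
  by rewrite Rminus_0_r.
(* Terms at [- alpha] are integrated over the reflected interval, to which the estimates for an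
   arbitrary left end apply. *)
have reflect (f : R -> R) (v : R) : is_RInt f (- (beta + eta)) (- (beta + eta) + eta) v ->
  is_RInt (fun x => f (- x)) beta (beta + eta) v.
  rewrite (_ : - (beta + eta) + eta = - beta); last ring.
  move=> h; have h1 := is_RInt_opp _ _ _ _ (is_RInt_comp_opp _ _ _ _ (is_RInt_swap _ _ _ _ h)).
  rewrite /opp /= Ropp_involutive in h1.
  by apply: is_RInt_ext h1 => x _; exact: Ropp_involutive.
have [a1 A1 E1] := partA beta; have [a2 A2 E2] := partA (- (beta + eta)).
have [c1 D1 E3] := partC beta; have [c2 D2 E4] := partC (- (beta + eta)).
have [d D3 E5] := partD beta.
exists (a1 + c1 + (a2 + c2) + d).
  apply: (is_RInt_plus (V := R_NormedModule)); last exact: D3.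
  apply: (is_RInt_plus (V := R_NormedModule)); apply: (is_RInt_plus (V := R_NormedModule)) => //; exact: reflect.
rewrite /g1_value; move: E1 E2 E3 E4 E5.
move: (Rpower _ _) (valueA _) (valueC1 _) (valueC2 _) (6 / PI ^ 2) => X vA vC vD p.
rewrite (_ : a1 + c1 + (a2 + c2) + d - eta * (1 - (1 - p * (2 * vA + 2 * vC + vD))) =
  (a1 - eta * (p * vA)) + (a2 - eta * (p * vA)) + (c1 - eta * (p * vC)) + (c2 - eta * (p * vC)) + (d - eta * (p * vD))); last ring.
by split_Rabs; lra.
Qed.

Lemma is_RInt_point_function (c k a b : R) : a <= b -> is_RInt (fun x => if Req_EM_T x c then k else 0) a b 0.
Proof.
move=> ab; have z u v : u <= v -> (forall x, u < x < v -> x <> c) -> is_RInt (fun x => if Req_EM_T x c then k else 0) u v 0.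
  move=> uv h; apply: (is_RInt_ext (fun _ => 0)).
    by move=> x; rewrite Rmin_left // Rmax_right // => hx; destruct (Req_EM_T x c) => //; case: (h x hx).
  by have := is_RInt_const u v 0; rewrite /scal /= /mult /= Rmult_0_r.
have [h|h] := Rle_lt_dec c a; first by apply: z => // x hx; lra.
have [h'|h'] := Rle_lt_dec b c; first by apply: z => // x hx; lra.
have h1 : is_RInt (fun x => if Req_EM_T x c then k else 0) a c 0 by apply: z => [|x hx]; lra.
have h2 : is_RInt (fun x => if Req_EM_T x c then k else 0) c b 0 by apply: z => [|x hx]; lra.
by have := is_RInt_Chasles _ _ _ _ _ _ h1 h2; rewrite /plus /= Rplus_0_r.
Qed.

(** [gap_frac_short] says nothing at fractions of denominator below [Q], where points coincide; the
    finitely many values there are corrected one at a time. *)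
Lemma is_RInt_ext_finite (l : list R) (f g : R -> R) (a b v : R) : a <= b ->
  (forall x, a < x < b -> ~ List.In x l -> f x = g x) -> is_RInt f a b v -> is_RInt g a b v.
Proof.
move=> ab; elim: l f => [|c l IH] f h hf.
  by apply: is_RInt_ext hf => x; rewrite Rmin_left // Rmax_right // => hx; apply: h.
apply: (IH (fun x => f x + (if Req_EM_T x c then g c - f c else 0))).
  move=> x hx nl; destruct (Req_EM_T x c) as [->|ne]; first ring.
  by rewrite Rplus_0_r; apply: h => // -[e|//]; apply: ne.
rewrite (_ : v = plus v 0); last by rewrite /plus /= Rplus_0_r.
by apply: (is_RInt_plus (V := R_NormedModule)) => //; apply: is_RInt_point_function.
Qed.

Definition farey_points (Q : nat) (beta : R) : list R :=
  List.flat_map (fun k => List.map (fun j => IZR (ceil (INR k * beta) + Z.of_nat j) / INR k) (List.seq 0 (Q + 2))) (List.seq 0 Q).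

Lemma farey_pointsP Q beta eta x k z : 0 <= eta <= 1 -> beta < x < beta + eta -> (0 < k < Q)%N ->
  INR k * x = IZR z -> List.In x (farey_points Q beta).
Proof.
move=> he hx hk e; have kp : 0 < INR k by apply: INR_pos; lia.
have kQ : INR k <= INR Q by apply: leq_INR; lia.
have [c1 c2] := ceilP (INR k * beta).
apply/List.in_flat_map; exists k; split; first by apply/List.in_seq; lia.
have z1 : (ceil (INR k * beta) <= z)%Z.
  have : IZR (ceil (INR k * beta)) < IZR (z + 1) by rewrite plus_IZR -e; nra.
  by move/lt_IZR; lia.
have z2 : (z < ceil (INR k * beta) + Z.of_nat (Q + 2))%Z.
  by apply: lt_IZR; rewrite plus_IZR -INR_IZR_INZ plus_INR INR2 -e; nra.
apply/List.in_map_iff; exists (Z.to_nat (z - ceil (INR k * beta))); split.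
  rewrite Z2Nat.id; last lia.
  by rewrite (_ : (ceil (INR k * beta) + (z - ceil (INR k * beta)))%Z = z) -?e; [field; lra | lia].
by apply/List.in_seq; lia.
Qed.

Lemma gap_frac_integral e : 0 < e -> exists2 C, 0 < C &
  forall lam Q beta eta, 0 < lam -> (1 < Q)%N -> 0 <= eta <= 1 ->
  exists2 v, is_RInt (gap_frac lam Q) beta (beta + eta) v &
    Rabs (v - eta * g1_value lam) <= C * Rpower (INR Q) (e - 1 / 2).
Proof.
move=> e0; have [C C0 hC] := short_gaps_integral e0; exists C => // lam Q beta eta lam0 Q1 he.
have [v hv hb] := hC lam Q beta eta lam0 Q1 he; exists (eta - v); last first.
  rewrite (_ : eta - v - eta * g1_value lam = - (v - eta * (1 - g1_value lam))); last ring.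
  by rewrite Rabs_Ropp.
apply: (@is_RInt_ext_finite (farey_points Q beta) (fun x => 1 - short_gaps lam Q x)); first lra.
  move=> x hx nl; rewrite (gap_frac_short lam0 Q1) // => k z hk ez; apply: nl.
  exact: (farey_pointsP he hx hk ez).
have c := is_RInt_const beta (beta + eta) 1.
have := is_RInt_minus _ _ _ _ _ _ c hv; rewrite /minus /plus /opp /scal /= /mult /=.
by rewrite (_ : (beta + eta - beta) * 1 + - v = eta - v); last ring.
Qed.

(** For [Q = 1] there is no dissection of order [Q - 1], but the only gap is the whole circle for
    every [alpha]. *)
Lemma gap_frac_one lam : exists2 c, 0 <= c <= 1 & forall alpha, gap_frac lam 1 alpha = c.
Proof.
exists (gap_frac lam 1 0); last by move=> alpha; rewrite /gap_frac /gaps /points /= !Rmult_0_r !Rmult_0_l.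
rewrite /gap_frac /gaps /points /= INR_1.
by destruct (Rle_dec _ _); [change (0 <= INR 1 / 1 <= 1); rewrite INR_1 | change (0 <= 0 / 1 <= 1)]; lra.
Qed.

Lemma kernel_value F V : kernel F V -> 0 <= V <= 1.
Proof.
move=> [E [P [G [_ _ _ [hP hE] ->]]]].
have [_ h] := hP 0 1 ltac:(lra) ltac:(lra) ltac:(lra).
have := hE 0 ltac:(lra); have := hE 1 ltac:(lra); lra.
Qed.

(** Serves at [Q = 1], where the power of [Q] is 1 and the error has to be bounded uniformly in
    [lam]. For [lam > 1] the bounds come from the fact that integrals of kernels lie in [[0,1]]. *)
Lemma g1_value_bounded lam : 0 < lam -> Rabs (g1_value lam) <= 6.
Proof.
move=> lam0.
have p3 : 0 <= 6 / PI ^ 2 <= 1.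
  have := PI2_3_2; have := PI_RGT_0 => p0 p1; have p2 : 9 < PI ^ 2 by nra.
  split; first by apply: Rlt_le; apply: Rdiv_lt_0_compat; lra.
  by apply: (Rmult_le_reg_r (PI ^ 2)); [lra | rewrite /Rdiv Rmult_assoc Rinv_l; lra].
have A : 0 <= valueA lam <= 1.
  rewrite /valueA; destruct (Rle_dec lam 1); first lra.
  by have := kernel_value (@kernel_large lam ltac:(lra)); lra.
have t1 : 1 < lam -> 0 < / lam < 1.
  move=> h; split; first exact: Rinv_0_lt_compat.
  by rewrite -Rinv_1; apply: Rinv_lt_contravar; lra.
have C : -1 <= valueC1 lam <= 1.
  rewrite /valueC1; destruct (Rle_dec lam 1); first lra.
  have {}t1 := t1 ltac:(lra); destruct (Rle_dec lam 2).
    by have := kernel_value (@kernel_one_large_le2 lam ltac:(lra) ltac:(lra)); lra.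
  by have := kernel_value (@kernel_one_large_ge2 lam ltac:(lra) ltac:(lra)); lra.
have D : 0 <= valueC2 lam <= 1.
  rewrite /valueC2; destruct (Rle_dec lam 1); first lra.
  destruct (Rle_dec lam 2).
    by have := kernel_value (@kernel_both_large_le2 lam ltac:(lra) ltac:(lra)).
  by have := kernel_value (@kernel_both_large_ge2 lam ltac:(lra) ltac:(lra)).
rewrite /g1_value; move: (6 / PI ^ 2) p3 => p p3.
have b : -2 <= 2 * valueA lam + 2 * valueC1 lam + valueC2 lam <= 5 by lra.
move: b; move: (2 * valueA lam + _ + _) => X b.
by apply: Rabs_le; nra.
Qed.

Theorem gap_frac_rate e : 0 < e -> exists2 C, 0 < C &
  forall lam Q beta eta, 0 < lam -> (0 < Q)%N -> 0 <= eta <= 1 ->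
  exists2 v, is_RInt (gap_frac lam Q) beta (beta + eta) v &
    Rabs (v - eta * g1_value lam) <= C * Rpower (INR Q) (e - 1 / 2).
Proof.
move=> e0; have [C C0 hC] := gap_frac_integral e0; exists (C + 7); first lra.
move=> lam Q beta eta lam0 Q0 he.
have X0 : 0 < Rpower (INR Q) (e - 1 / 2) by apply: exp_pos.
have [Q1|Q1] := ltnP 1 Q.
  have [v hv hb] := hC lam Q beta eta lam0 Q1 he; exists v => //.
  by apply: Rle_trans hb _; apply: Rmult_le_compat_r; lra.
have -> : Q = 1%N by lia.
have [c hc cE] := gap_frac_one lam; exists (eta * c).
  apply: (is_RInt_ext (fun _ => c)); first by move=> x _; rewrite cE.
  by have := is_RInt_const beta (beta + eta) c; rewrite /scal /= /mult /= (_ : beta + eta - beta = eta); last ring.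
rewrite INR_1 /Rpower ln_1 Rmult_0_r exp_0 -Rmult_minus_distr_l Rabs_mult (Rabs_pos_eq eta); last lra.
have B := g1_value_bounded lam0.
have : Rabs (c - g1_value lam) <= 7 by split_Rabs; lra.
have := Rabs_pos (c - g1_value lam); nra.
Qed.

End GapIntegral.

(** * From the rate to the limit *)

Module Limit.
Import Coquelicot.Coquelicot.
Import ssreflect ssrbool.
Import ClosedForm GapIntegral.
Open Scope R_scope.

Lemma Rpower_small C d y : 0 < C -> 0 < d -> 0 < y ->
  exists N : nat, forall Q : nat, (N <= Q)%nat -> (1 <= Q)%nat -> C * Rpower (INR Q) (- d) < y.
Proof.
move=> C0 d0 y0; have [N hN] := INR_unbounded (exp ((ln (C / y) + 1) / d)).
exists N => Q NQ Q1; have Qp : 0 < INR Q by apply: lt_0_INR; lia.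
have h : (ln (C / y) + 1) / d < ln (INR Q).
  rewrite -(ln_exp ((ln (C / y) + 1) / d)); apply: ln_increasing; first exact: exp_pos.
  by apply: Rlt_le_trans hN _; apply: le_INR.
have h' : ln (C / y) + 1 < d * ln (INR Q).
  have := Rmult_lt_compat_l d _ _ d0 h.
  by rewrite (_ : d * ((ln (C / y) + 1) / d) = ln (C / y) + 1); last by field; lra.
have cy : 0 < C / y by apply: Rdiv_lt_0_compat.
have : Rpower (INR Q) (- d) < y / C.
  rewrite /Rpower (_ : y / C = exp (- ln (C / y))); last by rewrite exp_Ropp exp_ln //; field; lra.
  by apply: exp_increasing; lra.
move=> k; have := Rmult_lt_compat_l C _ _ C0 k.
by rewrite (_ : C * (y / C) = y); last by field; lra.
Qed.

Lemma Riemann_gap_frac e : 0 < e -> exists C, 0 < C /\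
  forall beta eta lam (Q : nat), 0 < eta <= 1 -> 0 < lam -> (1 <= Q)%nat ->
  inhabited (Riemann_integrable (gap_frac lam Q) beta (beta + eta)) /\
  forall pr : Riemann_integrable (gap_frac lam Q) beta (beta + eta),
    Rabs (RiemannInt pr / eta - g1_value lam) <= C * Rpower (INR Q) (e - 1 / 2) / eta.
Proof.
move=> e0; have [C C0 hC] := gap_frac_rate e0; exists C; split=> // beta eta lam Q he lam0 Q1.
have [v hv hb] := hC lam Q beta eta lam0 (introT ssrnat.leP Q1) ltac:(lra).
split; first by constructor; apply: ex_RInt_Reals_0; exists v.
move=> pr; rewrite -RInt_Reals (is_RInt_unique _ _ _ _ hv).
rewrite (_ : v / eta - g1_value lam = (v - eta * g1_value lam) * / eta); last by field; lra.
have i0 : 0 < / eta by apply: Rinv_0_lt_compat; lra.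
rewrite Rabs_mult (Rabs_pos_eq (/ eta)); last lra.
by apply: Rmult_le_compat_r; lra.
Qed.

End Limit.

Import ClosedForm Limit.
Open Scope R_scope.

Theorem theorem1 :
  exists g1 : R -> R,
    (* value of the limit *)
    (forall lam, 0 < lam -> lam <> 1 -> lam <> 2 -> g1 lam = g1_formula lam) /\
    (* the integrand is Riemann integrable *)
    (forall beta eta lam (Q : nat), 0 < eta <= 1 -> 0 < lam -> (1 <= Q)%nat ->
       inhabited (Riemann_integrable (gap_frac lam Q) beta (beta + eta))) /\
    (* the limit Q -> oo exists and equals g1 lam (independent of beta, eta) *)
    (forall beta eta lam, 0 < eta <= 1 -> 0 < lam ->
       forall e, 0 < e -> exists N : nat, forall (Q : nat), (N <= Q)%nat -> (1 <= Q)%nat ->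
         forall pr : Riemann_integrable (gap_frac lam Q) beta (beta + eta),
           Rabs (RiemannInt pr / eta - g1 lam) < e) /\
    (* rate of convergence, implied constant depending only on epsilon *)
    (forall eps, 0 < eps -> exists C, 0 < C /\
       forall beta eta lam (Q : nat), 0 < eta <= 1 -> 0 < lam -> (1 <= Q)%nat ->
         forall pr : Riemann_integrable (gap_frac lam Q) beta (beta + eta),
           Rabs (RiemannInt pr / eta - g1 lam)
             <= C * (1 + lam) * Rpower (INR Q) (eps - 1 / 2) / eta).
Proof.
exists g1_value; split; [|split; [|split]].
- exact g1_valueE.
- intros beta eta lam Q he lam0 Q1.
  destruct (Riemann_gap_frac 1 Rlt_0_1) as [C [_ h]].
  now apply h.
- intros beta eta lam he lam0 e e0.
  (* Any exponent below 1/2 leaves a negative power of [Q]. *)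
  destruct (Riemann_gap_frac (1 / 4)) as [C [C0 h]]; [lra|].
  (* The target is [e * eta] because the error bound carries the factor [1/eta]; so [N] depends on
     [eta]. *)
  destruct (Rpower_small C (1 / 4) (e * eta)) as [N hN]; [lra | lra | nra |].
  exists N; intros Q NQ Q1 pr.
  destruct (h beta eta lam Q he lam0 Q1) as [_ r].
  eapply Rle_lt_trans; [apply r|].
  replace (1 / 4 - 1 / 2) with (- (1 / 4)) by field.
  apply (Rmult_lt_reg_r eta); [lra|].
  specialize (hN Q NQ Q1); unfold Rdiv at 1; rewrite Rmult_assoc, Rinv_l; lra.
- intros eps e0; destruct (Riemann_gap_frac eps e0) as [C [C0 h]].
  exists C; split; [exact C0|].
  intros beta eta lam Q he lam0 Q1 pr.
  destruct (h beta eta lam Q he lam0 Q1) as [_ r].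
  eapply Rle_trans; [apply r|].
  apply Rmult_le_compat_r; [apply Rlt_le, Rinv_0_lt_compat; lra|].
  apply Rmult_le_compat_r; [apply Rlt_le, exp_pos | nra].
Qed.
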